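(* Let $Z=(Z_1,Z_2)$ be the piecewise Kolmogorov system defined by $Z_i:\ (\dot{x},\dot{y})=(x f_i(x,y),\,y g_i(x,y))$ for $i=1,2$, with separation straight line $\alpha(x-1)-\beta(y-1)=0$, where $(\alpha,\beta)\neq(0,0)$, $\beta>0$ and $\alpha+\beta\neq 0$. Let $(1,1)$ be a monodromic pseudo-equilibrium such that the vector field rotates counter-clockwise. Then, if $|\alpha|\ge\beta$ and the equilibrium is unstable (resp. $|\alpha|\le\beta$ and the equilibrium is stable), there exists a perturbation inside the Kolmogorov class such that an unstable (resp. stable) limit cycle bifurcates from it.
   Context: The functions $f_i,g_i$ are smooth. With $h(x,y)=\alpha(x-1)-\beta(y-1)$, the vector field $Z_i$ acts in the region $\Sigma_i=\{(x,y):(-1)^ih(x,y)>0\}$, and $\Sigma=\{h=0\}$. The point $(1,1)\in\Sigma$ is a monodromic pseudo-equilibrium if trajectories of the piecewise system rotate around it, so that a return map on $\Sigma$ is well defined near it; here the rotation is counter-clockwise. ''Stable'' (resp. ''unstable'') means that trajectories near the point spiral towards it (resp. away from it). The Kolmogorov class consists of piecewise systems with the same separation line $\Sigma$, each of whose two vector fields has the form $(x f(x,y), y g(x,y))$, so that $x=0$ and $y=0$ are invariant. A perturbation inside the class is a family $Z_\varepsilon$ of such systems, depending continuously on a small parameter $\varepsilon$, with $Z_0=Z$. A limit cycle bifurcates from $(1,1)$ if, for arbitrarily small $\varepsilon$, the system $Z_\varepsilon$ has a crossing limit cycle (an isolated periodic orbit meeting both zones and intersecting $\Sigma$ only at points where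 both vector fields cross $\Sigma$ transversally in the same direction) which shrinks to $(1,1)$ as $\varepsilon\to0$. *)

(* Defs.v *)
From Stdlib Require Import Reals.
From Coquelicot Require Import Coquelicot.
Open Scope R_scope.

Definition smooth (f : R -> R -> R) : Prop := forall n x y, ex_diff_n f n x y.

Inductive zone : Type := zone1 | zone2.

Definition other (i : zone) : zone :=
  match i with zone1 => zone2 | zone2 => zone1 end.

(* (-1)^i *)
Definition sgn (i : zone) : R :=
  match i with zone1 => -1 | zone2 => 1 end.

Record kolmogorov : Type := Kolmogorov {
  kf : zone -> R -> R -> R;
  kg : zone -> R -> R -> R;
  kf_smooth : forall i, smooth (kf i);
  kg_smooth : forall i, smooth (kg i)
}.

Definition field (K : kolmogorov) (i : zone) (p : R * R) : R * R :=
  (fst p * kf K i (fst p) (snd p), snd p * kg K i (fst p) (snd p)).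

Definition h (alpha beta : R) (p : R * R) : R :=
  alpha * (fst p - 1) - beta * (snd p - 1).

Definition region (alpha beta : R) (i : zone) (p : R * R) : Prop :=
  0 < sgn i * h alpha beta p.

(* Derivative of h along the i-th vector field. *)
Definition lie_h (alpha beta : R) (K : kolmogorov) (i : zone) (p : R * R) : R :=
  alpha * fst (field K i p) - beta * snd (field K i p).

(* Parametrization of the line h = 0; for 0 < beta, s > 0 is the half-line
   x > 1. *)
Definition sigma (alpha beta s : R) : R * R := (1 + beta * s, 1 + alpha * s).

(* Trajectories of the piecewise system on the open time interval ]a, b[ that
   meet h = 0 only at crossing points: there both vector fields point into the
   same zone i, and the trajectory passes from the other zone into zone i. The
   conditions on both sides of t exclude motion along the line, on which no
   differential equation is imposed. *)
Definition trajectory (alpha beta : R) (K : kolmogorov) (a b : Rbar)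
    (gamma : R -> R * R) : Prop :=
  forall t : R, Rbar_lt a t -> Rbar_lt t b ->
    continuous gamma t /\
    (forall i, region alpha beta i (gamma t) ->
       is_derive gamma t (field K i (gamma t))) /\
    (h alpha beta (gamma t) = 0 ->
       exists i : zone,
         (forall j, 0 < sgn i * lie_h alpha beta K j (gamma t)) /\
         at_left t (fun u => region alpha beta (other i) (gamma u)) /\
         at_right t (fun u => region alpha beta i (gamma u))).

(* The trajectory of sigma s (s > 0) makes one counter-clockwise turn inside
   the ball of radius rho: through zone 1, which lies above the line when
   0 < beta, to the half-line x < 1, then through zone 2 back to sigma s'. *)
Definition ccw_return (alpha beta : R) (K : kolmogorov) (rho s s' : R) : Prop :=
  exists (gamma : R -> R * R) (a t1 t2 b r : R),
    a < 0 /\ 0 < t1 /\ t1 < t2 /\ t2 < b /\ r < 0 /\ 0 < s' /\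
    trajectory alpha beta K a b gamma /\
    gamma 0 = sigma alpha beta s /\
    (forall t, 0 < t < t1 -> region alpha beta zone1 (gamma t)) /\
    gamma t1 = sigma alpha beta r /\
    (forall t, t1 < t < t2 -> region alpha beta zone2 (gamma t)) /\
    gamma t2 = sigma alpha beta s' /\
    (forall t, 0 <= t <= t2 -> ball ((1, 1) : R * R) rho (gamma t)).

(* The turns are required to stay in arbitrarily small balls, so that the
   return map is a local object at (1, 1). *)
Definition monodromic_ccw (alpha beta : R) (K : kolmogorov) : Prop :=
  forall rho, 0 < rho ->
    exists s0, 0 < s0 /\
      forall s, 0 < s < s0 -> exists s', ccw_return alpha beta K rho s s'.

Definition near (A : R * R -> Prop) (eta : R) (p : R * R) : Prop :=
  exists q, A q /\ ball q eta p.

(* The end b of the time interval may be finite: a pseudo-equilibrium can be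
   reached in finite time, after infinitely many turns. *)
Definition tends_forward (alpha beta : R) (K : kolmogorov)
    (A : R * R -> Prop) (p : R * R) : Prop :=
  exists (gamma : R -> R * R) (a b : Rbar),
    Rbar_lt a 0 /\ Rbar_lt 0 b /\
    trajectory alpha beta K a b gamma /\ gamma 0 = p /\
    forall eta, 0 < eta ->
      exists t0 : R, 0 <= t0 /\ Rbar_lt t0 b /\
        forall t : R, t0 < t -> Rbar_lt t b -> near A eta (gamma t).

Definition tends_backward (alpha beta : R) (K : kolmogorov)
    (A : R * R -> Prop) (p : R * R) : Prop :=
  exists (gamma : R -> R * R) (a b : Rbar),
    Rbar_lt a 0 /\ Rbar_lt 0 b /\
    trajectory alpha beta K a b gamma /\ gamma 0 = p /\
    forall eta, 0 < eta ->
      exists t0 : R, t0 <= 0 /\ Rbar_lt a t0 /\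
        forall t : R, t < t0 -> Rbar_lt a t -> near A eta (gamma t).

(* Used both for A = {(1, 1)} and for A a periodic orbit. *)
Definition stable (alpha beta : R) (K : kolmogorov) (A : R * R -> Prop) : Prop :=
  exists delta, 0 < delta /\
    forall p, ~ A p -> near A delta p -> tends_forward alpha beta K A p.

Definition unstable (alpha beta : R) (K : kolmogorov) (A : R * R -> Prop) : Prop :=
  exists delta, 0 < delta /\
    forall p, ~ A p -> near A delta p -> tends_backward alpha beta K A p.

Definition periodic_orbit (alpha beta : R) (K : kolmogorov)
    (G : R * R -> Prop) : Prop :=
  exists (gamma : R -> R * R) (T : R),
    0 < T /\
    trajectory alpha beta K m_infty p_infty gamma /\
    (forall t, gamma (t + T) = gamma t) /\
    (exists t, gamma t <> gamma 0) /\
    (forall p, G p <-> exists t, gamma t = p).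

Definition crossing_limit_cycle (alpha beta : R) (K : kolmogorov)
    (G : R * R -> Prop) : Prop :=
  periodic_orbit alpha beta K G /\
  (forall i, exists p, G p /\ region alpha beta i p) /\
  (exists delta, 0 < delta /\
     forall G', periodic_orbit alpha beta K G' ->
       (forall p, G' p -> near G delta p) -> forall p, G' p <-> G p).

(* Continuity in the parameter is for the topology of the space of smooth
   functions: uniform convergence on compact sets of all partial derivatives,
   here in the form of joint continuity in (eps, x, y). *)
Definition continuous_family (F : R -> R -> R -> R) (e0 : R) : Prop :=
  forall (m k : nat) (e x y : R), Rabs e < e0 ->
    continuous
      (fun q : R * (R * R) =>
         partial_derive m k (F (fst q)) (fst (snd q)) (snd (snd q)))
      (e, (x, y)).

Definition perturbation (K : kolmogorov) (W : R -> kolmogorov) : Prop :=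
  (forall i x y, kf (W 0) i x y = kf K i x y /\ kg (W 0) i x y = kg K i x y) /\
  exists e0, 0 < e0 /\
    forall i, continuous_family (fun e => kf (W e) i) e0 /\
              continuous_family (fun e => kg (W e) i) e0.

(* E is the set of parameters at which the cycle is present. *)
Definition cycle_bifurcates (alpha beta : R) (W : R -> kolmogorov)
    (kind : kolmogorov -> (R * R -> Prop) -> Prop) : Prop :=
  exists (E : R -> Prop) (G : R -> R * R -> Prop),
    (forall delta, 0 < delta -> exists e, 0 < Rabs e < delta /\ E e) /\
    (forall e, E e ->
       crossing_limit_cycle alpha beta (W e) (G e) /\ kind (W e) (G e)) /\
    (forall rho, 0 < rho ->
       exists delta, 0 < delta /\
         forall e, E e -> Rabs e < delta ->
           forall p, G e p -> ball ((1, 1) : R * R) rho p).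

(* Submission.v *)
Require Import Defs.
From Stdlib Require Import Reals Lra Lia ClassicalEpsilon List FunctionalExtensionality.
From Coquelicot Require Import Coquelicot.
Open Scope R_scope.

(** The map [shear e], which sends (x, y) to (x + beta e x y, y + alpha e x y),
    moves points along the level lines of [h] and fixes both coordinate axes.
    Conjugating the field of one zone by it, and multiplying by the Jacobian
    determinant to get rid of denominators, yields a Kolmogorov field again
    ([field_family]). The separation line is invariant under [shear e], which
    acts on it by [slide e s] = s + e (1 + beta s) (1 + alpha s). The orbits of
    the zone are therefore transported by [shear e], and its half-return map is
    conjugated by [slide e], while the other zone is left as it is.

    Let the equilibrium be stable. The orbit of [sigma (- u)], for small
    [u > 0], runs through one zone to [sigma (b u)] and through the other one to
    [sigma (Ra (b u))]. Stability forces [- Ra (b u) < u]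
    ([stable_contracting]): otherwise the turns of the reversed system keep all
    points near (1, 1) on the near side of the orbit of [sigma (- u)], and the
    trajectory of [sigma (- u)] could not tend to (1, 1). In the perturbed system
    the orbit of [sigma (- u)] closes up if and only if
    [slide e (- u) = Ra (slide e (b u))]. The difference of both sides increases
    with [e], because [slide e] pushes every point of the line near (1, 1)
    forward and [Ra] is decreasing; it is negative for [e = 0] by contraction,
    and positive for [e = 4 u]. Hence there is exactly one parameter [E u]
    between 0 and [4 u] whose orbit through [sigma (- u)] is closed
    ([closing_parameter]).

    The function [E] is positive, tends to 0 with [u], and is differentiable,
    because the half-return maps are ([half_deriv], [E_deriv]). By the mean value
    theorem its derivative is positive at points [u] arbitrarily close to 0
    ([rising_parameter]). Fix such a [u] and the parameter [e = E u]. Nearby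
    starting points inside the closed orbit have a closing parameter below [e] and
    are moved outwards by the perturbed return map, those outside have one above
    [e] and are moved inwards, both at a linear rate. The closed orbit is thus
    isolated and attracting ([attracting_cycle], [cycle_exists]), and it shrinks
    to (1, 1) with [u].

    The unstable case is the stable case with time reversed: the return map of
    the reversed system is the inverse return map ([rotation_rev]), and the
    conjugation by [shear e] commutes with the reversal ([perturb_xopp]). *)

(** * Calculus on intervals *)

(** Real induction: properties of orbits are extended forward in time without
    talking about maximal intervals. *)
Lemma continuous_induction (Q : R -> Prop) (T : R) :
  Q 0 ->
  (forall t, 0 <= t < T -> (forall u, 0 <= u <= t -> Q u) ->
     exists eps, 0 < eps /\ forall u, t < u < t + eps -> Q u) ->
  (forall t, 0 < t <= T -> (forall u, 0 <= u < t -> Q u) -> Q t) ->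
  forall t, 0 <= t <= T -> Q t.
Proof.
  intros Q0 Hs Hl t1 Ht1.
  set (A := fun x => 0 <= x <= T /\ forall u, 0 <= u <= x -> Q u).
  assert (A0 : A 0).
  { split; [lra|]. intros u Hu. replace u with 0 by lra. exact Q0. }
  destruct (completeness A) as [m [Hub Hlub]].
  { exists T. intros x [Hx _]. lra. }
  { exists 0. exact A0. }
  assert (m0 : 0 <= m) by (apply Hub; exact A0).
  assert (mT : m <= T) by (apply Hlub; intros x [Hx _]; lra).
  assert (Hlt : forall u, 0 <= u < m -> Q u).
  { intros u Hu. apply NNPP. intros nQ.
    assert (m <= u); [|lra]. apply Hlub. intros x [Hx Hxu].
    destruct (Rle_dec x u) as [|Hn]; [assumption|]. exfalso. apply nQ, Hxu. lra. }
  assert (Am : A m).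
  { split; [lra|]. intros u Hu. destruct (Req_dec u m) as [->|Hne].
    - destruct (Req_dec m 0) as [->|Hm]; [exact Q0|]. apply Hl; [lra|exact Hlt].
    - apply Hlt. lra. }
  destruct (Rlt_dec m T) as [HmT|HmT].
  - exfalso. destruct (Hs m) as [eps [He Hq]]; [lra|apply Am|].
    set (x := Rmin T (m + eps / 2)).
    assert (Hx : m < x /\ x <= T /\ x < m + eps).
    { unfold x, Rmin. destruct (Rle_dec T (m + eps / 2)); lra. }
    assert (x <= m); [|lra]. apply Hub. split; [lra|].
    intros u Hu. destruct (Rle_dec u m); [apply Am; lra|apply Hq; lra].
  - apply Am. lra.
Qed.

Lemma mean_value (f df : R -> R) (a b : R) : a < b ->
  (forall x, a < x < b -> is_derive f x (df x)) ->
  (forall x, a <= x <= b -> continuity_pt f x) ->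
  exists c, a < c < b /\ f b - f a = df c * (b - a).
Proof.
  intros Hab Hd Hc.
  assert (pr1 : forall c, a < c < b -> derivable_pt f c).
  { intros c Hcc. exists (df c). apply is_derive_Reals. auto. }
  assert (pr2 : forall c, a < c < b -> derivable_pt id c).
  { intros c _. apply derivable_pt_id. }
  destruct (MVT f id a b pr1 pr2 Hab Hc) as [c [P Heq]].
  { intros c _. apply derivable_continuous_pt, derivable_pt_id. }
  exists c. split; [exact P|].
  rewrite (derive_pt_eq_0 f c (df c)) in Heq by (apply is_derive_Reals; auto).
  rewrite (derive_pt_eq_0 id c 1) in Heq by (apply derivable_pt_lim_id).
  unfold id in Heq. lra.
Qed.

Lemma deriv_nonpos_le (f df : R -> R) (a b : R) : a <= b ->
  (forall x, a < x < b -> is_derive f x (df x)) ->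
  (forall x, a <= x <= b -> continuity_pt f x) ->
  (forall x, a < x < b -> df x <= 0) -> f b <= f a.
Proof.
  intros Hab Hd Hc Hn. destruct (Req_dec a b) as [->|Hne]; [lra|].
  destruct (mean_value f df a b) as [c [Hcc Heq]]; auto; [lra|].
  specialize (Hn c Hcc). nra.
Qed.

Lemma is_derive_continuity_pt (f : R -> R) x l :
  is_derive f x l -> continuity_pt f x.
Proof.
  intros H. apply continuity_pt_filterlim.
  apply (ex_derive_continuous f x). exists l. exact H.
Qed.

(** * The plane with the sup distance *)

Definition dsup (p q : R * R) : R :=
  Rmax (Rabs (fst q - fst p)) (Rabs (snd q - snd p)).

Lemma dsup_le p q e : dsup p q <= e <->
  Rabs (fst q - fst p) <= e /\ Rabs (snd q - snd p) <= e.
Proof.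
  unfold dsup. split.
  - intros H. split; eapply Rle_trans; [apply Rmax_l|exact H|apply Rmax_r|exact H].
  - intros [H1 H2]. apply Rmax_lub; assumption.
Qed.

Lemma dsup_lt p q e : dsup p q < e <->
  Rabs (fst q - fst p) < e /\ Rabs (snd q - snd p) < e.
Proof.
  unfold dsup. split.
  - intros H. split; eapply Rle_lt_trans; [apply Rmax_l|exact H|apply Rmax_r|exact H].
  - intros [H1 H2]. apply Rmax_lub_lt; assumption.
Qed.

Lemma ball_dsup (p q : R * R) e : ball p e q <-> dsup p q < e.
Proof. rewrite dsup_lt. reflexivity. Qed.

Lemma dsup_fst p q : Rabs (fst q - fst p) <= dsup p q.
Proof. apply Rmax_l. Qed.

Lemma dsup_snd p q : Rabs (snd q - snd p) <= dsup p q.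
Proof. apply Rmax_r. Qed.

Lemma dsup_sym p q : dsup p q = dsup q p.
Proof.
  unfold dsup. rewrite (Rabs_minus_sym (fst q)), (Rabs_minus_sym (snd q)). reflexivity.
Qed.

Lemma dsup_refl p : dsup p p = 0.
Proof. unfold dsup. rewrite !Rminus_diag, Rabs_R0. apply Rmax_left. lra. Qed.

Lemma dsup_pos p q : 0 <= dsup p q.
Proof. eapply Rle_trans; [apply Rabs_pos|apply dsup_fst]. Qed.

Lemma dsup_tri p q r : dsup p r <= dsup p q + dsup q r.
Proof.
  apply dsup_le. pose proof (dsup_fst p q). pose proof (dsup_fst q r).
  pose proof (dsup_snd p q). pose proof (dsup_snd q r).
  split.
  - replace (fst r - fst p) with ((fst q - fst p) + (fst r - fst q)) by ring.
    eapply Rle_trans; [apply Rabs_triang|]. lra.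
  - replace (snd r - snd p) with ((snd q - snd p) + (snd r - snd q)) by ring.
    eapply Rle_trans; [apply Rabs_triang|]. lra.
Qed.

Lemma dsup_eq0 p q : dsup p q <= 0 -> p = q.
Proof.
  intros H. apply dsup_le in H. destruct H as [H1 H2].
  pose proof (Rabs_pos (fst q - fst p)). pose proof (Rabs_pos (snd q - snd p)).
  destruct p as [x y], q as [x' y']; simpl in *.
  assert (x' - x = 0) by (apply Rabs_eq_0; lra).
  assert (y' - y = 0) by (apply Rabs_eq_0; lra).
  f_equal; lra.
Qed.

Lemma dsup_sqr p q :
  (fst q - fst p)^2 + (snd q - snd p)^2 <= 2 * (dsup p q)^2 /\
  (dsup p q)^2 <= (fst q - fst p)^2 + (snd q - snd p)^2.
Proof.
  pose proof (dsup_fst p q) as H1. pose proof (dsup_snd p q) as H2.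
  pose proof (Rabs_pos (fst q - fst p)). pose proof (Rabs_pos (snd q - snd p)).
  rewrite <- (pow2_abs (fst q - fst p)), <- (pow2_abs (snd q - snd p)).
  split; [nra|]. unfold dsup.
  unfold Rmax. destruct (Rle_dec _ _); nra.
Qed.

Definition der (y : R -> R * R) (t : R) (v : R * R) : Prop :=
  is_derive (fun u => fst (y u)) t (fst v) /\
  is_derive (fun u => snd (y u)) t (snd v).

Definition cts (y : R -> R * R) (t : R) : Prop :=
  continuity_pt (fun u => fst (y u)) t /\ continuity_pt (fun u => snd (y u)) t.

Lemma der_cts y t v : der y t v -> cts y t.
Proof. intros [H1 H2]. split; eapply is_derive_continuity_pt; eassumption. Qed.

Lemma cts_dsup y t : cts y t <->
  forall e, 0 < e -> exists d, 0 < d /\ forall u, Rabs (u - t) < d -> dsup (y t) (y u) < e.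
Proof.
  unfold cts. split.
  - intros [H1 H2] e He.
    apply continuity_pt_locally with (eps := mkposreal e He) in H1.
    apply continuity_pt_locally with (eps := mkposreal e He) in H2.
    destruct H1 as [d1 H1], H2 as [d2 H2].
    exists (Rmin d1 d2). split; [apply Rmin_pos; apply cond_pos|].
    intros u Hu. apply dsup_lt. split; [apply H1|apply H2].
    + eapply Rlt_le_trans; [exact Hu|apply Rmin_l].
    + eapply Rlt_le_trans; [exact Hu|apply Rmin_r].
  - intros H. split; apply continuity_pt_locally; intros [e He];
    destruct (H e He) as [d [Hd Hu]]; exists (mkposreal d Hd); intros u Hb;
    specialize (Hu u Hb); apply dsup_lt in Hu; simpl; apply Hu.
Qed.

Lemma continuous_cts (y : R -> R * R) t : continuous y t <-> cts y t.
Proof.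
  rewrite cts_dsup. unfold continuous. rewrite filterlim_locally. split.
  - intros H e He. destruct (H (mkposreal e He)) as [d Hd].
    exists d. split; [apply cond_pos|]. intros u Hu. apply ball_dsup. apply Hd. exact Hu.
  - intros H [e He]. destruct (H e He) as [d [Hd Hu]].
    exists (mkposreal d Hd). intros u Hb. apply ball_dsup. apply Hu. exact Hb.
Qed.

Lemma is_derive_der (y : R -> R * R) t v : is_derive y t v <-> der y t v.
Proof.
  destruct v as [v1 v2]. unfold der; simpl. split.
  - intros H. split.
    + apply (filterdiff_comp' y fst t (fun u => scal u (v1, v2)) fst H).
      apply filterdiff_linear, is_linear_fst.
    + apply (filterdiff_comp' y snd t (fun u => scal u (v1, v2)) snd H).
      apply filterdiff_linear, is_linear_snd.
  - intros [H1 H2].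
    assert (H := filterdiff_comp'_2 (fun u => fst (y u)) (fun u => snd (y u))
                   (fun a b => (a, b) : R * R) t _ _ (fun a b => (a, b) : R * R) H1 H2).
    eapply filterdiff_ext_lin; [eapply filterdiff_ext; [|apply H]|].
    + intros u. simpl. destruct (y u); reflexivity.
    + eapply filterdiff_ext_lin; [eapply filterdiff_ext; [|apply filterdiff_id]|].
      * intros [a b]; reflexivity.
      * intros [a b]; reflexivity.
    + intros u. reflexivity.
Qed.

(** * Gronwall's inequality *)

(** The sum of the squares of both coordinates is differentiable, unlike the
    norm; the constant [4 * L + 2] absorbs the cross terms. *)
Lemma gronwall_sqr (u1 u2 d1 d2 : R -> R) (L k T : R) :
  0 <= T -> 0 <= L -> 0 <= k ->
  (forall t, 0 < t < T -> is_derive u1 t (d1 t) /\ is_derive u2 t (d2 t)) ->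
  (forall t, 0 <= t <= T -> continuity_pt u1 t /\ continuity_pt u2 t) ->
  (forall t, 0 < t < T -> Rabs (d1 t) <= L * (Rabs (u1 t) + Rabs (u2 t)) + k /\
                          Rabs (d2 t) <= L * (Rabs (u1 t) + Rabs (u2 t)) + k) ->
  u1 T ^ 2 + u2 T ^ 2 <= exp ((4 * L + 2) * T) * (u1 0 ^ 2 + u2 0 ^ 2 + k ^ 2 * T).
Proof.
  intros HT HL Hk Hd Hc Hb. set (c := 4 * L + 2).
  assert (Hmain : (u1 T ^ 2 + u2 T ^ 2) * exp (- (c * T)) - k ^ 2 * T
                  <= (u1 0 ^ 2 + u2 0 ^ 2) * exp (- (c * 0)) - k ^ 2 * 0).
  { apply (deriv_nonpos_le
      (fun t => (u1 t ^ 2 + u2 t ^ 2) * exp (- (c * t)) - k ^ 2 * t)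
      (fun t => (2 * (u1 t * d1 t + u2 t * d2 t) - c * (u1 t ^ 2 + u2 t ^ 2))
                * exp (- (c * t)) - k ^ 2) 0 T HT).
    - intros t Ht. destruct (Hd t Ht) as [D1 D2].
      auto_derive.
      + repeat split; eexists; eassumption.
      + replace (Derive (fun x => u1 x) t) with (d1 t) by (symmetry; apply is_derive_unique; exact D1).
        replace (Derive (fun x => u2 x) t) with (d2 t) by (symmetry; apply is_derive_unique; exact D2). ring.
    - intros t Ht. destruct (Hc t Ht) as [C1 C2].
      repeat first [apply continuity_pt_minus | apply continuity_pt_mult
        | apply continuity_pt_plus | assumption
        | apply continuity_pt_const; intros ? ?; reflexivity
        | apply (continuity_pt_comp (fun t => - (c * t)) exp)
        | apply continuity_pt_opp
        | apply derivable_continuous_pt, derivable_pt_id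
        | apply derivable_continuous_pt, derivable_pt_exp].
    - intros t Ht. destruct (Hb t Ht) as [B1 B2].
      assert (He : 0 < exp (- (c * t)) <= 1).
      { split; [apply exp_pos|]. rewrite <- exp_0.
        assert (0 <= c * t) by (unfold c; nra).
        destruct (Req_dec (c * t) 0) as [->|]; [rewrite Ropp_0; lra|].
        left. apply exp_increasing. lra. }
      assert (H2 : 2 * (u1 t * d1 t + u2 t * d2 t) - c * (u1 t ^ 2 + u2 t ^ 2) <= k ^ 2).
      { set (m := Rabs (u1 t) + Rabs (u2 t)) in *.
        assert (A1 : u1 t * d1 t <= Rabs (u1 t) * (L * m + k)).
        { eapply Rle_trans; [apply Rle_abs|]. rewrite Rabs_mult.
          apply Rmult_le_compat_l; [apply Rabs_pos|exact B1]. }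
        assert (A2 : u2 t * d2 t <= Rabs (u2 t) * (L * m + k)).
        { eapply Rle_trans; [apply Rle_abs|]. rewrite Rabs_mult.
          apply Rmult_le_compat_l; [apply Rabs_pos|exact B2]. }
        assert (Hm : m ^ 2 <= 2 * (u1 t ^ 2 + u2 t ^ 2)).
        { unfold m. rewrite <- (pow2_abs (u1 t)), <- (pow2_abs (u2 t)).
          generalize (Rabs (u1 t)) (Rabs (u2 t)). intros a b.
          pose proof (pow2_ge_0 (a - b)). nra. }
        assert (2 * (u1 t * d1 t + u2 t * d2 t) <= 2 * m * (L * m + k)).
        { unfold m at 1. nra. }
        assert (2 * m * k <= m ^ 2 + k ^ 2) by (pose proof (pow2_ge_0 (m - k)); nra).
        assert (L * m ^ 2 <= L * (2 * (u1 t ^ 2 + u2 t ^ 2)))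
          by (apply Rmult_le_compat_l; assumption).
        unfold c. nra. }
      assert (0 <= k ^ 2) by apply pow2_ge_0. nra. }
  rewrite Rmult_0_r, Ropp_0, exp_0 in Hmain.
  assert (He : exp (c * T) * exp (- (c * T)) = 1).
  { rewrite <- exp_plus. replace (c * T + - (c * T)) with 0 by ring. apply exp_0. }
  pose proof (exp_pos (c * T)) as Hp.
  replace (u1 T ^ 2 + u2 T ^ 2)
    with (exp (c * T) * ((u1 T ^ 2 + u2 T ^ 2) * exp (- (c * T))))
    by (rewrite (Rmult_comm (_ + _)), <- Rmult_assoc, He; ring).
  apply Rmult_le_compat_l; lra.
Qed.

Lemma gronwall (y z v w : R -> R * R) (L k T : R) :
  0 <= T -> 0 <= L -> 0 <= k ->
  (forall t, 0 < t < T -> der y t (v t) /\ der z t (w t)) ->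
  (forall t, 0 <= t <= T -> cts y t /\ cts z t) ->
  (forall t, 0 < t < T -> dsup (v t) (w t) <= L * dsup (y t) (z t) + k) ->
  dsup (y T) (z T) ^ 2
    <= exp ((4 * L + 2) * T) * (2 * dsup (y 0) (z 0) ^ 2 + k ^ 2 * T).
Proof.
  intros HT HL Hk Hd Hc Hb.
  pose proof (gronwall_sqr (fun t => fst (z t) - fst (y t)) (fun t => snd (z t) - snd (y t))
    (fun t => fst (w t) - fst (v t)) (fun t => snd (w t) - snd (v t)) L k T HT HL Hk) as G.
  simpl in G.
  eapply Rle_trans; [apply dsup_sqr|]. simpl. eapply Rle_trans; [apply G|].
  - intros t Ht. destruct (Hd t Ht) as [[Y1 Y2] [Z1 Z2]].
    split; [apply (is_derive_minus (fun u => fst (z u)) (fun u => fst (y u)))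
           |apply (is_derive_minus (fun u => snd (z u)) (fun u => snd (y u)))]; assumption.
  - intros t Ht. destruct (Hc t Ht) as [[Y1 Y2] [Z1 Z2]].
    split; [apply (continuity_pt_minus (fun u => fst (z u)) (fun u => fst (y u)))
           |apply (continuity_pt_minus (fun u => snd (z u)) (fun u => snd (y u)))]; assumption.
  - intros t Ht. specialize (Hb t Ht).
    assert (Hs : L * dsup (y t) (z t) <=
      L * (Rabs (fst (z t) - fst (y t)) + Rabs (snd (z t) - snd (y t)))).
    { apply Rmult_le_compat_l; [assumption|]. apply dsup_le.
      pose proof (Rabs_pos (fst (z t) - fst (y t))).
      pose proof (Rabs_pos (snd (z t) - snd (y t))). lra. }
    pose proof (dsup_fst (v t) (w t)). pose proof (dsup_snd (v t) (w t)). lra.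
  - apply Rmult_le_compat_l; [left; apply exp_pos|].
    pose proof (proj1 (dsup_sqr (y 0) (z 0))). simpl in *. lra.
Qed.

(** * Flows of bounded Lipschitz fields *)

(** The fields are bounded and Lipschitz on the whole plane, which makes their
    flows global; one constant [L] serves for both properties, so that the two
    zones can share it. *)
Record flow (V : R * R -> R * R) (Phi : R -> R * R -> R * R) (L : R) : Prop := {
  fl_pos : 0 < L;
  fl_lip : forall p q, dsup (V p) (V q) <= L * dsup p q;
  fl_bnd : forall p, Rabs (fst (V p)) <= L /\ Rabs (snd (V p)) <= L;
  fl_0 : forall p, Phi 0 p = p;
  fl_der : forall p t, der (fun u => Phi u p) t (V (Phi t p))
}.

Arguments fl_pos {V Phi L} _.
Arguments fl_lip {V Phi L} _ p q.
Arguments fl_bnd {V Phi L} _ p.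
Arguments fl_0 {V Phi L} _ p.
Arguments fl_der {V Phi L} _ p t.

(** In the norm weighted by [exp (c * Rabs t)], integration from 0 is a
    contraction with factor [1 / c], on the whole real line. *)
Lemma RInt_bound_exp (f : R -> R) (K c t : R) : 0 < c -> 0 <= K ->
  (forall u, continuous f u) ->
  (forall u, Rabs (f u) <= K * exp (c * Rabs u)) ->
  Rabs (RInt f 0 t) <= K / c * exp (c * Rabs t).
Proof.
  intros Hc HK Hf Hb.
  assert (HD : forall u, is_derive (fun u => RInt f 0 u) u (f u)).
  { intros u. apply (is_derive_RInt f (fun u => RInt f 0 u) 0 u); [|apply Hf].
    exists (mkposreal 1 Rlt_0_1). intros v _.
    apply (RInt_correct f). apply ex_RInt_continuous. intros; apply Hf. }
  assert (H0 : RInt f 0 0 = 0) by (apply (RInt_point 0 f)).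
  assert (key : forall (sg s : R), (s = 1 \/ s = -1) -> (sg = 1 \/ sg = -1) ->
    forall x, 0 <= x -> s * RInt f 0 (sg * x) <= K / c * exp (c * x)).
  { intros sg s Hs Hsg x Hx.
    assert (Hx2 : s * RInt f 0 (sg * x) - K / c * exp (c * x)
                  <= s * RInt f 0 (sg * 0) - K / c * exp (c * 0)).
    { assert (HDg : forall y, is_derive
        (fun x => s * RInt f 0 (sg * x) - K / c * exp (c * x)) y
        (s * (sg * f (sg * y)) - K * exp (c * y))).
      { intros y. apply (is_derive_minus (fun x => s * RInt f 0 (sg * x)) (fun x => K / c * exp (c * x))).
        - apply (is_derive_scal (fun x => RInt f 0 (sg * x))).
          apply (is_derive_comp (fun u => RInt f 0 u) (fun x => sg * x)); [apply HD|].
          auto_derive; [exact I|]. ring.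
        - auto_derive; [exact I|]. field. lra. }
      apply (deriv_nonpos_le (fun x => s * RInt f 0 (sg * x) - K / c * exp (c * x))
        (fun y => s * (sg * f (sg * y)) - K * exp (c * y)) 0 x Hx).
      - intros y _. apply HDg.
      - intros y _. eapply is_derive_continuity_pt. apply HDg.
      - intros y Hy. specialize (Hb (sg * y)).
        replace (Rabs (sg * y)) with y in Hb.
        2:{ destruct Hsg as [-> | ->]; [rewrite Rmult_1_l, Rabs_pos_eq; lra|].
            replace (-1 * y) with (- y) by ring. rewrite Rabs_Ropp, Rabs_pos_eq; lra. }
        apply Rabs_le_between in Hb.
        destruct Hs as [-> | ->], Hsg as [-> | ->]; lra. }
    rewrite (Rmult_0_r sg), H0, (Rmult_0_r c), exp_0 in Hx2.
    assert (0 <= K / c) by (apply Rdiv_le_0_compat; lra). lra. }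
  apply Rabs_le_between.
  destruct (Rle_dec 0 t) as [Ht|Ht].
  - rewrite (Rabs_pos_eq t Ht).
    pose proof (key 1 1 (or_introl eq_refl) (or_introl eq_refl) t Ht) as K1.
    pose proof (key 1 (-1) (or_intror eq_refl) (or_introl eq_refl) t Ht) as K2.
    rewrite Rmult_1_l in K1, K2. rewrite Rmult_1_l in K1. lra.
  - assert (Ht' : 0 <= - t) by lra.
    rewrite (Rabs_left t) by lra.
    pose proof (key (-1) 1 (or_introl eq_refl) (or_intror eq_refl) (- t) Ht') as K1.
    pose proof (key (-1) (-1) (or_intror eq_refl) (or_intror eq_refl) (- t) Ht') as K2.
    replace (-1 * - t) with t in K1, K2 by ring. lra.
Qed.

Lemma geometric_limit (u : nat -> R) (K : R) :
  (forall n, Rabs (u (S n) - u n) <= K * (1 / 2) ^ S n) ->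
  exists l, forall n, Rabs (u n - l) <= K * (1 / 2) ^ n.
Proof.
  intros H.
  assert (H2 : forall n k, Rabs (u (n + k)%nat - u n) <= K * ((1 / 2) ^ n - (1 / 2) ^ (n + k))).
  { intros n k. induction k as [|k IH].
    - rewrite Nat.add_0_r, Rminus_diag, Rabs_R0. lra.
    - rewrite Nat.add_succ_r.
      replace (u (S (n + k)) - u n) with ((u (S (n + k)) - u (n + k)%nat) + (u (n + k)%nat - u n)) by ring.
      eapply Rle_trans; [apply Rabs_triang|]. specialize (H (n + k)%nat). simpl in *. lra. }
  assert (HK : 0 <= K).
  { specialize (H 0%nat). pose proof (Rabs_pos (u 1%nat - u 0%nat)). simpl in H. lra. }
  assert (Hp : forall n, 0 < (1 / 2) ^ n) by (intros n; apply pow_lt; lra).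
  assert (Hlim : ex_finite_lim_seq u).
  { apply ex_lim_seq_cauchy_corr. intros eps.
    destruct (pow_lt_1_zero (1 / 2)) with (y := eps / (2 * (K + 1))) as [N HN].
    { rewrite Rabs_pos_eq; lra. }
    { apply Rdiv_lt_0_compat; [apply cond_pos|lra]. }
    exists N.
    assert (HNN : K * (1 / 2) ^ N < eps / 2).
    { specialize (HN N (le_n N)). rewrite Rabs_pos_eq in HN by (left; apply Hp).
      apply Rle_lt_trans with ((K + 1) * (1 / 2) ^ N); [specialize (Hp N); nra|].
      apply Rmult_lt_compat_l with (r := K + 1) in HN; [|lra].
      replace ((K + 1) * (eps / (2 * (K + 1)))) with (eps / 2) in HN by (field; lra). exact HN. }
    assert (Hc : forall n, (N <= n)%nat -> Rabs (u n - u N) < eps / 2).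
    { intros n Hn. replace n with (N + (n - N))%nat by lia.
      eapply Rle_lt_trans; [apply H2|]. specialize (Hp (N + (n - N))%nat). nra. }
    intros n m Hn Hm. replace (u n - u m) with ((u n - u N) - (u m - u N)) by ring.
    eapply Rle_lt_trans; [apply Rabs_triang|]. rewrite Rabs_Ropp.
    pose proof (Hc n Hn). pose proof (Hc m Hm). lra. }
  destruct Hlim as [l Hl]. exists l. intros n.
  assert (Hl2 : is_lim_seq (fun k => Rabs (u n - u (n + k)%nat)) (Rabs (u n - l))).
  { apply (is_lim_seq_abs _ (Finite (u n - l))). apply is_lim_seq_minus'; [apply is_lim_seq_const|].
    apply (is_lim_seq_incr_n u n) in Hl.
    eapply is_lim_seq_ext; [|exact Hl]. intros k. simpl. f_equal. lia. }
  assert (Rbar_le (Rabs (u n - l)) (K * (1 / 2) ^ n)).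
  { apply is_lim_seq_le with (2 := Hl2) (3 := is_lim_seq_const (K * (1 / 2) ^ n)).
    intros k. rewrite Rabs_minus_sym. eapply Rle_trans; [apply H2|]. specialize (Hp (n + k)%nat). nra. }
  exact H0.
Qed.

Lemma geometric_small (K a : R) : (forall n, a <= K * (1 / 2) ^ n) -> a <= 0.
Proof.
  intros Ha. apply Rnot_lt_le. intros Hpos.
  assert (0 < K) by (specialize (Ha 0%nat); simpl in Ha; lra).
  destruct (pow_lt_1_zero (1 / 2)) with (y := a / K) as [N HN].
  { rewrite Rabs_pos_eq; lra. }
  { apply Rdiv_lt_0_compat; lra. }
  specialize (HN N (le_n N)). rewrite Rabs_pos_eq in HN by (left; apply pow_lt; lra).
  apply Rmult_lt_compat_l with (r := K) in HN; [|assumption].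
  replace (K * (a / K)) with a in HN by (field; lra). specialize (Ha N). lra.
Qed.

Section Picard.

Variables (V : R * R -> R * R) (L : R) (p : R * R).
Hypothesis L_pos : 0 < L.
Hypothesis V_lip : forall q q', dsup (V q) (V q') <= L * dsup q q'.
Hypothesis V_bnd : forall q, Rabs (fst (V q)) <= L /\ Rabs (snd (V q)) <= L.

Let lip1 (y : R -> R * R) := forall t t', dsup (y t) (y t') <= L * Rabs (t' - t).

Let step (y : R -> R * R) (t : R) : R * R :=
  (fst p + RInt (fun u => fst (V (y u))) 0 t, snd p + RInt (fun u => snd (V (y u))) 0 t).

Lemma picard_cont y : lip1 y -> forall u,
  continuous (fun u => fst (V (y u))) u /\ continuous (fun u => snd (V (y u))) u.
Proof.
  intros Hy u. assert (cts (fun u => V (y u)) u).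
  { apply cts_dsup. intros e He. exists (e / (L * L)).
    assert (0 < L * L) by nra. split; [apply Rdiv_lt_0_compat; lra|].
    intros u' Hu. eapply Rle_lt_trans; [apply V_lip|].
    apply Rle_lt_trans with (L * (L * Rabs (u' - u))).
    - apply Rmult_le_compat_l; [lra|apply Hy].
    - apply Rmult_lt_compat_l with (r := L * L) in Hu; [|assumption].
      replace (L * L * (e / (L * L))) with e in Hu by (field; lra). lra. }
  destruct H as [H1 H2]. apply continuity_pt_filterlim in H1, H2. split; assumption.
Qed.

Lemma picard_der y : lip1 y -> forall t, der (step y) t (V (y t)).
Proof.
  intros Hy t. unfold step, der; simpl.
  assert (HD : forall f : R -> R, (forall u, continuous f u) -> forall a,
    is_derive (fun u => a + RInt f 0 u) t (f t)).
  { intros f Hf a. replace (f t) with (0 + f t) by ring.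
    apply (is_derive_plus (fun _ => a) (fun u => RInt f 0 u)); [apply (is_derive_const a)|].
    apply (is_derive_RInt f (fun u => RInt f 0 u) 0 t); [|apply Hf].
    exists (mkposreal 1 Rlt_0_1). intros v _.
    apply (RInt_correct f). apply ex_RInt_continuous. intros; apply Hf. }
  split; [apply (HD (fun u => fst (V (y u))))|apply (HD (fun u => snd (V (y u))))];
    intros u; apply picard_cont; assumption.
Qed.

Lemma bounded_der_lip (y v : R -> R * R) :
  (forall t, der y t (v t)) ->
  (forall t, Rabs (fst (v t)) <= L /\ Rabs (snd (v t)) <= L) -> lip1 y.
Proof.
  intros Hd Hb t t'. apply dsup_le.
  assert (key : forall f df : R -> R, (forall u, is_derive f u (df u)) ->
    (forall u, Rabs (df u) <= L) -> Rabs (f t' - f t) <= L * Rabs (t' - t)).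
  { intros f df HD HB.
    destruct (MVT_gen f t t' df) as [c [_ ->]].
    - intros x _. apply HD.
    - intros x _. eapply is_derive_continuity_pt, HD.
    - rewrite Rabs_mult. apply Rmult_le_compat_r; [apply Rabs_pos|apply HB]. }
  split.
  - apply (key (fun u => fst (y u)) (fun u => fst (v u))); [apply Hd|apply Hb].
  - apply (key (fun u => snd (y u)) (fun u => snd (v u))); [apply Hd|apply Hb].
Qed.

Let Fixpoint iter (n : nat) : R -> R * R :=
  match n with O => fun _ => p | S n => step (iter n) end.

Lemma picard_iter_lip n : lip1 (iter n).
Proof.
  induction n as [|n IH].
  - intros t t'. simpl. rewrite dsup_refl. pose proof (Rabs_pos (t' - t)). nra.
  - apply (bounded_der_lip (iter (S n)) (fun t => V (iter n t))).
    + intros t. apply (picard_der _ IH).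
    + intros t. apply V_bnd.
Qed.

(** The weight [exp (2 * L * Rabs t)] makes the Picard operator halve distances
    for all times at once, so that no gluing of local solutions is needed. *)
Lemma step_close y z K : 0 <= K -> lip1 y -> lip1 z ->
  (forall t, dsup (y t) (z t) <= K * exp (2 * L * Rabs t)) ->
  forall t, dsup (step y t) (step z t) <= K / 2 * exp (2 * L * Rabs t).
Proof.
  intros HK Hy Hz Hd t. apply dsup_le. unfold step; simpl.
  assert (HI : forall f : R -> R, (forall u, continuous f u) -> ex_RInt f 0 t).
  { intros f Hf. apply (ex_RInt_continuous f). intros; apply Hf. }
  assert (key : forall f g : R -> R, (forall u, continuous f u) -> (forall u, continuous g u) ->
    (forall u, Rabs (g u - f u) <= L * dsup (y u) (z u)) ->
    forall a, Rabs (a + RInt g 0 t - (a + RInt f 0 t)) <= K / 2 * exp (2 * L * Rabs t)).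
  { intros f g Hf Hg Hfg a.
    replace (a + RInt g 0 t - (a + RInt f 0 t)) with (RInt (fun u => minus (g u) (f u)) 0 t).
    2:{ rewrite (RInt_minus g f) by auto. unfold minus, plus, opp; simpl. ring. }
    eapply Rle_trans; [apply (RInt_bound_exp _ (L * K) (2 * L))|].
    - lra.
    - nra.
    - intros u. apply (continuous_minus g f); auto.
    - intros u. unfold minus, plus, opp; simpl. eapply Rle_trans; [apply Hfg|].
      rewrite Rmult_assoc. apply Rmult_le_compat_l; [lra|apply Hd].
    - right. field. lra. }
  split.
  - apply (key (fun u => fst (V (y u))) (fun u => fst (V (z u))));
      [apply (picard_cont y Hy)|apply (picard_cont z Hz)|].
    intros u. eapply Rle_trans; [apply dsup_fst|apply V_lip].
  - apply (key (fun u => snd (V (y u))) (fun u => snd (V (z u))));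
      [apply (picard_cont y Hy)|apply (picard_cont z Hz)|].
    intros u. eapply Rle_trans; [apply dsup_snd|apply V_lip].
Qed.

Lemma picard : exists y : R -> R * R, y 0 = p /\ forall t, der y t (V (y t)).
Proof.
  assert (Hexp : forall t, 0 < exp (2 * L * Rabs t)) by (intros; apply exp_pos).
  assert (Hstep : forall n t, dsup (iter n t) (iter (S n) t)
                              <= (1 / 2) ^ S n * exp (2 * L * Rabs t)).
  { induction n as [|n IH]; intros t.
    - apply dsup_le. simpl.
      assert (key : forall f : R, Rabs f <= L ->
        forall a, Rabs (a + RInt (fun _ => f) 0 t - a) <= 1 / 2 * 1 * exp (2 * L * Rabs t)).
      { intros f Hf a. assert (E : forall b : R, a + b - a = b) by (intros; ring). rewrite E.
        eapply Rle_trans; [apply (RInt_bound_exp (fun _ => f) L (2 * L))|].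
        - lra.
        - lra.
        - intros u. apply continuous_const.
        - intros u. assert (1 <= exp (2 * L * Rabs u)).
          { rewrite <- exp_0. pose proof (Rabs_pos u).
            destruct (Req_dec (2 * L * Rabs u) 0) as [->|]; [lra|]. left. apply exp_increasing.
            assert (0 <= 2 * L * Rabs u) by (apply Rmult_le_pos; lra). lra. }
          nra.
        - right. field. lra. }
      split; apply key; apply V_bnd.
    - change (iter (S n) t) with (step (iter n) t).
      change (iter (S (S n)) t) with (step (iter (S n)) t).
      replace ((1 / 2) ^ S (S n)) with ((1 / 2) ^ S n / 2) by (simpl; field).
      apply step_close; [left; apply pow_lt; lra|apply picard_iter_lip|apply picard_iter_lip|exact IH]. }
  assert (Hex : forall t, exists q, forall n, dsup (iter n t) q <= exp (2 * L * Rabs t) * (1 / 2) ^ n).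
  { intros t.
    destruct (geometric_limit (fun n => fst (iter n t)) (exp (2 * L * Rabs t))) as [l1 H1].
    { intros n. eapply Rle_trans; [apply dsup_fst|]. rewrite Rmult_comm. apply Hstep. }
    destruct (geometric_limit (fun n => snd (iter n t)) (exp (2 * L * Rabs t))) as [l2 H2].
    { intros n. eapply Rle_trans; [apply dsup_snd|]. rewrite Rmult_comm. apply Hstep. }
    exists (l1, l2). intros n. rewrite dsup_sym. apply dsup_le. split; [apply H1|apply H2]. }
  set (y := fun t => proj1_sig (constructive_indefinite_description _ (Hex t))).
  assert (Hy : forall t n, dsup (iter n t) (y t) <= exp (2 * L * Rabs t) * (1 / 2) ^ n).
  { intros t. unfold y. exact (proj2_sig (constructive_indefinite_description _ (Hex t))). }
  clearbody y.
  assert (Hlip : lip1 y).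
  { intros t t'. apply Rminus_le.
    apply (geometric_small (exp (2 * L * Rabs t) + exp (2 * L * Rabs t'))). intros n.
    pose proof (Hy t n) as A1. pose proof (Hy t' n) as A2. pose proof (picard_iter_lip n t t') as A3.
    pose proof (dsup_tri (y t) (iter n t) (y t')). pose proof (dsup_tri (iter n t) (iter n t') (y t')).
    rewrite (dsup_sym (y t) (iter n t)) in *. lra. }
  assert (Hfix : forall t, y t = step y t).
  { intros t. apply dsup_eq0. apply (geometric_small (2 * exp (2 * L * Rabs t))). intros n.
    pose proof (Hy t (S n)) as A1.
    assert (A2 : dsup (step (iter n) t) (step y t) <= (1 / 2) ^ n / 2 * exp (2 * L * Rabs t)).
    { apply step_close; [left; apply pow_lt; lra|apply picard_iter_lip|exact Hlip|].
      intros u. rewrite Rmult_comm. apply Hy. }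
    pose proof (dsup_tri (y t) (iter (S n) t) (step y t)) as A3.
    rewrite (dsup_sym (y t) (iter (S n) t)) in A3.
    change (iter (S n) t) with (step (iter n) t) in *. simpl in A1.
    pose proof (Hexp t). pose proof (pow_lt (1 / 2) n ltac:(lra)). nra. }
  exists y. split.
  - rewrite Hfix. unfold step. destruct p as [a b]; simpl. f_equal.
    + rewrite (RInt_point 0). unfold zero; simpl. ring.
    + rewrite (RInt_point 0). unfold zero; simpl. ring.
  - intros t. destruct (picard_der y Hlip t) as [D1 D2]. split.
    + eapply is_derive_ext; [|exact D1]. intros u. rewrite (Hfix u). reflexivity.
    + eapply is_derive_ext; [|exact D2]. intros u. rewrite (Hfix u). reflexivity.
Qed.

End Picard.

Theorem flow_exists (V : R * R -> R * R) (L : R) : 0 < L ->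
  (forall p q, dsup (V p) (V q) <= L * dsup p q) ->
  (forall p, Rabs (fst (V p)) <= L /\ Rabs (snd (V p)) <= L) ->
  exists Phi, flow V Phi L.
Proof.
  intros HL Hl Hb.
  destruct (choice (fun p (y : R -> R * R) => y 0 = p /\ forall t, der y t (V (y t)))) as [F HF].
  { intros p. apply (picard V L p HL Hl Hb). }
  exists (fun t p => F p t). constructor; auto.
  - intros p. apply HF.
  - intros p t. apply HF.
Qed.

Definition vopp (v : R * R) : R * R := (- fst v, - snd v).

Lemma dsup_vopp u v : dsup (vopp u) (vopp v) = dsup u v.
Proof.
  unfold dsup, vopp; simpl. f_equal; [rewrite <- (Rabs_Ropp (fst v - fst u))
    |rewrite <- (Rabs_Ropp (snd v - snd u))]; f_equal; ring.
Qed.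

Lemma flow_rev V Phi L : flow V Phi L ->
  flow (fun p => vopp (V p)) (fun t p => Phi (- t) p) L.
Proof.
  intros [H1 H2 H3 H4 H5]. constructor.
  - exact H1.
  - intros p q. rewrite dsup_vopp. apply H2.
  - intros p. simpl. rewrite !Rabs_Ropp. apply H3.
  - intros p. rewrite Ropp_0. apply H4.
  - intros p t. destruct (H5 p (- t)) as [D1 D2].
    split; simpl.
    + replace (- fst (V (Phi (- t) p))) with (-1 * fst (V (Phi (- t) p))) by ring.
      apply (is_derive_comp (fun u => fst (Phi u p)) (fun u => - u)); [exact D1|].
      auto_derive; [exact I|]. reflexivity.
    + replace (- snd (V (Phi (- t) p))) with (-1 * snd (V (Phi (- t) p))) by ring.
      apply (is_derive_comp (fun u => snd (Phi u p)) (fun u => - u)); [exact D2|].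
      auto_derive; [exact I|]. reflexivity.
Qed.

Lemma flow_unique V Phi L (y : R -> R * R) T : flow V Phi L -> 0 <= T ->
  (forall t, 0 <= t <= T -> cts y t) ->
  (forall t, 0 < t < T -> der y t (V (y t))) ->
  y T = Phi T (y 0).
Proof.
  intros F HT Hc Hd.
  assert (HL : 0 <= L) by (left; apply (fl_pos F)).
  pose proof (gronwall y (fun t => Phi t (y 0)) (fun t => V (y t)) (fun t => V (Phi t (y 0)))
    L 0 T HT HL (Rle_refl 0)) as G.
  apply dsup_eq0. cbv beta in G. rewrite (fl_0 F), dsup_refl in G.
  assert (G' : dsup (y T) (Phi T (y 0)) ^ 2 <= 0).
  { eapply Rle_trans; [apply G|].
    - intros t Ht. split; [apply Hd; exact Ht|apply (fl_der F)].
    - intros t Ht. split; [apply Hc; exact Ht|exact (der_cts _ _ _ (fl_der F _ _))].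
    - intros t _. rewrite Rplus_0_r. apply (fl_lip F).
    - right. ring. }
  pose proof (dsup_pos (y T) (Phi T (y 0))). nra.
Qed.

Lemma der_shift (y : R -> R * R) a t v : der y (t + a) v -> der (fun u => y (u + a)) t v.
Proof.
  intros [D1 D2]. split.
  - replace (fst v) with (1 * fst v) by ring.
    apply (is_derive_comp (fun u => fst (y u)) (fun u => u + a)); [exact D1|].
    auto_derive; [exact I|ring].
  - replace (snd v) with (1 * snd v) by ring.
    apply (is_derive_comp (fun u => snd (y u)) (fun u => u + a)); [exact D2|].
    auto_derive; [exact I|ring].
Qed.

Lemma flow_add_pos V Phi L t s p : flow V Phi L -> 0 <= t ->
  Phi (t + s) p = Phi t (Phi s p).
Proof.
  intros F Ht.
  pose proof (flow_unique V Phi L (fun u => Phi (u + s) p) t F Ht) as U.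
  cbv beta in U. rewrite Rplus_0_l in U. apply U.
  - intros u _. apply (der_cts _ u (V (Phi (u + s) p))).
    apply (der_shift (fun u => Phi u p)), (fl_der F).
  - intros u _. apply (der_shift (fun u => Phi u p)), (fl_der F).
Qed.

Lemma flow_add V Phi L t s p : flow V Phi L -> Phi (t + s) p = Phi t (Phi s p).
Proof.
  intros F. destruct (Rle_dec 0 t) as [Ht|Ht]; [eapply flow_add_pos; eassumption|].
  pose proof (flow_add_pos _ _ _ (- t) (- s) p (flow_rev _ _ _ F)) as H. cbv beta in H.
  rewrite !Ropp_involutive in H. rewrite <- H by lra. f_equal. ring.
Qed.

Arguments flow_add {V Phi L t s p} _.

Lemma flow_back V Phi L t p : flow V Phi L -> Phi (- t) (Phi t p) = p.
Proof.
  intros F. rewrite <- (flow_add F).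
  replace (- t + t) with 0 by ring. apply (fl_0 F).
Qed.

Lemma flow_dep_pos V Phi L t p q : flow V Phi L -> 0 <= t ->
  dsup (Phi t p) (Phi t q) <= 2 * exp ((4 * L + 2) * t) * dsup p q.
Proof.
  intros F Ht.
  assert (HL : 0 <= L) by (left; apply (fl_pos F)).
  assert (G : dsup (Phi t p) (Phi t q) ^ 2 <= exp ((4 * L + 2) * t) * (2 * dsup p q ^ 2)).
  { pose proof (gronwall (fun t => Phi t p) (fun t => Phi t q) (fun t => V (Phi t p))
      (fun t => V (Phi t q)) L 0 t Ht HL (Rle_refl 0)) as G.
    cbv beta in G. rewrite !(fl_0 F) in G.
    eapply Rle_trans; [apply G|].
    - intros u _. split; apply (fl_der F).
    - intros u _. split; exact (der_cts _ _ _ (fl_der F _ _)).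
    - intros u _. rewrite Rplus_0_r. apply (fl_lip F).
    - right. ring. }
  assert (He : 1 <= exp ((4 * L + 2) * t)).
  { rewrite <- exp_0. destruct (Req_dec ((4 * L + 2) * t) 0) as [->|Hn]; [lra|].
    left. apply exp_increasing. assert (0 <= (4 * L + 2) * t) by (apply Rmult_le_pos; lra). lra. }
  pose proof (dsup_pos (Phi t p) (Phi t q)). pose proof (dsup_pos p q) as Hd.
  set (E := exp ((4 * L + 2) * t)) in *.
  apply Rsqr_incr_0; [|assumption|apply Rmult_le_pos; lra].
  unfold Rsqr. replace (2 * E * dsup p q * (2 * E * dsup p q)) with (4 * (E * E) * dsup p q ^ 2) by ring.
  assert (E * (2 * dsup p q ^ 2) <= 4 * (E * E) * dsup p q ^ 2).
  { assert (0 <= dsup p q ^ 2) by apply pow2_ge_0. nra. }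
  simpl in G. simpl in *. lra.
Qed.

Lemma flow_dep V Phi L t p q : flow V Phi L ->
  dsup (Phi t p) (Phi t q) <= 2 * exp ((4 * L + 2) * Rabs t) * dsup p q.
Proof.
  intros F. destruct (Rle_dec 0 t) as [Ht|Ht].
  - rewrite Rabs_pos_eq by exact Ht. eapply flow_dep_pos; eassumption.
  - rewrite Rabs_left by lra.
    pose proof (flow_dep_pos _ _ _ (- t) p q (flow_rev _ _ _ F)) as H. cbv beta in H.
    rewrite Ropp_involutive in H. apply H. lra.
Qed.

Lemma flow_speed V Phi L t t' p : flow V Phi L ->
  dsup (Phi t p) (Phi t' p) <= L * Rabs (t' - t).
Proof.
  intros F. apply (bounded_der_lip L (fun u => Phi u p) (fun u => V (Phi u p))).
  - intros u. apply (fl_der F).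
  - intros u. apply (fl_bnd F).
Qed.

Lemma flow_near V Phi L t0 p0 e : flow V Phi L -> 0 < e -> exists d, 0 < d /\
  forall t p, Rabs (t - t0) < d -> dsup p0 p < d -> dsup (Phi t0 p0) (Phi t p) < e.
Proof.
  intros F He. set (C := 2 * exp ((4 * L + 2) * Rabs t0)).
  pose proof (fl_pos F) as HL.
  assert (HC : 0 < C) by (unfold C; pose proof (exp_pos ((4 * L + 2) * Rabs t0)); lra).
  exists (e / (C + L)). assert (HE : 0 < e / (C + L)) by (apply Rdiv_lt_0_compat; lra).
  split; [exact HE|].
  intros t p Ht Hp.
  pose proof (dsup_tri (Phi t0 p0) (Phi t0 p) (Phi t p)) as H1.
  pose proof (flow_dep _ _ _ t0 p0 p F) as H2. fold C in H2.
  pose proof (flow_speed _ _ _ t0 t p F) as H3.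
  assert (C * dsup p0 p < C * (e / (C + L))) by (apply Rmult_lt_compat_l; lra).
  assert (L * Rabs (t - t0) < L * (e / (C + L))) by (apply Rmult_lt_compat_l; lra).
  assert (C * (e / (C + L)) + L * (e / (C + L)) = e) by (field; lra). lra.
Qed.

(** Orbits of neighbouring points stay close up to a slightly later time; past
    time [T] they are compared with the end point. *)
Lemma flow_close V Phi L T p0 e : flow V Phi L -> 0 <= T -> 0 < e -> exists d, 0 < d /\
  forall p, dsup p0 p < d -> forall t, 0 <= t < T + d -> dsup (Phi (Rmin t T) p0) (Phi t p) < e.
Proof.
  intros F HT He. set (C := 2 * exp ((4 * L + 2) * T)).
  pose proof (fl_pos F) as HL.
  assert (HC : 0 < C) by (unfold C; pose proof (exp_pos ((4 * L + 2) * T)); lra).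
  exists (e / (C + L)). assert (HE : 0 < e / (C + L)) by (apply Rdiv_lt_0_compat; lra).
  split; [exact HE|].
  intros p Hp t Ht.
  set (m := Rmin t T).
  assert (Hm : 0 <= m <= T) by (unfold m, Rmin; destruct (Rle_dec t T); lra).
  assert (Hm2 : Rabs (t - m) < e / (C + L)).
  { unfold m, Rmin; destruct (Rle_dec t T); [rewrite Rminus_diag, Rabs_R0; lra|].
    rewrite Rabs_pos_eq; lra. }
  pose proof (dsup_tri (Phi m p0) (Phi m p) (Phi t p)) as H1.
  assert (H2 : dsup (Phi m p0) (Phi m p) <= C * dsup p0 p).
  { eapply Rle_trans; [apply (flow_dep_pos _ _ _ m p0 p F); lra|].
    apply Rmult_le_compat_r; [apply dsup_pos|]. unfold C.
    apply Rmult_le_compat_l; [lra|].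
    destruct (Req_dec m T) as [->|]; [lra|]. left. apply exp_increasing. nra. }
  pose proof (flow_speed _ _ _ m t p F) as H3.
  assert (C * dsup p0 p < C * (e / (C + L))) by (apply Rmult_lt_compat_l; lra).
  assert (L * Rabs (t - m) < L * (e / (C + L))) by (apply Rmult_lt_compat_l; lra).
  assert (C * (e / (C + L)) + L * (e / (C + L)) = e) by (field; lra). lra.
Qed.

(** * Flows and the line h = 0 *)

Definition lie (alpha beta : R) (V : R * R -> R * R) (p : R * R) : R :=
  alpha * fst (V p) - beta * snd (V p).

Section Line.

Variables alpha beta : R.

Local Notation h := (Defs.h alpha beta).
Local Notation sigma := (Defs.sigma alpha beta).
Local Notation lie := (lie alpha beta).

Lemma h_sigma s : h (sigma s) = 0.
Proof. unfold Defs.h, Defs.sigma; simpl. ring. Qed.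

Lemma h_zero_sigma p : beta <> 0 -> h p = 0 -> p = sigma ((fst p - 1) / beta).
Proof.
  intros Hb Hh. unfold Defs.h in Hh. destruct p as [x y]; unfold Defs.sigma; simpl in *.
  f_equal; [field; assumption|].
  apply Rmult_eq_reg_l with beta; [|assumption].
  replace (beta * (1 + alpha * ((x - 1) / beta))) with (beta + alpha * (x - 1)) by (field; assumption).
  lra.
Qed.

Lemma sigma_inj s s' : beta <> 0 -> sigma s = sigma s' -> s = s'.
Proof. intros Hb H. injection H as H1 H2. apply Rmult_eq_reg_l with beta; lra. Qed.

Lemma sigma_dsup s s' : Rabs beta * Rabs (s' - s) <= dsup (sigma s) (sigma s') /\
  dsup (sigma s) (sigma s') <= (Rabs alpha + Rabs beta) * Rabs (s' - s).
Proof.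
  pose proof (Rabs_pos alpha). pose proof (Rabs_pos beta). pose proof (Rabs_pos (s' - s)).
  split.
  - eapply Rle_trans; [|apply dsup_fst]. simpl. right. rewrite <- Rabs_mult. f_equal. ring.
  - apply dsup_le. simpl. split.
    + replace (1 + beta * s' - (1 + beta * s)) with (beta * (s' - s)) by ring.
      rewrite Rabs_mult. nra.
    + replace (1 + alpha * s' - (1 + alpha * s)) with (alpha * (s' - s)) by ring.
      rewrite Rabs_mult. nra.
Qed.

Lemma covector_bound u v : Rabs (alpha * u - beta * v) <=
  Rabs alpha * Rabs u + Rabs beta * Rabs v.
Proof.
  eapply Rle_trans; [apply Rabs_triang|]. rewrite Rabs_Ropp, !Rabs_mult. lra.
Qed.

Lemma covector_dsup p q : Rabs ((alpha * fst q - beta * snd q) - (alpha * fst p - beta * snd p))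
  <= (Rabs alpha + Rabs beta) * dsup p q.
Proof.
  replace ((alpha * fst q - beta * snd q) - (alpha * fst p - beta * snd p))
    with (alpha * (fst q - fst p) - beta * (snd q - snd p)) by ring.
  eapply Rle_trans; [apply covector_bound|].
  pose proof (dsup_fst p q). pose proof (dsup_snd p q).
  pose proof (Rabs_pos alpha). pose proof (Rabs_pos beta). nra.
Qed.

Lemma h_dsup p q : Rabs (h q - h p) <= (Rabs alpha + Rabs beta) * dsup p q.
Proof.
  eapply Rle_trans; [|apply covector_dsup]. right. f_equal. unfold Defs.h. ring.
Qed.

Lemma h_near p e : 0 < e -> exists d, 0 < d /\ forall q, dsup p q < d -> Rabs (h q - h p) < e.
Proof.
  intros He. pose proof (Rabs_pos alpha). pose proof (Rabs_pos beta).
  exists (e / (Rabs alpha + Rabs beta + 1)). split; [apply Rdiv_lt_0_compat; lra|].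
  intros q Hq. eapply Rle_lt_trans; [apply h_dsup|].
  apply Rlt_div_r in Hq; [|lra]. pose proof (dsup_pos p q). nra.
Qed.

Lemma lie_near V Phi L p e : flow V Phi L -> 0 < e -> exists d, 0 < d /\
  forall q, dsup p q < d -> Rabs (lie V q - lie V p) < e.
Proof.
  intros F He. pose proof (Rabs_pos alpha). pose proof (Rabs_pos beta).
  pose proof (fl_pos F) as HL. set (K := (Rabs alpha + Rabs beta) * L).
  assert (0 <= K) by (unfold K; nra).
  exists (e / (K + 1)). split; [apply Rdiv_lt_0_compat; lra|].
  intros q Hq. unfold Submission.lie.
  eapply Rle_lt_trans; [apply covector_dsup|].
  apply Rlt_div_r in Hq; [|lra]. pose proof (dsup_pos p q).
  apply Rle_lt_trans with (K * dsup p q); [|nra].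
  unfold K. rewrite Rmult_assoc. apply Rmult_le_compat_l; [lra|apply (fl_lip F)].
Qed.

Lemma h_der y t v : der y t v ->
  is_derive (fun u => h (y u)) t (alpha * fst v - beta * snd v).
Proof.
  intros [D1 D2].
  assert (E : forall u : R, alpha * fst (y u) - beta * snd (y u) + (beta - alpha) = h (y u)).
  { intros u. unfold Defs.h. ring. }
  apply (is_derive_ext _ _ t _ E).
  replace (alpha * fst v - beta * snd v) with (alpha * fst v - beta * snd v + 0) by ring.
  apply (is_derive_plus (fun u => alpha * fst (y u) - beta * snd (y u)) (fun _ => beta - alpha));
    [|apply (is_derive_const (beta - alpha))].
  apply (is_derive_minus (fun u => alpha * fst (y u)) (fun u => beta * snd (y u))).
  - apply (is_derive_scal (fun u => fst (y u))). exact D1.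
  - apply (is_derive_scal (fun u => snd (y u))). exact D2.
Qed.

Variables (V : R * R -> R * R) (Phi : R -> R * R -> R * R) (L c : R).
Hypothesis F : flow V Phi L.

Lemma h_flow_der p t : is_derive (fun u => c * h (Phi u p)) t (c * lie V (Phi t p)).
Proof.
  apply (is_derive_scal (fun u => h (Phi u p))). apply h_der. apply (fl_der F).
Qed.

Lemma h_flow_cont p t : continuity_pt (fun u => c * h (Phi u p)) t.
Proof. eapply is_derive_continuity_pt, h_flow_der. Qed.

Lemma lie_window p0 : 0 < c * lie V p0 -> exists w, 0 < w /\
  forall p t, dsup p0 p < w -> Rabs t < w -> 0 < c * lie V (Phi t p).
Proof.
  intros Hl.
  assert (c <> 0) by (intros ->; lra).
  assert (Hc : 0 < Rabs c) by (apply Rabs_pos_lt; assumption).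
  destruct (lie_near V Phi L p0 (c * lie V p0 / Rabs c) F) as [d1 [Hd1 H1]].
  { apply Rdiv_lt_0_compat; lra. }
  destruct (flow_near V Phi L 0 p0 d1 F Hd1) as [w [Hw H2]].
  exists w. split; [exact Hw|]. intros p t Hp Ht.
  specialize (H2 t p). rewrite Rminus_0_r, (fl_0 F) in H2. specialize (H2 Ht Hp).
  specialize (H1 _ H2). apply Rlt_div_r in H1; [|exact Hc].
  rewrite <- Rabs_mult in H1. apply Rabs_lt_between in H1. lra.
Qed.

Lemma h_increasing p a b : a < b -> (forall t, a < t < b -> 0 < c * lie V (Phi t p)) ->
  c * h (Phi a p) < c * h (Phi b p).
Proof.
  intros Hab Hp.
  destruct (mean_value (fun u => c * h (Phi u p)) (fun t => c * lie V (Phi t p)) a b Hab)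
    as [x [Hx Hm]].
  - intros; apply h_flow_der.
  - intros; apply h_flow_cont.
  - specialize (Hp x Hx). nra.
Qed.

End Line.

Section Hit.

Variables (alpha beta : R).
Variables (V : R * R -> R * R) (Phi : R -> R * R -> R * R) (L c : R).
Hypothesis F : flow V Phi L.

Local Notation h := (Defs.h alpha beta).
Local Notation sigma := (Defs.sigma alpha beta).
Local Notation lie := (lie alpha beta).

(** By transversality [c * h] decreases strictly along all orbits close to [p0];
    the time [t'] is its only zero near 0. *)
Lemma exit_hit p0 : h p0 = 0 -> c * lie V p0 < 0 -> exists w, 0 < w /\
  forall e, 0 < e -> exists d, 0 < d /\ forall p, dsup p0 p < d ->
    exists t', Rabs t' < e /\ Rabs t' < w /\ h (Phi t' p) = 0 /\
      forall t, Rabs t < w -> (t < t' -> 0 < c * h (Phi t p)) /\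
                              (t' < t -> c * h (Phi t p) < 0).
Proof.
  intros Hh Hl.
  assert (c <> 0) by (intros ->; lra).
  destruct (lie_window alpha beta V Phi L (- c) F p0) as [w [Hw Hwin]]; [lra|].
  assert (mono : forall p a b, dsup p0 p < w -> Rabs a < w -> Rabs b < w -> a < b ->
    c * h (Phi b p) < c * h (Phi a p)).
  { intros p a b Hp Ha Hb Hab. apply Rabs_lt_between in Ha, Hb.
    pose proof (h_increasing alpha beta V Phi L (- c) F p a b Hab) as HI.
    assert (- c * h (Phi a p) < - c * h (Phi b p)); [|lra].
    apply HI. intros t Ht. apply Hwin; [exact Hp|]. apply Rabs_lt_between. lra. }
  exists w. split; [exact Hw|]. intros e He.
  set (e' := Rmin e w / 2).
  assert (He' : 0 < e' /\ e' < e /\ e' < w).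
  { unfold e', Rmin. destruct (Rle_dec e w); lra. }
  assert (Hae : Rabs e' < w) by (rewrite Rabs_pos_eq; lra).
  assert (Haem : Rabs (- e') < w) by (rewrite Rabs_Ropp; exact Hae).
  assert (H00 : Rabs 0 < w) by (rewrite Rabs_R0; lra).
  assert (Hpp : dsup p0 p0 < w) by (rewrite dsup_refl; lra).
  pose proof (mono p0 (- e') 0 Hpp Haem H00 ltac:(lra)) as M1.
  pose proof (mono p0 0 e' Hpp H00 Hae ltac:(lra)) as M2.
  rewrite (fl_0 F), Hh, Rmult_0_r in M1, M2.
  assert (cont : forall t x, c * h (Phi t p0) <> 0 -> x = Rabs (c * h (Phi t p0)) -> exists d, 0 < d /\
    forall p, dsup p0 p < d -> Rabs (c * h (Phi t p) - c * h (Phi t p0)) < x).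
  { intros t x Hx ->.
    assert (Hc : 0 < Rabs c) by (apply Rabs_pos_lt; assumption).
    destruct (h_near alpha beta (Phi t p0) (Rabs (c * h (Phi t p0)) / Rabs c)) as [d1 [Hd1 H1]].
    { apply Rdiv_lt_0_compat; [apply Rabs_pos_lt|]; assumption. }
    destruct (flow_near V Phi L t p0 d1 F Hd1) as [d2 [Hd2 H2]].
    exists d2. split; [exact Hd2|]. intros p Hp.
    specialize (H1 (Phi t p)). specialize (H2 t p).
    rewrite Rminus_diag, Rabs_R0 in H2. specialize (H1 (H2 Hd2 Hp)).
    apply Rlt_div_r in H1; [|exact Hc]. rewrite <- Rabs_mult in H1.
    replace (c * h (Phi t p) - c * h (Phi t p0)) with ((h (Phi t p) - h (Phi t p0)) * c) by ring.
    exact H1. }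
  destruct (cont (- e') _ ltac:(lra) eq_refl) as [d1 [Hd1 C1]].
  destruct (cont e' _ ltac:(lra) eq_refl) as [d2 [Hd2 C2]].
  exists (Rmin w (Rmin d1 d2)).
  split; [repeat apply Rmin_pos; assumption|].
  intros p Hp.
  assert (Hpw : dsup p0 p < w) by (eapply Rlt_le_trans; [exact Hp|apply Rmin_l]).
  assert (Hp1 : dsup p0 p < d1)
    by (eapply Rlt_le_trans; [exact Hp|eapply Rle_trans; [apply Rmin_r|apply Rmin_l]]).
  assert (Hp2 : dsup p0 p < d2)
    by (eapply Rlt_le_trans; [exact Hp|eapply Rle_trans; [apply Rmin_r|apply Rmin_r]]).
  specialize (C1 p Hp1). specialize (C2 p Hp2).
  rewrite (Rabs_pos_eq (c * h (Phi (- e') p0))) in C1 by lra.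
  rewrite (Rabs_left (c * h (Phi e' p0))) in C2 by lra.
  apply Rabs_lt_between in C1, C2.
  destruct (Ranalysis5.IVT_interv (fun t => (- c) * h (Phi t p)) (- e') e') as [t' [Ht' Hz]].
  { intros a _. apply (h_flow_cont alpha beta V Phi L (- c) F). }
  { lra. }
  { lra. }
  { lra. }
  assert (Hat : Rabs t' <= e') by (apply Rabs_le_between; lra).
  exists t'. split; [lra|]. split; [lra|].
  assert (Hz' : h (Phi t' p) = 0).
  { apply Rmult_eq_reg_l with (- c); lra. }
  split; [exact Hz'|].
  intros t Ht.
  split; intros Hlt.
  - pose proof (mono p t t' Hpw Ht ltac:(lra) Hlt) as M. rewrite Hz', Rmult_0_r in M. exact M.
  - pose proof (mono p t' t Hpw ltac:(lra) Ht Hlt) as M. rewrite Hz', Rmult_0_r in M. exact M.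
Qed.

(** The points from which the orbit is in the zone immediately afterwards. *)
Definition enters p := 0 < c * h p \/ (h p = 0 /\ 0 < c * lie V p).

(** Transversality makes an excursion into a zone persist under small changes
    of its starting point: at both ends by monotonicity of [h], in between by
    compactness. *)
Lemma arc_persist p0 T : 0 < T -> enters p0 ->
  (forall t, 0 < t < T -> 0 < c * h (Phi t p0)) ->
  h (Phi T p0) = 0 -> c * lie V (Phi T p0) < 0 ->
  forall e, 0 < e -> exists d, 0 < d /\ forall p, dsup p0 p < d -> 0 <= c * h p ->
    exists T', Rabs (T' - T) < e /\ 0 < T' /\ h (Phi T' p) = 0 /\
      (forall t, 0 < t < T' -> 0 < c * h (Phi t p)) /\
      c * lie V (Phi T' p) < 0 /\ dsup (Phi T p0) (Phi T' p) < e.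
Proof.
  intros HT Hent Harc HhT HlT e He.
  assert (Hc0 : c <> 0) by (intros ->; lra).
  assert (Hc : 0 < Rabs c) by (apply Rabs_pos_lt; assumption).
  (* near the starting point *)
  assert (Hstart : exists w, 0 < w /\ forall p, dsup p0 p < w -> 0 <= c * h p ->
    forall t, 0 < t < w -> 0 < c * h (Phi t p)).
  { destruct Hent as [Hpos|[Hz Hlie]].
    - destruct (h_near alpha beta p0 (c * h p0 / Rabs c)) as [d1 [Hd1 H1]].
      { apply Rdiv_lt_0_compat; assumption. }
      destruct (flow_near V Phi L 0 p0 d1 F Hd1) as [d2 [Hd2 H2]].
      exists d2. split; [exact Hd2|]. intros p Hp _ t Ht.
      specialize (H2 t p). rewrite (fl_0 F), Rminus_0_r in H2.
      assert (Hat : Rabs t < d2) by (rewrite Rabs_pos_eq; lra).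
      specialize (H1 _ (H2 Hat Hp)). apply Rlt_div_r in H1; [|exact Hc].
      rewrite <- Rabs_mult in H1. apply Rabs_lt_between in H1. lra.
    - destruct (lie_window alpha beta V Phi L c F p0 Hlie) as [w [Hw Hwin]].
      exists w. split; [exact Hw|]. intros p Hp Hh t Ht.
      pose proof (h_increasing alpha beta V Phi L c F p 0 t) as HI.
      rewrite (fl_0 F) in HI. eapply Rle_lt_trans; [exact Hh|]. apply HI; [lra|].
      intros u Hu. apply Hwin; [exact Hp|]. rewrite Rabs_pos_eq; lra. }
  destruct Hstart as [w1 [Hw1 Hstart]].
  destruct (exit_hit (Phi T p0) HhT HlT) as [w2 [Hw2 Hend]].
  set (k := Rmin w1 T / 2). set (m := Rmin w2 T / 2).
  assert (Hk : 0 < k /\ k < w1 /\ k < T) by (unfold k, Rmin; destruct (Rle_dec w1 T); lra).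
  assert (Hm : 0 < m /\ m < w2 /\ m < T) by (unfold m, Rmin; destruct (Rle_dec w2 T); lra).
  assert (Hmid : exists d, 0 < d /\ forall p, dsup p0 p < d ->
    forall t, k <= t <= T - m -> 0 < c * h (Phi t p)).
  { destruct (Rle_dec k (T - m)) as [Hle|Hn].
    2:{ exists 1. split; [lra|]. intros; lra. }
    destruct (continuity_ab_min (fun t => c * h (Phi t p0)) k (T - m) Hle) as [x [Hx Hxk]].
    { intros; apply (h_flow_cont alpha beta V Phi L c F). }
    assert (Hmx : 0 < c * h (Phi x p0)) by (apply Harc; lra).
    set (K := Rabs alpha + Rabs beta).
    pose proof (Rabs_pos alpha). pose proof (Rabs_pos beta).
    set (mu := c * h (Phi x p0)) in *.
    assert (Hmu : 0 < mu / (Rabs c * (K + 1))).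
    { apply Rdiv_lt_0_compat; [assumption|]. apply Rmult_lt_0_compat; unfold K; lra. }
    destruct (flow_close V Phi L T p0 _ F ltac:(lra) Hmu) as [d [Hd Hcl]].
    exists d. split; [exact Hd|]. intros p Hp t Ht.
    specialize (Hcl p Hp t ltac:(lra)). rewrite Rmin_left in Hcl by lra.
    specialize (Hx t Ht).
    pose proof (h_dsup alpha beta (Phi t p0) (Phi t p)) as Hd1. fold K in Hd1.
    assert (HK1 : 0 < Rabs c * (K + 1)) by (apply Rmult_lt_0_compat; unfold K; lra).
    apply Rlt_div_r in Hcl; [|exact HK1].
    assert (Hlt : Rabs (c * (h (Phi t p) - h (Phi t p0))) < mu).
    { rewrite Rabs_mult.
      apply Rle_lt_trans with (Rabs c * (K * dsup (Phi t p0) (Phi t p))).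
      - apply Rmult_le_compat_l; lra.
      - eapply Rle_lt_trans; [|exact Hcl]. pose proof (dsup_pos (Phi t p0) (Phi t p)). nra. }
    apply Rabs_lt_between in Hlt. lra. }
  destruct Hmid as [d3 [Hd3 Hmid]].
  (* near the end point *)
  destruct (lie_near alpha beta V Phi L (Phi T p0) (Rabs (lie V (Phi T p0))) F) as [e1 [He1 Hlie1]].
  { apply Rabs_pos_lt. intros Hz. rewrite Hz in HlT. lra. }
  destruct (flow_near V Phi L T p0 (Rmin e e1) F) as [d4 [Hd4 Hnear]].
  { apply Rmin_pos; assumption. }
  set (e' := Rmin (Rmin e d4) (Rmin m (T - k))).
  assert (He' : 0 < e') by (unfold e'; repeat apply Rmin_pos; lra).
  assert (He'2 : e' <= e /\ e' <= d4 /\ e' <= m /\ e' <= T - k).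
  { unfold e'. pose proof (Rmin_l (Rmin e d4) (Rmin m (T - k))).
    pose proof (Rmin_r (Rmin e d4) (Rmin m (T - k))).
    pose proof (Rmin_l e d4). pose proof (Rmin_r e d4).
    pose proof (Rmin_l m (T - k)). pose proof (Rmin_r m (T - k)). lra. }
  destruct (Hend e' He') as [d5 [Hd5 Hhit]].
  destruct (flow_near V Phi L T p0 d5 F Hd5) as [d6 [Hd6 Hnear6]].
  exists (Rmin (Rmin w1 d3) (Rmin d4 d6)).
  split; [repeat apply Rmin_pos; assumption|].
  intros p Hp Hh.
  pose proof (Rmin_l (Rmin w1 d3) (Rmin d4 d6)).
  pose proof (Rmin_r (Rmin w1 d3) (Rmin d4 d6)).
  pose proof (Rmin_l w1 d3). pose proof (Rmin_r w1 d3).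
  pose proof (Rmin_l d4 d6). pose proof (Rmin_r d4 d6).
  destruct (Hhit (Phi T p)) as [t' [Ht1 [Ht2 [Hz Hsign]]]].
  { apply Hnear6; [rewrite Rminus_diag, Rabs_R0; lra|lra]. }
  pose proof Ht1 as Ht1'. apply Rabs_lt_between in Ht1'.
  rewrite <- (flow_add F) in Hz.
  assert (Hpt : dsup (Phi T p0) (Phi (t' + T) p) < Rmin e e1).
  { apply Hnear; [|lra]. replace (t' + T - T) with t' by ring. lra. }
  exists (t' + T). repeat split.
  - replace (t' + T - T) with t' by ring. lra.
  - lra.
  - exact Hz.
  - intros t Ht. destruct (Rlt_dec t w1) as [Hc1|Hc1]; [apply Hstart; lra|].
    destruct (Rle_dec t (T - m)) as [Hc2|Hc2]; [apply Hmid; lra|].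
    destruct (Hsign (t - T)) as [S1 _]; [apply Rabs_lt_between; lra|].
    rewrite <- (flow_add F) in S1.
    replace (t - T + T) with t in S1 by ring. apply S1. lra.
  - specialize (Hlie1 (Phi (t' + T) p)).
    pose proof (Rmin_r e e1). specialize (Hlie1 ltac:(lra)).
    unfold Rabs in Hlie1. destruct (Rcase_abs (lie V (Phi T p0))) as [Hn|Hn];
    destruct (Rcase_abs (lie V (Phi (t' + T) p) - lie V (Phi T p0))).
    + assert (0 < c) by nra. nra.
    + assert (0 < c) by nra. nra.
    + assert (c < 0) by nra. nra.
    + assert (c < 0) by nra. nra.
  - pose proof (Rmin_l e e1). lra.
Qed.

End Hit.

(** * Half-return maps *)

Definition halfarc (alpha beta : R) (Phi : R -> R * R -> R * R) (c s T r : R) : Prop :=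
  0 < T /\ r < 0 /\ Phi T (Defs.sigma alpha beta s) = Defs.sigma alpha beta r /\
  forall t, 0 < t < T -> 0 < c * Defs.h alpha beta (Phi t (Defs.sigma alpha beta s)).

(** The half-return map [Rf] of one zone, with return times [Tf], from the half
    line [s > 0] to the half line [s < 0]. Replacing [(alpha, beta)] by its
    opposite reverses both [sigma] and [h]; the map of the zone that is entered
    through [s < 0] is therefore described by the same record. *)
Record half_map (alpha beta : R) (V : R * R -> R * R) (Phi : R -> R * R -> R * R)
    (c s0 : R) (Tf Rf : R -> R) : Prop := {
  hm_arc : forall s, 0 < s < s0 -> halfarc alpha beta Phi c s (Tf s) (Rf s);
  hm_in : forall s, 0 < s < s0 -> 0 < c * lie alpha beta V (Defs.sigma alpha beta s);
  hm_out : forall s, 0 < s < s0 -> c * lie alpha beta V (Defs.sigma alpha beta (Rf s)) < 0;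
  hm_small : forall rho, 0 < rho -> exists s1, 0 < s1 /\
    forall s, 0 < s < s1 -> s < s0 -> forall t, 0 <= t <= Tf s ->
      dsup (1, 1) (Phi t (Defs.sigma alpha beta s)) < rho
}.

Arguments hm_arc {alpha beta V Phi c s0 Tf Rf} _.
Arguments hm_in {alpha beta V Phi c s0 Tf Rf} _.
Arguments hm_out {alpha beta V Phi c s0 Tf Rf} _.
Arguments hm_small {alpha beta V Phi c s0 Tf Rf} _.

Lemma halfarc_unique alpha beta Phi c s T r T' r' : beta <> 0 ->
  halfarc alpha beta Phi c s T r -> halfarc alpha beta Phi c s T' r' -> T = T' /\ r = r'.
Proof.
  intros Hb [H1 [H2 [H3 H4]]] [H1' [H2' [H3' H4']]].
  assert (T = T').
  { destruct (Rtotal_order T T') as [Hlt|[Heq|Hlt]]; [|exact Heq|]; exfalso.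
    - specialize (H4' T ltac:(lra)). rewrite H3, h_sigma in H4'. lra.
    - specialize (H4 T' ltac:(lra)). rewrite H3', h_sigma in H4. lra. }
  subst T'. split; [reflexivity|]. rewrite H3 in H3'.
  eapply sigma_inj; eassumption.
Qed.

Arguments halfarc_unique {alpha beta Phi c s T r T' r'} _ _ _.

Lemma sigma_0 alpha beta : Defs.sigma alpha beta 0 = (1, 1).
Proof. unfold Defs.sigma. f_equal; ring. Qed.

Lemma subsequence_limit (u : nat -> R) (a b : R) : (forall n, a <= u n <= b) ->
  exists l, a <= l <= b /\ forall e N, 0 < e -> exists n, (N <= n)%nat /\ Rabs (u n - l) < e.
Proof.
  intros H. destruct (Bolzano_Weierstrass u _ (compact_P3 a b) H) as [l Hl].
  assert (Hacc : forall e N, 0 < e -> exists n, (N <= n)%nat /\ Rabs (u n - l) < e).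
  { intros e N He. apply (Hl (disc l (mkposreal e He)) N).
    exists (mkposreal e He). intros x Hx. exact Hx. }
  exists l. split; [|exact Hacc].
  split; apply Rnot_lt_le; intros Hn.
  - destruct (Hacc (a - l) 0%nat) as [n [_ Hn2]]; [lra|]. apply Rabs_lt_between in Hn2.
    specialize (H n). lra.
  - destruct (Hacc (l - b) 0%nat) as [n [_ Hn2]]; [lra|]. apply Rabs_lt_between in Hn2.
    specialize (H n). lra.
Qed.

Section Half.

Variables (alpha beta : R) (V : R * R -> R * R) (Phi : R -> R * R -> R * R) (L c s0 : R).
Variables (Tf Rf : R -> R).
Hypothesis beta_neq0 : beta <> 0.
Hypothesis F : flow V Phi L.
Hypothesis HM : half_map alpha beta V Phi c s0 Tf Rf.

Local Notation h := (Defs.h alpha beta).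
Local Notation sigma := (Defs.sigma alpha beta).
Local Notation lie := (lie alpha beta).

Lemma half_cont s e : 0 < s < s0 -> 0 < e -> exists d, 0 < d /\
  forall s', Rabs (s' - s) < d ->
    0 < s' < s0 /\ Rabs (Tf s' - Tf s) < e /\ Rabs (Rf s' - Rf s) < e.
Proof.
  intros Hs He. destruct (hm_arc HM s Hs) as [A1 [A2 [A3 A4]]].
  assert (Hb : 0 < Rabs beta) by (apply Rabs_pos_lt; assumption).
  set (e' := Rmin e (Rabs beta * Rmin e (- Rf s))).
  assert (He' : 0 < e').
  { unfold e'. apply Rmin_pos; [assumption|]. apply Rmult_lt_0_compat; [assumption|].
    apply Rmin_pos; lra. }
  destruct (arc_persist alpha beta V Phi L c F (sigma s) (Tf s)) with (e := e') as [d [Hd Hp]];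
    [assumption| | |rewrite A3; apply h_sigma|rewrite A3; apply (hm_out HM s Hs)
    |assumption|].
  { right. split; [apply h_sigma|apply (hm_in HM s Hs)]. }
  { exact A4. }
  set (K := Rabs alpha + Rabs beta).
  assert (HK : 0 < K) by (unfold K; pose proof (Rabs_pos alpha); lra).
  exists (Rmin (d / K) (Rmin s (s0 - s))).
  assert (Hdk : 0 < d / K) by (apply Rdiv_lt_0_compat; lra).
  split; [repeat apply Rmin_pos; lra|].
  intros s' Hs'.
  pose proof (Rmin_l (d / K) (Rmin s (s0 - s))). pose proof (Rmin_r (d / K) (Rmin s (s0 - s))).
  pose proof (Rmin_l s (s0 - s)). pose proof (Rmin_r s (s0 - s)).
  assert (Hs'2 : Rabs (s' - s) < Rmin s (s0 - s)) by lra.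
  apply Rabs_lt_between in Hs'2.
  assert (Hin : 0 < s' < s0) by lra. split; [exact Hin|].
  destruct (Hp (sigma s')) as [T' [B1 [B2 [B3 [B4 [B5 B6]]]]]].
  { eapply Rle_lt_trans; [apply sigma_dsup|]. fold K.
    assert (Hlt : Rabs (s' - s) < d / K) by lra. apply Rlt_div_r in Hlt; [|exact HK]. lra. }
  { rewrite h_sigma. lra. }
  apply (h_zero_sigma alpha beta _ beta_neq0) in B3.
  set (r' := (fst (Phi T' (sigma s')) - 1) / beta) in B3.
  rewrite A3, B3 in B6.
  pose proof (proj1 (sigma_dsup alpha beta (Rf s) r')) as B7.
  assert (B8 : Rabs beta * Rabs (r' - Rf s) < Rabs beta * Rmin e (- Rf s)).
  { eapply Rle_lt_trans; [exact B7|]. eapply Rlt_le_trans; [exact B6|apply Rmin_r]. }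
  apply Rmult_lt_reg_l in B8; [|exact Hb].
  pose proof (Rmin_l e (- Rf s)). pose proof (Rmin_r e (- Rf s)).
  assert (B9 : Rabs (r' - Rf s) < - Rf s) by lra. apply Rabs_lt_between in B9.
  assert (HA : halfarc alpha beta Phi c s' T' r') by (repeat split; auto; lra).
  destruct (halfarc_unique beta_neq0 HA (hm_arc HM s' Hin))
    as [E1 E2].
  rewrite <- E1, <- E2. split; [|lra].
  eapply Rlt_le_trans; [exact B1|apply Rmin_l].
Qed.

Lemma half_cont_pt s : 0 < s < s0 -> continuity_pt Rf s.
Proof.
  intros Hs. apply continuity_pt_locally. intros [e He].
  destruct (half_cont s e Hs He) as [d [Hd H]].
  exists (mkposreal d Hd). intros s' Hs'. apply (H s' Hs').
Qed.

Lemma half_lim rho : 0 < rho -> exists s1, 0 < s1 /\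
  forall s, 0 < s < s1 -> s < s0 -> - rho < Rf s.
Proof.
  intros Hr.
  assert (Hb : 0 < Rabs beta) by (apply Rabs_pos_lt; assumption).
  destruct (hm_small HM (Rabs beta * rho)) as [s1 [Hs1 H]];
    [apply Rmult_lt_0_compat; assumption|].
  exists s1. split; [exact Hs1|]. intros s Hs Hs0.
  destruct (hm_arc HM s ltac:(lra)) as [A1 [A2 [A3 A4]]].
  specialize (H s Hs Hs0 (Tf s) ltac:(lra)). rewrite A3, <- (sigma_0 alpha beta) in H.
  pose proof (proj1 (sigma_dsup alpha beta 0 (Rf s))) as B.
  assert (B2 : Rabs beta * Rabs (Rf s - 0) < Rabs beta * rho) by lra.
  apply Rmult_lt_reg_l in B2; [|exact Hb]. apply Rabs_lt_between in B2. lra.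
Qed.

(** Two arcs with the same end point lie on one orbit, on which the longer arc
    would meet the line at the starting point of the shorter one. *)
Lemma half_inj s s' : 0 < s < s0 -> 0 < s' < s0 -> Rf s = Rf s' -> s = s'.
Proof.
  assert (key : forall s s', 0 < s < s0 -> 0 < s' < s0 -> Rf s = Rf s' -> Tf s <= Tf s' -> s = s').
  { clear s s'. intros s s' Hs Hs' HR HT.
    destruct (hm_arc HM s Hs) as [A1 [A2 [A3 A4]]].
    destruct (hm_arc HM s' Hs') as [B1 [B2 [B3 B4]]].
    assert (E : Phi (Tf s' - Tf s) (sigma s') = sigma s).
    { replace (Tf s' - Tf s) with (- Tf s + Tf s') by ring.
      rewrite (flow_add F), B3, <- HR, <- A3. apply (flow_back _ _ _ _ _ F). }
    destruct (Req_dec (Tf s) (Tf s')) as [HE|HE].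
    - rewrite HE, Rminus_diag, (fl_0 F) in E. symmetry. eapply sigma_inj; eassumption.
    - specialize (B4 (Tf s' - Tf s) ltac:(lra)). rewrite E, h_sigma in B4. lra. }
  intros Hs Hs' HR. destruct (Rle_dec (Tf s) (Tf s')) as [H|H].
  - apply key; assumption.
  - symmetry. apply key; auto. lra.
Qed.

Lemma half_ivt a b r : 0 < a -> a < b -> b < s0 -> Rf b < r < Rf a ->
  exists u, a <= u <= b /\ Rf u = r.
Proof.
  intros Ha Hab Hb Hr.
  destruct (Ranalysis5.IVT_interv (fun x => r - Rf x) a b) as [u [Hu Hz]].
  - intros x Hx. apply (continuity_pt_minus (fun _ => r) Rf).
    + apply continuity_pt_const. intros ? ?; reflexivity.
    + apply half_cont_pt. lra.
  - exact Hab.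
  - lra.
  - lra.
  - exists u. split; [exact Hu|lra].
Qed.

Lemma half_surj s r : 0 < s < s0 -> Rf s < r < 0 -> exists u, 0 < u < s /\ Rf u = r.
Proof.
  intros Hs Hr. destruct (half_lim (- r)) as [s1 [Hs1 H1]]; [lra|].
  set (a := Rmin s1 s / 2).
  assert (Ha : 0 < a /\ a < s1 /\ a < s) by (unfold a, Rmin; destruct (Rle_dec s1 s); lra).
  specialize (H1 a ltac:(lra) ltac:(lra)).
  destruct (half_ivt a s r) as [u [Hu1 Hu2]]; [lra|lra|lra|lra|].
  exists u. split; [|exact Hu2]. split; [lra|].
  destruct (Req_dec u s) as [->|]; lra.
Qed.

(** An injective continuous function with limit 0 at 0 and negative values is
    decreasing. *)
Lemma half_decr s s' : 0 < s -> s < s' -> s' < s0 -> Rf s' < Rf s.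
Proof.
  intros Hs Hss Hs'. apply Rnot_le_lt. intros Hle.
  destruct (Req_dec (Rf s) (Rf s')) as [E|E].
  { apply half_inj in E; lra. }
  destruct (half_surj s (Rf s')) as [u [Hu1 Hu2]].
  - lra.
  - split; [lra|]. apply (hm_arc HM). lra.
  - apply half_inj in Hu2; lra.
Qed.

(** Every point close to [(1, 1)] on the zone side of the line lies on one of
    the arcs: along a segment inside the zone, the set covered by the arcs
    starting below [s1] is open by persistence, and it can only end on the arc of
    [s1] itself, which stays away from [(1, 1)]. *)
Lemma half_fill s1 : 0 < s1 < s0 -> exists eps, 0 < eps /\
  forall p, dsup (1, 1) p < eps -> 0 < c * h p ->
    exists s t, 0 < s < s1 /\ 0 < t < Tf s /\ p = Phi t (sigma s).
Proof.
  intros Hs1.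
  destruct (hm_arc HM s1 Hs1) as [A1 [A2 [A3 A4]]].
  assert (hne : forall p, h p <> 0 -> 0 < dsup (1, 1) p).
  { intros p Hp. destruct (dsup_pos (1, 1) p) as [H|H]; [exact H|]. exfalso. apply Hp.
    rewrite <- (dsup_eq0 (1, 1) p) by lra. unfold Defs.h; simpl. ring. }
  assert (Hdist : exists eps, 0 < eps /\ forall t, 0 <= t <= Tf s1 ->
    eps <= dsup (1, 1) (Phi t (sigma s1))).
  { destruct (continuity_ab_min (fun t => dsup (1, 1) (Phi t (sigma s1))) 0 (Tf s1)) as [x [Hx Hx2]].
    - lra.
    - intros t _. apply continuity_pt_locally. intros [e He].
      destruct (flow_near V Phi L t (sigma s1) e F He) as [d [Hd H]].
      exists (mkposreal d Hd). intros u Hu.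
      specialize (H u (sigma s1) Hu). rewrite dsup_refl in H. specialize (H Hd).
      simpl. apply Rabs_lt_between.
      pose proof (dsup_tri (1, 1) (Phi t (sigma s1)) (Phi u (sigma s1))).
      pose proof (dsup_tri (1, 1) (Phi u (sigma s1)) (Phi t (sigma s1))) as H'.
      rewrite (dsup_sym (Phi u _)) in H'. lra.
    - exists (dsup (1, 1) (Phi x (sigma s1))). split; [|exact Hx].
      destruct (Req_dec x 0) as [->|H0].
      + rewrite (fl_0 F), <- (sigma_0 alpha beta).
        eapply Rlt_le_trans; [|apply sigma_dsup].
        apply Rmult_lt_0_compat; apply Rabs_pos_lt; [assumption|lra].
      + destruct (Req_dec x (Tf s1)) as [->|H1].
        * rewrite A3, <- (sigma_0 alpha beta).
          eapply Rlt_le_trans; [|apply sigma_dsup].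
          apply Rmult_lt_0_compat; apply Rabs_pos_lt; [assumption|lra].
        * apply hne. specialize (A4 x ltac:(lra)). intros E. rewrite E in A4. lra. }
  destruct Hdist as [eps [Heps Hdist]].
  exists eps. split; [exact Heps|]. intros p Hp Hhp.
  set (U := fun q => exists s t, 0 < s < s1 /\ 0 < t < Tf s /\ q = Phi t (sigma s)).
  (* a base point of the covered set in the half ball *)
  destruct (hm_small HM eps Heps) as [s2' [Hs2' Hsm]].
  set (s2 := Rmin s2' s1 / 2).
  assert (Hs2 : 0 < s2 /\ s2 < s2' /\ s2 < s1) by (unfold s2, Rmin; destruct (Rle_dec s2' s1); lra).
  destruct (hm_arc HM s2 ltac:(lra)) as [B1 [B2 [B3 B4]]].
  set (p1 := Phi (Tf s2 / 2) (sigma s2)).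
  assert (Hp1 : dsup (1, 1) p1 < eps) by (apply Hsm; lra).
  assert (Hhp1 : 0 < c * h p1) by (apply B4; lra).
  assert (Up1 : U p1) by (exists s2, (Tf s2 / 2); repeat split; lra).
  set (z := fun l => (fst p1 + l * (fst p - fst p1), snd p1 + l * (snd p - snd p1))).
  assert (Hz : forall l, 0 <= l <= 1 -> dsup (1, 1) (z l) < eps /\ 0 < c * h (z l)).
  { intros l Hl. apply dsup_lt in Hp, Hp1. simpl in Hp, Hp1.
    destruct Hp as [P1 P2], Hp1 as [Q1 Q2]. apply Rabs_lt_between in P1, P2, Q1, Q2.
    split.
    - assert (cv : forall a b x, - eps < a < eps -> - eps < b < eps -> x = (1 - l) * a + l * b ->
        Rabs x < eps).
      { intros a b x Ha Hb ->. apply Rabs_lt_between. destruct (Req_dec l 0) as [->|]; [lra|].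
        assert (0 <= (1 - l) * (eps - a)) by (apply Rmult_le_pos; lra).
        assert (0 <= (1 - l) * (a + eps)) by (apply Rmult_le_pos; lra).
        assert (0 < l * (eps - b)) by (apply Rmult_lt_0_compat; lra).
        assert (0 < l * (b + eps)) by (apply Rmult_lt_0_compat; lra). lra. }
      apply dsup_lt. unfold z; cbn [fst snd]. split.
      + apply (cv (fst p1 - 1) (fst p - 1)); [lra|lra|ring].
      + apply (cv (snd p1 - 1) (snd p - 1)); [lra|lra|ring].
    - replace (c * h (z l)) with ((1 - l) * (c * h p1) + l * (c * h p))
        by (unfold Defs.h, z; simpl; ring).
      destruct (Req_dec l 0) as [->|]; [lra|].
      assert (0 < l * (c * h p)) by (apply Rmult_lt_0_compat; lra).
      assert (0 <= (1 - l) * (c * h p1)) by (apply Rmult_le_pos; lra). lra. }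
  assert (HzL : forall l l', dsup (z l) (z l') <= Rabs (l' - l) * dsup p1 p).
  { intros l l'. apply dsup_le. unfold z; simpl. split.
    - replace (fst p1 + l' * (fst p - fst p1) - (fst p1 + l * (fst p - fst p1)))
        with ((l' - l) * (fst p - fst p1)) by ring.
      rewrite Rabs_mult. apply Rmult_le_compat_l; [apply Rabs_pos|apply dsup_fst].
    - replace (snd p1 + l' * (snd p - snd p1) - (snd p1 + l * (snd p - snd p1)))
        with ((l' - l) * (snd p - snd p1)) by ring.
      rewrite Rabs_mult. apply Rmult_le_compat_l; [apply Rabs_pos|apply dsup_snd]. }
  assert (HzN : forall l e, 0 < e -> exists d, 0 < d /\ forall l', Rabs (l' - l) < d -> dsup (z l) (z l') < e).
  { intros l e He. pose proof (dsup_pos p1 p). exists (e / (dsup p1 p + 1)).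
    split; [apply Rdiv_lt_0_compat; lra|]. intros l' Hl'. apply Rlt_div_r in Hl'; [|lra].
    eapply Rle_lt_trans; [apply HzL|]. pose proof (Rabs_pos (l' - l)). nra. }
  assert (HU : U (z 1)).
  { apply (continuous_induction (fun l => U (z l)) 1).
    - unfold z. rewrite !Rmult_0_l, !Rplus_0_r. rewrite <- surjective_pairing. exact Up1.
    - (* openness, by following the flow backwards *)
      intros l Hl Hprev. destruct (Hprev l ltac:(lra)) as [s [t [Hs [Ht Hzl]]]].
      destruct (hm_arc HM s ltac:(lra)) as [C1 [C2 [C3 C4]]].
      assert (Eb : Phi (- t) (z l) = sigma s) by (rewrite Hzl; apply (flow_back _ _ _ _ _ F)).
      set (e := Rabs beta * Rmin s (s1 - s)).
      assert (He : 0 < e).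
      { apply Rmult_lt_0_compat; [apply Rabs_pos_lt; assumption|]. apply Rmin_pos; lra. }
      destruct (arc_persist alpha beta (fun p => vopp (V p)) (fun t p => Phi (- t) p) L c
        (flow_rev _ _ _ F) (z l) t) with (e := e) as [d [Hd Hper]].
      + lra.
      + left. apply Hz. lra.
      + intros u Hu. rewrite Hzl, <- (flow_add F).
        apply C4. lra.
      + rewrite Eb. apply h_sigma.
      + rewrite Eb. pose proof (hm_in HM s ltac:(lra)) as Hin.
        unfold Submission.lie, vopp in *; simpl. lra.
      + exact He.
      + destruct (HzN l d Hd) as [d' [Hd' Hnear]].
        exists (Rmin d' (1 - l)). split; [apply Rmin_pos; lra|].
        intros u Hu. pose proof (Rmin_l d' (1 - l)). pose proof (Rmin_r d' (1 - l)).
        assert (Hzu : 0 < c * h (z u)) by (apply Hz; lra).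
        destruct (Hper (z u)) as [T' [D1 [D2 [D3 [D4 [_ D5]]]]]].
        { apply Hnear. rewrite Rabs_pos_eq; lra. }
        { lra. }
        apply (h_zero_sigma alpha beta _ beta_neq0) in D3.
        set (s' := (fst (Phi (- T') (z u)) - 1) / beta) in D3.
        rewrite Eb, D3 in D5. pose proof (proj1 (sigma_dsup alpha beta s s')) as D6.
        assert (D7 : Rabs beta * Rabs (s' - s) < Rabs beta * Rmin s (s1 - s)) by (fold e; lra).
        apply Rmult_lt_reg_l in D7; [|apply Rabs_pos_lt; assumption].
        pose proof (Rmin_l s (s1 - s)). pose proof (Rmin_r s (s1 - s)).
        assert (D8 : Rabs (s' - s) < Rmin s (s1 - s)) by exact D7.
        apply Rabs_lt_between in D8.
        assert (Ez : z u = Phi T' (sigma s')).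
        { rewrite <- D3. rewrite <- (Ropp_involutive T') at 1. symmetry.
          apply (flow_back _ _ _ (- T') _ F). }
        exists s', T'. split; [lra|]. split; [|exact Ez].
        split; [exact D2|]. apply Rnot_le_lt. intros Hle.
        destruct (hm_arc HM s' ltac:(lra)) as [E1 [E2 [E3 E4]]].
        assert (0 < c * h (Phi (Tf s') (sigma s'))); [|rewrite E3, h_sigma in H3; lra].
        destruct (Req_dec (Tf s') T') as [->|Hne]; [rewrite <- Ez; exact Hzu|].
        specialize (D4 (T' - Tf s') ltac:(lra)).
        rewrite Ez, <- (flow_add F) in D4.
        replace (- (T' - Tf s') + T') with (Tf s') in D4 by ring. exact D4.
    - (* closedness, by compactness *)
      intros l Hl Hprev.
      destruct (choice (fun (n : nat) (st : R * R) =>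
        (0 < fst st < s1 /\ 0 < snd st < Tf (fst st)) /\
        dsup (z l) (Phi (snd st) (sigma (fst st))) < / INR (S n))) as [st Hst].
      { intros n. destruct (HzN l (/ INR (S n))) as [d [Hd Hn]].
        { apply Rinv_0_lt_compat, lt_0_INR. lia. }
        set (u := Rmax 0 (l - d / 2)).
        assert (Hu : 0 <= u < l /\ l - d / 2 <= u).
        { unfold u, Rmax. destruct (Rle_dec 0 (l - d / 2)); lra. }
        destruct (Hprev u ltac:(lra)) as [s [t [Hs [Ht Hzu]]]].
        exists (s, t). simpl. split; [split; assumption|]. rewrite <- Hzu. apply Hn.
        apply Rabs_lt_between. lra. }
      assert (Hinv : forall e, 0 < e -> exists N, forall n, (N <= n)%nat -> / INR (S n) < e).
      { intros e He. destruct (archimed_cor1 e He) as [N [HN1 HN2]]. exists N.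
        intros n Hn. eapply Rle_lt_trans; [|exact HN1].
        apply Rinv_le_contravar; [apply lt_0_INR; lia|apply le_INR; lia]. }
      destruct (subsequence_limit (fun n => fst (st n)) 0 s1) as [s [Hs Hacc]].
      { intros n. destruct (Hst n) as [[H1 H2] H3]. lra. }
      destruct (Hz l ltac:(lra)) as [Hzl1 Hzl2].
      destruct (Req_dec s 0) as [->|Hs0].
      { exfalso. set (rho := dsup (1, 1) (z l) / 2).
        assert (Hrho : 0 < rho).
        { assert (0 < dsup (1, 1) (z l)); [|unfold rho; lra]. apply hne. intros E.
          rewrite E in Hzl2. lra. }
        destruct (hm_small HM rho Hrho) as [s3 [Hs3 Hsm3]].
        destruct (Hinv rho Hrho) as [N HN].
        destruct (Hacc s3 N Hs3) as [n [Hn1 Hn2]].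
        destruct (Hst n) as [[H1 H2] H3]. specialize (HN n Hn1).
        apply Rabs_lt_between in Hn2.
        assert (Hlt : dsup (1, 1) (Phi (snd (st n)) (sigma (fst (st n)))) < rho) by (apply Hsm3; lra).
        pose proof (dsup_tri (1, 1) (Phi (snd (st n)) (sigma (fst (st n)))) (z l)) as Htri.
        rewrite (dsup_sym (Phi _ _) (z l)) in Htri. unfold rho in *. lra. }
      assert (Hsin : 0 < s < s0) by lra.
      destruct (half_cont s 1 Hsin Rlt_0_1) as [d [Hd Hc1]].
      destruct (choice (fun (k n : nat) => (k <= n)%nat /\ Rabs (fst (st n) - s) < Rmin d (/ INR (S k))))
        as [nk Hnk].
      { intros k. destruct (Hacc (Rmin d (/ INR (S k))) k) as [n Hn].
        - apply Rmin_pos; [assumption|]. apply Rinv_0_lt_compat, lt_0_INR. lia.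
        - exists n. exact Hn. }
      destruct (subsequence_limit (fun k => snd (st (nk k))) 0 (Tf s + 1)) as [t [Ht Hacct]].
      { intros k. destruct (Hnk k) as [H1 H2]. destruct (Hst (nk k)) as [[H3 H4] H5].
        destruct (Hc1 (fst (st (nk k)))) as [H6 [H7 H8]].
        - eapply Rlt_le_trans; [exact H2|apply Rmin_l].
        - apply Rabs_lt_between in H7. lra. }
      assert (Ezl : z l = Phi t (sigma s)).
      { symmetry. apply dsup_eq0. apply Rnot_lt_le. intros Hpos.
        set (e := dsup (Phi t (sigma s)) (z l) / 2).
        assert (He : 0 < e) by (unfold e; lra).
        destruct (flow_near V Phi L t (sigma s) e F He) as [d2 [Hd2 Hnear]].
        set (K := Rabs alpha + Rabs beta).
        assert (HK : 0 < K).
        { unfold K. pose proof (Rabs_pos alpha). pose proof (Rabs_pos_lt beta beta_neq0). lra. }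
        destruct (Hinv (Rmin e (d2 / K))) as [N HN].
        { apply Rmin_pos; [assumption|apply Rdiv_lt_0_compat; assumption]. }
        destruct (Hacct d2 N Hd2) as [k [Hk1 Hk2]].
        destruct (Hnk k) as [Hk3 Hk4]. destruct (Hst (nk k)) as [_ Hk5].
        pose proof (HN k Hk1) as HNk. pose proof (HN (nk k) ltac:(lia)) as HNn.
        pose proof (Rmin_l e (d2 / K)). pose proof (Rmin_r e (d2 / K)).
        pose proof (Rmin_r d (/ INR (S k))).
        assert (Hdd : dsup (sigma s) (sigma (fst (st (nk k)))) < d2).
        { eapply Rle_lt_trans; [apply sigma_dsup|]. fold K.
          assert (Hlt : Rabs (fst (st (nk k)) - s) < d2 / K) by lra.
          apply Rlt_div_r in Hlt; [|exact HK]. lra. }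
        specialize (Hnear _ _ Hk2 Hdd).
        pose proof (dsup_tri (Phi t (sigma s)) (Phi (snd (st (nk k))) (sigma (fst (st (nk k))))) (z l)) as Htri.
        rewrite (dsup_sym (Phi (snd _) _) (z l)) in Htri. unfold e in *. lra. }
      assert (HtT : t <= Tf s).
      { apply Rnot_lt_le. intros Hlt. set (e := (t - Tf s) / 2).
        assert (He : 0 < e) by (unfold e; lra).
        destruct (half_cont s e Hsin He) as [d2 [Hd2 Hc2]].
        destruct (Hinv d2 Hd2) as [N HN].
        destruct (Hacct e N He) as [k [Hk1 Hk2]]. specialize (HN k Hk1).
        destruct (Hnk k) as [Hk3 Hk4]. destruct (Hst (nk k)) as [[_ Hk5] _].
        pose proof (Rmin_r d (/ INR (S k))).
        destruct (Hc2 (fst (st (nk k)))) as [_ [Hk6 _]]; [lra|].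
        apply Rabs_lt_between in Hk2, Hk6. unfold e in *. lra. }
      destruct (hm_arc HM s Hsin) as [E1 [E2 [E3 E4]]].
      assert (t <> 0) by (intros ->; rewrite Ezl, (fl_0 F), h_sigma in Hzl2; lra).
      assert (t <> Tf s) by (intros ->; rewrite Ezl, E3, h_sigma in Hzl2; lra).
      destruct (Req_dec s s1) as [->|Hne].
      + exfalso. specialize (Hdist t ltac:(lra)). rewrite Ezl in Hzl1. lra.
      + exists s, t. split; [lra|]. split; [lra|exact Ezl].
    - lra. }
  replace p with (z 1).
  - exact HU.
  - unfold z. destruct p as [x y], p1 as [x1 y1]; simpl. f_equal; ring.
Qed.

End Half.

Arguments half_cont_pt {alpha beta V Phi L c s0 Tf Rf} _ _ _.
Arguments half_surj {alpha beta V Phi L c s0 Tf Rf} _ _ _.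
Arguments half_decr {alpha beta V Phi L c s0 Tf Rf} _ _ _.
Arguments half_fill {alpha beta V Phi L c s0 Tf Rf} _ _ _.
Arguments half_lim {alpha beta V Phi c s0 Tf Rf} _ _.

(** * Differentiability with respect to the starting point *)

(** A uniform form of twice differentiability around [(1, 1)]. *)
Definition quadratic (V : R * R -> R * R) (d0 : R) : Prop :=
  exists (a11 a12 a21 a22 : R * R -> R) (M K : R), 0 <= M /\ 0 <= K /\
  (forall p, dsup (1, 1) p < d0 ->
    Rabs (a11 p) <= M /\ Rabs (a12 p) <= M /\ Rabs (a21 p) <= M /\ Rabs (a22 p) <= M) /\
  (forall p q, dsup (1, 1) p < d0 -> dsup (1, 1) q < d0 ->
    Rabs (fst (V q) - fst (V p) - (a11 p * (fst q - fst p) + a12 p * (snd q - snd p)))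
      <= K * dsup p q ^ 2 /\
    Rabs (snd (V q) - snd (V p) - (a21 p * (fst q - fst p) + a22 p * (snd q - snd p)))
      <= K * dsup p q ^ 2).

(** The difference quotients of the flow form a Cauchy family: two of them solve
    the same linear equation up to an error of the size of the increments, so
    Gronwall's inequality compares them. *)
Lemma flow_deriv V Phi L d0 p0 v T d1 : flow V Phi L -> quadratic V d0 ->
  0 <= T -> d1 < d0 -> (forall t, 0 <= t <= T -> dsup (1, 1) (Phi t p0) <= d1) ->
  exists (w : R * R) (C eta : R), 0 < eta /\ 0 <= C /\ forall x, Rabs x < eta ->
    Rabs (fst (Phi T (fst p0 + x * fst v, snd p0 + x * snd v)) - fst (Phi T p0) - x * fst w) <= C * x ^ 2 /\
    Rabs (snd (Phi T (fst p0 + x * fst v, snd p0 + x * snd v)) - snd (Phi T p0) - x * snd w) <= C * x ^ 2.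
Proof.
  intros F [a11 [a12 [a21 [a22 [M [K [HM [HK [Ha Hq]]]]]]]]] HT Hd Horb.
  set (P := fun x => (fst p0 + x * fst v, snd p0 + x * snd v)).
  set (C1 := 2 * exp ((4 * L + 2) * T) * (Rabs (fst v) + Rabs (snd v))).
  pose proof (fl_pos F) as HL.
  pose proof (Rabs_pos (fst v)) as Hv1. pose proof (Rabs_pos (snd v)) as Hv2.
  assert (HC1 : 0 <= C1).
  { unfold C1. pose proof (exp_pos ((4 * L + 2) * T)). apply Rmult_le_pos; lra. }
  assert (Hdist : forall x t, 0 <= t <= T -> dsup (Phi t p0) (Phi t (P x)) <= C1 * Rabs x).
  { intros x t Ht. eapply Rle_trans; [apply (flow_dep_pos _ _ _ t _ _ F); lra|].
    assert (dsup p0 (P x) <= (Rabs (fst v) + Rabs (snd v)) * Rabs x).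
    { apply dsup_le. unfold P; simpl. pose proof (Rabs_pos x).
      split.
      - replace (fst p0 + x * fst v - fst p0) with (x * fst v) by ring. rewrite Rabs_mult. nra.
      - replace (snd p0 + x * snd v - snd p0) with (x * snd v) by ring. rewrite Rabs_mult. nra. }
    unfold C1. pose proof (exp_pos ((4 * L + 2) * t)) as He1.
    rewrite (Rmult_assoc (2 * exp ((4 * L + 2) * T))).
    apply Rmult_le_compat; [lra|apply dsup_pos| |assumption].
    apply Rmult_le_compat_l; [lra|]. destruct (Req_dec t T) as [->|]; [lra|].
    left. apply exp_increasing. apply Rmult_lt_compat_l; lra. }
  set (eta := (d0 - d1) / (C1 + 1)).
  assert (Heta : 0 < eta) by (apply Rdiv_lt_0_compat; lra).
  assert (Hbox : forall x t, Rabs x < eta -> 0 <= t <= T -> dsup (1, 1) (Phi t (P x)) < d0).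
  { intros x t Hx Ht. pose proof (dsup_tri (1, 1) (Phi t p0) (Phi t (P x))).
    pose proof (Hdist x t Ht). pose proof (Horb t Ht).
    apply Rlt_div_r in Hx; [|lra]. pose proof (Rabs_pos x). nra. }
  set (W := fun x t => ((fst (Phi t (P x)) - fst (Phi t p0)) / x,
                        (snd (Phi t (P x)) - snd (Phi t p0)) / x)).
  set (W' := fun x t => ((fst (V (Phi t (P x))) - fst (V (Phi t p0))) / x,
                         (snd (V (Phi t (P x))) - snd (V (Phi t p0))) / x)).
  assert (HW : forall x t, der (W x) t (W' x t)).
  { intros x t. destruct (fl_der F (P x) t) as [D1 D2].
    destruct (fl_der F p0 t) as [E1 E2]. unfold W, W'. split; cbn [fst snd]; unfold Rdiv.
    - rewrite (Rmult_comm _ (/ x)).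
      apply (is_derive_ext (fun u => / x * (fst (Phi u (P x)) - fst (Phi u p0)))).
      { intros u. apply Rmult_comm. }
      apply (is_derive_scal (fun u => fst (Phi u (P x)) - fst (Phi u p0))).
      apply (is_derive_minus (fun u => fst (Phi u (P x))) (fun u => fst (Phi u p0))); assumption.
    - rewrite (Rmult_comm _ (/ x)).
      apply (is_derive_ext (fun u => / x * (snd (Phi u (P x)) - snd (Phi u p0)))).
      { intros u. apply Rmult_comm. }
      apply (is_derive_scal (fun u => snd (Phi u (P x)) - snd (Phi u p0))).
      apply (is_derive_minus (fun u => snd (Phi u (P x))) (fun u => snd (Phi u p0))); assumption. }
  set (E := exp ((4 * (2 * M) + 2) * T)).
  assert (HE : 0 < E) by apply exp_pos.
  set (C2 := K * C1 ^ 2 * (E * T + 1)).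
  assert (HET : 0 <= E * T) by (apply Rmult_le_pos; lra).
  assert (HKC : 0 <= K * C1 ^ 2) by (apply Rmult_le_pos; [assumption|apply pow2_ge_0]).
  assert (HC2 : 0 <= C2) by (unfold C2; apply Rmult_le_pos; lra).
  assert (Hrem : forall x t, x <> 0 -> Rabs x < eta -> 0 <= t <= T ->
    Rabs (fst (W' x t) - (a11 (Phi t p0) * fst (W x t) + a12 (Phi t p0) * snd (W x t))) <= K * C1 ^ 2 * Rabs x /\
    Rabs (snd (W' x t) - (a21 (Phi t p0) * fst (W x t) + a22 (Phi t p0) * snd (W x t))) <= K * C1 ^ 2 * Rabs x).
  { intros x t Hx0 Hx Ht.
    destruct (Hq (Phi t p0) (Phi t (P x))) as [Q1 Q2].
    { pose proof (Horb t Ht). lra. }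
    { apply Hbox; assumption. }
    assert (Hax : 0 < Rabs x) by (apply Rabs_pos_lt; assumption).
    assert (HB : K * dsup (Phi t p0) (Phi t (P x)) ^ 2 <= K * C1 ^ 2 * Rabs x * Rabs x).
    { rewrite !Rmult_assoc. apply Rmult_le_compat_l; [assumption|].
      pose proof (Hdist x t Ht). pose proof (dsup_pos (Phi t p0) (Phi t (P x))).
      replace (C1 ^ 2 * (Rabs x * Rabs x)) with ((C1 * Rabs x) ^ 2) by ring.
      apply pow_incr. lra. }
    assert (key : forall a b, Rabs a <= b * Rabs x -> Rabs (a / x) <= b).
    { intros a b Hab. unfold Rdiv. rewrite Rabs_mult, Rabs_inv.
      apply Rmult_le_reg_r with (Rabs x); [assumption|].
      rewrite Rmult_assoc, Rinv_l by lra. lra. }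
    unfold W, W'; cbn [fst snd]. split.
    - match goal with |- Rabs ?e <= _ => replace e with
        ((fst (V (Phi t (P x))) - fst (V (Phi t p0)) - (a11 (Phi t p0) * (fst (Phi t (P x)) - fst (Phi t p0))
          + a12 (Phi t p0) * (snd (Phi t (P x)) - snd (Phi t p0)))) / x) by (field; assumption) end.
      apply key. lra.
    - match goal with |- Rabs ?e <= _ => replace e with
        ((snd (V (Phi t (P x))) - snd (V (Phi t p0)) - (a21 (Phi t p0) * (fst (Phi t (P x)) - fst (Phi t p0))
          + a22 (Phi t p0) * (snd (Phi t (P x)) - snd (Phi t p0)))) / x) by (field; assumption) end.
      apply key. lra. }
  assert (Hcauchy : forall x x', x <> 0 -> x' <> 0 -> Rabs x < eta -> Rabs x' < eta ->
    dsup (W x T) (W x' T) <= C2 * (Rabs x + Rabs x')).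
  { intros x x' Hx0 Hx'0 Hx Hx'.
    pose proof (Rabs_pos x) as Hax. pose proof (Rabs_pos x') as Hax'.
    set (k := K * C1 ^ 2 * (Rabs x + Rabs x')).
    assert (Hk : 0 <= k) by (unfold k; apply Rmult_le_pos; lra).
    pose proof (gronwall (W x) (W x') (W' x) (W' x') (2 * M) k T HT ltac:(lra) Hk) as G.
    assert (G' : dsup (W x T) (W x' T) ^ 2 <= E * T * k ^ 2).
    { eapply Rle_trans; [apply G|].
      - intros t _. split; apply HW.
      - intros t _. split; eapply der_cts; apply HW.
      - intros t Ht. destruct (Hrem x t Hx0 Hx ltac:(lra)) as [R1 R2].
        destruct (Hrem x' t Hx'0 Hx' ltac:(lra)) as [R1' R2'].
        destruct (Ha (Phi t p0)) as [M1 [M2 [M3 M4]]].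
        { pose proof (Horb t ltac:(lra)). lra. }
        pose proof (dsup_fst (W x t) (W x' t)) as D1. pose proof (dsup_snd (W x t) (W x' t)) as D2.
        pose proof (dsup_pos (W x t) (W x' t)) as D0.
        assert (key : forall b1 b2 u u', Rabs b1 <= M -> Rabs b2 <= M ->
          Rabs (u - (b1 * fst (W x t) + b2 * snd (W x t))) <= K * C1 ^ 2 * Rabs x ->
          Rabs (u' - (b1 * fst (W x' t) + b2 * snd (W x' t))) <= K * C1 ^ 2 * Rabs x' ->
          Rabs (u' - u) <= 2 * M * dsup (W x t) (W x' t) + k).
        { intros b1 b2 u u' B1 B2 U U'.
          replace (u' - u) with ((u' - (b1 * fst (W x' t) + b2 * snd (W x' t)))
            - (u - (b1 * fst (W x t) + b2 * snd (W x t)))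
            + (b1 * (fst (W x' t) - fst (W x t)) + b2 * (snd (W x' t) - snd (W x t)))) by ring.
          eapply Rle_trans; [apply Rabs_triang|].
          pose proof (Rabs_triang (u' - (b1 * fst (W x' t) + b2 * snd (W x' t)))
            (- (u - (b1 * fst (W x t) + b2 * snd (W x t))))) as T1.
          rewrite Rabs_Ropp in T1.
          pose proof (Rabs_triang (b1 * (fst (W x' t) - fst (W x t))) (b2 * (snd (W x' t) - snd (W x t)))) as T2.
          rewrite !Rabs_mult in T2.
          assert (Rabs b1 * Rabs (fst (W x' t) - fst (W x t)) <= M * dsup (W x t) (W x' t))
            by (apply Rmult_le_compat; auto using Rabs_pos).
          assert (Rabs b2 * Rabs (snd (W x' t) - snd (W x t)) <= M * dsup (W x t) (W x' t))
            by (apply Rmult_le_compat; auto using Rabs_pos).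
          unfold k. unfold Rminus in T1 at 1. unfold Rminus in *. lra. }
        apply dsup_le. split.
        + apply (key (a11 (Phi t p0)) (a12 (Phi t p0))); assumption.
        + apply (key (a21 (Phi t p0)) (a22 (Phi t p0))); assumption.
      - assert (E0 : dsup (W x 0) (W x' 0) = 0).
        { unfold W. rewrite !(fl_0 F).
          assert (Ew : forall x, x <> 0 -> ((fst (P x) - fst p0) / x, (snd (P x) - snd p0) / x) = v).
          { intros y Hy. unfold P; cbn [fst snd]. rewrite (surjective_pairing v) at 3.
            f_equal; field; assumption. }
          rewrite !Ew by assumption. apply dsup_refl. }
        rewrite E0. fold E. right. ring. }
    pose proof (dsup_pos (W x T) (W x' T)) as D0.
    replace (C2 * (Rabs x + Rabs x')) with ((E * T + 1) * k) by (unfold C2, k; ring).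
    apply Rsqr_incr_0; [|assumption|apply Rmult_le_pos; lra].
    unfold Rsqr. replace (dsup (W x T) (W x' T) * dsup (W x T) (W x' T)) with (dsup (W x T) (W x' T) ^ 2) by ring.
    eapply Rle_trans; [exact G'|].
    replace ((E * T + 1) * k * ((E * T + 1) * k)) with ((E * T + 1) * (E * T + 1) * k ^ 2) by ring.
    apply Rmult_le_compat_r; [apply pow2_ge_0|]. nra. }
  (* limit along a geometric sequence of increments *)
  set (x_ := fun n => eta * (1 / 2) ^ S n).
  assert (Hpow : forall n, 0 < (1 / 2) ^ n) by (intros n; apply pow_lt; lra).
  assert (Hpow1 : forall n, (1 / 2) ^ n <= 1).
  { induction n as [|n IH]; simpl; [lra|]. specialize (Hpow n). lra. }
  assert (Hx_ : forall n, 0 < x_ n /\ x_ n < eta).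
  { intros n. unfold x_. specialize (Hpow n). specialize (Hpow1 n). simpl. split; nra. }
  assert (Hseq : forall n, dsup (W (x_ n) T) (W (x_ (S n)) T) <= 2 * C2 * eta * (1 / 2) ^ S n).
  { intros n. pose proof (Hx_ n). pose proof (Hx_ (S n)).
    eapply Rle_trans; [apply Hcauchy|].
    - lra.
    - lra.
    - rewrite Rabs_pos_eq; lra.
    - rewrite Rabs_pos_eq; lra.
    - rewrite !Rabs_pos_eq by lra.
      replace (2 * C2 * eta * (1 / 2) ^ S n) with (C2 * (2 * x_ n)) by (unfold x_; ring).
      apply Rmult_le_compat_l; [assumption|]. unfold x_ in *. simpl in *. lra. }
  destruct (geometric_limit (fun n => fst (W (x_ n) T)) (2 * C2 * eta)) as [l1 Hl1].
  { intros n. eapply Rle_trans; [apply dsup_fst|apply Hseq]. }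
  destruct (geometric_limit (fun n => snd (W (x_ n) T)) (2 * C2 * eta)) as [l2 Hl2].
  { intros n. eapply Rle_trans; [apply dsup_snd|apply Hseq]. }
  assert (Hclose : forall x, x <> 0 -> Rabs x < eta ->
    Rabs (fst (W x T) - l1) <= C2 * Rabs x /\ Rabs (snd (W x T) - l2) <= C2 * Rabs x).
  { intros x Hx0 Hx.
    assert (Hc : forall n, dsup (W x T) (W (x_ n) T) <= C2 * Rabs x + C2 * eta * (1 / 2) ^ n).
    { intros n. pose proof (Hx_ n). eapply Rle_trans; [apply Hcauchy|].
      - assumption.
      - lra.
      - assumption.
      - rewrite Rabs_pos_eq; lra.
      - rewrite (Rabs_pos_eq (x_ n)) by lra. unfold x_. simpl. specialize (Hpow n).
        assert (0 <= C2 * eta) by (apply Rmult_le_pos; lra). nra. }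
    split; apply Rminus_le; apply (geometric_small (3 * C2 * eta)); intros n.
    - pose proof (Hc n) as B1. pose proof (dsup_fst (W x T) (W (x_ n) T)) as B2. specialize (Hl1 n).
      cbv beta in Hl1. rewrite Rabs_minus_sym in B2.
      pose proof (Rabs_triang (fst (W x T) - fst (W (x_ n) T)) (fst (W (x_ n) T) - l1)) as B3.
      replace (fst (W x T) - fst (W (x_ n) T) + (fst (W (x_ n) T) - l1)) with (fst (W x T) - l1) in B3 by ring.
      lra.
    - pose proof (Hc n) as B1. pose proof (dsup_snd (W x T) (W (x_ n) T)) as B2. specialize (Hl2 n).
      cbv beta in Hl2. rewrite Rabs_minus_sym in B2.
      pose proof (Rabs_triang (snd (W x T) - snd (W (x_ n) T)) (snd (W (x_ n) T) - l2)) as B3.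
      replace (snd (W x T) - snd (W (x_ n) T) + (snd (W (x_ n) T) - l2)) with (snd (W x T) - l2) in B3 by ring.
      lra. }
  exists (l1, l2), C2, eta. split; [assumption|]. split; [assumption|].
  intros x Hx. fold (P x). cbn [fst snd].
  destruct (Req_dec x 0) as [->|Hx0].
  - replace (P 0) with p0 by (unfold P; rewrite !Rmult_0_l, !Rplus_0_r; apply surjective_pairing).
    split; match goal with |- Rabs ?e <= _ => replace e with 0 by ring end; rewrite Rabs_R0; right; ring.
  - destruct (Hclose x Hx0 Hx) as [B1 B2].
    assert (key : forall a l, Rabs (a / x - l) <= C2 * Rabs x -> Rabs (a - x * l) <= C2 * x ^ 2).
    { intros a l Hal. replace (a - x * l) with (x * (a / x - l)) by (field; assumption).
      rewrite Rabs_mult, <- pow2_abs. pose proof (Rabs_pos x). nra. }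
    split; apply key; assumption.
Qed.

(** First order expansion of the flow in time, uniform in the starting point. *)
Lemma flow_taylor V Phi L p q t : flow V Phi L ->
  Rabs (fst (Phi t q) - fst q - t * fst (V p)) <= Rabs t * (L * (dsup p q + L * Rabs t)) /\
  Rabs (snd (Phi t q) - snd q - t * snd (V p)) <= Rabs t * (L * (dsup p q + L * Rabs t)).
Proof.
  intros F. pose proof (fl_pos F) as HL.
  assert (Hs : forall s, Rmin 0 t <= s <= Rmax 0 t -> Rabs s <= Rabs t).
  { intros s. unfold Rmin, Rmax. destruct (Rle_dec 0 t); intros Hs.
    - rewrite !Rabs_pos_eq; lra.
    - rewrite (Rabs_left1 s), (Rabs_left1 t); lra. }
  assert (HV : forall s, Rabs s <= Rabs t -> dsup (V p) (V (Phi s q)) <= L * (dsup p q + L * Rabs t)).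
  { intros s Hst. eapply Rle_trans; [apply (fl_lip F)|]. apply Rmult_le_compat_l; [lra|].
    pose proof (flow_speed _ _ _ 0 s q F) as B. rewrite (fl_0 F), Rminus_0_r in B.
    pose proof (dsup_tri p q (Phi s q)). assert (L * Rabs s <= L * Rabs t) by (apply Rmult_le_compat_l; lra).
    lra. }
  split.
  - destruct (MVT_gen (fun u => fst (Phi u q)) 0 t (fun u => fst (V (Phi u q)))) as [x [Hx Hm]].
    + intros u _. exact (proj1 (fl_der F q u)).
    + intros u _. exact (is_derive_continuity_pt _ _ _ (proj1 (fl_der F q u))).
    + rewrite (fl_0 F), Rminus_0_r in Hm. rewrite Hm.
      replace (fst (V (Phi x q)) * t - t * fst (V p)) with (t * (fst (V (Phi x q)) - fst (V p))) by ring.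
      rewrite Rabs_mult. apply Rmult_le_compat_l; [apply Rabs_pos|].
      eapply Rle_trans; [apply dsup_fst|]. apply HV, Hs, Hx.
  - destruct (MVT_gen (fun u => snd (Phi u q)) 0 t (fun u => snd (V (Phi u q)))) as [x [Hx Hm]].
    + intros u _. exact (proj2 (fl_der F q u)).
    + intros u _. exact (is_derive_continuity_pt _ _ _ (proj2 (fl_der F q u))).
    + rewrite (fl_0 F), Rminus_0_r in Hm. rewrite Hm.
      replace (snd (V (Phi x q)) * t - t * snd (V p)) with (t * (snd (V (Phi x q)) - snd (V p))) by ring.
      rewrite Rabs_mult. apply Rmult_le_compat_l; [apply Rabs_pos|].
      eapply Rle_trans; [apply dsup_snd|]. apply HV, Hs, Hx.
Qed.

Lemma quadratic_is_derive (f : R -> R) x0 l C eta : 0 < eta -> 0 <= C ->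
  (forall x, Rabs x < eta -> Rabs (f (x0 + x) - f x0 - x * l) <= C * x ^ 2) -> is_derive f x0 l.
Proof.
  intros He HC H. apply is_derive_Reals. intros eps Heps.
  assert (Hd : 0 < Rmin eta (eps / (C + 1))).
  { apply Rmin_pos; [assumption|apply Rdiv_lt_0_compat; lra]. }
  exists (mkposreal _ Hd). intros x Hx0 Hx. simpl in Hx.
  pose proof (Rmin_l eta (eps / (C + 1))). pose proof (Rmin_r eta (eps / (C + 1))).
  specialize (H x ltac:(lra)).
  assert (Hlt : Rabs x < eps / (C + 1)) by lra. apply Rlt_div_r in Hlt; [|lra].
  assert (Hax : 0 < Rabs x) by (apply Rabs_pos_lt; assumption).
  replace ((f (x0 + x) - f x0) / x - l) with ((f (x0 + x) - f x0 - x * l) / x) by (field; assumption).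
  unfold Rdiv. rewrite Rabs_mult, Rabs_inv. apply Rmult_lt_reg_r with (Rabs x); [assumption|].
  rewrite Rmult_assoc, Rinv_l by lra. rewrite <- pow2_abs in H. nra.
Qed.

Section HalfDeriv.

Variables (alpha beta : R) (V : R * R -> R * R) (Phi : R -> R * R -> R * R) (L c s0 : R).
Variables (Tf Rf : R -> R) (d0 d1 : R).
Hypothesis beta_neq0 : beta <> 0.
Hypothesis F : flow V Phi L.
Hypothesis HM : half_map alpha beta V Phi c s0 Tf Rf.
Hypothesis V_quadratic : quadratic V d0.
Hypothesis d1_lt : d1 < d0.
Hypothesis arcs_inside : forall s t, 0 < s < s0 -> 0 <= t <= Tf s ->
  dsup (1, 1) (Phi t (Defs.sigma alpha beta s)) <= d1.

Local Notation h := (Defs.h alpha beta).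
Local Notation sigma := (Defs.sigma alpha beta).
Local Notation lie := (lie alpha beta).

(** The end point at the moment [Tf s] moves differentiably with the starting
    point; projecting it along the flow back to the line costs a time which is
    determined to first order by the transversality of the flow. *)
Lemma half_deriv s : 0 < s < s0 -> exists l, is_derive Rf s l.
Proof.
  intros Hs. destruct (hm_arc HM s Hs) as [A1 [A2 [A3 A4]]].
  pose proof (hm_out HM s Hs) as Hout.
  pose proof (fl_pos F) as HL.
  destruct (flow_deriv V Phi L d0 (sigma s) (beta, alpha) (Tf s) d1 F V_quadratic ltac:(lra) d1_lt)
    as [w [C [eta [Heta [HC Hw]]]]].
  { intros t Ht. apply arcs_inside; assumption. }
  set (y := fun x => Phi (Tf s) (sigma (s + x))).
  assert (Hy : forall x, Rabs x < eta ->
    Rabs (fst (y x) - fst (sigma (Rf s)) - x * fst w) <= C * x ^ 2 /\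
    Rabs (snd (y x) - snd (sigma (Rf s)) - x * snd w) <= C * x ^ 2).
  { intros x Hx. specialize (Hw x Hx). rewrite A3 in Hw. unfold y.
    replace (sigma (s + x)) with (fst (sigma s) + x * fst (beta, alpha), snd (sigma s) + x * snd (beta, alpha)).
    - exact Hw.
    - unfold Defs.sigma; simpl. f_equal; ring. }
  set (q0 := sigma (Rf s)) in *.
  set (K := Rabs alpha + Rabs beta).
  assert (HK : 0 < K).
  { unfold K. pose proof (Rabs_pos alpha). pose proof (Rabs_pos_lt beta beta_neq0). lra. }
  set (C1 := 2 * exp ((4 * L + 2) * Tf s) * K).
  assert (HC1 : 0 < C1).
  { unfold C1. pose proof (exp_pos ((4 * L + 2) * Tf s)). apply Rmult_lt_0_compat; lra. }
  assert (Hylip : forall x, dsup q0 (y x) <= C1 * Rabs x).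
  { intros x. unfold y. rewrite <- A3.
    eapply Rle_trans; [apply (flow_dep_pos _ _ _ (Tf s) _ _ F); lra|].
    unfold C1. rewrite (Rmult_assoc (2 * exp ((4 * L + 2) * Tf s))). apply Rmult_le_compat_l.
    - pose proof (exp_pos ((4 * L + 2) * Tf s)). lra.
    - eapply Rle_trans; [apply sigma_dsup|]. fold K. right. f_equal. f_equal. ring. }
  (* the remaining time is at most proportional to the increment *)
  set (l0 := Rabs (lie V q0)).
  assert (Hl0 : 0 < l0).
  { apply Rabs_pos_lt. intros E. rewrite E in Hout. lra. }
  destruct (lie_near alpha beta V Phi L q0 (l0 / 2) F ltac:(lra)) as [e1 [He1 Hlie]].
  destruct (flow_near V Phi L 0 q0 e1 F He1) as [e2 [He2 Hnear]].
  destruct (half_cont alpha beta V Phi L c s0 Tf Rf beta_neq0 F HM s e2 Hs He2) as [e3 [He3 Hcont]].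
  set (tau := fun x => Tf (s + x) - Tf s).
  set (eta2 := Rmin eta (Rmin e3 (e2 / C1))).
  assert (Heta2 : 0 < eta2).
  { unfold eta2. repeat apply Rmin_pos; [assumption|assumption|apply Rdiv_lt_0_compat; lra]. }
  assert (Heta3 : eta2 <= eta /\ eta2 <= e3 /\ eta2 <= e2 / C1).
  { unfold eta2. pose proof (Rmin_l eta (Rmin e3 (e2 / C1))). pose proof (Rmin_r eta (Rmin e3 (e2 / C1))).
    pose proof (Rmin_l e3 (e2 / C1)). pose proof (Rmin_r e3 (e2 / C1)). lra. }
  assert (Htau : forall x, Rabs x < eta2 -> Rabs (tau x) < e2 /\ dsup q0 (y x) < e2 /\
    Phi (tau x) (y x) = sigma (Rf (s + x))).
  { intros x Hx. destruct (Hcont (s + x)) as [H1 [H2 H3]].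
    { replace (s + x - s) with x by ring. lra. }
    split; [exact H2|]. split.
    - eapply Rle_lt_trans; [apply Hylip|]. assert (Hlt : Rabs x < e2 / C1) by lra.
      apply Rlt_div_r in Hlt; [|exact HC1]. lra.
    - unfold tau, y. rewrite <- (flow_add F).
      replace (Tf (s + x) - Tf s + Tf s) with (Tf (s + x)) by ring.
      apply (hm_arc HM (s + x) H1). }
  set (C3 := 2 * K * C1 / l0).
  assert (HC3 : 0 <= C3) by (unfold C3; apply Rdiv_le_0_compat; [|lra]; apply Rmult_le_pos; [apply Rmult_le_pos|]; lra).
  assert (Htau2 : forall x, Rabs x < eta2 -> Rabs (tau x) <= C3 * Rabs x).
  { intros x Hx. destruct (Htau x Hx) as [T1 [T2 T3]].
    destruct (MVT_gen (fun u => h (Phi u (y x))) 0 (tau x) (fun u => lie V (Phi u (y x)))) as [z [Hz Hm]].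
    - intros u _. apply (h_der alpha beta (fun u => Phi u (y x))). apply (fl_der F).
    - intros u _. apply (is_derive_continuity_pt _ u (lie V (Phi u (y x)))).
      apply (h_der alpha beta (fun u => Phi u (y x))). apply (fl_der F).
    - rewrite T3, h_sigma, (fl_0 F), Rminus_0_r in Hm.
      assert (Hza : Rabs z < e2).
      { apply Rle_lt_trans with (Rabs (tau x)); [|exact T1].
        revert Hz. unfold Rmin, Rmax. destruct (Rle_dec 0 (tau x)); intros Hz.
        - rewrite !Rabs_pos_eq; lra.
        - rewrite (Rabs_left1 z), (Rabs_left1 (tau x)); lra. }
      specialize (Hnear z (y x)). rewrite Rminus_0_r, (fl_0 F) in Hnear.
      specialize (Hlie _ (Hnear Hza T2)).
      assert (Hlz : l0 / 2 <= Rabs (lie V (Phi z (y x)))).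
      { pose proof (Rabs_triang_inv (lie V q0) (lie V q0 - lie V (Phi z (y x)))) as HT.
        replace (lie V q0 - (lie V q0 - lie V (Phi z (y x)))) with (lie V (Phi z (y x))) in HT by ring.
        rewrite (Rabs_minus_sym (lie V q0)) in HT. fold l0 in HT. lra. }
      assert (Hhy : Rabs (h (y x)) <= K * (C1 * Rabs x)).
      { pose proof (h_dsup alpha beta q0 (y x)) as HH. fold K in HH.
        assert (E0 : h q0 = 0) by apply h_sigma.
        rewrite E0, Rminus_0_r in HH. eapply Rle_trans; [exact HH|].
        apply Rmult_le_compat_l; [lra|apply Hylip]. }
      assert (Hm2 : Rabs (h (y x)) = Rabs (lie V (Phi z (y x))) * Rabs (tau x)).
      { rewrite <- Rabs_mult, <- Hm. rewrite Rminus_0_l, Rabs_Ropp. reflexivity. }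
      assert (l0 / 2 * Rabs (tau x) <= K * (C1 * Rabs x)).
      { eapply Rle_trans; [|exact Hhy]. rewrite Hm2.
        apply Rmult_le_compat_r; [apply Rabs_pos|exact Hlz]. }
      unfold C3. apply Rmult_le_reg_l with (l0 / 2); [lra|].
      replace (l0 / 2 * (2 * K * C1 / l0 * Rabs x)) with (K * (C1 * Rabs x)) by (field; lra). assumption. }
  (* second order expansion of the end point on the line *)
  set (C4 := C + C3 * (L * (C1 + L * C3))).
  assert (HC4 : 0 <= C4).
  { unfold C4. assert (0 <= L * C3) by (apply Rmult_le_pos; lra).
    assert (0 <= L * (C1 + L * C3)) by (apply Rmult_le_pos; lra).
    assert (0 <= C3 * (L * (C1 + L * C3))) by (apply Rmult_le_pos; lra). lra. }
  assert (Hexp : forall x, Rabs x < eta2 ->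
    Rabs (fst (sigma (Rf (s + x))) - fst q0 - (x * fst w + tau x * fst (V q0))) <= C4 * x ^ 2 /\
    Rabs (snd (sigma (Rf (s + x))) - snd q0 - (x * snd w + tau x * snd (V q0))) <= C4 * x ^ 2).
  { intros x Hx. destruct (Htau x Hx) as [_ [_ T3]]. rewrite <- T3.
    pose proof (Htau2 x Hx) as T4. destruct (Hy x ltac:(lra)) as [Y1 Y2].
    destruct (flow_taylor V Phi L q0 (y x) (tau x) F) as [B1 B2].
    pose proof (Hylip x) as B3. pose proof (Rabs_pos x) as Hx0. pose proof (Rabs_pos (tau x)).
    pose proof (dsup_pos q0 (y x)).
    assert (B4 : Rabs (tau x) * (L * (dsup q0 (y x) + L * Rabs (tau x))) <= C3 * (L * (C1 + L * C3)) * x ^ 2).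
    { rewrite <- (pow2_abs x).
      replace (C3 * (L * (C1 + L * C3)) * Rabs x ^ 2) with ((C3 * Rabs x) * (L * (C1 * Rabs x + L * (C3 * Rabs x)))) by ring.
      assert (0 <= L * Rabs (tau x)) by (apply Rmult_le_pos; lra).
      assert (L * Rabs (tau x) <= L * (C3 * Rabs x)) by (apply Rmult_le_compat_l; lra).
      apply Rmult_le_compat; [lra|apply Rmult_le_pos; lra|exact T4|].
      apply Rmult_le_compat_l; lra. }
    unfold C4. rewrite Rmult_plus_distr_r.
    split.
    - replace (fst (Phi (tau x) (y x)) - fst q0 - (x * fst w + tau x * fst (V q0)))
        with ((fst (y x) - fst q0 - x * fst w) + (fst (Phi (tau x) (y x)) - fst (y x) - tau x * fst (V q0))) by ring.
      eapply Rle_trans; [apply Rabs_triang|]. lra.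
    - replace (snd (Phi (tau x) (y x)) - snd q0 - (x * snd w + tau x * snd (V q0)))
        with ((snd (y x) - snd q0 - x * snd w) + (snd (Phi (tau x) (y x)) - snd (y x) - tau x * snd (V q0))) by ring.
      eapply Rle_trans; [apply Rabs_triang|]. lra. }
  (* both coordinates are tied by the line, which eliminates the time *)
  set (m := alpha * fst w - beta * snd w).
  set (l := lie V q0).
  assert (Hlne : l <> 0) by (intros E; unfold l0 in Hl0; fold l in Hl0; rewrite E, Rabs_R0 in Hl0; lra).
  exists ((fst w - m / l * fst (V q0)) / beta).
  apply (quadratic_is_derive Rf s _ ((C4 + K * C4 * Rabs (fst (V q0) / l)) / Rabs beta) eta2 Heta2).
  { apply Rdiv_le_0_compat; [|apply Rabs_pos_lt; assumption].
    assert (0 <= K * C4 * Rabs (fst (V q0) / l)) by (repeat apply Rmult_le_pos; try lra; apply Rabs_pos). lra. }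
  intros x Hx. destruct (Hexp x Hx) as [X1 X2].
  set (r1 := fst (sigma (Rf (s + x))) - fst q0 - (x * fst w + tau x * fst (V q0))) in *.
  set (r2 := snd (sigma (Rf (s + x))) - snd q0 - (x * snd w + tau x * snd (V q0))) in *.
  assert (Etau : tau x = - (x * m + (alpha * r1 - beta * r2)) / l).
  { apply Rmult_eq_reg_r with l; [|exact Hlne].
    replace (- (x * m + (alpha * r1 - beta * r2)) / l * l) with (- (x * m + (alpha * r1 - beta * r2))) by (field; assumption).
    unfold r1, r2, m, l, Submission.lie, q0, Defs.sigma; simpl. ring. }
  assert (ER : beta * (Rf (s + x) - Rf s) = x * fst w + tau x * fst (V q0) + r1).
  { unfold r1, q0, Defs.sigma; simpl. ring. }
  assert (E : Rf (s + x) - Rf s - x * ((fst w - m / l * fst (V q0)) / beta)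
    = (r1 - (alpha * r1 - beta * r2) * (fst (V q0) / l)) / beta).
  { apply Rmult_eq_reg_l with beta; [|assumption].
    replace (beta * (Rf (s + x) - Rf s - x * ((fst w - m / l * fst (V q0)) / beta)))
      with (beta * (Rf (s + x) - Rf s) - x * (fst w - m / l * fst (V q0))) by (field; split; assumption).
    rewrite ER, Etau. field. split; assumption. }
  rewrite E. unfold Rdiv at 1. rewrite Rabs_mult, Rabs_inv. fold (Rdiv (Rabs (r1 - (alpha * r1 - beta * r2) * (fst (V q0) / l))) (Rabs beta)).
  assert (Hbp : 0 < Rabs beta) by (apply Rabs_pos_lt; assumption).
  apply Rmult_le_reg_r with (Rabs beta); [exact Hbp|].
  replace (Rabs (r1 - (alpha * r1 - beta * r2) * (fst (V q0) / l)) / Rabs beta * Rabs beta)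
    with (Rabs (r1 - (alpha * r1 - beta * r2) * (fst (V q0) / l))) by (field; lra).
  replace ((C4 + K * C4 * Rabs (fst (V q0) / l)) / Rabs beta * x ^ 2 * Rabs beta)
    with (C4 * x ^ 2 + (K * (C4 * x ^ 2)) * Rabs (fst (V q0) / l)) by (field; lra).
  eapply Rle_trans; [apply Rabs_triang|]. rewrite Rabs_Ropp, Rabs_mult.
  apply Rplus_le_compat; [exact X1|]. apply Rmult_le_compat_r; [apply Rabs_pos|].
  eapply Rle_trans; [apply covector_bound|]. unfold K. rewrite Rmult_plus_distr_r.
  apply Rplus_le_compat; apply Rmult_le_compat_l; auto using Rabs_pos.
Qed.

End HalfDeriv.

(** * Trajectories of piecewise systems *)

(** [trajectory] for an arbitrary pair of fields, so that time can be reversed. *)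
Definition gtraj (alpha beta : R) (X : zone -> R * R -> R * R) (a b : Rbar)
    (gamma : R -> R * R) : Prop :=
  forall t : R, Rbar_lt a t -> Rbar_lt t b ->
    continuous gamma t /\
    (forall i, region alpha beta i (gamma t) ->
       is_derive gamma t (X i (gamma t))) /\
    (Defs.h alpha beta (gamma t) = 0 ->
       exists i : zone,
         (forall j, 0 < sgn i * lie alpha beta (X j) (gamma t)) /\
         at_left t (fun u => region alpha beta (other i) (gamma u)) /\
         at_right t (fun u => region alpha beta i (gamma u))).

Definition xopp (X : zone -> R * R -> R * R) (i : zone) (p : R * R) : R * R := vopp (X i p).

Lemma other_other i : other (other i) = i.
Proof. destruct i; reflexivity. Qed.

Lemma sgn_other i : sgn (other i) = - sgn i.
Proof. destruct i; simpl; lra. Qed.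

Lemma sgn_pm i : sgn i = 1 \/ sgn i = -1.
Proof. destruct i; simpl; lra. Qed.

Lemma sgn_pos_inj i j x : 0 < sgn i * x -> 0 < sgn j * x -> i = j.
Proof. destruct i, j; simpl; intros; try reflexivity; lra. Qed.

Lemma lie_vopp alpha beta V p : lie alpha beta (fun q => vopp (V q)) p = - lie alpha beta V p.
Proof. unfold lie, vopp; simpl. ring. Qed.

Lemma der_opp (y : R -> R * R) t v : der y (- t) v -> der (fun u => y (- u)) t (vopp v).
Proof.
  intros [D1 D2]. unfold vopp. split; simpl.
  - replace (- fst v) with (-1 * fst v) by ring.
    apply (is_derive_comp (fun u => fst (y u)) (fun u => - u)); [exact D1|].
    auto_derive; [exact I|]. reflexivity.
  - replace (- snd v) with (-1 * snd v) by ring.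
    apply (is_derive_comp (fun u => snd (y u)) (fun u => - u)); [exact D2|].
    auto_derive; [exact I|]. reflexivity.
Qed.

Lemma at_right_iff (t : R) (P : R -> Prop) :
  at_right t P <-> exists e, 0 < e /\ forall u, t < u < t + e -> P u.
Proof.
  split.
  - intros [[e He] H]. exists e. split; [exact He|]. intros u Hu. apply H; [|lra].
    apply Rabs_lt_between. simpl. unfold minus, plus, opp; simpl. lra.
  - intros [e [He H]]. exists (mkposreal e He). intros u Hu Hlt. apply H.
    apply Rabs_lt_between in Hu. simpl in Hu. unfold minus, plus, opp in Hu; simpl in Hu. lra.
Qed.

Lemma at_left_iff (t : R) (P : R -> Prop) :
  at_left t P <-> exists e, 0 < e /\ forall u, t - e < u < t -> P u.
Proof.
  split.
  - intros [[e He] H]. exists e. split; [exact He|]. intros u Hu. apply H; [|lra].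
    apply Rabs_lt_between. simpl. unfold minus, plus, opp; simpl. lra.
  - intros [e [He H]]. exists (mkposreal e He). intros u Hu Hlt. apply H.
    apply Rabs_lt_between in Hu. simpl in Hu. unfold minus, plus, opp in Hu; simpl in Hu. lra.
Qed.

Lemma gtraj_rev alpha beta X a b gamma : gtraj alpha beta X a b gamma ->
  gtraj alpha beta (xopp X) (Rbar_opp b) (Rbar_opp a) (fun t => gamma (- t)).
Proof.
  intros H t Ha Hb.
  destruct (H (- t)) as [H1 [H2 H3]].
  { destruct a; simpl in *; auto. lra. }
  { destruct b; simpl in *; auto. lra. }
  split; [|split].
  - apply (continuous_comp (fun u => - u) gamma); [|exact H1].
    apply (ex_derive_continuous (fun u : R => - u)). auto_derive. exact I.
  - intros i Hi. apply is_derive_der. apply (der_opp gamma). apply is_derive_der. apply H2, Hi.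
  - intros Hh. destruct (H3 Hh) as [i [I1 [I2 I3]]]. exists (other i). split; [|split].
    + intros j. specialize (I1 j). unfold xopp. rewrite lie_vopp, sgn_other. lra.
    + rewrite other_other. apply at_right_iff in I3. destruct I3 as [e [He I3]].
      apply at_left_iff. exists e. split; [exact He|]. intros u Hu. apply I3. lra.
    + apply at_left_iff in I2. destruct I2 as [e [He I2]].
      apply at_right_iff. exists e. split; [exact He|]. intros u Hu. apply I2. lra.
Qed.

Lemma gtraj_shift alpha beta X (a b s : R) (b' : Rbar) gamma :
  gtraj alpha beta X a b' gamma ->
  gtraj alpha beta X (a - s) (Rbar_plus b' (- s)) (fun t => gamma (t + s)).
Proof.
  intros H t Ha Hb.
  destruct (H (t + s)) as [H1 [H2 H3]].
  { simpl in *. lra. }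
  { destruct b'; simpl in *; auto. lra. }
  split; [|split].
  - apply (continuous_comp (fun u => u + s) gamma); [|exact H1].
    apply (ex_derive_continuous (fun u : R => u + s)). auto_derive. exact I.
  - intros i Hi. apply is_derive_der. apply der_shift. apply is_derive_der. apply H2, Hi.
  - intros Hh. destruct (H3 Hh) as [i [I1 [I2 I3]]]. exists i. split; [exact I1|split].
    + apply at_left_iff in I2. destruct I2 as [e [He I2]].
      apply at_left_iff. exists e. split; [exact He|]. intros u Hu. apply I2. lra.
    + apply at_right_iff in I3. destruct I3 as [e [He I3]].
      apply at_right_iff. exists e. split; [exact He|]. intros u Hu. apply I3. lra.
Qed.

Lemma gtraj_local alpha beta X a b gamma :
  (forall t : R, Rbar_lt a t -> Rbar_lt t b -> exists (e : R) (gamma' : R -> R * R), 0 < e /\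
     gtraj alpha beta X (t - e) (t + e) gamma' /\
     forall u, t - e < u < t + e -> gamma u = gamma' u) ->
  gtraj alpha beta X a b gamma.
Proof.
  intros H t Ha Hb. destruct (H t Ha Hb) as [e [g [He [Hg Heq]]]].
  assert (Hloc : locally t (fun u => g u = gamma u)).
  { exists (mkposreal e He). intros u Hu. symmetry. apply Heq.
    apply Rabs_lt_between in Hu. simpl in Hu. unfold minus, plus, opp in Hu; simpl in Hu. lra. }
  assert (E : gamma t = g t) by (apply Heq; lra).
  destruct (Hg t) as [H1 [H2 H3]]; [simpl; lra|simpl; lra|].
  split; [|split].
  - apply (continuous_ext_loc gamma g); assumption.
  - intros i Hi. rewrite E in *. apply (is_derive_ext_loc g); [exact Hloc|]. apply H2, Hi.
  - intros Hh. rewrite E in *. destruct (H3 Hh) as [i [I1 [I2 I3]]]. exists i. split; [exact I1|split].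
    + apply at_left_iff in I2. destruct I2 as [d [Hd I2]].
      apply at_left_iff. exists (Rmin d e). split; [apply Rmin_pos; assumption|]. intros u Hu.
      pose proof (Rmin_l d e). pose proof (Rmin_r d e).
      rewrite Heq by lra. apply I2. lra.
    + apply at_right_iff in I3. destruct I3 as [d [Hd I3]].
      apply at_right_iff. exists (Rmin d e). split; [apply Rmin_pos; assumption|]. intros u Hu.
      pose proof (Rmin_l d e). pose proof (Rmin_r d e).
      rewrite Heq by lra. apply I3. lra.
Qed.

Lemma gtraj_sub alpha beta X a b a' b' gamma : Rbar_le a a' -> Rbar_le b' b ->
  gtraj alpha beta X a b gamma -> gtraj alpha beta X a' b' gamma.
Proof.
  intros Ha Hb H t Ht1 Ht2. apply H.
  - eapply Rbar_le_lt_trans; eassumption.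
  - eapply Rbar_lt_le_trans; eassumption.
Qed.

Section Piecewise.

Variables (alpha beta : R) (X V : zone -> R * R -> R * R) (Phi : zone -> R -> R * R -> R * R).
Variables (L d0 : R).
Hypothesis F : forall i, flow (V i) (Phi i) L.
Hypothesis V_eq : forall i p, dsup (1, 1) p < d0 -> V i p = X i p.

Local Notation h := (Defs.h alpha beta).
Local Notation sigma := (Defs.sigma alpha beta).
Local Notation lie := (lie alpha beta).
Local Notation region := (region alpha beta).

Lemma h_continuity (y : R -> R * R) t : cts y t -> continuity_pt (fun u => h (y u)) t.
Proof.
  intros H. apply continuity_pt_locally. intros [e He].
  destruct (h_near alpha beta (y t) e He) as [d [Hd Hn]].
  apply cts_dsup with (e := d) in H; [|exact Hd]. destruct H as [d' [Hd' H]].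
  exists (mkposreal d' Hd'). intros u Hu. apply Hn, H. exact Hu.
Qed.

Lemma region_open i p : region i p -> exists d, 0 < d /\ forall q, dsup p q < d -> region i q.
Proof.
  intros Hr. unfold Defs.region in *.
  destruct (h_near alpha beta p (sgn i * h p) Hr) as [d [Hd H]].
  exists d. split; [exact Hd|]. intros q Hq. specialize (H q Hq). apply Rabs_lt_between in H.
  destruct (sgn_pm i) as [E|E]; rewrite E in *; lra.
Qed.

(** The crossing condition puts the trajectory into the zone it enters, where its
    differential equation has a unique solution. *)
Lemma follow gamma (a b : Rbar) (t0 : R) i p (T : R) : gtraj alpha beta X a b gamma ->
  Rbar_lt a t0 -> 0 <= T -> Rbar_lt (t0 + T) b -> gamma t0 = p ->
  region i p \/ (h p = 0 /\ 0 < sgn i * lie (X i) p) ->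
  (forall t, 0 < t < T -> region i (Phi i t p)) ->
  (forall t, 0 <= t <= T -> dsup (1, 1) (Phi i t p) < d0) ->
  forall t, 0 <= t <= T -> gamma (t0 + t) = Phi i t p.
Proof.
  intros G Ha HT Hb Hp Hent Hreg Hbox.
  assert (Hdom : forall t, 0 <= t <= T -> Rbar_lt a (t0 + t) /\ Rbar_lt (t0 + t) b).
  { intros t Ht. split; [destruct a; simpl in *; try tauto; lra|destruct b; simpl in *; try tauto; lra]. }
  assert (Hcts : forall t, 0 <= t <= T -> cts gamma (t0 + t)).
  { intros t Ht. destruct (Hdom t Ht) as [D1 D2]. apply continuous_cts. apply (G _ D1 D2). }
  apply (continuous_induction (fun t => gamma (t0 + t) = Phi i t p)).
  - rewrite Rplus_0_r, Hp. symmetry. apply (fl_0 (F i)).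
  - intros t Ht Hprev. pose proof (Hprev t ltac:(lra)) as Et.
    assert (Hin : exists e, 0 < e /\ forall u, t < u < t + e -> region i (gamma (t0 + u))).
    { assert (Hcase : region i (Phi i t p) \/ (t = 0 /\ h p = 0 /\ 0 < sgn i * lie (X i) p)).
      { destruct (Req_dec t 0) as [->|Hne].
        - destruct Hent as [Hr|Hr]; [left|right; tauto]. rewrite (fl_0 (F i)). exact Hr.
        - left. apply Hreg. lra. }
      destruct Hcase as [Hr|[-> [Hh Hl]]].
      - rewrite <- Et in Hr. destruct (region_open i _ Hr) as [d [Hd Hro]].
        destruct (proj1 (cts_dsup gamma (t0 + t)) (Hcts t ltac:(lra)) d Hd) as [e [He Hc]].
        exists e. split; [exact He|]. intros u Hu. apply Hro, Hc.
        rewrite Rabs_pos_eq; lra.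
      - destruct (Hdom 0 ltac:(lra)) as [D1 D2].
        rewrite Rplus_0_r in D1, D2.
        destruct (G t0 D1 D2) as [_ [_ Hcr]]. rewrite Hp in Hcr.
        destruct (Hcr Hh) as [i' [I1 [_ I3]]].
        assert (i' = i) by (eapply sgn_pos_inj; [apply I1|exact Hl]). subst i'.
        apply at_right_iff in I3. destruct I3 as [e [He I3]].
        exists e. split; [exact He|]. intros u Hu. apply I3. lra. }
    destruct Hin as [e1 [He1 Hin]].
    pose proof (Hbox t ltac:(lra)) as Hbt. rewrite <- Et in Hbt.
    destruct (proj1 (cts_dsup gamma (t0 + t)) (Hcts t ltac:(lra)) (d0 - dsup (1, 1) (gamma (t0 + t))) ltac:(lra))
      as [e2 [He2 Hc]].
    exists (Rmin (T - t) (Rmin e1 e2)).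
    split; [repeat apply Rmin_pos; lra|].
    intros u Hu. pose proof (Rmin_l (T - t) (Rmin e1 e2)). pose proof (Rmin_r (T - t) (Rmin e1 e2)).
    pose proof (Rmin_l e1 e2). pose proof (Rmin_r e1 e2).
    pose proof (flow_unique (V i) (Phi i) L (fun w => gamma (w + (t0 + t))) (u - t) (F i)) as U.
    cbv beta in U. rewrite Rplus_0_l, Et, <- (flow_add (F i)) in U.
    replace (u - t + (t0 + t)) with (t0 + u) in U by ring.
    replace (u - t + t) with u in U by ring.
    apply U.
    + lra.
    + intros w Hw. replace (w + (t0 + t)) with (t0 + (t + w)) by ring.
      apply cts_dsup. intros e He.
      destruct (proj1 (cts_dsup gamma (t0 + (t + w))) (Hcts (t + w) ltac:(lra)) e He) as [d [Hd Hcw]].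
      exists d. split; [exact Hd|]. intros v Hv.
      replace (w + (t0 + t)) with (t0 + (t + w)) by ring. apply Hcw.
      replace (v + (t0 + t) - (t0 + (t + w))) with (v - w) by ring. exact Hv.
    + intros w Hw. apply (der_shift gamma).
      replace (w + (t0 + t)) with (t0 + (t + w)) by ring.
      destruct (Hdom (t + w) ltac:(lra)) as [D1 D2].
      rewrite V_eq.
      * apply is_derive_der. apply (G _ D1 D2). apply Hin. lra.
      * pose proof (dsup_tri (1, 1) (gamma (t0 + t)) (gamma (t0 + (t + w)))).
        specialize (Hc (t0 + (t + w))).
        assert (Rabs (t0 + (t + w) - (t0 + t)) < e2).
        { replace (t0 + (t + w) - (t0 + t)) with w by ring. rewrite Rabs_pos_eq; lra. }
        specialize (Hc H4). lra.
  - intros t Ht Hprev. apply dsup_eq0. apply Rnot_lt_le. intros Hpos.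
    set (e := dsup (gamma (t0 + t)) (Phi i t p) / 2).
    assert (He : 0 < e) by (unfold e; lra).
    destruct (proj1 (cts_dsup gamma (t0 + t)) (Hcts t ltac:(lra)) e He) as [d1 [Hd1 H1]].
    destruct (flow_near (V i) (Phi i) L t p e (F i) He) as [d2 [Hd2 H2]].
    set (u := Rmax 0 (t - Rmin d1 d2 / 2)).
    assert (Hu : 0 <= u < t /\ t - Rmin d1 d2 / 2 <= u).
    { pose proof (Rmin_pos d1 d2 Hd1 Hd2).
      unfold u, Rmax. destruct (Rle_dec 0 (t - Rmin d1 d2 / 2)); lra. }
    pose proof (Rmin_l d1 d2). pose proof (Rmin_r d1 d2). pose proof (Rmin_pos d1 d2 Hd1 Hd2).
    specialize (H1 (t0 + u)). specialize (H2 u p). rewrite dsup_refl in H2.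
    assert (A1 : Rabs (t0 + u - (t0 + t)) < d1) by (apply Rabs_lt_between; lra).
    assert (A2 : Rabs (u - t) < d2) by (apply Rabs_lt_between; lra).
    specialize (H1 A1). specialize (H2 A2 Hd2).
    rewrite (Hprev u ltac:(lra)) in H1.
    pose proof (dsup_tri (gamma (t0 + t)) (Phi i u p) (Phi i t p)) as Htri.
    rewrite (dsup_sym (Phi i u p)) in Htri. unfold e in *. lra.
Qed.

Section Concat.

Variables (zk : nat -> zone) (pk : nat -> R * R) (tauk : nat -> R) (t0 : R).

Fixpoint switch_time (k : nat) : R :=
  match k with O => t0 | S k => switch_time k + tauk k end.

Hypothesis tau_pos : forall k, 0 < tauk k.
Hypothesis z_next : forall k, zk (S k) = other (zk k).
Hypothesis p_next : forall k, Phi (zk k) (tauk k) (pk k) = pk (S k).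
Hypothesis in_region : forall k t, 0 < t < tauk k -> region (zk k) (Phi (zk k) t (pk k)).
Hypothesis in_box : forall k t, 0 <= t <= tauk k -> dsup (1, 1) (Phi (zk k) t (pk k)) < d0.
Hypothesis on_line : forall k, h (pk (S k)) = 0.
Hypothesis transversal : forall k j, 0 < sgn (zk (S k)) * lie (X j) (pk (S k)).
Hypothesis unbounded : forall M, exists k, M < switch_time k.

Lemma switch_time_le k m : (k <= m)%nat -> switch_time k <= switch_time m.
Proof.
  intros H. induction H as [|m H IH]; [lra|]. simpl. specialize (tau_pos m). lra.
Qed.

Lemma switch_time_find t : t0 <= t -> exists k, switch_time k <= t < switch_time (S k).
Proof.
  intros Ht. destruct (unbounded t) as [m Hm].
  induction m as [|m IH]; [simpl in Hm; lra|].
  destruct (Rlt_dec t (switch_time m)) as [H|H]; [apply IH, H|].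
  exists m. lra.
Qed.

(** The switching times are unbounded, so that the arcs cover all later times; at
    a switching time transversality provides the crossing condition. *)
Lemma concat : exists gamma, gtraj alpha beta X t0 p_infty gamma /\
  forall k u, 0 <= u <= tauk k -> gamma (switch_time k + u) = Phi (zk k) u (pk k).
Proof.
  set (idx := fun t => epsilon (inhabits 0%nat) (fun k => switch_time k <= t < switch_time (S k))).
  set (gamma := fun t => Phi (zk (idx t)) (t - switch_time (idx t)) (pk (idx t))).
  assert (Hidx : forall k t, switch_time k <= t < switch_time (S k) -> idx t = k).
  { intros k t Ht. unfold idx.
    assert (Hex : exists k, switch_time k <= t < switch_time (S k)) by (exists k; exact Ht).
    pose proof (epsilon_spec (inhabits 0%nat) _ Hex) as Hs. cbv beta in Hs.
    set (m := epsilon (inhabits 0%nat) (fun k => switch_time k <= t < switch_time (S k))) in *.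
    destruct (Compare_dec.lt_eq_lt_dec m k) as [[Hlt|Heq]|Hlt]; [|exact Heq|].
    - pose proof (switch_time_le (S m) k Hlt). lra.
    - pose proof (switch_time_le (S k) m Hlt). lra. }
  assert (Hg : forall k u, 0 <= u <= tauk k -> gamma (switch_time k + u) = Phi (zk k) u (pk k)).
  { intros k u Hu. destruct (Req_dec u (tauk k)) as [->|Hne].
    - change (switch_time k + tauk k) with (switch_time (S k)).
      unfold gamma. rewrite (Hidx (S k)).
      + rewrite Rminus_diag, (fl_0 (F _)), p_next. reflexivity.
      + simpl. specialize (tau_pos (S k)). lra.
    - unfold gamma. rewrite (Hidx k) by (simpl; lra). f_equal. ring. }
  exists gamma. split; [|exact Hg].
  assert (Hg2 : forall k t, switch_time k <= t <= switch_time (S k) ->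
    gamma t = Phi (zk k) (t - switch_time k) (pk k)).
  { intros k t Ht. rewrite <- (Hg k); [f_equal; ring|]. simpl in Ht. lra. }
  intros t Ht _. simpl in Ht.
  destruct (switch_time_find t ltac:(lra)) as [k Hk].
  destruct (Req_dec t (switch_time k)) as [Et|Hne].
  - (* a switching time *)
    destruct k as [|k]; [simpl in Et; lra|].
    assert (Ht' : gamma t = pk (S k)).
    { rewrite (Hg2 (S k)) by lra. rewrite Et, Rminus_diag. apply (fl_0 (F _)). }
    assert (Htk : t = switch_time k + tauk k) by (rewrite Et; reflexivity).
    pose proof (tau_pos k) as Hp. pose proof (tau_pos (S k)) as Hp'.
    assert (HS : switch_time (S (S k)) = t + tauk (S k)) by (rewrite Et; reflexivity).
    split; [|split].
    + apply continuous_cts, cts_dsup. intros e He.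
      destruct (flow_near _ _ _ (tauk k) (pk k) e (F (zk k)) He) as [d1 [Hd1 H1]].
      destruct (flow_near _ _ _ 0 (pk (S k)) e (F (zk (S k))) He) as [d2 [Hd2 H2]].
      exists (Rmin (Rmin d1 d2) (Rmin (tauk k) (tauk (S k)))).
      split; [repeat apply Rmin_pos; assumption|]. intros u Hu.
      pose proof (Rmin_l (Rmin d1 d2) (Rmin (tauk k) (tauk (S k)))).
      pose proof (Rmin_r (Rmin d1 d2) (Rmin (tauk k) (tauk (S k)))).
      pose proof (Rmin_l d1 d2). pose proof (Rmin_r d1 d2).
      pose proof (Rmin_l (tauk k) (tauk (S k))). pose proof (Rmin_r (tauk k) (tauk (S k))).
      pose proof Hu as Hu'. apply Rabs_lt_between in Hu'.
      rewrite Ht'. destruct (Rle_dec u t).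
      * rewrite (Hg2 k) by (simpl; lra). rewrite <- p_next. apply H1; [|rewrite dsup_refl; lra].
        apply Rabs_lt_between. lra.
      * rewrite (Hg2 (S k)) by lra. rewrite (fl_0 (F _)) in H2.
        apply H2; [|rewrite dsup_refl; lra]. apply Rabs_lt_between. lra.
    + intros i Hi. exfalso. unfold Defs.region in Hi. rewrite Ht', on_line in Hi. lra.
    + intros _. exists (zk (S k)). rewrite Ht'. split; [apply transversal|]. split.
      * apply at_left_iff. exists (tauk k). split; [exact Hp|]. intros u Hu.
        rewrite (Hg2 k) by (simpl; lra). rewrite z_next, other_other. apply in_region. lra.
      * apply at_right_iff. exists (tauk (S k)). split; [exact Hp'|]. intros u Hu.
        rewrite (Hg2 (S k)) by lra. apply in_region. lra.
  - (* inside an arc *)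
    assert (Hloc : locally t (fun u => Phi (zk k) (u - switch_time k) (pk k) = gamma u)).
    { assert (Hd : 0 < Rmin (t - switch_time k) (switch_time (S k) - t)) by (apply Rmin_pos; lra).
      exists (mkposreal _ Hd). intros u Hu. symmetry. apply Hg2.
      apply Rabs_lt_between in Hu. simpl in Hu. unfold minus, plus, opp in Hu; simpl in Hu.
      pose proof (Rmin_l (t - switch_time k) (switch_time k + tauk k - t)).
      pose proof (Rmin_r (t - switch_time k) (switch_time k + tauk k - t)). simpl. lra. }
    assert (HD : der (fun u => Phi (zk k) (u - switch_time k) (pk k)) t
      (V (zk k) (Phi (zk k) (t - switch_time k) (pk k)))).
    { apply (der_shift (fun u => Phi (zk k) u (pk k)) (- switch_time k)).
      apply (fl_der (F (zk k))). }
    assert (Et : gamma t = Phi (zk k) (t - switch_time k) (pk k)) by (apply Hg2; lra).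
    assert (Hr : region (zk k) (gamma t)) by (rewrite Et; apply in_region; simpl in Hk; lra).
    split; [|split].
    + apply (continuous_ext_loc gamma (fun u => Phi (zk k) (u - switch_time k) (pk k))); [exact Hloc|].
      apply continuous_cts. eapply der_cts. exact HD.
    + intros i Hi. assert (i = zk k) by (eapply sgn_pos_inj; [exact Hi|exact Hr]). subst i.
      apply (is_derive_ext_loc (fun u => Phi (zk k) (u - switch_time k) (pk k))); [exact Hloc|].
      apply is_derive_der. rewrite <- V_eq; [rewrite Et; exact HD|].
      rewrite Et. apply in_box. simpl in Hk. lra.
    + intros Hh. exfalso. unfold Defs.region in Hr. rewrite Hh in Hr. lra.
Qed.

End Concat.

End Piecewise.

(** * Attracting cycles *)

(** The definitions for Kolmogorov systems, word for word, for pairs of fields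
    that need not be of Kolmogorov type: for [X := field K] they coincide
    definitionally with the original ones. *)
Definition gtends (alpha beta : R) (X : zone -> R * R -> R * R)
    (A : R * R -> Prop) (p : R * R) : Prop :=
  exists (gamma : R -> R * R) (a b : Rbar),
    Rbar_lt a 0 /\ Rbar_lt 0 b /\
    gtraj alpha beta X a b gamma /\ gamma 0 = p /\
    forall eta, 0 < eta ->
      exists t0 : R, 0 <= t0 /\ Rbar_lt t0 b /\
        forall t : R, t0 < t -> Rbar_lt t b -> near A eta (gamma t).

Definition gstable (alpha beta : R) X (A : R * R -> Prop) : Prop :=
  exists delta, 0 < delta /\
    forall p, ~ A p -> near A delta p -> gtends alpha beta X A p.

Definition gperiodic (alpha beta : R) X (G : R * R -> Prop) : Prop :=
  exists (gamma : R -> R * R) (T : R),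
    0 < T /\
    gtraj alpha beta X m_infty p_infty gamma /\
    (forall t, gamma (t + T) = gamma t) /\
    (exists t, gamma t <> gamma 0) /\
    (forall p, G p <-> exists t, gamma t = p).

Definition glimit_cycle (alpha beta : R) X (G : R * R -> Prop) : Prop :=
  gperiodic alpha beta X G /\
  (forall i, exists p, G p /\ region alpha beta i p) /\
  (exists delta, 0 < delta /\
     forall G', gperiodic alpha beta X G' ->
       (forall p, G' p -> near G delta p) -> forall p, G' p <-> G p).

Lemma near_dsup A e p : near A e p <-> exists q, A q /\ dsup q p < e.
Proof.
  unfold near. split; intros [q [H1 H2]]; exists q; split; auto; apply ball_dsup; exact H2.
Qed.

Section Cycle.

Variables (alpha beta : R) (X V : zone -> R * R -> R * R) (Phi : zone -> R -> R * R -> R * R).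
Variables (L d0 : R).
Hypothesis beta_neq0 : beta <> 0.
Hypothesis F : forall i, flow (V i) (Phi i) L.
Hypothesis V_eq : forall i p, dsup (1, 1) p < d0 -> V i p = X i p.

Local Notation h := (Defs.h alpha beta).
Local Notation sigma := (Defs.sigma alpha beta).
Local Notation lie := (lie alpha beta).
Local Notation region := (region alpha beta).

Definition arc i p T x : Prop :=
  0 < T /\ Phi i T p = sigma x /\ forall t, 0 < t < T -> region i (Phi i t p).

Lemma arc_unique i p T x T' x' : arc i p T x -> arc i p T' x' -> T = T' /\ x = x'.
Proof.
  intros [H1 [H2 H3]] [H1' [H2' H3']].
  assert (T = T').
  { destruct (Rtotal_order T T') as [Hlt|[Heq|Hlt]]; [|exact Heq|]; exfalso.
    - specialize (H3' T ltac:(lra)). unfold Defs.region in H3'. rewrite H2, h_sigma in H3'. lra.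
    - specialize (H3 T' ltac:(lra)). unfold Defs.region in H3. rewrite H2', h_sigma in H3. lra. }
  subst T'. split; [reflexivity|]. rewrite H2 in H2'. eapply sigma_inj; eassumption.
Qed.

Definition turn z0 x x' : Prop :=
  exists y T1 T2, arc z0 (sigma x) T1 y /\ arc (other z0) (sigma y) T2 x'.

(* The cycle leaves [sigma (xs i)] through zone [i]; near it the return map
   through zone [z0] and back contracts. *)
Variables (xs Ts : zone -> R) (z0 : zone) (eta0 : R).
Hypothesis xs_neq : forall i, xs i <> xs (other i).
Hypothesis arc_xs : forall i, arc i (sigma (xs i)) (Ts i) (xs (other i)).
Hypothesis arc_box : forall i t, 0 <= t <= Ts i -> dsup (1, 1) (Phi i t (sigma (xs i))) < d0.
Hypothesis trans : forall i j, 0 < sgn i * lie (X j) (sigma (xs i)).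
Hypothesis eta0_pos : 0 < eta0.
Variable lam : R.
Hypothesis lam_range : 0 <= lam < 1.
Hypothesis contracting : forall x x', Rabs (x - xs z0) < eta0 -> turn z0 x x' ->
  Rabs (x' - xs z0) <= lam * Rabs (x - xs z0).

Lemma contraction x x' : Rabs (x - xs z0) < eta0 -> turn z0 x x' ->
  (x <> xs z0 -> Rabs (x' - xs z0) < Rabs (x - xs z0)) /\ (x = xs z0 -> x' = xs z0).
Proof.
  intros Hx Ht. pose proof (contracting x x' Hx Ht) as Hc. split; intros Hne.
  - assert (0 < Rabs (x - xs z0)) by (apply Rabs_pos_lt; lra). nra.
  - rewrite Hne, Rminus_diag, Rabs_R0, Rmult_0_r in Hc.
    pose proof (Rabs_pos (x' - xs z0)). assert (x' - xs z0 = 0) by (apply Rabs_eq_0; lra). lra.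
Qed.

Lemma convergence (u : nat -> R) : Rabs (u 0%nat - xs z0) < eta0 ->
  (forall n, turn z0 (u n) (u (S n))) ->
  forall e, 0 < e -> exists N, forall n, (N <= n)%nat -> Rabs (u n - xs z0) < e.
Proof.
  intros H0 Hturn e He.
  assert (Hg : forall n, Rabs (u n - xs z0) < eta0 /\ Rabs (u n - xs z0) <= lam ^ n * eta0).
  { induction n as [|n [I1 I2]]; [simpl; lra|].
    pose proof (contracting _ _ I1 (Hturn n)) as Hc.
    pose proof (Rabs_pos (u n - xs z0)). split; [nra|]. simpl.
    assert (lam * Rabs (u n - xs z0) <= lam * (lam ^ n * eta0)) by (apply Rmult_le_compat_l; lra).
    lra. }
  destruct (pow_lt_1_zero lam) with (y := e / eta0) as [N HN].
  { rewrite Rabs_pos_eq; lra. }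
  { apply Rdiv_lt_0_compat; assumption. }
  exists N. intros n Hn. specialize (HN n Hn). rewrite Rabs_pos_eq in HN by (apply pow_le; lra).
  apply Rlt_div_r in HN; [|assumption]. destruct (Hg n) as [_ H]. lra.
Qed.

Definition cycle (p : R * R) : Prop :=
  exists i t, 0 <= t <= Ts i /\ p = Phi i t (sigma (xs i)).

Definition near_cycle e q := exists g, cycle g /\ dsup g q < e.

Lemma Ts_pos i : 0 < Ts i.
Proof. apply (arc_xs i). Qed.

Lemma lie_V i p : dsup (1, 1) p < d0 -> lie (V i) p = lie (X i) p.
Proof. intros Hp. unfold Submission.lie. rewrite V_eq by exact Hp. reflexivity. Qed.

Lemma xs_box i : dsup (1, 1) (sigma (xs i)) < d0.
Proof.
  pose proof (arc_box i 0) as H. rewrite (fl_0 (F i)) in H. apply H.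
  pose proof (Ts_pos i). lra.
Qed.

Lemma trans_V i j : 0 < sgn i * lie (V j) (sigma (xs i)).
Proof. rewrite lie_V by apply xs_box. apply trans. Qed.

Lemma near_cycle_box : exists e, 0 < e /\ forall q, near_cycle e q -> dsup (1, 1) q < d0.
Proof.
  assert (H : forall i, exists m, m < d0 /\ forall t, 0 <= t <= Ts i ->
    dsup (1, 1) (Phi i t (sigma (xs i))) <= m).
  { intros i.
    destruct (continuity_ab_maj (fun t => dsup (1, 1) (Phi i t (sigma (xs i)))) 0 (Ts i)) as [x [Hx Hx2]].
    - pose proof (Ts_pos i). lra.
    - intros t _. apply continuity_pt_locally. intros [e He].
      destruct (flow_near _ _ _ t (sigma (xs i)) e (F i) He) as [d [Hd H]].
      exists (mkposreal d Hd). intros u Hu.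
      specialize (H u (sigma (xs i)) Hu). rewrite dsup_refl in H. specialize (H Hd).
      simpl. apply Rabs_lt_between.
      pose proof (dsup_tri (1, 1) (Phi i t (sigma (xs i))) (Phi i u (sigma (xs i)))).
      pose proof (dsup_tri (1, 1) (Phi i u (sigma (xs i))) (Phi i t (sigma (xs i)))) as H'.
      rewrite (dsup_sym (Phi i u _)) in H'. lra.
    - exists (dsup (1, 1) (Phi i x (sigma (xs i)))). split; [apply arc_box; exact Hx2|exact Hx]. }
  destruct (H zone1) as [m1 [M1 H1]], (H zone2) as [m2 [M2 H2]].
  exists (Rmin (d0 - m1) (d0 - m2)). split; [apply Rmin_pos; lra|].
  intros q [g [[i [t [Ht ->]]] Hq]].
  pose proof (Rmin_l (d0 - m1) (d0 - m2)). pose proof (Rmin_r (d0 - m1) (d0 - m2)).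
  pose proof (dsup_tri (1, 1) (Phi i t (sigma (xs i))) q).
  destruct i; [specialize (H1 t Ht)|specialize (H2 t Ht)]; lra.
Qed.

Lemma trans_near : exists e, 0 < e /\ forall i j x, Rabs (x - xs i) < e ->
  0 < sgn i * lie (V j) (sigma x) /\ 0 < sgn i * lie (X j) (sigma x).
Proof.
  assert (HK : 0 < Rabs alpha + Rabs beta).
  { pose proof (Rabs_pos alpha). pose proof (Rabs_pos_lt beta beta_neq0). lra. }
  assert (H : forall i j, exists e, 0 < e /\ forall x, Rabs (x - xs i) < e ->
    0 < sgn i * lie (V j) (sigma x) /\ 0 < sgn i * lie (X j) (sigma x)).
  { intros i j. pose proof (trans_V i j) as Ht. pose proof (xs_box i) as Hb.
    destruct (lie_near alpha beta (V j) (Phi j) L (sigma (xs i)) _ (F j) Ht) as [d [Hd Hl]].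
    set (m := Rmin d (d0 - dsup (1, 1) (sigma (xs i)))).
    assert (Hm : 0 < m) by (apply Rmin_pos; lra).
    exists (m / (Rabs alpha + Rabs beta)). split; [apply Rdiv_lt_0_compat; assumption|].
    intros x Hx. apply Rlt_div_r in Hx; [|exact HK].
    pose proof (proj2 (sigma_dsup alpha beta (xs i) x)) as Hs.
    pose proof (Rmin_l d (d0 - dsup (1, 1) (sigma (xs i)))) as M1.
    pose proof (Rmin_r d (d0 - dsup (1, 1) (sigma (xs i)))) as M2. fold m in M1, M2.
    specialize (Hl (sigma x) ltac:(lra)).
    pose proof (dsup_tri (1, 1) (sigma (xs i)) (sigma x)).
    rewrite <- (lie_V j (sigma x)) by lra.
    apply Rabs_lt_between in Hl. destruct (sgn_pm i) as [E|E]; rewrite E in *; lra. }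
  destruct (H zone1 zone1) as [e1 [E1 H1]], (H zone1 zone2) as [e2 [E2 H2]],
    (H zone2 zone1) as [e3 [E3 H3]], (H zone2 zone2) as [e4 [E4 H4]].
  exists (Rmin (Rmin e1 e2) (Rmin e3 e4)). split; [repeat apply Rmin_pos; assumption|].
  intros i j x Hx.
  pose proof (Rmin_l (Rmin e1 e2) (Rmin e3 e4)). pose proof (Rmin_r (Rmin e1 e2) (Rmin e3 e4)).
  pose proof (Rmin_l e1 e2). pose proof (Rmin_r e1 e2).
  pose proof (Rmin_l e3 e4). pose proof (Rmin_r e3 e4).
  destruct i, j; [apply H1|apply H2|apply H3|apply H4]; lra.
Qed.

(** For small [e], staying close to the cycle keeps an arc in the box where [V]
    and [X] agree. *)
Definition garc e i p T x := arc i p T x /\ forall t, 0 <= t <= T -> near_cycle e (Phi i t p).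

(** The cycle is entered from every nearby point: [p] lies in the closure of
    zone [i], and its arc follows the cycle to the line. *)
Definition reach e p := exists i T x, garc e i p T x /\ Rabs (x - xs (other i)) < e /\
  (region i p \/ exists x', p = sigma x' /\ Rabs (x' - xs i) < e).

(** Orbits starting close to a point [q] of the cycle, on the right side of the
    line, follow it to its end: the arc persists by transversality. *)
Lemma arc_near i q T : cycle q -> 0 < T -> enters alpha beta (V i) (sgn i) q ->
  arc i q T (xs (other i)) -> (forall t, 0 <= t <= T -> cycle (Phi i t q)) ->
  forall e, 0 < e -> exists d, 0 < d /\ forall p, dsup q p < d -> 0 <= sgn i * h p ->
    exists T' x, garc e i p T' x /\ Rabs (x - xs (other i)) < e.
Proof.
  intros Hq HT Hent [_ [Hend Hreg]] Hcyc e He.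
  assert (Hb : 0 < Rabs beta) by (apply Rabs_pos_lt; assumption).
  destruct (flow_close _ _ _ T q e (F i) ltac:(lra) He) as [d1 [Hd1 H1]].
  set (e' := Rmin d1 (Rabs beta * e)).
  assert (He' : 0 < e') by (apply Rmin_pos; [assumption|apply Rmult_lt_0_compat; assumption]).
  destruct (arc_persist alpha beta (V i) (Phi i) L (sgn i) (F i) q T HT Hent) with (e := e')
    as [d2 [Hd2 H2]].
  - exact Hreg.
  - rewrite Hend. apply h_sigma.
  - rewrite Hend. pose proof (trans_V (other i) i) as Htr. rewrite sgn_other in Htr. lra.
  - exact He'.
  - exists (Rmin d1 d2). split; [apply Rmin_pos; assumption|]. intros p Hp Hh.
    pose proof (Rmin_l d1 d2). pose proof (Rmin_r d1 d2).
    destruct (H2 p ltac:(lra) Hh) as [T' [A1 [A2 [A3 [A4 [A5 A6]]]]]].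
    pose proof (Rmin_l d1 (Rabs beta * e)) as M1. pose proof (Rmin_r d1 (Rabs beta * e)) as M2.
    fold e' in M1, M2.
    apply (h_zero_sigma alpha beta _ beta_neq0) in A3.
    set (x := (fst (Phi i T' p) - 1) / beta) in A3.
    exists T', x. split; [split|].
    + split; [exact A2|]. split; [exact A3|exact A4].
    + intros t Ht. exists (Phi i (Rmin t T) q). apply Rabs_lt_between in A1. split.
      * apply Hcyc. unfold Rmin. destruct (Rle_dec t T); lra.
      * apply H1; lra.
    + rewrite Hend, A3 in A6. pose proof (proj1 (sigma_dsup alpha beta (xs (other i)) x)) as B.
      apply Rmult_lt_reg_l with (Rabs beta); [exact Hb|]. lra.
Qed.

Lemma cycle_xs i : cycle (sigma (xs i)).
Proof.
  exists i, 0. pose proof (Ts_pos i). split; [lra|]. rewrite (fl_0 (F i)). reflexivity.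
Qed.

Lemma arc_near_xs i e : 0 < e -> exists d, 0 < d /\ forall p, dsup (sigma (xs i)) p < d ->
  0 <= sgn i * h p -> exists T' x, garc e i p T' x /\ Rabs (x - xs (other i)) < e.
Proof.
  intros He. apply (arc_near i (sigma (xs i)) (Ts i)).
  - apply cycle_xs.
  - apply Ts_pos.
  - right. split; [apply h_sigma|apply trans_V].
  - apply arc_xs.
  - intros t Ht. exists i, t. split; [exact Ht|reflexivity].
  - exact He.
Qed.

Lemma step e : 0 < e -> exists d, 0 < d /\ forall i x, Rabs (x - xs i) < d ->
  exists T x', garc e i (sigma x) T x' /\ Rabs (x' - xs (other i)) < e.
Proof.
  intros He.
  assert (HK : 0 < Rabs alpha + Rabs beta).
  { pose proof (Rabs_pos alpha). pose proof (Rabs_pos_lt beta beta_neq0). lra. }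
  assert (H : forall i, exists d, 0 < d /\ forall x, Rabs (x - xs i) < d ->
    exists T x', garc e i (sigma x) T x' /\ Rabs (x' - xs (other i)) < e).
  { intros i. destruct (arc_near_xs i e He) as [d [Hd H]].
    exists (d / (Rabs alpha + Rabs beta)). split; [apply Rdiv_lt_0_compat; assumption|].
    intros x Hx. apply Rlt_div_r in Hx; [|exact HK]. apply H.
    - eapply Rle_lt_trans; [apply sigma_dsup|]. lra.
    - rewrite h_sigma. lra. }
  destruct (H zone1) as [d1 [D1 H1]], (H zone2) as [d2 [D2 H2]].
  exists (Rmin d1 d2). split; [apply Rmin_pos; assumption|].
  intros i x Hx. pose proof (Rmin_l d1 d2). pose proof (Rmin_r d1 d2).
  destruct i; [apply H1|apply H2]; lra.
Qed.

(** At the two corners of the cycle a nearby point is either on the side of the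
    zone being entered, or it still has a short way to go through the zone being
    left. *)
Lemma reach_near_xs i e : 0 < e -> exists d, 0 < d /\ forall p, dsup (sigma (xs i)) p < d -> reach e p.
Proof.
  intros He. destruct (arc_near_xs i e He) as [d1 [Hd1 H1]].
  assert (Hb : 0 < Rabs beta) by (apply Rabs_pos_lt; assumption).
  set (j := other i).
  destruct (exit_hit alpha beta (V j) (Phi j) L (sgn j) (F j) (sigma (xs i))) as [w [Hw H2]].
  { apply h_sigma. }
  { unfold j. rewrite sgn_other. pose proof (trans_V i (other i)). lra. }
  set (e' := Rmin e (Rabs beta * e)).
  assert (He' : 0 < e') by (apply Rmin_pos; [assumption|apply Rmult_lt_0_compat; assumption]).
  destruct (flow_near _ _ _ 0 (sigma (xs i)) e' (F j) He') as [d2 [Hd2 H3]].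
  destruct (H2 d2 Hd2) as [d3 [Hd3 H4]].
  exists (Rmin (Rmin d1 (Rabs beta * e)) (Rmin d2 d3)).
  split; [repeat apply Rmin_pos; try assumption; apply Rmult_lt_0_compat; assumption|].
  intros p Hp.
  pose proof (Rmin_l (Rmin d1 (Rabs beta * e)) (Rmin d2 d3)).
  pose proof (Rmin_r (Rmin d1 (Rabs beta * e)) (Rmin d2 d3)).
  pose proof (Rmin_l d1 (Rabs beta * e)). pose proof (Rmin_r d1 (Rabs beta * e)).
  pose proof (Rmin_l d2 d3). pose proof (Rmin_r d2 d3).
  destruct (Rle_dec 0 (sgn i * h p)) as [Hh|Hh].
  - destruct (H1 p ltac:(lra) Hh) as [T [x [G1 G2]]].
    exists i, T, x. split; [exact G1|]. split; [exact G2|].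
    destruct (Req_dec (h p) 0) as [E|E].
    + right. pose proof (h_zero_sigma alpha beta p beta_neq0 E) as Ep.
      exists ((fst p - 1) / beta). split; [exact Ep|].
      pose proof (proj1 (sigma_dsup alpha beta (xs i) ((fst p - 1) / beta))) as B.
      rewrite <- Ep in B. apply Rmult_lt_reg_l with (Rabs beta); [exact Hb|]. lra.
    + left. unfold Defs.region. destruct (sgn_pm i) as [Es|Es]; rewrite Es in *; lra.
  - assert (Hrj : region j p) by (unfold Defs.region, j; rewrite sgn_other; lra).
    destruct (H4 p ltac:(lra)) as [t' [A1 [A2 [A3 A4]]]].
    assert (Ht' : 0 < t').
    { destruct (A4 0) as [B1 B2]; [rewrite Rabs_R0; exact Hw|].
      rewrite (fl_0 (F j)) in B2. unfold Defs.region in Hrj.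
      destruct (Rtotal_order t' 0) as [C|[C|C]]; [specialize (B2 C); lra| |exact C].
      rewrite C, (fl_0 (F j)) in A3. rewrite A3 in Hrj. lra. }
    rewrite Rabs_pos_eq in A1, A2 by lra.
    assert (Hclose : forall t, 0 <= t <= t' -> dsup (sigma (xs i)) (Phi j t p) < e').
    { intros t Ht. specialize (H3 t p). rewrite (fl_0 (F j)), Rminus_0_r in H3.
      apply H3; [rewrite Rabs_pos_eq; lra|lra]. }
    apply (h_zero_sigma alpha beta _ beta_neq0) in A3.
    set (x := (fst (Phi j t' p) - 1) / beta) in A3.
    pose proof (Rmin_l e (Rabs beta * e)) as M1. pose proof (Rmin_r e (Rabs beta * e)) as M2. fold e' in M1, M2.
    exists j, t', x. split; [split|split].
    + split; [exact Ht'|]. split; [exact A3|]. intros t Ht. apply A4; [rewrite Rabs_pos_eq; lra|lra].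
    + intros t Ht. exists (sigma (xs i)). split; [apply cycle_xs|]. specialize (Hclose t Ht). lra.
    + unfold j. rewrite other_other. specialize (Hclose t' ltac:(lra)). rewrite A3 in Hclose.
      pose proof (proj1 (sigma_dsup alpha beta (xs i) x)) as B.
      apply Rmult_lt_reg_l with (Rabs beta); [exact Hb|]. lra.
    + left. exact Hrj.
Qed.

Lemma reach_near_cycle q e : cycle q -> 0 < e -> exists d, 0 < d /\ forall p, dsup q p < d -> reach e p.
Proof.
  intros [i [t [Ht ->]]] He.
  destruct (arc_xs i) as [A1 [A2 A3]].
  destruct (Req_dec t 0) as [->|H0].
  { rewrite (fl_0 (F i)). apply reach_near_xs, He. }
  destruct (Req_dec t (Ts i)) as [->|H1].
  { rewrite A2. apply reach_near_xs, He. }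
  set (q := Phi i t (sigma (xs i))).
  assert (Hq : region i q) by (apply A3; lra).
  destruct (arc_near i q (Ts i - t)) with (e := e) as [d1 [Hd1 B]].
  - exists i, t. split; [exact Ht|reflexivity].
  - lra.
  - left. exact Hq.
  - split; [lra|]. unfold q. split.
    + rewrite <- (flow_add (F i)). replace (Ts i - t + t) with (Ts i) by ring. exact A2.
    + intros u Hu. rewrite <- (flow_add (F i)). apply A3. lra.
  - intros u Hu. exists i, (u + t). split; [lra|]. unfold q. symmetry. apply (flow_add (F i)).
  - exact He.
  - destruct (region_open alpha beta i q Hq) as [d2 [Hd2 C]].
    exists (Rmin d1 d2). split; [apply Rmin_pos; assumption|]. intros p Hp.
    pose proof (Rmin_l d1 d2). pose proof (Rmin_r d1 d2).
    assert (Hr : region i p) by (apply C; lra).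
    destruct (B p ltac:(lra)) as [T' [x [G1 G2]]]; [unfold Defs.region in Hr; lra|].
    exists i, T', x. split; [exact G1|]. split; [exact G2|left; exact Hr].
Qed.

(** The cycle is compact, so the neighbourhoods of its points contain a uniform
    one. *)
Lemma cycle_neighbourhood e : 0 < e -> exists d, 0 < d /\ forall p, near_cycle d p -> reach e p.
Proof.
  intros He.
  assert (H : forall i, exists d, 0 < d /\ forall t p, 0 <= t <= Ts i ->
    dsup (Phi i t (sigma (xs i))) p < d -> reach e p).
  { intros i.
    assert (Hd : forall t, exists d : posreal, 0 <= t <= Ts i -> forall t' p, Rabs (t' - t) < d ->
      dsup (Phi i t' (sigma (xs i))) p < d -> reach e p).
    { intros t. destruct (Rle_dec 0 t) as [T0|T0]; [|exists (mkposreal 1 Rlt_0_1); intros; lra].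
      destruct (Rle_dec t (Ts i)) as [T1|T1]; [|exists (mkposreal 1 Rlt_0_1); intros; lra].
      destruct (reach_near_cycle (Phi i t (sigma (xs i))) e) as [d [Hd Hr]].
      { exists i, t. split; [lra|reflexivity]. }
      { exact He. }
      destruct (flow_near _ _ _ t (sigma (xs i)) (d / 2) (F i) ltac:(lra)) as [d2 [Hd2 Hn]].
      assert (Hm : 0 < Rmin d2 (d / 2)) by (apply Rmin_pos; lra).
      exists (mkposreal _ Hm). simpl. intros _ t' p Ht' Hp.
      pose proof (Rmin_l d2 (d / 2)). pose proof (Rmin_r d2 (d / 2)).
      specialize (Hn t' (sigma (xs i)) ltac:(lra)). rewrite dsup_refl in Hn. specialize (Hn Hd2).
      apply Hr. pose proof (dsup_tri (Phi i t (sigma (xs i))) (Phi i t' (sigma (xs i))) p). lra. }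
    destruct (choice _ Hd) as [delta Hdelta].
    destruct (compactness_value_1d 0 (Ts i) delta) as [d Hc].
    exists d. split; [apply cond_pos|]. intros t p Ht Hp.
    apply NNPP. intros Hno. apply (Hc t Ht). intros [t' [Ht' [H1 H2]]].
    apply Hno. apply (Hdelta t' Ht' t p); [exact H1|lra]. }
  destruct (H zone1) as [d1 [D1 H1]], (H zone2) as [d2 [D2 H2]].
  exists (Rmin d1 d2). split; [apply Rmin_pos; assumption|].
  intros p [g [[i [t [Ht ->]]] Hg]]. pose proof (Rmin_l d1 d2). pose proof (Rmin_r d1 d2).
  destruct i; [apply (H1 t)|apply (H2 t)]; auto; lra.
Qed.

(** ** The cycle is a periodic orbit *)

Let period := Ts z0 + Ts (other z0).

Let cz (k : nat) := Nat.iter k other z0.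

Lemma cz_SS k : cz (S (S k)) = cz k.
Proof. unfold cz. simpl. apply other_other. Qed.

Let ctime := switch_time (fun k => Ts (cz k)) 0.

Lemma ctime_SS k : ctime (S (S k)) = ctime k + period.
Proof.
  unfold ctime. simpl. unfold period.
  assert (E : (cz k = z0 /\ cz (S k) = other z0) \/ (cz k = other z0 /\ cz (S k) = z0)).
  { induction k as [|k IH]; [left; split; reflexivity|].
    destruct IH as [[I1 I2]|[I1 I2]]; [right|left]; rewrite cz_SS; tauto. }
  change (Nat.iter k other z0) with (cz k). change (other (cz k)) with (cz (S k)).
  destruct E as [[-> ->]|[-> ->]]; ring.
Qed.

Lemma Ts_lower i : Rmin (Ts zone1) (Ts zone2) <= Ts i.
Proof. destruct i; [apply Rmin_l|apply Rmin_r]. Qed.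

Lemma times_unbounded (tau : nat -> R) (t0 m : R) : 0 < m -> (forall k, m <= tau (S k)) ->
  (forall k, 0 < tau k) -> forall M, exists k, M < switch_time tau t0 k.
Proof.
  intros Hm Hk Hp M.
  assert (H : forall k, t0 + INR k * m <= switch_time tau t0 (S k)).
  { induction k as [|k IH].
    - simpl. specialize (Hp 0%nat). lra.
    - change (switch_time tau t0 (S (S k))) with (switch_time tau t0 (S k) + tau (S k)).
      rewrite S_INR. specialize (Hk k). lra. }
  destruct (INR_unbounded ((M - t0) / m)) as [n Hn].
  exists (S n). specialize (H n). apply Rlt_gt in Hn. apply Rlt_div_l in Hn; [|exact Hm]. lra.
Qed.

Lemma cycle_forward : exists gamma, gtraj alpha beta X 0 p_infty gamma /\
  (forall k u, 0 <= u <= Ts (cz k) -> gamma (ctime k + u) = Phi (cz k) u (sigma (xs (cz k)))) /\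
  (forall t, 0 <= t -> gamma (t + period) = gamma t) /\
  (forall t, 0 <= t -> exists k u, 0 <= u <= Ts (cz k) /\ t = ctime k + u).
Proof.
  assert (Hm : 0 < Rmin (Ts zone1) (Ts zone2)) by (apply Rmin_pos; apply Ts_pos).
  assert (Hunb : forall M, exists k, M < ctime k).
  { apply (times_unbounded _ 0 _ Hm); intros k; [apply Ts_lower|apply Ts_pos]. }
  destruct (concat alpha beta X V Phi L d0 F V_eq cz (fun k => sigma (xs (cz k)))
    (fun k => Ts (cz k)) 0) as [gamma [G1 G2]].
  - intros k. apply Ts_pos.
  - intros k. reflexivity.
  - intros k. apply (arc_xs (cz k)).
  - intros k. apply (arc_xs (cz k)).
  - intros k. apply arc_box.
  - intros k. apply h_sigma.
  - intros k j. apply trans.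
  - exact Hunb.
  - assert (Hfind : forall t, 0 <= t -> exists k u, 0 <= u <= Ts (cz k) /\ t = ctime k + u).
    { intros t Ht.
      destruct (switch_time_find (fun k => Ts (cz k)) 0 Hunb t Ht) as [k Hk].
      exists k, (t - ctime k). simpl in Hk. fold ctime in Hk. split; [lra|ring]. }
    change (forall k u, 0 <= u <= Ts (cz k) -> gamma (ctime k + u) = Phi (cz k) u (sigma (xs (cz k)))) in G2.
    exists gamma. split; [exact G1|]. split; [exact G2|]. split; [|exact Hfind].
    intros t Ht. destruct (Hfind t Ht) as [k [u [Hu ->]]].
    rewrite (G2 k u Hu). replace (ctime k + u + period) with (ctime (S (S k)) + u)
      by (rewrite ctime_SS; ring).
    rewrite (G2 (S (S k)) u); rewrite cz_SS; [reflexivity|exact Hu].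
Qed.

Lemma period_pos : 0 < period.
Proof. unfold period. pose proof (Ts_pos z0). pose proof (Ts_pos (other z0)). lra. Qed.

(** The forward orbit is extended to negative times by its period. *)
Lemma cycle_periodic : gperiodic alpha beta X cycle.
Proof.
  destruct cycle_forward as [gamma [G1 [G2 [G3 G4]]]].
  pose proof period_pos as HP.
  assert (Gn : forall n t, 0 <= t -> gamma (t + INR n * period) = gamma t).
  { induction n as [|n IH]; intros t Ht.
    - simpl. rewrite Rmult_0_l, Rplus_0_r. reflexivity.
    - rewrite S_INR. replace (t + (INR n + 1) * period) with (t + period + INR n * period) by ring.
      rewrite IH by lra. apply G3, Ht. }
  set (N := fun t => epsilon (inhabits 0%nat) (fun n => 0 <= t + INR n * period)).
  assert (HN : forall t, 0 <= t + INR (N t) * period).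
  { intros t. unfold N. apply (epsilon_spec (inhabits 0%nat) (fun n => 0 <= t + INR n * period)).
    destruct (INR_unbounded (- t / period)) as [n Hn]. exists n.
    apply Rlt_gt in Hn. apply Rlt_div_l in Hn; [|exact HP]. lra. }
  set (g := fun t => gamma (t + INR (N t) * period)).
  assert (Hg : forall t n, 0 <= t + INR n * period -> g t = gamma (t + INR n * period)).
  { intros t n Hn. unfold g. specialize (HN t). destruct (Nat.le_ge_cases (N t) n) as [Hle|Hle].
    - rewrite <- (Gn (n - N t)%nat (t + INR (N t) * period) HN). f_equal.
      rewrite minus_INR by exact Hle. ring.
    - rewrite <- (Gn (N t - n)%nat (t + INR n * period) Hn). f_equal.
      rewrite minus_INR by exact Hle. ring. }
  assert (Hg0 : forall t, 0 <= t -> g t = gamma t).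
  { intros t Ht. rewrite (Hg t 0%nat); simpl; [f_equal; ring|lra]. }
  assert (Hxs0 : g 0 = sigma (xs z0)).
  { rewrite Hg0 by lra. pose proof (Ts_pos (cz 0)) as Hp. specialize (G2 0%nat 0).
    change (ctime 0 + 0) with (0 + 0) in G2. rewrite Rplus_0_r in G2. rewrite G2 by lra.
    apply (fl_0 (F _)). }
  exists g, period. split; [exact HP|]. split; [|split; [|split]].
  - apply gtraj_local. intros t _ _.
    destruct (INR_unbounded ((1 - t) / period)) as [n Hn].
    apply Rlt_gt in Hn. apply Rlt_div_l in Hn; [|exact HP].
    exists 1, (fun u => gamma (u + INR n * period)). split; [lra|]. split.
    + apply (gtraj_sub _ _ _ (0 - INR n * period) (Rbar_plus p_infty (- (INR n * period)))).
      * simpl. lra.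
      * exact I.
      * apply (gtraj_shift alpha beta X 0 0 (INR n * period) p_infty gamma G1).
    + intros u Hu. apply Hg. lra.
  - intros t. rewrite (Hg t (S (N t))); [|rewrite S_INR; specialize (HN t); lra].
    rewrite (Hg (t + period) (N t)) by (specialize (HN t); lra). f_equal. rewrite S_INR. ring.
  - exists (Ts z0). rewrite Hxs0. pose proof (Ts_pos z0) as Hp. rewrite Hg0 by lra.
    specialize (G2 0%nat (Ts z0)). change (ctime 0 + Ts z0) with (0 + Ts z0) in G2.
    rewrite Rplus_0_l in G2. change (cz 0) with z0 in G2. rewrite G2 by lra.
    destruct (arc_xs z0) as [_ [-> _]]. intros E. apply sigma_inj in E; [|exact beta_neq0].
    apply (xs_neq z0). symmetry. exact E.
  - intros p. split.
    + intros [i [t [Ht ->]]].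
      assert (E : exists k, cz k = i).
      { destruct z0, i; [exists 0%nat|exists 1%nat|exists 1%nat|exists 0%nat]; reflexivity. }
      destruct E as [k Ek]. exists (ctime k + t). rewrite <- Ek in *. rewrite Hg0.
      * apply G2. exact Ht.
      * assert (0 <= ctime k); [|lra]. unfold ctime.
        apply (switch_time_le (fun k => Ts (cz k)) 0 (fun k => Ts_pos (cz k)) 0 k). lia.
    + intros [t <-]. destruct (G4 _ (HN t)) as [k [u [Hu E]]].
      exists (cz k), u. split; [exact Hu|]. unfold g. rewrite E. apply G2, Hu.
Qed.

(** ** Nearby trajectories follow the cycle *)

Section Near.

Variables (e0 eta : R).
Hypothesis e0_pos : 0 < e0.
Hypothesis box_e0 : forall q, near_cycle e0 q -> dsup (1, 1) q < d0.
Hypothesis trans_e0 : forall i j x, Rabs (x - xs i) < e0 -> 0 < sgn i * lie (X j) (sigma x).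
Hypothesis gap_e0 : 4 * e0 <= Rabs (xs zone1 - xs zone2).
Hypothesis eta_e0 : eta <= e0.
Hypothesis eta_eta0 : eta <= eta0.
Hypothesis turns : forall x, Rabs (x - xs z0) < eta -> exists T1 y T2 x',
  garc e0 z0 (sigma x) T1 y /\ Rabs (y - xs (other z0)) < e0 /\
  garc e0 (other z0) (sigma y) T2 x' /\ Rabs (x' - xs z0) < eta.

(** States (zone, point) from which the orbit turns around the cycle forever. *)
Definition good_end i x :=
  (i = other z0 /\ Rabs (x - xs z0) < eta) \/
  (i = z0 /\ Rabs (x - xs (other z0)) < e0 /\
   exists T x', garc e0 (other z0) (sigma x) T x' /\ Rabs (x' - xs z0) < eta).

Definition good i p := exists T x, garc e0 i p T x /\ good_end i x.

Lemma good_next i x : good_end i x -> good (other i) (sigma x).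
Proof.
  intros [[-> Hx]|[-> [Hx [T [x' [G Hx']]]]]].
  - rewrite other_other. destruct (turns x Hx) as [T1 [y [T2 [x' [G1 [H1 [G2 H2]]]]]]].
    exists T1, y. split; [exact G1|]. right. split; [reflexivity|]. split; [exact H1|].
    exists T2, x'. split; assumption.
  - exists T, x'. split; [exact G|]. left. split; [reflexivity|exact Hx'].
Qed.

Lemma good_end_near i x : good_end i x -> Rabs (x - xs (other i)) < e0.
Proof.
  intros [[-> H]|[-> [H _]]]; [rewrite other_other; lra|exact H].
Qed.

Lemma orbit_sequence i p : good i p -> exists (zk : nat -> zone) (pk : nat -> R * R) (tauk xk : nat -> R),
  zk 0%nat = i /\ pk 0%nat = p /\
  (forall k, zk (S k) = other (zk k)) /\
  (forall k, pk (S k) = sigma (xk k)) /\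
  (forall k, garc e0 (zk k) (pk k) (tauk k) (xk k)) /\
  (forall k, good_end (zk k) (xk k)).
Proof.
  intros Hg.
  destruct (choice (fun (s : zone * (R * R)) (Tx : R * R) => good (fst s) (snd s) ->
    garc e0 (fst s) (snd s) (fst Tx) (snd Tx) /\ good_end (fst s) (snd Tx))) as [f Hf].
  { intros [j q]. destruct (classic (good j q)) as [[T [x Hx]]|Hn].
    - exists (T, x). intros _. exact Hx.
    - exists (0, 0). intros H. contradiction. }
  set (st := fun k => Nat.iter k (fun s : zone * (R * R) => (other (fst s), sigma (snd (f s)))) (i, p)).
  assert (Hst : forall k, good (fst (st k)) (snd (st k))).
  { induction k as [|k IH]; [exact Hg|]. simpl. apply good_next. apply (Hf _ IH). }
  exists (fun k => fst (st k)), (fun k => snd (st k)), (fun k => fst (f (st k))), (fun k => snd (f (st k))).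
  repeat split; try (intros k; reflexivity).
  - apply (Hf _ (Hst k)).
  - apply (Hf _ (Hst k)).
  - apply (Hf _ (Hst k)).
  - apply (Hf _ (Hst k)).
  - intros k. apply (Hf _ (Hst k)).
Qed.

Section Sequence.

Variables (zk : nat -> zone) (pk : nat -> R * R) (tauk xk : nat -> R).
Hypothesis zk_S : forall k, zk (S k) = other (zk k).
Hypothesis pk_S : forall k, pk (S k) = sigma (xk k).
Hypothesis garc_k : forall k, garc e0 (zk k) (pk k) (tauk k) (xk k).
Hypothesis good_k : forall k, good_end (zk k) (xk k).

Lemma tauk_pos k : 0 < tauk k.
Proof. apply (garc_k k). Qed.

(** Each arc joins the neighbourhoods of two distinct points at bounded speed, so
    that the switching times cannot accumulate. *)
Lemma tauk_lower k : Rabs beta * (2 * e0) / L <= tauk (S k).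
Proof.
  pose proof (fl_pos (F zone1)) as HL.
  destruct (garc_k (S k)) as [[A1 [A2 _]] _].
  pose proof (good_end_near _ _ (good_k k)) as B1.
  pose proof (good_end_near _ _ (good_k (S k))) as B2.
  rewrite zk_S, other_other in B2. rewrite pk_S, zk_S in A2.
  pose proof (flow_speed _ _ _ 0 (tauk (S k)) (sigma (xk k)) (F (other (zk k)))) as B3.
  rewrite (fl_0 (F _)), A2, Rminus_0_r, Rabs_pos_eq in B3 by lra.
  pose proof (proj1 (sigma_dsup alpha beta (xk k) (xk (S k)))) as B4.
  assert (B5 : 4 * e0 <= Rabs (xs (zk k) - xs (other (zk k)))).
  { destruct (zk k); simpl; [exact gap_e0|rewrite Rabs_minus_sym; exact gap_e0]. }
  assert (B6 : 2 * e0 <= Rabs (xk (S k) - xk k)).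
  { pose proof (Rabs_triang (xk (S k) - xk k) (- (xk (S k) - xs (zk k)) + (xk k - xs (other (zk k))))) as T1.
    replace (xk (S k) - xk k + (- (xk (S k) - xs (zk k)) + (xk k - xs (other (zk k)))))
      with (xs (zk k) - xs (other (zk k))) in T1 by ring.
    pose proof (Rabs_triang (- (xk (S k) - xs (zk k))) (xk k - xs (other (zk k)))) as T2.
    rewrite Rabs_Ropp in T2. lra. }
  apply Rle_div_l; [exact HL|].
  assert (Rabs beta * (2 * e0) <= Rabs beta * Rabs (xk (S k) - xk k))
    by (apply Rmult_le_compat_l; [apply Rabs_pos|exact B6]).
  lra.
Qed.

Lemma seq_unbounded (t0 M : R) : exists k, M < switch_time tauk t0 k.
Proof.
  apply (times_unbounded tauk t0 (Rabs beta * (2 * e0) / L)).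
  - apply Rdiv_lt_0_compat; [|apply (fl_pos (F zone1))].
    apply Rmult_lt_0_compat; [apply Rabs_pos_lt; assumption|lra].
  - apply tauk_lower.
  - apply tauk_pos.
Qed.

(** The points of section belonging to zone [z0] form an orbit of the return map. *)
Lemma seq_turns k0 : zk k0 = z0 -> (1 <= k0)%nat ->
  forall n, zk (k0 + 2 * n)%nat = z0 /\
    turn z0 (xk (k0 + 2 * n - 1)%nat) (xk (k0 + 2 * S n - 1)%nat).
Proof.
  intros H0 Hk n.
  assert (Hz : zk (k0 + 2 * n)%nat = z0).
  { induction n as [|n IH]; [rewrite Nat.mul_0_r, Nat.add_0_r; exact H0|].
    replace (k0 + 2 * S n)%nat with (S (S (k0 + 2 * n))) by lia.
    rewrite !zk_S, other_other. exact IH. }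
  split; [exact Hz|].
  replace (k0 + 2 * S n - 1)%nat with (S (k0 + 2 * n)) by lia.
  assert (Hp : pk (k0 + 2 * n)%nat = sigma (xk (k0 + 2 * n - 1)%nat)).
  { replace (k0 + 2 * n)%nat with (S (k0 + 2 * n - 1)) at 1 by lia. apply pk_S. }
  destruct (garc_k (k0 + 2 * n)%nat) as [A _]. rewrite Hz, Hp in A.
  destruct (garc_k (S (k0 + 2 * n))) as [B _]. rewrite zk_S, Hz, pk_S in B.
  exists (xk (k0 + 2 * n)%nat), (tauk (k0 + 2 * n)%nat), (tauk (S (k0 + 2 * n))). split; assumption.
Qed.

Lemma seq_start : exists k0, zk k0 = z0 /\ (1 <= k0 <= 2)%nat /\ Rabs (xk (k0 - 1)%nat - xs z0) < eta.
Proof.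
  assert (E : zk 1%nat = z0 \/ zk 2%nat = z0).
  { rewrite (zk_S 1), (zk_S 0). destruct (zk 0%nat), z0; simpl; tauto. }
  assert (Hk : forall k, zk (S k) = z0 -> Rabs (xk k - xs z0) < eta).
  { intros k Hz. rewrite zk_S in Hz. destruct (good_k k) as [[_ Hx]|[Hzk _]]; [exact Hx|].
    rewrite Hzk in Hz. destruct z0; discriminate. }
  destruct E as [E|E]; [exists 1%nat|exists 2%nat]; (split; [exact E|split; [lia|]]); apply Hk, E.
Qed.

(** The return map contracts, hence the arcs converge to those of the cycle. *)
Lemma seq_limit e : 0 < e -> exists K, forall k, (K <= k)%nat ->
  forall t, 0 <= t <= tauk k -> near_cycle e (Phi (zk k) t (pk k)).
Proof.
  intros He. destruct seq_start as [k0 [Hz [Hk0 Hx]]].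
  pose proof (seq_turns k0 Hz (proj1 Hk0)) as Ht.
  destruct (step e He) as [d1 [Hd1 S1]].
  destruct (step (Rmin e d1) (Rmin_pos _ _ He Hd1)) as [d2 [Hd2 S2]].
  destruct (convergence (fun n => xk (k0 + 2 * n - 1)%nat)) with (e := d2) as [N HN].
  { rewrite Nat.mul_0_r, Nat.add_0_r. lra. }
  { intros n. apply Ht. }
  { exact Hd2. }
  exists (k0 + 2 * N)%nat. intros k Hk.
  assert (Hmono : forall e1 e2 q, e1 <= e2 -> near_cycle e1 q -> near_cycle e2 q).
  { intros e1 e2 q H12 [g [G1 G2]]. exists g. split; [exact G1|lra]. }
  assert (Hex : exists n, (N <= n)%nat /\ (k = (k0 + 2 * n)%nat \/ k = S (k0 + 2 * n))).
  { exists ((k - k0) / 2)%nat.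
    pose proof (Nat.div_mod (k - k0) 2 ltac:(lia)). pose proof (Nat.mod_upper_bound (k - k0) 2 ltac:(lia)).
    split; [|lia]. apply Nat.div_le_lower_bound; lia. }
  destruct Hex as [n [Hn Hcase]].
  destruct (Ht n) as [Hzn _]. specialize (HN n Hn).
  assert (Hp : pk (k0 + 2 * n)%nat = sigma (xk (k0 + 2 * n - 1)%nat)).
  { replace (k0 + 2 * n)%nat with (S (k0 + 2 * n - 1)) at 1 by lia. apply pk_S. }
  destruct (S2 z0 _ HN) as [T1 [y [G1 Hy]]].
  destruct (garc_k (k0 + 2 * n)%nat) as [A _]. rewrite Hzn, Hp in A.
  destruct (arc_unique _ _ _ _ _ _ (proj1 G1) A) as [E1 E2].
  pose proof (Rmin_l e d1). pose proof (Rmin_r e d1).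
  destruct Hcase as [->| ->].
  - rewrite Hzn, Hp, <- E1. intros t Htt. eapply Hmono; [|apply G1; exact Htt]. lra.
  - destruct (S1 (other z0) y ltac:(lra)) as [T2 [x' [G2 _]]].
    destruct (garc_k (S (k0 + 2 * n))) as [B _]. rewrite zk_S, Hzn, pk_S, <- E2 in B.
    destruct (arc_unique _ _ _ _ _ _ (proj1 G2) B) as [E3 E4].
    rewrite zk_S, Hzn, pk_S, <- E2, <- E3. apply G2.
Qed.

Lemma seq_trajectory (t0 : R) : exists gamma, gtraj alpha beta X t0 p_infty gamma /\
  forall k u, 0 <= u <= tauk k -> gamma (switch_time tauk t0 k + u) = Phi (zk k) u (pk k).
Proof.
  apply (concat alpha beta X V Phi L d0 F V_eq zk pk tauk t0).
  - apply tauk_pos.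
  - exact zk_S.
  - intros k. rewrite pk_S. apply (garc_k k).
  - intros k. apply (garc_k k).
  - intros k t Ht. apply box_e0. apply (garc_k k), Ht.
  - intros k. rewrite pk_S. apply h_sigma.
  - intros k j. rewrite pk_S, zk_S. apply trans_e0. apply good_end_near, good_k.
  - apply seq_unbounded.
Qed.

Lemma seq_follow gamma (a : Rbar) (t0 : R) : gtraj alpha beta X a p_infty gamma -> Rbar_lt a t0 ->
  gamma t0 = pk 0%nat ->
  region (zk 0%nat) (pk 0%nat) \/ (h (pk 0%nat) = 0 /\ 0 < sgn (zk 0%nat) * lie (X (zk 0%nat)) (pk 0%nat)) ->
  forall k u, 0 <= u <= tauk k -> gamma (switch_time tauk t0 k + u) = Phi (zk k) u (pk k).
Proof.
  intros G Ha H0 Hent.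
  assert (key : forall k, gamma (switch_time tauk t0 k) = pk k ->
    region (zk k) (pk k) \/ (h (pk k) = 0 /\ 0 < sgn (zk k) * lie (X (zk k)) (pk k)) ->
    forall u, 0 <= u <= tauk k -> gamma (switch_time tauk t0 k + u) = Phi (zk k) u (pk k)).
  { intros k Hk He. pose proof (tauk_pos k).
    apply (follow alpha beta X V Phi L d0 F V_eq gamma a p_infty).
    - exact G.
    - eapply Rbar_lt_le_trans; [exact Ha|]. simpl.
      apply (switch_time_le tauk t0 tauk_pos 0 k). lia.
    - lra.
    - exact I.
    - exact Hk.
    - exact He.
    - apply (garc_k k).
    - intros t Ht. apply box_e0. apply (garc_k k), Ht. }
  assert (Hall : forall k, gamma (switch_time tauk t0 k) = pk k /\
    (region (zk k) (pk k) \/ (h (pk k) = 0 /\ 0 < sgn (zk k) * lie (X (zk k)) (pk k)))).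
  { induction k as [|k [I1 I2]]; [split; assumption|]. split.
    - simpl. pose proof (tauk_pos k). rewrite (key k I1 I2) by lra. rewrite pk_S. apply (garc_k k).
    - right. rewrite pk_S, zk_S. split; [apply h_sigma|]. apply trans_e0. apply good_end_near, good_k. }
  intros k. destruct (Hall k) as [I1 I2]. apply key; assumption.
Qed.

(** Off the cycle, each turn brings the trajectory strictly closer to the cycle,
    so that it cannot come back to where it was one period before. *)
Lemma seq_periodic gamma (T : R) : 0 < T -> gtraj alpha beta X m_infty p_infty gamma ->
  (forall t, gamma (t + T) = gamma t) -> gamma 0 = pk 0%nat ->
  region (zk 0%nat) (pk 0%nat) \/ (h (pk 0%nat) = 0 /\ 0 < sgn (zk 0%nat) * lie (X (zk 0%nat)) (pk 0%nat)) ->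
  exists t, gamma t = sigma (xs z0).
Proof.
  intros HT G Hper H0 Hent.
  pose proof (seq_follow gamma m_infty 0 G I H0 Hent) as Hf.
  destruct seq_start as [k0 [Hz [Hk0 Hx]]].
  pose proof (seq_turns k0 Hz (proj1 Hk0)) as Ht.
  assert (Hgk : forall k, gamma (switch_time tauk 0 (S k)) = sigma (xk k)).
  { intros k. pose proof (tauk_pos (S k)).
    replace (switch_time tauk 0 (S k)) with (switch_time tauk 0 (S k) + 0) by ring.
    rewrite Hf by lra. rewrite (fl_0 (F _)). apply pk_S. }
  set (x0 := xk (k0 - 1)%nat) in *.
  assert (Hx0 : gamma (switch_time tauk 0 k0) = sigma x0).
  { replace k0 with (S (k0 - 1)) by lia. rewrite Hgk. unfold x0. f_equal. }
  destruct (Req_dec x0 (xs z0)) as [E|E].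
  { exists (switch_time tauk 0 k0). rewrite Hx0, E. reflexivity. }
  exfalso.
  assert (Hdec : forall n, Rabs (xk (k0 + 2 * S n - 1)%nat - xs z0) < Rabs (x0 - xs z0)).
  { induction n as [|n IH].
    - destruct (Ht 0%nat) as [_ Hturn]. rewrite Nat.mul_0_r, Nat.add_0_r in Hturn. fold x0 in Hturn.
      apply (contraction x0); [lra|exact Hturn|exact E].
    - destruct (Ht (S n)) as [_ Hturn].
      assert (Hlt : Rabs (xk (k0 + 2 * S n - 1)%nat - xs z0) < eta0) by lra.
      destruct (contraction _ _ Hlt Hturn) as [C1 C2].
      destruct (Req_dec (xk (k0 + 2 * S n - 1)%nat) (xs z0)) as [E1|E1].
      + rewrite (C2 E1), Rminus_diag, Rabs_R0. apply Rabs_pos_lt. lra.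
      + specialize (C1 E1). lra. }
  (* a period later the trajectory is back at the same point of the line *)
  assert (Hpern : forall n t, gamma (t + INR n * T) = gamma t).
  { induction n as [|n IH]; intros t.
    - simpl. rewrite Rmult_0_l, Rplus_0_r. reflexivity.
    - rewrite S_INR. replace (t + (INR n + 1) * T) with (t + T + INR n * T) by ring.
      rewrite IH. apply Hper. }
  destruct (INR_unbounded (tauk k0 / T)) as [n Hn].
  apply Rlt_gt in Hn. apply Rlt_div_l in Hn; [|exact HT].
  set (s := switch_time tauk 0 k0 + INR n * T).
  assert (Hs : gamma s = sigma x0) by (unfold s; rewrite Hpern; exact Hx0).
  assert (Hs1 : switch_time tauk 0 (S k0) < s) by (unfold s; simpl; lra).
  destruct (switch_time_find tauk 0 (seq_unbounded 0) s) as [k Hk].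
  { pose proof (switch_time_le tauk 0 tauk_pos 0 (S k0) ltac:(lia)) as H. simpl in H. simpl in Hs1. lra. }
  assert (Hkk : (k0 < k)%nat).
  { destruct (Nat.le_gt_cases k k0) as [Hle|Hgt]; [|exact Hgt]. exfalso.
    pose proof (switch_time_le tauk 0 tauk_pos (S k) (S k0) ltac:(lia)). lra. }
  pose proof (Hf k (s - switch_time tauk 0 k)) as Hfk. simpl in Hk.
  replace (switch_time tauk 0 k + (s - switch_time tauk 0 k)) with s in Hfk by ring.
  specialize (Hfk ltac:(lra)). rewrite Hs in Hfk.
  destruct (Req_dec s (switch_time tauk 0 k)) as [Es|Es].
  - rewrite Es, Rminus_diag, (fl_0 (F _)) in Hfk.
    destruct k as [|k]; [lia|]. rewrite pk_S in Hfk. apply sigma_inj in Hfk; [|exact beta_neq0].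
    pose proof (good_end_near _ _ (good_k k)) as Hnear. rewrite <- zk_S in Hnear.
    destruct (Nat.Even_Odd_dec (S k - k0)) as [[m Hm]|[m Hm]].
    + destruct m as [|m]; [lia|]. specialize (Hdec m).
      replace (k0 + 2 * S m - 1)%nat with k in Hdec by lia. rewrite <- Hfk in Hdec. lra.
    + destruct (Ht m) as [Hzm _].
      assert (Hzk : zk (S k) = other z0).
      { replace (S k) with (S (k0 + 2 * m)) by lia. rewrite zk_S, Hzm. reflexivity. }
      rewrite Hzk, <- Hfk in Hnear.
      assert (B5 : 4 * e0 <= Rabs (xs z0 - xs (other z0))).
      { destruct z0; simpl; [exact gap_e0|rewrite Rabs_minus_sym; exact gap_e0]. }
      pose proof (Rabs_triang (- (x0 - xs z0)) (x0 - xs (other z0))) as T1.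
      replace (- (x0 - xs z0) + (x0 - xs (other z0))) with (xs z0 - xs (other z0)) in T1 by ring.
      rewrite Rabs_Ropp in T1. lra.
  - destruct (garc_k k) as [[_ [_ Hr]] _]. specialize (Hr (s - switch_time tauk 0 k) ltac:(lra)).
    rewrite <- Hfk in Hr. unfold Defs.region in Hr. rewrite h_sigma in Hr. lra.
Qed.

End Sequence.

End Near.

Lemma follow_cycle gamma (t1 : R) : gtraj alpha beta X m_infty p_infty gamma ->
  gamma t1 = sigma (xs z0) ->
  (forall q, cycle q -> exists t, gamma t = q) /\ (forall t, t1 <= t -> cycle (gamma t)).
Proof.
  intros G H1.
  assert (one : forall t i, gamma t = sigma (xs i) -> forall u, 0 <= u <= Ts i ->
    gamma (t + u) = Phi i u (sigma (xs i))).
  { intros t i Ht. pose proof (Ts_pos i).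
    apply (follow alpha beta X V Phi L d0 F V_eq gamma m_infty p_infty); auto.
    - exact I.
    - lra.
    - exact I.
    - right. split; [apply h_sigma|apply trans].
    - apply (arc_xs i). }
  assert (half : forall t i, gamma t = sigma (xs i) -> gamma (t + Ts i) = sigma (xs (other i))).
  { intros t i Ht. pose proof (Ts_pos i). rewrite (one t i Ht) by lra. apply (arc_xs i). }
  split.
  - intros q [i [t [Ht ->]]].
    assert (E : i = z0 \/ i = other z0) by (destruct i, z0; simpl; tauto).
    destruct E as [-> | ->].
    + exists (t1 + t). apply one; assumption.
    + exists (t1 + Ts z0 + t). apply one; [|exact Ht]. apply half, H1.
  - assert (HP : forall n, gamma (t1 + INR n * period) = sigma (xs z0)).
    { induction n as [|n IH]; [simpl; rewrite Rmult_0_l, Rplus_0_r; exact H1|].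
      rewrite S_INR. unfold period.
      replace (t1 + (INR n + 1) * (Ts z0 + Ts (other z0)))
        with (t1 + INR n * (Ts z0 + Ts (other z0)) + Ts z0 + Ts (other z0)) by ring.
      fold period. rewrite (half _ (other z0)); [rewrite other_other; reflexivity|].
      apply half. exact IH. }
    intros t Ht. pose proof period_pos as Hp.
    destruct (nfloor_ex ((t - t1) / period)) as [n [N1 N2]].
    { apply Rdiv_le_0_compat; lra. }
    apply Rle_div_r in N1; [|exact Hp]. apply Rlt_div_l in N2; [|exact Hp].
    set (s := t1 + INR n * period). specialize (HP n). fold s in HP.
    assert (Hs : s <= t < s + period) by (unfold s; lra).
    destruct (Rle_dec (t - s) (Ts z0)) as [Hc|Hc].
    + exists z0, (t - s). split; [lra|]. rewrite <- (one s z0 HP) by lra. f_equal. ring.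
    + exists (other z0), (t - s - Ts z0). unfold period in Hs. split; [lra|].
      rewrite <- (one (s + Ts z0) (other z0)); [f_equal; ring|apply half, HP|lra].
Qed.

(** A point near the cycle has an arc that ends where the return map contracts.
    Its trajectory is the concatenation of the following arcs, which converges to
    the cycle; a periodic trajectory can only do so by lying on the cycle. *)
Theorem attracting_cycle : glimit_cycle alpha beta X cycle /\ gstable alpha beta X cycle.
Proof.
  destruct near_cycle_box as [b1 [B1 HB1]]. destruct trans_near as [b2 [B2 HB2]].
  assert (Hgap : 0 < Rabs (xs zone1 - xs zone2)).
  { apply Rabs_pos_lt. pose proof (xs_neq zone1) as Hn. simpl in Hn. lra. }
  set (e0 := Rmin (Rmin b1 b2) (Rabs (xs zone1 - xs zone2) / 4)).
  assert (He0 : 0 < e0) by (unfold e0; repeat apply Rmin_pos; lra).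
  assert (He0' : e0 <= b1 /\ e0 <= b2 /\ 4 * e0 <= Rabs (xs zone1 - xs zone2)).
  { unfold e0. pose proof (Rmin_l (Rmin b1 b2) (Rabs (xs zone1 - xs zone2) / 4)).
    pose proof (Rmin_r (Rmin b1 b2) (Rabs (xs zone1 - xs zone2) / 4)).
    pose proof (Rmin_l b1 b2). pose proof (Rmin_r b1 b2). lra. }
  assert (box_e0 : forall q, near_cycle e0 q -> dsup (1, 1) q < d0).
  { intros q [g [Hg1 Hg2]]. apply HB1. exists g. split; [exact Hg1|lra]. }
  assert (trans_e0 : forall i j x, Rabs (x - xs i) < e0 -> 0 < sgn i * lie (X j) (sigma x)).
  { intros i j x Hx. apply HB2. lra. }
  (* sizes of neighbourhoods on the line that allow two, then one, further arcs *)
  destruct (step e0 He0) as [d1 [D1 S1]].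
  destruct (step (Rmin d1 e0) (Rmin_pos _ _ D1 He0)) as [d2 [D2 S2]].
  set (eta := Rmin (Rmin d2 e0) eta0).
  assert (Heta : 0 < eta) by (unfold eta; apply Rmin_pos; [apply Rmin_pos|]; assumption).
  assert (Heta' : eta <= d2 /\ eta <= e0 /\ eta <= eta0).
  { unfold eta. pose proof (Rmin_l (Rmin d2 e0) eta0). pose proof (Rmin_r (Rmin d2 e0) eta0).
    pose proof (Rmin_l d2 e0). pose proof (Rmin_r d2 e0). lra. }
  assert (Hmono : forall e1 e2 i p T x, e1 <= e2 -> garc e1 i p T x -> garc e2 i p T x).
  { intros e1 e2 i p T x H12 [A1 A2]. split; [exact A1|]. intros t Ht.
    destruct (A2 t Ht) as [g [G1 G2]]. exists g. split; [exact G1|lra]. }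
  assert (turns : forall x, Rabs (x - xs z0) < eta -> exists T1 y T2 x',
    garc e0 z0 (sigma x) T1 y /\ Rabs (y - xs (other z0)) < e0 /\
    garc e0 (other z0) (sigma y) T2 x' /\ Rabs (x' - xs z0) < eta).
  { intros x Hx. pose proof (Rmin_l d1 e0). pose proof (Rmin_r d1 e0).
    destruct (S2 z0 x ltac:(lra)) as [T1 [y [G1 Hy]]].
    destruct (S1 (other z0) y ltac:(lra)) as [T2 [x' [G2 Hx']]].
    exists T1, y, T2, x'. split; [apply (Hmono (Rmin d1 e0)); [lra|exact G1]|]. split; [lra|].
    split; [exact G2|].
    destruct (contraction x x') as [C1 C2]; [lra| |].
    { exists y, T1, T2. split; [apply G1|apply G2]. }
    destruct (Req_dec x (xs z0)) as [E|E]; [rewrite (C2 E), Rminus_diag, Rabs_R0; exact Heta|].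
    specialize (C1 E). lra. }
  destruct (step (Rmin eta e0) (Rmin_pos _ _ Heta He0)) as [d3 [D3 S3]].
  set (e2 := Rmin (Rmin eta d3) (e0 / 2)).
  assert (He2 : 0 < e2) by (unfold e2; apply Rmin_pos; [apply Rmin_pos|]; lra).
  assert (He2' : e2 <= eta /\ e2 <= d3 /\ e2 <= e0 / 2).
  { unfold e2. pose proof (Rmin_l (Rmin eta d3) (e0 / 2)). pose proof (Rmin_r (Rmin eta d3) (e0 / 2)).
    pose proof (Rmin_l eta d3). pose proof (Rmin_r eta d3). lra. }
  assert (Hend : forall i x, Rabs (x - xs (other i)) < e2 -> good_end e0 eta i x).
  { intros i x Hx. assert (E : i = z0 \/ i = other z0) by (destruct i, z0; simpl; tauto).
    destruct E as [-> | ->].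
    - right. split; [reflexivity|]. split; [lra|].
      destruct (S3 (other z0) x ltac:(lra)) as [T [x' [G Hx']]].
      pose proof (Rmin_l eta e0). pose proof (Rmin_r eta e0). rewrite other_other in Hx'.
      exists T, x'. split; [apply (Hmono (Rmin eta e0)); [lra|exact G]|lra].
    - left. split; [reflexivity|]. rewrite other_other in Hx. lra. }
  destruct (cycle_neighbourhood e2 He2) as [delta [Hdelta Hreach]].
  split; [split; [exact cycle_periodic|split]|].
  - intros i. pose proof (Ts_pos i). exists (Phi i (Ts i / 2) (sigma (xs i))). split.
    + exists i, (Ts i / 2). split; [lra|reflexivity].
    + apply (arc_xs i). lra.
  - exists delta. split; [exact Hdelta|].
    intros G' [gamma [T [HT [Gtr [Hper [_ HG']]]]]] Hnear.
    assert (Hr : reach e2 (gamma 0)).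
    { apply Hreach. apply near_dsup. apply Hnear, HG'. exists 0. reflexivity. }
    destruct Hr as [i [T' [x [G1 [G2 G3]]]]].
    destruct (orbit_sequence e0 eta turns i (gamma 0)) as [zk [pk [tauk [xk [Q1 [Q2 [Q3 [Q4 [Q5 Q6]]]]]]]]].
    { exists T', x. split; [apply (Hmono e2); [lra|exact G1]|]. apply Hend, G2. }
    assert (Ht1 : exists t, gamma t = sigma (xs z0)).
    { apply (seq_periodic e0 eta) with (zk := zk) (pk := pk) (tauk := tauk) (xk := xk) (T := T);
        try assumption; try tauto.
      - rewrite Q2. reflexivity.
      - rewrite Q1, Q2. destruct G3 as [Hreg|[x' [E Hx']]]; [left; exact Hreg|right].
        rewrite E. split; [apply h_sigma|]. apply trans_e0. lra. }
    destruct Ht1 as [t1 Ht1].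
    destruct (follow_cycle gamma t1 Gtr Ht1) as [C1 C2].
    assert (Hpern : forall n t, gamma (t + INR n * T) = gamma t).
    { induction n as [|n IH]; intros t.
      - simpl. rewrite Rmult_0_l, Rplus_0_r. reflexivity.
      - rewrite S_INR. replace (t + (INR n + 1) * T) with (t + T + INR n * T) by ring.
        rewrite IH. apply Hper. }
    intros p. rewrite HG'. split.
    + intros [t <-]. destruct (INR_unbounded ((t1 - t) / T)) as [n Hn].
      apply Rlt_gt in Hn. apply Rlt_div_l in Hn; [|exact HT].
      rewrite <- (Hpern n t). apply C2. lra.
    + intros Hp. apply C1, Hp.
  - exists delta. split; [exact Hdelta|]. intros p _ Hp. apply near_dsup in Hp.
    destruct (Hreach p Hp) as [i [T' [x [G1 [G2 G3]]]]].
    (* a trajectory is defined on an open interval around the moment at which it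
       is at [p], hence a short piece of orbit before [p] is needed *)
    assert (Hbefore : exists i0 p0 k T0 x0, 0 < k <= T0 /\ Phi i0 k p0 = p /\
      garc e0 i0 p0 T0 x0 /\ good_end e0 eta i0 x0).
    { assert (piece : forall j, (forall d, 0 < d -> exists k, 0 < k < d /\
          forall t, 0 < t <= k -> region j (Phi j (- t) p)) ->
        exists k, 0 < k /\ (forall t, 0 < t <= k -> region j (Phi j (- t) p)) /\
          forall t, 0 <= t <= k -> near_cycle e0 (Phi j (- t) p)).
      { intros j Hj. destruct (flow_near _ _ _ 0 p (e0 / 2) (F j) ltac:(lra)) as [d [Hd Hn]].
        destruct (Hj d Hd) as [k [Hk1 Hk2]]. exists k. split; [lra|]. split; [exact Hk2|].
        intros t Ht. specialize (Hn (- t) p). rewrite (fl_0 (F j)), dsup_refl, Rminus_0_r in Hn.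
        specialize (Hn ltac:(rewrite Rabs_Ropp, Rabs_pos_eq; lra) Hd).
        destruct G1 as [[GT _] GN]. destruct (GN 0 ltac:(lra)) as [g [Hg1 Hg2]].
        rewrite (fl_0 (F i)) in Hg2. exists g. split; [exact Hg1|].
        pose proof (dsup_tri g p (Phi j (- t) p)). lra. }
      destruct G3 as [Hreg|[x' [E Hx']]].
      - destruct (piece i) as [k [Hk1 [Hk2 Hk3]]].
        { intros d Hd. destruct (region_open alpha beta i p Hreg) as [e [He Ho]].
          destruct (flow_near _ _ _ 0 p e (F i) He) as [d2' [Hd2 Hn]].
          exists (Rmin d d2' / 2). pose proof (Rmin_pos d d2' Hd Hd2).
          pose proof (Rmin_l d d2'). pose proof (Rmin_r d d2'). split; [lra|].
          intros t Ht. apply Ho. specialize (Hn (- t) p).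
          rewrite (fl_0 (F i)), dsup_refl, Rminus_0_r in Hn.
          apply Hn; [rewrite Rabs_Ropp, Rabs_pos_eq; lra|exact Hd2]. }
        destruct G1 as [[GT [GE GR]] GN].
        assert (Hsh : forall t, Phi i t (Phi i (- k) p) = Phi i (t - k) p).
        { intros t. rewrite <- (flow_add (F i)). reflexivity. }
        exists i, (Phi i (- k) p), k, (k + T'), x. split; [lra|]. split; [|split; [split; [split; [|split]|]|]].
        + rewrite Hsh, Rminus_diag. apply (fl_0 (F i)).
        + lra.
        + rewrite Hsh. replace (k + T' - k) with T' by ring. exact GE.
        + intros t Ht. rewrite Hsh. destruct (Rlt_dec t k) as [Hc|Hc].
          * replace (t - k) with (- (k - t)) by ring. apply Hk2. lra.
          * destruct (Req_dec t k) as [->|Hne]; [rewrite Rminus_diag, (fl_0 (F i)); exact Hreg|].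
            apply GR. lra.
        + intros t Ht. rewrite Hsh. destruct (Rlt_dec t k) as [Hc|Hc].
          * replace (t - k) with (- (k - t)) by ring. apply Hk3. lra.
          * destruct (GN (t - k) ltac:(lra)) as [g [Hg1 Hg2]]. exists g. split; [exact Hg1|lra].
        + apply Hend, G2.
      - set (j := other i).
        destruct (exit_hit alpha beta (V j) (Phi j) L (sgn j) (F j) p) as [w [Hw Hex]].
        { rewrite E. apply h_sigma. }
        { rewrite E. unfold j. rewrite sgn_other. destruct (HB2 i (other i) x') as [HB _]; [lra|]. lra. }
        destruct (piece j) as [k [Hk1 [Hk2 Hk3]]].
        { intros d Hd. destruct (Hex w Hw) as [d' [Hd' Hp']].
          destruct (Hp' p) as [t' [A1 [A2 [A3 A4]]]]; [rewrite dsup_refl; exact Hd'|].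
          assert (Ht' : t' = 0).
          { destruct (A4 0) as [C1 C2]; [rewrite Rabs_R0; exact Hw|].
            rewrite (fl_0 (F j)), E, h_sigma, Rmult_0_r in C1, C2.
            destruct (Rtotal_order t' 0) as [C|[C|C]]; [specialize (C2 C); lra|exact C|specialize (C1 C); lra]. }
          exists (Rmin d w / 2). pose proof (Rmin_pos d w Hd Hw).
          pose proof (Rmin_l d w). pose proof (Rmin_r d w). split; [lra|].
          intros t Ht. apply A4; [rewrite Rabs_Ropp, Rabs_pos_eq; lra|lra]. }
        assert (Hsh : forall t, Phi j t (Phi j (- k) p) = Phi j (t - k) p).
        { intros t. rewrite <- (flow_add (F j)). reflexivity. }
        exists j, (Phi j (- k) p), k, k, x'. split; [lra|]. split; [|split; [split; [split; [|split]|]|]].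
        + rewrite Hsh, Rminus_diag. apply (fl_0 (F j)).
        + lra.
        + rewrite Hsh, Rminus_diag, (fl_0 (F j)). exact E.
        + intros t Ht. rewrite Hsh. replace (t - k) with (- (k - t)) by ring. apply Hk2. lra.
        + intros t Ht. rewrite Hsh. replace (t - k) with (- (k - t)) by ring. apply Hk3. lra.
        + apply Hend. unfold j. rewrite other_other. exact Hx'. }
    destruct Hbefore as [i0 [p0 [k [T0 [x0 [Hk [Hkp [Hg0 Hge]]]]]]]].
    destruct (orbit_sequence e0 eta turns i0 p0) as [zk [pk [tauk [xk [Q1 [Q2 [Q3 [Q4 [Q5 Q6]]]]]]]]].
    { exists T0, x0. split; assumption. }
    destruct (seq_trajectory e0 eta He0 box_e0 trans_e0 (proj2 (proj2 He0')) ltac:(lra)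
      zk pk tauk xk Q3 Q4 Q5 Q6 (- k)) as [gamma [Gtr Hg]].
    assert (Htau0 : tauk 0%nat = T0).
    { pose proof (proj1 (Q5 0%nat)) as HA. rewrite Q1, Q2 in HA.
      apply (arc_unique _ _ _ _ _ _ HA (proj1 Hg0)). }
    exists gamma, (- k), p_infty. split; [simpl; lra|]. split; [exact I|]. split; [exact Gtr|]. split.
    + specialize (Hg 0%nat k). simpl in Hg. rewrite Q1, Q2 in Hg.
      replace (- k + k) with 0 in Hg by ring. rewrite Hg; [exact Hkp|lra].
    + intros e He.
      assert (HN : exists K, forall k, (K <= k)%nat -> forall t, 0 <= t <= tauk k ->
        near_cycle e (Phi (zk k) t (pk k))).
      { apply (seq_limit e0 eta) with (xk := xk); try assumption; tauto. }
      destruct HN as [N HN].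
      exists (Rmax 0 (switch_time tauk (- k) N)). split; [apply Rmax_l|]. split; [exact I|].
      intros t Ht _. pose proof (Rmax_l 0 (switch_time tauk (- k) N)). pose proof (Rmax_r 0 (switch_time tauk (- k) N)).
      destruct (switch_time_find tauk (- k) (seq_unbounded e0 eta He0 (proj2 (proj2 He0')) ltac:(lra)
        zk pk tauk xk Q3 Q4 Q5 Q6 (- k)) t ltac:(lra)) as [m Hm].
      assert (HNm : (N <= m)%nat).
      { destruct (Nat.le_gt_cases N m) as [Hle|Hgt]; [exact Hle|]. exfalso.
        pose proof (switch_time_le tauk (- k) (tauk_pos e0 zk pk tauk xk Q5) (S m) N ltac:(lia)). lra. }
      simpl in Hm. apply near_dsup.
      replace t with (switch_time tauk (- k) m + (t - switch_time tauk (- k) m)) by ring.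
      rewrite Hg by lra. apply HN; [exact HNm|lra].
Qed.

End Cycle.

(** * Local flows *)

Definition lip_on (f : R * R -> R) (d : R) : Prop := exists L, 0 <= L /\
  forall p q, dsup (1, 1) p <= d -> dsup (1, 1) q <= d -> Rabs (f q - f p) <= L * dsup p q.

Lemma lip_on_const a d : lip_on (fun _ => a) d.
Proof.
  exists 0. split; [lra|]. intros p q _ _. rewrite Rminus_diag, Rabs_R0. lra.
Qed.

Lemma lip_on_fst d : lip_on fst d.
Proof. exists 1. split; [lra|]. intros p q _ _. rewrite Rmult_1_l. apply dsup_fst. Qed.

Lemma lip_on_snd d : lip_on snd d.
Proof. exists 1. split; [lra|]. intros p q _ _. rewrite Rmult_1_l. apply dsup_snd. Qed.

Lemma lip_on_plus f g d : lip_on f d -> lip_on g d -> lip_on (fun p => f p + g p) d.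
Proof.
  intros [L1 [H1 F1]] [L2 [H2 F2]]. exists (L1 + L2). split; [lra|]. intros p q Hp Hq.
  specialize (F1 p q Hp Hq). specialize (F2 p q Hp Hq).
  replace (f q + g q - (f p + g p)) with ((f q - f p) + (g q - g p)) by ring.
  eapply Rle_trans; [apply Rabs_triang|]. lra.
Qed.

Lemma lip_on_mult f g d : 0 <= d -> lip_on f d -> lip_on g d -> lip_on (fun p => f p * g p) d.
Proof.
  intros Hd [L1 [H1 F1]] [L2 [H2 F2]].
  assert (B : forall f L, 0 <= L -> (forall p q, dsup (1, 1) p <= d -> dsup (1, 1) q <= d ->
    Rabs (f q - f p) <= L * dsup p q) -> forall p, dsup (1, 1) p <= d ->
    Rabs (f p) <= Rabs (f (1, 1)) + L * d).
  { clear. intros f L HL Hf p Hp.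
    assert (H0 : dsup (1, 1) (1, 1) <= d).
    { rewrite dsup_refl. pose proof (dsup_pos (1, 1) p). lra. }
    specialize (Hf (1, 1) p H0 Hp).
    replace (f p) with (f (1, 1) + (f p - f (1, 1))) by ring.
    eapply Rle_trans; [apply Rabs_triang|]. assert (L * dsup (1, 1) p <= L * d) by (apply Rmult_le_compat_l; lra).
    lra. }
  set (M1 := Rabs (f (1, 1)) + L1 * d). set (M2 := Rabs (g (1, 1)) + L2 * d).
  assert (HM1 : 0 <= M1).
  { unfold M1. pose proof (Rabs_pos (f (1, 1))). assert (0 <= L1 * d) by (apply Rmult_le_pos; lra). lra. }
  assert (HM2 : 0 <= M2).
  { unfold M2. pose proof (Rabs_pos (g (1, 1))). assert (0 <= L2 * d) by (apply Rmult_le_pos; lra). lra. }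
  exists (M1 * L2 + M2 * L1). split.
  { assert (0 <= M1 * L2) by (apply Rmult_le_pos; lra). assert (0 <= M2 * L1) by (apply Rmult_le_pos; lra). lra. }
  intros p q Hp Hq. specialize (F1 p q Hp Hq) as G1. specialize (F2 p q Hp Hq) as G2.
  replace (f q * g q - f p * g p) with (f q * (g q - g p) + g p * (f q - f p)) by ring.
  eapply Rle_trans; [apply Rabs_triang|]. rewrite !Rabs_mult.
  assert (Rabs (f q) * Rabs (g q - g p) <= M1 * (L2 * dsup p q)).
  { apply Rmult_le_compat; auto using Rabs_pos. apply (B f L1); assumption. }
  assert (Rabs (g p) * Rabs (f q - f p) <= M2 * (L1 * dsup p q)).
  { apply Rmult_le_compat; auto using Rabs_pos. apply (B g L2); assumption. }
  lra.
Qed.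

Lemma lip_on_comp f u v d d' : lip_on f d' -> lip_on u d -> lip_on v d ->
  (forall p, dsup (1, 1) p <= d -> dsup (1, 1) (u p, v p) <= d') ->
  lip_on (fun p => f (u p, v p)) d.
Proof.
  intros [L [HL Hf]] [L1 [H1 F1]] [L2 [H2 F2]] Hm. exists (L * (L1 + L2)).
  split; [apply Rmult_le_pos; lra|]. intros p q Hp Hq.
  eapply Rle_trans; [apply Hf; apply Hm; assumption|]. rewrite Rmult_assoc.
  apply Rmult_le_compat_l; [exact HL|].
  specialize (F1 p q Hp Hq). specialize (F2 p q Hp Hq). pose proof (dsup_pos p q).
  apply dsup_le; simpl. split; nra.
Qed.

Definition clamp1 (d x : R) : R := Rmax (1 - d) (Rmin (1 + d) x).
Definition clamp (d : R) (p : R * R) : R * R := (clamp1 d (fst p), clamp1 d (snd p)).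

Lemma clamp1_range d x : 0 <= d -> Rabs (clamp1 d x - 1) <= d.
Proof.
  intros Hd. apply Rabs_le_between. unfold clamp1, Rmax, Rmin.
  destruct (Rle_dec (1 + d) x); destruct (Rle_dec (1 - d) _); lra.
Qed.

Lemma clamp1_id d x : Rabs (x - 1) <= d -> clamp1 d x = x.
Proof.
  intros H. apply Rabs_le_between in H. unfold clamp1, Rmax, Rmin.
  destruct (Rle_dec (1 + d) x); destruct (Rle_dec (1 - d) _); lra.
Qed.

Lemma clamp1_lip d x y : 0 <= d -> Rabs (clamp1 d y - clamp1 d x) <= Rabs (y - x).
Proof.
  intros Hd. unfold clamp1, Rmax, Rmin.
  destruct (Rle_dec (1 + d) x); destruct (Rle_dec (1 + d) y);
  repeat match goal with |- context [Rle_dec ?a ?b] => destruct (Rle_dec a b) end;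
  unfold Rabs; repeat match goal with |- context [Rcase_abs ?a] => destruct (Rcase_abs a) end; lra.
Qed.

Lemma clamp_range d p : 0 <= d -> dsup (1, 1) (clamp d p) <= d.
Proof. intros Hd. apply dsup_le. split; apply clamp1_range; exact Hd. Qed.

Lemma clamp_id d p : dsup (1, 1) p <= d -> clamp d p = p.
Proof.
  intros H. apply dsup_le in H. destruct p as [x y], H as [H1 H2]. unfold clamp. simpl in *.
  rewrite !clamp1_id by assumption. reflexivity.
Qed.

Lemma clamp_lip d p q : 0 <= d -> dsup (clamp d p) (clamp d q) <= dsup p q.
Proof.
  intros Hd. apply dsup_le. unfold clamp; simpl. split.
  - eapply Rle_trans; [apply clamp1_lip, Hd|apply dsup_fst].
  - eapply Rle_trans; [apply clamp1_lip, Hd|apply dsup_snd].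
Qed.

(** A field that is Lipschitz on a box is extended by its values at the nearest
    point of the box, which makes its flow global. *)
Lemma local_flow (X : R * R -> R * R) d : 0 < d ->
  lip_on (fun p => fst (X p)) d -> lip_on (fun p => snd (X p)) d ->
  exists V Phi L, flow V Phi L /\ forall p, dsup (1, 1) p <= d -> V p = X p.
Proof.
  intros Hd [L1 [H1 F1]] [L2 [H2 F2]].
  set (L := L1 + L2 + Rabs (fst (X (1, 1))) + Rabs (snd (X (1, 1))) + (L1 + L2) * d + 1).
  pose proof (Rabs_pos (fst (X (1, 1)))). pose proof (Rabs_pos (snd (X (1, 1)))).
  assert (0 <= L1 * d) by (apply Rmult_le_pos; lra).
  assert (0 <= L2 * d) by (apply Rmult_le_pos; lra).
  assert (Hc : forall p, dsup (1, 1) (clamp d p) <= d) by (intros p; apply clamp_range; lra).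
  assert (Hcen : dsup (1, 1) (1, 1) <= d) by (rewrite dsup_refl; lra).
  destruct (flow_exists (fun p => X (clamp d p)) L) as [Phi HPhi].
  - unfold L. lra.
  - intros p q. pose proof (clamp_lip d p q ltac:(lra)) as Hl.
    pose proof (dsup_pos (clamp d p) (clamp d q)). pose proof (dsup_pos p q).
    assert (L1 * dsup (clamp d p) (clamp d q) <= L1 * dsup p q) by (apply Rmult_le_compat_l; lra).
    assert (L2 * dsup (clamp d p) (clamp d q) <= L2 * dsup p q) by (apply Rmult_le_compat_l; lra).
    assert (L1 * dsup p q <= L * dsup p q) by (apply Rmult_le_compat_r; unfold L; lra).
    assert (L2 * dsup p q <= L * dsup p q) by (apply Rmult_le_compat_r; unfold L; lra).
    specialize (F1 _ _ (Hc p) (Hc q)). specialize (F2 _ _ (Hc p) (Hc q)).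
    apply dsup_le. split; lra.
  - intros p. specialize (F1 _ _ Hcen (Hc p)). specialize (F2 _ _ Hcen (Hc p)).
    assert (L1 * dsup (1, 1) (clamp d p) <= L1 * d) by (apply Rmult_le_compat_l; auto).
    assert (L2 * dsup (1, 1) (clamp d p) <= L2 * d) by (apply Rmult_le_compat_l; auto).
    split.
    + replace (fst (X (clamp d p))) with (fst (X (1, 1)) + (fst (X (clamp d p)) - fst (X (1, 1)))) by ring.
      eapply Rle_trans; [apply Rabs_triang|]. unfold L. lra.
    + replace (snd (X (clamp d p))) with (snd (X (1, 1)) + (snd (X (clamp d p)) - snd (X (1, 1)))) by ring.
      eapply Rle_trans; [apply Rabs_triang|]. unfold L. lra.
  - exists (fun p => X (clamp d p)), Phi, L. split; [exact HPhi|].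
    intros p Hp. rewrite clamp_id by exact Hp. reflexivity.
Qed.

Lemma flow_weaken V Phi L L' : flow V Phi L -> L <= L' -> flow V Phi L'.
Proof.
  intros [H1 H2 H3 H4 H5] HL. constructor.
  - lra.
  - intros p q. eapply Rle_trans; [apply H2|]. apply Rmult_le_compat_r; [apply dsup_pos|exact HL].
  - intros p. destruct (H3 p). split; lra.
  - exact H4.
  - exact H5.
Qed.

(** * The perturbation *)

(** Points move along the level lines of [h], and the coordinate axes are fixed. *)
Definition shear (alpha beta e : R) (p : R * R) : R * R :=
  (fst p + beta * (e * fst p * snd p), snd p + alpha * (e * fst p * snd p)).

Definition det_shear (alpha beta e : R) (p : R * R) : R :=
  1 + beta * e * snd p + alpha * e * fst p.

(** The field conjugate to [V] under [shear e], multiplied by the Jacobian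
    determinant: the adjugate of the differential of [shear e] applied to
    [V] at the image point. *)
Definition pull (alpha beta e : R) (V : R * R -> R * R) (p : R * R) : R * R :=
  let q := shear alpha beta e p in
  ((1 + alpha * e * fst p) * fst (V q) - beta * e * fst p * snd (V q),
   - (alpha * e * snd p) * fst (V q) + (1 + beta * e * snd p) * snd (V q)).

(** The trace of [shear e] on the line [h = 0]. *)
Definition slide (alpha beta e s : R) : R := s + e * ((1 + beta * s) * (1 + alpha * s)).

Section Shear.

Variables alpha beta : R.

Lemma h_shear e p : Defs.h alpha beta (shear alpha beta e p) = Defs.h alpha beta p.
Proof. unfold Defs.h, shear; simpl. ring. Qed.

Lemma shear_sigma e s : shear alpha beta e (Defs.sigma alpha beta s) = Defs.sigma alpha beta (slide alpha beta e s).
Proof. unfold shear, Defs.sigma, slide; simpl. f_equal; ring. Qed.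

(** The determinant is a change of speed; up to it, transversality to the line is
    transported by [shear e]. *)
Lemma lie_pull e V p : lie alpha beta (pull alpha beta e V) p =
  det_shear alpha beta e p * lie alpha beta V (shear alpha beta e p).
Proof. unfold lie, pull, det_shear; simpl. ring. Qed.

Lemma pull_vopp e V p : pull alpha beta e (fun q => vopp (V q)) p = vopp (pull alpha beta e V p).
Proof. unfold pull, vopp; simpl. f_equal; ring. Qed.

Lemma der_shear e V (y : R -> R * R) t : der y t (pull alpha beta e V (y t)) ->
  der (fun u => shear alpha beta e (y u)) t
    (det_shear alpha beta e (y t) * fst (V (shear alpha beta e (y t))),
     det_shear alpha beta e (y t) * snd (V (shear alpha beta e (y t)))).
Proof.
  intros [D1 D2].
  assert (Dxy : is_derive (fun u => e * fst (y u) * snd (y u)) t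
    (e * (fst (pull alpha beta e V (y t)) * snd (y t) + fst (y t) * snd (pull alpha beta e V (y t))))).
  { assert (E : forall u : R, e * (fst (y u) * snd (y u)) = e * fst (y u) * snd (y u)) by (intros; ring).
    apply (is_derive_ext _ _ t _ E). apply (is_derive_scal (fun u => fst (y u) * snd (y u))).
    apply (is_derive_mult (fun u => fst (y u)) (fun u => snd (y u))); [exact D1|exact D2|].
    intros n m. apply Rmult_comm. }
  set (q := shear alpha beta e (y t)).
  split; cbn [fst snd].
  - replace (det_shear alpha beta e (y t) * fst (V q)) with
      (fst (pull alpha beta e V (y t)) + beta * (e * (fst (pull alpha beta e V (y t)) * snd (y t)
         + fst (y t) * snd (pull alpha beta e V (y t)))))
      by (unfold det_shear, pull; cbn [fst snd]; fold q; ring).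
    apply (is_derive_plus (fun u => fst (y u)) (fun u => beta * (e * fst (y u) * snd (y u)))); [exact D1|].
    apply (is_derive_scal (fun u => e * fst (y u) * snd (y u))). exact Dxy.
  - replace (det_shear alpha beta e (y t) * snd (V q)) with
      (snd (pull alpha beta e V (y t)) + alpha * (e * (fst (pull alpha beta e V (y t)) * snd (y t)
         + fst (y t) * snd (pull alpha beta e V (y t)))))
      by (unfold det_shear, pull; cbn [fst snd]; fold q; ring).
    apply (is_derive_plus (fun u => snd (y u)) (fun u => alpha * (e * fst (y u) * snd (y u)))); [exact D2|].
    apply (is_derive_scal (fun u => e * fst (y u) * snd (y u))). exact Dxy.
Qed.

Definition Kab := Rabs alpha + Rabs beta.

Lemma Kab_pos : 0 <= Kab.
Proof. unfold Kab. pose proof (Rabs_pos alpha). pose proof (Rabs_pos beta). lra. Qed.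

Lemma box_bound p d : d <= 1 -> dsup (1, 1) p <= d -> Rabs (fst p) <= 2 /\ Rabs (snd p) <= 2.
Proof.
  intros Hd Hp. apply dsup_le in Hp. simpl in Hp. destruct Hp as [H1 H2].
  apply Rabs_le_between in H1, H2. split; apply Rabs_le_between; lra.
Qed.

Lemma shear_close e p : dsup (1, 1) p <= 1 -> dsup p (shear alpha beta e p) <= 4 * Kab * Rabs e.
Proof.
  intros Hp. destruct (box_bound p 1 ltac:(lra) Hp) as [B1 B2].
  pose proof (Rabs_pos e). pose proof (Rabs_pos alpha). pose proof (Rabs_pos beta).
  assert (Hx : Rabs (e * fst p * snd p) <= 4 * Rabs e).
  { rewrite !Rabs_mult. pose proof (Rabs_pos (fst p)). pose proof (Rabs_pos (snd p)).
    assert (Rabs (fst p) * Rabs (snd p) <= 2 * 2) by (apply Rmult_le_compat; lra). nra. }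
  apply dsup_le. unfold shear, Kab; cbn [fst snd]. split.
  - replace (fst p + beta * (e * fst p * snd p) - fst p) with (beta * (e * fst p * snd p)) by ring.
    rewrite Rabs_mult. assert (Rabs beta * Rabs (e * fst p * snd p) <= Rabs beta * (4 * Rabs e))
      by (apply Rmult_le_compat_l; lra). nra.
  - replace (snd p + alpha * (e * fst p * snd p) - snd p) with (alpha * (e * fst p * snd p)) by ring.
    rewrite Rabs_mult. assert (Rabs alpha * Rabs (e * fst p * snd p) <= Rabs alpha * (4 * Rabs e))
      by (apply Rmult_le_compat_l; lra). nra.
Qed.

Lemma det_shear_range e p : dsup (1, 1) p <= 1 -> 4 * Kab * Rabs e <= 1 ->
  1 / 2 <= det_shear alpha beta e p <= 3 / 2.
Proof.
  intros Hp He. destruct (box_bound p 1 ltac:(lra) Hp) as [B1 B2].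
  assert (H : Rabs (beta * e * snd p + alpha * e * fst p) <= 1 / 2).
  { eapply Rle_trans; [apply Rabs_triang|]. rewrite !Rabs_mult.
    pose proof (Rabs_pos e). pose proof (Rabs_pos alpha). pose proof (Rabs_pos beta).
    assert (Rabs beta * Rabs e * Rabs (snd p) <= Rabs beta * Rabs e * 2)
      by (apply Rmult_le_compat_l; [apply Rmult_le_pos; lra|lra]).
    assert (Rabs alpha * Rabs e * Rabs (fst p) <= Rabs alpha * Rabs e * 2)
      by (apply Rmult_le_compat_l; [apply Rmult_le_pos; lra|lra]).
    unfold Kab in He. nra. }
  apply Rabs_le_between in H. unfold det_shear. lra.
Qed.

Lemma lip_on_pull e (X : R * R -> R * R) d0 d1 : 0 <= d1 <= 1 -> d1 + 4 * Kab * Rabs e <= d0 ->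
  lip_on (fun p => fst (X p)) d0 -> lip_on (fun p => snd (X p)) d0 ->
  lip_on (fun p => fst (pull alpha beta e X p)) d1 /\ lip_on (fun p => snd (pull alpha beta e X p)) d1.
Proof.
  intros Hd1 Hd0 F1 F2.
  pose proof (lip_on_fst d1) as Lf. pose proof (lip_on_snd d1) as Ls.
  assert (Lp : lip_on (fun p => e * fst p * snd p) d1).
  { apply lip_on_mult; [lra| |exact Ls]. apply lip_on_mult; [lra|apply lip_on_const|exact Lf]. }
  assert (Lu : lip_on (fun p => fst p + beta * (e * fst p * snd p)) d1).
  { apply lip_on_plus; [exact Lf|]. apply lip_on_mult; [lra|apply lip_on_const|exact Lp]. }
  assert (Lv : lip_on (fun p => snd p + alpha * (e * fst p * snd p)) d1).
  { apply lip_on_plus; [exact Ls|]. apply lip_on_mult; [lra|apply lip_on_const|exact Lp]. }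
  assert (Hm : forall p, dsup (1, 1) p <= d1 ->
    dsup (1, 1) (fst p + beta * (e * fst p * snd p), snd p + alpha * (e * fst p * snd p)) <= d0).
  { intros p Hp. pose proof (dsup_tri (1, 1) p (shear alpha beta e p)).
    pose proof (shear_close e p ltac:(lra)). fold (shear alpha beta e p). lra. }
  pose proof (lip_on_comp _ _ _ d1 d0 F1 Lu Lv Hm) as G1.
  pose proof (lip_on_comp _ _ _ d1 d0 F2 Lu Lv Hm) as G2.
  assert (A : forall k : R, lip_on (fun p => k * fst p) d1)
    by (intros k; apply lip_on_mult; [lra|apply lip_on_const|exact Lf]).
  assert (B : forall k : R, lip_on (fun p => k * snd p) d1)
    by (intros k; apply lip_on_mult; [lra|apply lip_on_const|exact Ls]).
  assert (ext : forall f g, lip_on f d1 -> (forall p, f p = g p) -> lip_on g d1).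
  { intros f g [L [HL Hf]] E. exists L. split; [exact HL|]. intros p q Hp Hq. rewrite <- !E. apply Hf; assumption. }
  unfold pull; cbn [fst snd]. split.
  - apply (ext (fun p => (1 + alpha * e * fst p) * fst (X (shear alpha beta e p))
      + (- (beta * e)) * fst p * snd (X (shear alpha beta e p)))); [|intros; ring].
    apply lip_on_plus; apply lip_on_mult; try lra; auto.
    apply lip_on_plus; [apply lip_on_const|apply A].
  - apply (ext (fun p => (- (alpha * e)) * snd p * fst (X (shear alpha beta e p))
      + (1 + beta * e * snd p) * snd (X (shear alpha beta e p)))); [|intros; ring].
    apply lip_on_plus; apply lip_on_mult; try lra; auto.
    apply lip_on_plus; [apply lip_on_const|apply B].
Qed.

(** Arcs of the perturbed field are the preimages under [shear e] of arcs of
    the unperturbed one, run through at a different speed. *)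
Lemma perturbed_arc e c X V Phi L U Psi L' d0 d1 s T r :
  beta <> 0 -> flow V Phi L -> flow U Psi L' -> 0 < d1 <= 1 -> 5 / 4 * d1 <= d0 ->
  16 * Kab * Rabs e <= d1 ->
  (forall p, dsup (1, 1) p <= d0 -> V p = X p) ->
  (forall p, dsup (1, 1) p <= d1 -> U p = pull alpha beta e X p) ->
  0 < T -> Phi T (Defs.sigma alpha beta (slide alpha beta e s)) = Defs.sigma alpha beta r ->
  (forall t, 0 < t < T -> 0 < c * Defs.h alpha beta (Phi t (Defs.sigma alpha beta (slide alpha beta e s)))) ->
  (forall t, 0 <= t <= T -> dsup (1, 1) (Phi t (Defs.sigma alpha beta (slide alpha beta e s))) <= d1 / 2) ->
  dsup (1, 1) (Defs.sigma alpha beta s) <= d1 / 2 ->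
  exists T' r', 0 < T' /\ Psi T' (Defs.sigma alpha beta s) = Defs.sigma alpha beta r' /\
    slide alpha beta e r' = r /\
    (forall t, 0 < t < T' -> 0 < c * Defs.h alpha beta (Psi t (Defs.sigma alpha beta s))) /\
    (forall t, 0 <= t <= T' -> dsup (1, 1) (Psi t (Defs.sigma alpha beta s)) <= 3 / 4 * d1 /\
      exists t', 0 <= t' <= T /\
        dsup (Phi t' (Defs.sigma alpha beta (slide alpha beta e s))) (Psi t (Defs.sigma alpha beta s))
          <= 4 * Kab * Rabs e).
Proof.
  intros Hb F G Hd1 Hd0 He HV HU HT Hend Hreg Hbox Hs.
  set (s' := slide alpha beta e s) in *.
  set (p := Defs.sigma alpha beta s) in *. set (p' := Defs.sigma alpha beta s') in *.
  assert (Epp : shear alpha beta e p = p') by apply shear_sigma.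
  pose proof (fl_pos F) as HL. pose proof Kab_pos as HK. pose proof (Rabs_pos e) as Hae.
  (* the integral of the determinant is the time change; the maximum keeps it
     invertible while the orbit is not yet known to stay in the box *)
  set (D := fun t => Rmax (1 / 2) (det_shear alpha beta e (Psi t p))).
  assert (HD : forall t, 1 / 2 <= D t) by (intros t; apply Rmax_l).
  assert (HDc : forall t, continuous D t).
  { intros t.
    assert (Hdet : continuous (fun u => det_shear alpha beta e (Psi u p)) t).
    { destruct (fl_der G p t) as [D1 D2].
      apply (ex_derive_continuous (fun u => det_shear alpha beta e (Psi u p))).
      exists (beta * e * snd (U (Psi t p)) + alpha * e * fst (U (Psi t p))).
      assert (E : forall u : R, 1 + (beta * e * snd (Psi u p) + alpha * e * fst (Psi u p)) = det_shear alpha beta e (Psi u p))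
        by (intros u; unfold det_shear; ring).
      apply (is_derive_ext _ _ t _ E).
      replace (beta * e * snd (U (Psi t p)) + alpha * e * fst (U (Psi t p)))
        with (0 + (beta * e * snd (U (Psi t p)) + alpha * e * fst (U (Psi t p)))) by ring.
      apply (is_derive_plus (fun _ => 1)); [apply (is_derive_const 1)|].
      apply (is_derive_plus (fun u => beta * e * snd (Psi u p)) (fun u => alpha * e * fst (Psi u p))).
      - apply (is_derive_scal (fun u => snd (Psi u p))). exact D2.
      - apply (is_derive_scal (fun u => fst (Psi u p))). exact D1. }
    apply continuity_pt_filterlim. apply continuity_pt_filterlim in Hdet.
    apply continuity_pt_locally. intros eps.
    apply continuity_pt_locally with (eps := eps) in Hdet. destruct Hdet as [d Hd].
    exists d. intros u Hu. specialize (Hd u Hu). unfold D. simpl in *.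
    eapply Rle_lt_trans; [|exact Hd]. unfold Rmax.
    destruct (Rle_dec _ _); destruct (Rle_dec _ _); unfold Rabs;
      repeat match goal with |- context [Rcase_abs ?a] => destruct (Rcase_abs a) end; lra. }
  set (theta := fun t => RInt D 0 t).
  assert (Hth : forall t, is_derive theta t (D t)).
  { intros t. apply (is_derive_RInt D theta 0 t); [|apply HDc].
    exists (mkposreal 1 Rlt_0_1). intros v _.
    apply (RInt_correct D). apply (ex_RInt_continuous D). intros; apply HDc. }
  assert (Hth0 : theta 0 = 0) by apply (RInt_point 0 D).
  assert (Hinc : forall a b, a <= b -> (b - a) / 2 <= theta b - theta a).
  { intros a b Hab. destruct (Req_dec a b) as [->|Hne]; [lra|].
    destruct (mean_value theta D a b) as [x [_ Hx]]; [lra| | |].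
    - intros x _. apply Hth.
    - intros x _. exact (is_derive_continuity_pt _ _ _ (Hth x)).
    - rewrite Hx. specialize (HD x). nra. }
  destruct (Ranalysis5.IVT_interv (fun t => theta t - (T - 0)) 0 (2 * T + 1)) as [T' [HT' Hz]].
  { intros t _. apply (continuity_pt_minus theta (fun _ => T - 0)).
    - exact (is_derive_continuity_pt _ _ _ (Hth t)).
    - apply continuity_pt_const. intros ? ?; reflexivity. }
  { lra. }
  { lra. }
  { specialize (Hinc 0 (2 * T + 1) ltac:(lra)). lra. }
  assert (ET : theta T' = T) by lra. clear Hz.
  assert (HT'0 : 0 < T').
  { destruct (Req_dec T' 0) as [E|]; [|lra]. rewrite E, Hth0 in ET. lra. }
  assert (Hthr : forall t, 0 <= t <= T' -> 0 <= theta t <= T).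
  { intros t Ht. pose proof (Hinc 0 t ltac:(lra)). pose proof (Hinc t T' ltac:(lra)). lra. }
  (* as long as the perturbed orbit stays in the box it is the conjugate orbit *)
  assert (Hconj : forall u, 0 <= u -> (forall v, 0 <= v <= u -> dsup (1, 1) (Psi v p) <= d1) ->
    shear alpha beta e (Psi u p) = Phi (theta u) p').
  { intros u Hu Hin.
    pose proof (gronwall (fun v => shear alpha beta e (Psi v p)) (fun v => Phi (theta v) p')
      (fun v => (D v * fst (V (shear alpha beta e (Psi v p))), D v * snd (V (shear alpha beta e (Psi v p)))))
      (fun v => (D v * fst (V (Phi (theta v) p')), D v * snd (V (Phi (theta v) p'))))
      (2 * L) 0 u Hu ltac:(lra) (Rle_refl 0)) as Gr.
    assert (HDer1 : forall v, 0 <= v <= u -> der (fun v => shear alpha beta e (Psi v p)) v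
      (D v * fst (V (shear alpha beta e (Psi v p))), D v * snd (V (shear alpha beta e (Psi v p))))).
    { intros v Hv. specialize (Hin v Hv).
      assert (ED : D v = det_shear alpha beta e (Psi v p)).
      { apply Rmax_right. apply (det_shear_range e (Psi v p)); lra. }
      rewrite ED, HV.
      - apply (der_shear e X (fun v => Psi v p)). rewrite <- HU by exact Hin. apply (fl_der G).
      - pose proof (dsup_tri (1, 1) (Psi v p) (shear alpha beta e (Psi v p))).
        pose proof (shear_close e (Psi v p) ltac:(lra)). lra. }
    assert (HDer2 : forall v, der (fun v => Phi (theta v) p') v
      (D v * fst (V (Phi (theta v) p')), D v * snd (V (Phi (theta v) p')))).
    { intros v. destruct (fl_der F p' (theta v)) as [E1 E2]. split; cbn [fst snd].
      - apply (is_derive_comp (fun w => fst (Phi w p')) theta); [exact E1|apply Hth].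
      - apply (is_derive_comp (fun w => snd (Phi w p')) theta); [exact E2|apply Hth]. }
    apply dsup_eq0. cbv beta in Gr.
    assert (Gr' : dsup (shear alpha beta e (Psi u p)) (Phi (theta u) p') ^ 2 <= 0).
    { eapply Rle_trans; [apply Gr|].
      - intros v Hv. split; [apply HDer1; lra|apply HDer2].
      - intros v Hv. split; [eapply der_cts, HDer1; lra|exact (der_cts _ _ _ (HDer2 v))].
      - intros v Hv. specialize (HD v).
        assert (HD2 : D v <= 2).
        { unfold D. apply Rmax_lub; [lra|].
          specialize (Hin v ltac:(lra)).
          pose proof (det_shear_range e (Psi v p) ltac:(lra) ltac:(lra)). lra. }
        pose proof (fl_lip F (shear alpha beta e (Psi v p)) (Phi (theta v) p')) as Hl.
        pose proof (dsup_pos (V (shear alpha beta e (Psi v p))) (V (Phi (theta v) p'))) as Hp0.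
        apply dsup_le. cbn [fst snd].
        pose proof (dsup_fst (V (shear alpha beta e (Psi v p))) (V (Phi (theta v) p'))) as M1.
        pose proof (dsup_snd (V (shear alpha beta e (Psi v p))) (V (Phi (theta v) p'))) as M2.
        rewrite <- !Rmult_minus_distr_l, !Rabs_mult, (Rabs_pos_eq (D v)) by lra.
        split.
        + apply Rle_trans with (2 * (L * dsup (shear alpha beta e (Psi v p)) (Phi (theta v) p'))); [|lra].
          apply Rmult_le_compat; [lra|apply Rabs_pos|exact HD2|lra].
        + apply Rle_trans with (2 * (L * dsup (shear alpha beta e (Psi v p)) (Phi (theta v) p'))); [|lra].
          apply Rmult_le_compat; [lra|apply Rabs_pos|exact HD2|lra].
      - rewrite (fl_0 G), Hth0, (fl_0 F), Epp, dsup_refl. right. ring. }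
    pose proof (dsup_pos (shear alpha beta e (Psi u p)) (Phi (theta u) p')). nra. }
  assert (Hclose : forall u, 0 <= u <= T' -> (forall v, 0 <= v <= u -> dsup (1, 1) (Psi v p) <= d1) ->
    dsup (1, 1) (Psi u p) <= 3 / 4 * d1).
  { intros u Hu Hin. pose proof (Hconj u ltac:(lra) Hin) as E.
    pose proof (shear_close e (Psi u p)) as Hc. specialize (Hin u ltac:(lra)). specialize (Hc ltac:(lra)).
    rewrite E in Hc. pose proof (Hbox (theta u) (Hthr u Hu)) as Hb2.
    pose proof (dsup_tri (1, 1) (Phi (theta u) p') (Psi u p)) as Htri.
    rewrite (dsup_sym (Phi (theta u) p')) in Htri. lra. }
  assert (Hstay : forall u, 0 <= u <= T' -> dsup (1, 1) (Psi u p) <= 3 / 4 * d1).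
  { apply (continuous_induction (fun u => dsup (1, 1) (Psi u p) <= 3 / 4 * d1)).
    - rewrite (fl_0 G). lra.
    - intros u Hu Hprev.
      destruct (flow_near _ _ _ u p (d1 / 4) G ltac:(lra)) as [d [Hd Hn]].
      exists (Rmin d (T' - u)). split; [apply Rmin_pos; lra|]. intros w Hw.
      pose proof (Rmin_l d (T' - u)). pose proof (Rmin_r d (T' - u)).
      apply Hclose; [lra|]. intros v Hv. destruct (Rle_dec v u) as [Hle|Hgt].
      + specialize (Hprev v ltac:(lra)). lra.
      + specialize (Hn v p). rewrite dsup_refl in Hn. specialize (Hn ltac:(apply Rabs_lt_between; lra) Hd).
        pose proof (dsup_tri (1, 1) (Psi u p) (Psi v p)). specialize (Hprev u ltac:(lra)). lra.
    - intros u Hu Hprev. apply Rnot_lt_le. intros Hlt.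
      set (k := dsup (1, 1) (Psi u p) - 3 / 4 * d1).
      destruct (flow_near _ _ _ u p k G ltac:(unfold k; lra)) as [d [Hd Hn]].
      set (v := Rmax 0 (u - d / 2)).
      assert (Hv : 0 <= v < u /\ u - d / 2 <= v).
      { unfold v, Rmax. destruct (Rle_dec 0 (u - d / 2)); lra. }
      specialize (Hn v p). rewrite dsup_refl in Hn. specialize (Hn ltac:(apply Rabs_lt_between; lra) Hd).
      specialize (Hprev v ltac:(lra)).
      pose proof (dsup_tri (1, 1) (Psi v p) (Psi u p)) as Htri.
      rewrite (dsup_sym (Psi v p)) in Htri. unfold k in *. lra. }
  assert (Hc : forall u, 0 <= u <= T' -> shear alpha beta e (Psi u p) = Phi (theta u) p').
  { intros u Hu. apply Hconj; [lra|]. intros v Hv. specialize (Hstay v ltac:(lra)). lra. }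
  assert (HhT : Defs.h alpha beta (Psi T' p) = 0).
  { rewrite <- (h_shear e), Hc, ET, Hend by lra. apply h_sigma. }
  apply (h_zero_sigma alpha beta _ Hb) in HhT.
  set (r' := (fst (Psi T' p) - 1) / beta) in HhT.
  exists T', r'. split; [exact HT'0|]. split; [exact HhT|]. split; [|split].
  - pose proof (Hc T' ltac:(lra)) as E. rewrite HhT, shear_sigma, ET, Hend in E.
    eapply sigma_inj; eassumption.
  - intros t Ht. rewrite <- (h_shear e), Hc by lra. apply Hreg.
    pose proof (Hinc 0 t ltac:(lra)). pose proof (Hinc t T' ltac:(lra)). lra.
  - intros t Ht. split; [apply Hstay, Ht|]. exists (theta t). split; [apply Hthr, Ht|].
    rewrite <- Hc by exact Ht. rewrite dsup_sym. apply shear_close.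
    specialize (Hstay t Ht). lra.
Qed.

End Shear.

(** * The perturbed return map *)

Lemma exists_below (l : list R) : (forall x, In x l -> 0 < x) ->
  exists m, 0 < m /\ forall x, In x l -> m <= x.
Proof.
  induction l as [|a l IH]; intros H; [exists 1; split; [lra|intros x []]|].
  destruct IH as [m [Hm Hl]]; [intros x Hx; apply H; right; exact Hx|].
  exists (Rmin a m). split; [apply Rmin_pos; [apply H; left; reflexivity|assumption]|].
  intros x [<-|Hx]; [apply Rmin_l|]. pose proof (Rmin_r a m). specialize (Hl x Hx). lra.
Qed.

(** Caratheodory's form of differentiability. *)
Lemma is_derive_factor (f : R -> R) x0 l : is_derive f x0 l ->
  exists phi, continuity_pt phi x0 /\ phi x0 = l /\ forall x, f x = f x0 + (x - x0) * phi x.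
Proof.
  intros H. apply is_derive_Reals in H.
  exists (fun x => if Req_EM_T x x0 then l else (f x - f x0) / (x - x0)).
  split; [|split].
  - apply continuity_pt_locally. intros [eps Heps]. destruct (H eps Heps) as [d Hd].
    destruct (Req_EM_T x0 x0) as [_|]; [|contradiction].
    exists d.
    enough (Hq : forall x : R, Rabs (x - x0) < d ->
      Rabs ((if Req_EM_T x x0 then l else (f x - f x0) / (x - x0)) - l) < eps) by exact Hq.
    intros x Hx.
    destruct (Req_EM_T x x0) as [->|Hne]; [rewrite Rminus_diag, Rabs_R0; exact Heps|].
    specialize (Hd (x - x0)). replace (x0 + (x - x0)) with x in Hd by ring.
    apply Hd; [lra|exact Hx].
  - destruct (Req_EM_T x0 x0); [reflexivity|contradiction].
  - intros x. destruct (Req_EM_T x x0) as [->|Hne]; [ring|field; lra].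
Qed.

Lemma factor_is_derive (f phi : R -> R) x0 d : 0 < d -> continuity_pt phi x0 ->
  (forall x, Rabs (x - x0) < d -> f x = f x0 + (x - x0) * phi x) -> is_derive f x0 (phi x0).
Proof.
  intros Hd Hc Hf. apply is_derive_Reals. intros eps Heps.
  apply continuity_pt_locally with (eps := mkposreal eps Heps) in Hc. destruct Hc as [d' Hd'].
  assert (Hm : 0 < Rmin d d') by (apply Rmin_pos; [assumption|apply cond_pos]).
  exists (mkposreal _ Hm). intros x Hx0 Hx. simpl in Hx.
  pose proof (Rmin_l d d'). pose proof (Rmin_r d d').
  rewrite (Hf (x0 + x)) by (replace (x0 + x - x0) with x by ring; lra).
  replace ((f x0 + (x0 + x - x0) * phi (x0 + x) - f x0) / x - phi x0) with (phi (x0 + x) - phi x0) by (field; assumption).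
  apply Hd'. replace (x0 + x) with (x0 + x) by ring. unfold ball; simpl. unfold AbsRing_ball, abs, minus, plus, opp; simpl.
  replace (x0 + x + - x0) with x by ring. lra.
Qed.

Lemma zone_eq_dec (i j : zone) : {i = j} + {i <> j}.
Proof. decide equality. Qed.

Lemma other_neq i : other i <> i.
Proof. destruct i; discriminate. Qed.

Lemma zone_cases za i : i = za \/ i = other za.
Proof. destruct za, i; simpl; tauto. Qed.

Definition perturb (alpha beta : R) (za : zone) (e : R) (X : zone -> R * R -> R * R) (i : zone) :=
  if zone_eq_dec i za then pull alpha beta e (X i) else X i.

Lemma sigma_opp alpha beta s : Defs.sigma (- alpha) (- beta) s = Defs.sigma alpha beta (- s).
Proof. unfold Defs.sigma. f_equal; ring. Qed.

Lemma h_opp alpha beta p : Defs.h (- alpha) (- beta) p = - Defs.h alpha beta p.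
Proof. unfold Defs.h. ring. Qed.

Lemma lie_opp alpha beta V p : lie (- alpha) (- beta) V p = - lie alpha beta V p.
Proof. unfold lie. ring. Qed.

(** The derivative of [slide e s] in [e]. *)
Definition slope (alpha beta s : R) : R := (1 + beta * s) * (1 + alpha * s).

Lemma slide_slope alpha beta e s : slide alpha beta e s = s + e * slope alpha beta s.
Proof. reflexivity. Qed.

Lemma slope_range alpha beta s : Kab alpha beta * Rabs s <= 1 / 4 ->
  1 / 2 <= slope alpha beta s <= 2.
Proof.
  intros H. unfold Kab in H. pose proof (Rabs_pos alpha). pose proof (Rabs_pos beta). pose proof (Rabs_pos s).
  assert (A : Rabs (alpha * s) <= 1 / 4) by (rewrite Rabs_mult; nra).
  assert (B : Rabs (beta * s) <= 1 / 4) by (rewrite Rabs_mult; nra).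
  apply Rabs_le_between in A, B. unfold slope. nra.
Qed.

Lemma slide_diff alpha beta e s s' : 0 <= e -> 6 * Kab alpha beta * e <= 1 ->
  Rabs (beta * s) <= 1 -> Rabs (beta * s') <= 1 ->
  exists k, 1 / 2 <= k <= 3 / 2 /\ slide alpha beta e s' - slide alpha beta e s = (s' - s) * k.
Proof.
  intros He HK Hs Hs'. exists (1 + e * (alpha + beta + alpha * (beta * s + beta * s'))). split.
  - assert (H : Rabs (alpha + beta + alpha * (beta * s + beta * s')) <= 3 * Kab alpha beta).
    { eapply Rle_trans; [apply Rabs_triang|]. rewrite Rabs_mult.
      pose proof (Rabs_triang alpha beta). pose proof (Rabs_triang (beta * s) (beta * s')).
      pose proof (Rabs_pos alpha). pose proof (Rabs_pos beta). unfold Kab.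
      assert (Rabs alpha * Rabs (beta * s + beta * s') <= Rabs alpha * 2) by (apply Rmult_le_compat_l; lra).
      lra. }
    apply Rabs_le_between in H. nra.
  - unfold slide. ring.
Qed.

Section Core.

Variables (alpha beta : R) (X V : zone -> R * R -> R * R) (Phi : zone -> R -> R * R -> R * R).
Variables (L d0 d1 s0 : R) (za : zone) (Ta Ra Tb Rb : R -> R).
Hypothesis beta_neq0 : beta <> 0.
Hypothesis F : forall i, flow (V i) (Phi i) L.
Hypothesis V_eq : forall i p, dsup (1, 1) p <= d0 -> V i p = X i p.
Hypothesis X_lip : lip_on (fun p => fst (X za p)) d0 /\ lip_on (fun p => snd (X za p)) d0.
Hypothesis d1_range : 0 < d1 <= 1.
Hypothesis d1_d0 : 5 / 4 * d1 <= d0.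
Hypothesis V_quadratic : forall i, quadratic (V i) d0.
Hypothesis s0_pos : 0 < s0.
Hypothesis HA : half_map alpha beta (V za) (Phi za) (sgn za) s0 Ta Ra.
Hypothesis HB : half_map (- alpha) (- beta) (V (other za)) (Phi (other za)) (sgn za) s0 Tb Rb.
Hypothesis boxA : forall s t, 0 < s < s0 -> 0 <= t <= Ta s ->
  dsup (1, 1) (Phi za t (Defs.sigma alpha beta s)) <= d1 / 2.
Hypothesis boxB : forall s t, 0 < s < s0 -> 0 <= t <= Tb s ->
  dsup (1, 1) (Phi (other za) t (Defs.sigma (- alpha) (- beta) s)) <= d1 / 2.
Hypothesis transA : forall s j, 0 < s < s0 -> 0 < sgn za * lie alpha beta (V j) (Defs.sigma alpha beta s).
Hypothesis transB : forall s j, 0 < s < s0 ->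
  0 < sgn (other za) * lie alpha beta (V j) (Defs.sigma alpha beta (- s)).
Hypothesis contracting : exists u1, 0 < u1 /\ forall u, 0 < u < u1 -> u < s0 -> - Rb u < s0 ->
  - Ra (- Rb u) < u.

Local Notation h := (Defs.h alpha beta).
Local Notation sigma := (Defs.sigma alpha beta).
Local Notation lie := (lie alpha beta).
Local Notation slide := (slide alpha beta).
Local Notation slope := (slope alpha beta).
Local Notation K := (Kab alpha beta).

Let b (u : R) := - Rb u.

Lemma mbeta_neq0 : - beta <> 0.
Proof. lra. Qed.

Lemma b_pos u : 0 < u < s0 -> 0 < b u.
Proof. intros Hu. pose proof (hm_arc HB u Hu) as [_ [H _]]. unfold b. lra. Qed.

Lemma b_incr u u' : 0 < u -> u < u' -> u' < s0 -> b u < b u'.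
Proof.
  intros H1 H2 H3.
  pose proof (half_decr mbeta_neq0 (F (other za)) HB u u' H1 H2 H3). unfold b. lra.
Qed.

Lemma Ra_neg s : 0 < s < s0 -> Ra s < 0.
Proof. intros Hs. apply (hm_arc HA s Hs). Qed.

Lemma Ra_decr s s' : 0 < s -> s <= s' -> s' < s0 -> Ra s' <= Ra s.
Proof.
  intros H1 [H2| ->] H3; [|lra].
  left. apply (half_decr beta_neq0 (F za) HA); assumption.
Qed.

(** Displacement of the perturbed return map of the half line [s < 0] at
    [sigma (- u)], transported by [slide e] to the unperturbed picture. *)
Let Fd (u e : R) := slide e (- u) - Ra (slide e (b u)).

Section Window.

Variable u1 : R.
Hypothesis u1_range : 0 < u1 <= s0 / 16.
Hypothesis K_u1 : K * u1 <= 1 / 4.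
Hypothesis b_u1 : forall u, 0 < u < u1 -> b u < s0 / 4 /\ K * b u <= 1 / 4.
Hypothesis P_u1 : forall u, 0 < u < u1 -> - Ra (b u) < u.

Lemma slope_neg u : 0 < u < u1 -> 1 / 2 <= slope (- u) <= 2.
Proof.
  intros Hu. apply slope_range. rewrite Rabs_Ropp, Rabs_pos_eq by lra.
  pose proof (Kab_pos alpha beta). nra.
Qed.

Lemma slope_b u : 0 < u < u1 -> 1 / 2 <= slope (b u) <= 2.
Proof.
  intros Hu. apply slope_range. assert (0 < b u) by (apply b_pos; lra).
  rewrite Rabs_pos_eq by lra. apply b_u1, Hu.
Qed.

Lemma slide_b u e : 0 < u < u1 -> 0 <= e <= 4 * u1 -> b u <= slide e (b u) <= b u + 2 * e /\
  0 < slide e (b u) < s0.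
Proof.
  intros Hu He. pose proof (slope_b u Hu). assert (0 < b u) by (apply b_pos; lra).
  destruct (b_u1 u Hu). rewrite slide_slope. split; nra.
Qed.

Lemma Fd_incr u e e' : 0 < u < u1 -> 0 <= e -> e <= e' -> e' <= 4 * u1 ->
  (e' - e) / 2 <= Fd u e' - Fd u e.
Proof.
  intros Hu H1 H2 H3.
  destruct (slide_b u e Hu ltac:(lra)) as [_ A1]. destruct (slide_b u e' Hu ltac:(lra)) as [_ A2].
  pose proof (slope_neg u Hu) as B1. pose proof (slope_b u Hu) as B2.
  assert (slide e (b u) <= slide e' (b u)) by (rewrite !slide_slope; nra).
  pose proof (Ra_decr (slide e (b u)) (slide e' (b u)) ltac:(lra) ltac:(lra) ltac:(lra)).
  unfold Fd. rewrite (slide_slope _ _ e'), (slide_slope _ _ e (- u)). nra.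
Qed.

Lemma slide_cont e s : continuity_pt (fun x => slide x s) e /\ continuity_pt (fun x => slide e x) s.
Proof.
  split; unfold Submission.slide.
  - apply (is_derive_continuity_pt _ e ((1 + beta * s) * (1 + alpha * s))). auto_derive; [exact I|ring].
  - apply (is_derive_continuity_pt _ s (1 + e * (beta * (1 + alpha * s) + (1 + beta * s) * alpha))).
    auto_derive; [exact I|ring].
Qed.

Lemma Fd_cont_e u e : 0 < u < u1 -> 0 <= e <= 4 * u1 -> continuity_pt (Fd u) e.
Proof.
  intros Hu He. apply (continuity_pt_minus (fun e => slide e (- u)) (fun e => Ra (slide e (b u)))).
  - apply slide_cont.
  - apply (continuity_pt_comp (fun e => slide e (b u)) Ra); [apply slide_cont|].
    apply (half_cont_pt beta_neq0 (F za) HA). apply slide_b; assumption.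
Qed.

Lemma b_cont u : 0 < u < s0 -> continuity_pt b u.
Proof.
  intros Hu. apply (continuity_pt_opp Rb).
  apply (half_cont_pt mbeta_neq0 (F (other za)) HB). exact Hu.
Qed.

Lemma Fd_cont_u u e : 0 < u < u1 -> 0 <= e <= 4 * u1 -> continuity_pt (fun u => Fd u e) u.
Proof.
  intros Hu He. apply (continuity_pt_minus (fun u => slide e (- u)) (fun u => Ra (slide e (b u)))).
  - apply (continuity_pt_comp (fun u => - u) (fun s => slide e s)); [|apply slide_cont].
    apply (continuity_pt_opp (fun u => u)). apply derivable_continuous_pt, derivable_pt_id.
  - apply (continuity_pt_comp (fun u => slide e (b u)) Ra).
    + apply (continuity_pt_comp b (fun s => slide e s)); [apply b_cont; lra|apply slide_cont].
    + apply (half_cont_pt beta_neq0 (F za) HA). apply slide_b; assumption.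
Qed.

(** Without perturbation the displacement is negative by contraction, and
    [slide (4 * u)] pushes [- u] to the positive side, while [Ra] is negative. *)
Lemma closing_parameter u : 0 < u < u1 -> exists e, 0 < e < 4 * u /\ Fd u e = 0.
Proof.
  intros Hu.
  assert (F0 : Fd u 0 < 0).
  { unfold Fd. rewrite !slide_slope, !Rmult_0_l, !Rplus_0_r. specialize (P_u1 u Hu). lra. }
  assert (F1 : 0 < Fd u (4 * u)).
  { unfold Fd. destruct (slide_b u (4 * u) Hu ltac:(lra)) as [_ A]. pose proof (Ra_neg _ A).
    pose proof (slope_neg u Hu). rewrite slide_slope. nra. }
  destruct (Ranalysis5.IVT_interv (Fd u) 0 (4 * u)) as [e [He Hz]].
  - intros a Ha. apply Fd_cont_e; [exact Hu|lra].
  - lra.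
  - exact F0.
  - exact F1.
  - exists e. split; [|exact Hz]. destruct (Req_dec e 0) as [->|]; [lra|].
    destruct (Req_dec e (4 * u)) as [->|]; lra.
Qed.

Variable E : R -> R.
Hypothesis E_spec : forall u, 0 < u < u1 -> 0 < E u < 4 * u /\ Fd u (E u) = 0.

(** The displacement increases with [e], so its sign changes around [E u0] persist
    for nearby [u]. *)
Lemma E_cont u0 : 0 < u0 < u1 -> continuity_pt E u0.
Proof.
  intros Hu0. destruct (E_spec u0 Hu0) as [R0 Z0].
  apply continuity_pt_locally. intros [eps Heps].
  set (d := Rmin eps (Rmin (E u0) (4 * u1 - E u0)) / 2).
  assert (Hd : 0 < d /\ d < eps /\ d < E u0 /\ d < 4 * u1 - E u0).
  { pose proof (Rmin_l eps (Rmin (E u0) (4 * u1 - E u0))). pose proof (Rmin_r eps (Rmin (E u0) (4 * u1 - E u0))).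
    pose proof (Rmin_l (E u0) (4 * u1 - E u0)). pose proof (Rmin_r (E u0) (4 * u1 - E u0)).
    assert (0 < Rmin eps (Rmin (E u0) (4 * u1 - E u0))) by (apply Rmin_pos; [lra|apply Rmin_pos; lra]).
    unfold d. lra. }
  assert (Lo : Fd u0 (E u0 - d) < 0).
  { pose proof (Fd_incr u0 (E u0 - d) (E u0) Hu0 ltac:(lra) ltac:(lra) ltac:(lra)). lra. }
  assert (Hi : 0 < Fd u0 (E u0 + d)).
  { pose proof (Fd_incr u0 (E u0) (E u0 + d) Hu0 ltac:(lra) ltac:(lra) ltac:(lra)). lra. }
  assert (C1 := Fd_cont_u u0 (E u0 - d) Hu0 ltac:(lra)).
  assert (C2 := Fd_cont_u u0 (E u0 + d) Hu0 ltac:(lra)).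
  assert (P1 : 0 < - Fd u0 (E u0 - d)) by lra.
  apply continuity_pt_locally with (eps := mkposreal _ P1) in C1.
  apply continuity_pt_locally with (eps := mkposreal _ Hi) in C2.
  destruct C1 as [d1' C1], C2 as [d2' C2].
  assert (Hm : 0 < Rmin (Rmin d1' d2') (Rmin u0 (u1 - u0))).
  { apply Rmin_pos; apply Rmin_pos; try apply cond_pos; lra. }
  exists (mkposreal _ Hm). intros u Hu.
  assert (Hu' : Rabs (u - u0) < Rmin (Rmin d1' d2') (Rmin u0 (u1 - u0))) by exact Hu.
  pose proof (Rmin_l (Rmin d1' d2') (Rmin u0 (u1 - u0))). pose proof (Rmin_r (Rmin d1' d2') (Rmin u0 (u1 - u0))).
  pose proof (Rmin_l d1' d2'). pose proof (Rmin_r d1' d2').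
  pose proof (Rmin_l u0 (u1 - u0)). pose proof (Rmin_r u0 (u1 - u0)).
  assert (Hd1' : Rabs (u - u0) < d1') by lra. assert (Hd2' : Rabs (u - u0) < d2') by lra.
  assert (B1 := C1 u Hd1'). assert (B2 := C2 u Hd2').
  simpl in B1, B2. apply Rabs_lt_between in B1, B2, Hu'.
  assert (Hur : 0 < u < u1) by lra.
  destruct (E_spec u Hur) as [R1 Z1]. simpl. apply Rabs_lt_between. split.
  - apply Rnot_le_lt. intros Hle.
    pose proof (Fd_incr u (E u) (E u0 - d) Hur ltac:(lra) ltac:(lra) ltac:(lra)). lra.
  - apply Rnot_le_lt. intros Hle.
    pose proof (Fd_incr u (E u0 + d) (E u) Hur ltac:(lra) ltac:(lra) ltac:(lra)). lra.
Qed.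

(** An implicit function theorem for maps that are only known to be
    differentiable at each point: with the factorizations of [b] and [Ra], the
    equation [Fd u (E u) = 0] becomes linear in [E u - E u0], and its coefficient
    [M u] is positive because [Ra] decreases. *)
Lemma E_deriv u0 : 0 < u0 < u1 -> exists l, is_derive E u0 l.
Proof.
  intros Hu0. destruct (E_spec u0 Hu0) as [Re0 Z0].
  set (e0 := E u0) in *. set (b0 := b u0). set (w := fun u => slide (E u) (b u)). set (w0 := w u0).
  destruct (slide_b u0 e0 Hu0 ltac:(lra)) as [_ Hw0]. fold b0 in Hw0.
  change (slide e0 b0) with w0 in Hw0.
  assert (Hbd : exists l, is_derive b u0 l).
  { destruct (half_deriv _ _ _ _ _ _ _ _ _ d0 (d1 / 2) mbeta_neq0 (F (other za)) HB
      (V_quadratic (other za)) ltac:(lra) boxB u0 ltac:(lra)) as [l Hl].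
    exists (- l). apply (is_derive_opp Rb). exact Hl. }
  destruct Hbd as [lb Hlb].
  destruct (half_deriv _ _ _ _ _ _ _ _ _ d0 (d1 / 2) beta_neq0 (F za) HA
    (V_quadratic za) ltac:(lra) boxA w0 Hw0) as [la Hla].
  destruct (is_derive_factor b u0 lb Hlb) as [chi [Cchi [_ Hchi]]].
  destruct (is_derive_factor Ra w0 la Hla) as [psi [Cpsi [Epsi Hpsi]]].
  pose proof (E_cont u0 Hu0) as CE. pose proof (b_cont u0 ltac:(lra)) as Cb.
  assert (Cw : continuity_pt w u0).
  { unfold w, Submission.slide.
    repeat first [apply continuity_pt_plus | apply continuity_pt_mult | exact CE | exact Cb
      | apply continuity_pt_const; intros ? ?; reflexivity]. }
  assert (Cpw : continuity_pt (fun u => psi (w u)) u0).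
  { apply (continuity_pt_comp w psi); assumption. }
  assert (Hneg : forall x, 0 < x < s0 -> x <> w0 -> psi x <= 0).
  { intros x Hx Hne. specialize (Hpsi x).
    destruct (Rtotal_order x w0) as [Hlt|[Heq|Hlt]]; [|contradiction|].
    - pose proof (Ra_decr x w0 ltac:(lra) ltac:(lra) ltac:(lra)). nra.
    - pose proof (Ra_decr w0 x ltac:(lra) ltac:(lra) ltac:(lra)). nra. }
  assert (Hneg0 : psi w0 <= 0).
  { apply Rnot_lt_le. intros Hpos.
    pose proof Cpsi as C. apply continuity_pt_locally with (eps := mkposreal _ Hpos) in C.
    destruct C as [d Hd]. set (x := w0 + Rmin d (s0 - w0) / 2).
    assert (Hm : 0 < Rmin d (s0 - w0)) by (apply Rmin_pos; [apply cond_pos|lra]).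
    pose proof (Rmin_l d (s0 - w0)). pose proof (Rmin_r d (s0 - w0)).
    assert (Hx : Rabs (x - w0) < d) by (unfold x; apply Rabs_lt_between; lra).
    specialize (Hd x Hx). simpl in Hd. apply Rabs_lt_between in Hd.
    pose proof (Hneg x ltac:(unfold x; lra) ltac:(unfold x; lra)). lra. }
  assert (Hnegw : forall u, 0 < u < u1 -> psi (w u) <= 0).
  { intros u Hu. destruct (E_spec u Hu) as [Re _]. destruct (slide_b u (E u) Hu ltac:(lra)) as [_ Hwu].
    destruct (Req_dec (w u) w0) as [->|Hne]; [exact Hneg0|]. apply Hneg; assumption. }
  set (k1 := fun u => 1 + E u * (alpha + beta + alpha * beta * (b u + b0))).
  set (k2 := fun u => 1 + E u * (alpha + beta - alpha * beta * (u + u0))).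
  set (M := fun u => slope (- u0) - slope b0 * psi (w u)).
  set (N := fun u => k2 u + chi u * k1 u * psi (w u)).
  pose proof (slope_neg u0 Hu0) as B1. pose proof (slope_b u0 Hu0) as B2. fold b0 in B2.
  assert (HM : forall u, 0 < u < u1 -> 0 < M u).
  { intros u Hu. specialize (Hnegw u Hu). unfold M. nra. }
  exists (N u0 / M u0).
  apply (factor_is_derive E (fun u => N u / M u) u0 (Rmin u0 (u1 - u0))).
  - apply Rmin_pos; lra.
  - apply continuity_pt_div; [| |specialize (HM u0 Hu0); lra].
    + unfold N, k1, k2.
      repeat first [apply continuity_pt_minus | apply continuity_pt_plus | apply continuity_pt_mult
        | exact CE | exact Cb | exact Cpw | exact Cchi
        | apply continuity_pt_const; intros ? ?; reflexivity
        | apply derivable_continuous_pt, derivable_pt_id].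
    + unfold M.
      repeat first [apply continuity_pt_minus | apply continuity_pt_mult | exact Cpw
        | apply continuity_pt_const; intros ? ?; reflexivity].
  - intros u Hu. pose proof (Rmin_l u0 (u1 - u0)). pose proof (Rmin_r u0 (u1 - u0)).
    apply Rabs_lt_between in Hu. assert (Hur : 0 < u < u1) by lra.
    destruct (E_spec u Hur) as [_ Z]. specialize (HM u Hur).
    apply Rmult_eq_reg_r with (M u); [|lra]. fold e0.
    replace ((e0 + (u - u0) * (N u / M u)) * M u) with (e0 * M u + (u - u0) * N u) by (field; lra).
    assert (Eq : (E u - e0) * M u = (u - u0) * N u); [|lra].
    unfold Fd in Z, Z0. change (slide (E u) (b u)) with (w u) in Z.
    change (slide e0 (b u0)) with w0 in Z0. rewrite (Hpsi (w u)) in Z.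
    assert (Ew : w u - w0 = (u - u0) * chi u * k1 u + (E u - e0) * slope b0).
    { unfold w, w0, w, Submission.slide, Submission.slope, k1. fold e0 b0. rewrite (Hchi u). fold b0. ring. }
    assert (Es : slide (E u) (- u) - slide e0 (- u0) = - (u - u0) * k2 u + (E u - e0) * slope (- u0)).
    { unfold Submission.slide, Submission.slope, k2. ring. }
    unfold M, N. rewrite Ew in Z.
    replace (slide (E u) (- u)) with (slide e0 (- u0) + (- (u - u0) * k2 u + (E u - e0) * slope (- u0))) in Z by lra.
    lra.
Qed.

(** The bound [E u < 4 * u] makes [E] smaller at a point close to 0 than at
    [u1 / 2]. *)
Lemma rising_parameter : exists u l, 0 < u < u1 /\ 0 < l /\ is_derive E u l.
Proof.
  destruct (choice (fun u l => 0 < u < u1 -> is_derive E u l)) as [dE HdE].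
  { intros u. destruct (Rlt_dec 0 u) as [H1|H1]; [|exists 0; intros; lra].
    destruct (Rlt_dec u u1) as [H2|H2]; [|exists 0; intros; lra].
    destruct (E_deriv u (conj H1 H2)) as [l Hl]. exists l. intros _. exact Hl. }
  set (u2 := u1 / 2). assert (Hu2 : 0 < u2 < u1) by (unfold u2; lra).
  destruct (E_spec u2 Hu2) as [R2 _].
  set (u3 := Rmin u2 (E u2 / 4) / 2).
  assert (Hu3 : 0 < u3 /\ u3 < u2 /\ 4 * u3 < E u2).
  { assert (0 < Rmin u2 (E u2 / 4)) by (apply Rmin_pos; lra).
    pose proof (Rmin_l u2 (E u2 / 4)). pose proof (Rmin_r u2 (E u2 / 4)). unfold u3. lra. }
  destruct (E_spec u3 ltac:(lra)) as [R3 _].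
  destruct (mean_value E dE u3 u2) as [u [Hu Hm]].
  - lra.
  - intros x Hx. apply HdE. lra.
  - intros x Hx. apply E_cont. lra.
  - exists u, (dE u). split; [lra|]. split; [|apply HdE; lra]. nra.
Qed.

End Window.

(** Where [E] rises, the closed orbit attracts: the displacement at [u] is
    comparable to [E u - e], hence to [u - us], and its sign moves the point
    towards the cycle without passing it, because the return map is increasing. *)
Theorem cycle_exists rho : 0 < rho -> exists e G, 0 < e < rho /\
  glimit_cycle alpha beta (perturb alpha beta za e X) G /\
  gstable alpha beta (perturb alpha beta za e X) G /\
  forall p, G p -> dsup (1, 1) p < rho.
Proof.
  intros Hrho. destruct contracting as [uc [Huc Hcontr]].
  destruct (hm_small HA (rho / 2) ltac:(lra)) as [sa [Hsa HsmA]].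
  destruct (hm_small HB rho Hrho) as [sb [Hsb HsmB]].
  pose proof (Kab_pos alpha beta) as HK.
  set (K1 := K + 1).
  assert (HK1 : 0 < K1 /\ K <= K1) by (unfold K1; lra).
  (* bound for the starting points in the half line [s > 0] *)
  destruct (exists_below (s0 / 4 :: 1 / (4 * K1) :: sa / 2 :: d1 / (2 * K1) :: nil)) as [bm [Hbm Hbl]].
  { simpl. intros x [<-|[<-|[<-|[<-|[]]]]]; try lra; apply Rdiv_lt_0_compat; lra. }
  assert (M1 : bm <= s0 / 4) by (apply Hbl; simpl; tauto).
  assert (M2 : bm <= 1 / (4 * K1)) by (apply Hbl; simpl; tauto).
  assert (M3 : bm <= sa / 2) by (apply Hbl; simpl; tauto).
  assert (M4 : bm <= d1 / (2 * K1)) by (apply Hbl; simpl; tauto).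
  clear Hbl.
  assert (HKbm : K * bm <= 1 / 4 /\ K * bm <= d1 / 2).
  { apply Rle_div_r in M2; [|lra]. apply Rle_div_r in M4; [|lra]. split; nra. }
  destruct (half_lim mbeta_neq0 HB bm Hbm) as [sl0 [Hsl Hlim]].
  destruct (exists_below (s0 / 16 :: 1 / (4 * K1) :: sl0 :: uc :: sb :: sa / 16 :: d1 / (64 * K1) :: 1 / (24 * K1)
    :: rho / (32 * K1) :: rho / 4 :: nil)) as [u1 [Hu1 Hul]].
  { simpl. intros x [<-|[<-|[<-|[<-|[<-|[<-|[<-|[<-|[<-|[<-|[]]]]]]]]]]]; try lra; apply Rdiv_lt_0_compat; lra. }
  assert (N1 : u1 <= s0 / 16) by (apply Hul; simpl; tauto).
  assert (N2 : u1 <= 1 / (4 * K1)) by (apply Hul; simpl; tauto).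
  assert (N3 : u1 <= sl0) by (apply Hul; simpl; tauto).
  assert (N4 : u1 <= uc) by (apply Hul; simpl; tauto).
  assert (N5 : u1 <= sb) by (apply Hul; simpl; tauto).
  assert (N6 : u1 <= sa / 16) by (apply Hul; simpl; tauto).
  assert (N7 : u1 <= d1 / (64 * K1)) by (apply Hul; simpl; tauto).
  assert (N8 : u1 <= 1 / (24 * K1)) by (apply Hul; simpl; tauto).
  assert (N9 : u1 <= rho / (32 * K1)) by (apply Hul; simpl; tauto).
  assert (N10 : u1 <= rho / 4) by (apply Hul; simpl; tauto).
  clear Hul.
  assert (HKu : K * u1 <= 1 / 4 /\ 64 * (K * u1) <= d1 /\ 24 * (K * u1) <= 1 /\ 32 * (K * u1) <= rho).
  { apply Rle_div_r in N2; [|lra]. apply Rle_div_r in N7; [|lra]. apply Rle_div_r in N8; [|lra].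
    apply Rle_div_r in N9; [|lra]. repeat split; nra. }
  assert (Hb : forall u, 0 < u < u1 -> 0 < b u < bm).
  { intros u Hu. split; [apply b_pos; lra|]. specialize (Hlim u ltac:(lra) ltac:(lra)). unfold b. lra. }
  assert (HKb : forall u, 0 < u < u1 -> K * b u <= K * bm).
  { intros u Hu. specialize (Hb u Hu). apply Rmult_le_compat_l; lra. }
  assert (Hbu : forall u, 0 < u < u1 -> b u < s0 / 4 /\ K * b u <= 1 / 4).
  { intros u Hu. specialize (Hb u Hu). specialize (HKb u Hu). lra. }
  assert (HPu : forall u, 0 < u < u1 -> - Ra (b u) < u).
  { intros u Hu. specialize (Hb u Hu). apply Hcontr; [lra|lra|]. unfold b in Hb. lra. }
  destruct (choice (fun u e => 0 < u < u1 -> 0 < e < 4 * u /\ Fd u e = 0)) as [E HE].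
  { intros u. destruct (Rlt_dec 0 u) as [G1|G1]; [|exists 0; intros; lra].
    destruct (Rlt_dec u u1) as [G2|G2]; [|exists 0; intros; lra].
    destruct (closing_parameter u1 ltac:(lra) ltac:(lra) Hbu HPu u (conj G1 G2)) as [e He].
    exists e. intros _. exact He. }
  destruct (rising_parameter u1 ltac:(lra) ltac:(lra) Hbu E HE) as [us [l [Hus [Hl HdE]]]].
  set (e := E us) in *. destruct (HE us Hus) as [He Hz]. fold e in He, Hz.
  assert (Hae : Rabs e = e) by (apply Rabs_pos_eq; lra).
  assert (He4 : e <= 4 * u1) by lra.
  assert (HKe0 : K * e <= 4 * (K * u1)).
  { replace (4 * (K * u1)) with (K * (4 * u1)) by ring. apply Rmult_le_compat_l; lra. }
  assert (HKe : 16 * K * Rabs e <= d1) by (rewrite Hae, Rmult_assoc; lra).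
  assert (HKe2 : 6 * K * e <= 1) by lra.
  assert (HKe3 : 4 * K * Rabs e <= rho / 2) by (rewrite Hae, Rmult_assoc; lra).
  destruct (lip_on_pull alpha beta e (X za) d0 d1 ltac:(lra)) as [Lp1 Lp2];
    [lra|apply X_lip|apply X_lip|].
  destruct (local_flow (pull alpha beta e (X za)) d1 ltac:(lra) Lp1 Lp2) as [U [Psi [L' [FU HU]]]].
  set (zb := other za) in *.
  assert (Hzb : zb <> za) by apply other_neq.
  set (V' := fun i => if zone_eq_dec i za then U else V i).
  set (Phi' := fun i => if zone_eq_dec i za then Psi else Phi i).
  set (X' := perturb alpha beta za e X).
  assert (V'a : V' za = U) by (unfold V'; destruct (zone_eq_dec za za); congruence).
  assert (V'b : V' zb = V zb) by (unfold V'; destruct (zone_eq_dec zb za); congruence).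
  assert (Phi'a : Phi' za = Psi) by (unfold Phi'; destruct (zone_eq_dec za za); congruence).
  assert (Phi'b : Phi' zb = Phi zb) by (unfold Phi'; destruct (zone_eq_dec zb za); congruence).
  assert (X'a : X' za = pull alpha beta e (X za)) by (unfold X', perturb; destruct (zone_eq_dec za za); congruence).
  assert (X'b : X' zb = X zb) by (unfold X', perturb; destruct (zone_eq_dec zb za); congruence).
  assert (F' : forall i, flow (V' i) (Phi' i) (Rmax L L')).
  { intros i. destruct (zone_cases za i) as [-> | ->].
    - rewrite V'a, Phi'a. apply (flow_weaken _ _ L'); [exact FU|apply Rmax_r].
    - fold zb. rewrite V'b, Phi'b. apply (flow_weaken _ _ L); [apply F|apply Rmax_l]. }
  assert (V'_eq : forall i p, dsup (1, 1) p < d1 -> V' i p = X' i p).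
  { intros i p Hp. destruct (zone_cases za i) as [-> | ->].
    - rewrite V'a, X'a. apply HU. lra.
    - fold zb. rewrite V'b, X'b. apply V_eq. lra. }
  assert (arcb : forall u, 0 < u < u1 ->
    arc alpha beta Phi' zb (sigma (- u)) (Tb u) (b u) /\
    forall t, 0 <= t <= Tb u -> dsup (1, 1) (Phi' zb t (sigma (- u))) <= d1 / 2).
  { intros u Hu. rewrite <- sigma_opp. unfold arc. rewrite Phi'b.
    destruct (hm_arc HB u ltac:(lra)) as [A1 [A2 [A3 A4]]]. fold zb in A3, A4.
    split; [split; [exact A1|split]|].
    - rewrite A3, sigma_opp. reflexivity.
    - intros t Ht. specialize (A4 t Ht). rewrite h_opp in A4. unfold region, zb at 1.
      rewrite sgn_other. lra.
    - intros t Ht. apply boxB; [lra|exact Ht]. }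
  assert (sigma_small : forall x, K * Rabs x <= d1 / 2 -> dsup (1, 1) (sigma x) <= d1 / 2).
  { intros x Hx. rewrite <- (sigma_0 alpha beta). eapply Rle_trans; [apply sigma_dsup|].
    rewrite Rminus_0_r. exact Hx. }
  assert (arca : forall u, 0 < u < u1 -> exists T' x',
    arc alpha beta Phi' za (sigma (b u)) T' x' /\ slide e x' = Ra (slide e (b u)) /\
    forall t, 0 <= t <= T' -> dsup (1, 1) (Phi' za t (sigma (b u))) <= 3 / 4 * d1 /\
      dsup (1, 1) (Phi' za t (sigma (b u))) < rho).
  { intros u Hu. destruct (slide_b u1 ltac:(lra) Hbu u e Hu ltac:(lra)) as [W1 W2].
    specialize (Hb u Hu).
    destruct (hm_arc HA _ W2) as [A1 [A2 [A3 A4]]].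
    destruct (perturbed_arc alpha beta e (sgn za) (X za) (V za) (Phi za) L U Psi L' d0 d1 (b u)
      (Ta (slide e (b u))) (Ra (slide e (b u)))) as [T' [x' [B1 [B2 [B3 [B4 B5]]]]]]; try assumption.
    { exact (F za). }
    { intros q Hq. apply V_eq, Hq. }
    { intros t Ht. apply boxA; assumption. }
    { apply sigma_small. specialize (HKb u Hu). rewrite Rabs_pos_eq by lra. lra. }
    exists T', x'. unfold arc. rewrite Phi'a. split; [|split].
    - split; [exact B1|]. split; [exact B2|exact B4].
    - exact B3.
    - intros t Ht. destruct (B5 t Ht) as [C1 [t' [C2 C3]]]. split; [exact C1|].
      assert (C4 : dsup (1, 1) (Phi za t' (sigma (slide e (b u)))) < rho / 2) by (apply HsmA; lra).
      pose proof (dsup_tri (1, 1) (Phi za t' (sigma (slide e (b u)))) (Psi t (sigma (b u)))). lra. }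
  assert (sl : forall x x', Rabs (beta * x) <= 1 -> Rabs (beta * x') <= 1 ->
    exists k, 1 / 2 <= k <= 3 / 2 /\ slide e x' - slide e x = (x' - x) * k).
  { intros x x' Hx Hx'. apply slide_diff; auto. lra. }
  assert (beta_neg : forall u, 0 < u < u1 -> Rabs (beta * - u) <= 1).
  { intros u Hu. rewrite Rabs_mult, Rabs_Ropp, (Rabs_pos_eq u) by lra.
    assert (Rabs beta <= K) by (unfold Kab; pose proof (Rabs_pos alpha); lra).
    assert (Rabs beta * u <= K * u1) by (apply Rmult_le_compat; try lra; apply Rabs_pos). lra. }
  assert (beta_end : forall u T' x', 0 < u < u1 -> arc alpha beta Phi' za (sigma (b u)) T' x' ->
    slide e x' = Ra (slide e (b u)) /\ Rabs (beta * x') <= 1).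
  { intros u T' x' Hu Ha. destruct (arca u Hu) as [T2 [x2 [A1 [A2 A3]]]].
    destruct (arc_unique alpha beta Phi' beta_neq0 _ _ _ _ _ _ Ha A1) as [-> ->]. split; [exact A2|].
    destruct A1 as [B1 [B2 _]]. destruct (A3 T2 ltac:(lra)) as [C _]. rewrite B2 in C.
    apply dsup_le in C. simpl in C. destruct C as [C _].
    replace (1 + beta * x2 - 1) with (beta * x2) in C by ring. lra. }
  (* expansion of the closing parameter around [us] *)
  destruct (is_derive_factor E us l HdE) as [phi [Cphi [Ephi Hphi]]].
  assert (Hl2 : 0 < l / 2) by lra.
  apply continuity_pt_locally with (eps := mkposreal _ Hl2) in Cphi. destruct Cphi as [dphi Cphi].
  rewrite Ephi in Cphi. simpl in Cphi.
  set (eta := Rmin dphi (Rmin us (u1 - us))).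
  assert (Heta : 0 < eta) by (unfold eta; apply Rmin_pos; [apply cond_pos|apply Rmin_pos; lra]).
  assert (Heta2 : eta <= dphi /\ eta <= us /\ eta <= u1 - us).
  { unfold eta. pose proof (Rmin_l dphi (Rmin us (u1 - us))). pose proof (Rmin_r dphi (Rmin us (u1 - us))).
    pose proof (Rmin_l us (u1 - us)). pose proof (Rmin_r us (u1 - us)). lra. }
  destruct (arca us Hus) as [Tas [xas [Aa1 [Aa2 Aa3]]]].
  assert (Hxas : xas = - us).
  { destruct (beta_end us Tas xas Hus Aa1) as [_ Hbx].
    destruct (sl (- us) xas (beta_neg us Hus) Hbx) as [k [Hk1 Hk2]].
    unfold Fd in Hz. rewrite Aa2 in Hk2.
    apply Rmult_eq_reg_r with k; lra. }
  subst xas. destruct (arcb us Hus) as [Ab1 Ab2].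
  set (xs := fun i => if zone_eq_dec i za then b us else - us).
  set (Ts := fun i => if zone_eq_dec i za then Tas else Tb us).
  assert (xsa : xs za = b us) by (unfold xs; destruct (zone_eq_dec za za); congruence).
  assert (xsb : xs zb = - us) by (unfold xs; destruct (zone_eq_dec zb za); congruence).
  assert (Tsa : Ts za = Tas) by (unfold Ts; destruct (zone_eq_dec za za); congruence).
  assert (Tsb : Ts zb = Tb us) by (unfold Ts; destruct (zone_eq_dec zb za); congruence).
  assert (ozb : other zb = za) by apply other_other.
  pose proof (Hb us Hus) as Hbus.
  assert (Hcyc : glimit_cycle alpha beta X' (cycle alpha beta Phi' xs Ts) /\
    gstable alpha beta X' (cycle alpha beta Phi' xs Ts)).
  { apply (attracting_cycle alpha beta X' V' Phi' (Rmax L L') d1 beta_neq0 F' V'_eq xs Ts zb eta)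
      (* the rate: [l / 2] bounds the slope of [E] from below near [us], [1 / 2]
         that of [Fd u], and [3 / 2] that of [slide e] from above *)
      with (lam := Rmax 0 (1 - l / 6)).
    - intros i. destruct (zone_cases za i) as [-> | ->]; fold zb; [|rewrite ozb]; rewrite xsa, xsb; lra.
    - intros i. destruct (zone_cases za i) as [-> | ->]; fold zb.
      + rewrite xsa, xsb, Tsa. exact Aa1.
      + rewrite ozb, xsa, xsb, Tsb. exact Ab1.
    - intros i t Ht. destruct (zone_cases za i) as [-> | ->]; fold zb in Ht |- *.
      + rewrite xsa. rewrite Tsa in Ht. destruct (Aa3 t Ht) as [C _]. lra.
      + rewrite xsb. rewrite Tsb in Ht. specialize (Ab2 t Ht). lra.
    - (* transversality of the perturbed fields *)
      destruct (slide_b u1 ltac:(lra) Hbu us e Hus ltac:(lra)) as [W1 W2].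
      assert (Ba : dsup (1, 1) (sigma (b us)) <= d1 / 2).
      { apply sigma_small. specialize (HKb us Hus). rewrite Rabs_pos_eq by lra. lra. }
      assert (Bb : dsup (1, 1) (sigma (- us)) <= d1 / 2).
      { apply sigma_small. rewrite Rabs_Ropp, Rabs_pos_eq by lra.
        assert (K * us <= K * u1) by (apply Rmult_le_compat_l; lra). lra. }
      assert (Hpull : forall x, dsup (1, 1) (sigma x) <= d1 / 2 -> exists k, 0 < k /\
        lie (pull alpha beta e (X za)) (sigma x) = k * lie (V za) (sigma (slide e x))).
      { intros x Hx. exists (det_shear alpha beta e (sigma x)). split.
        - pose proof (det_shear_range alpha beta e (sigma x) ltac:(lra) ltac:(lra)). lra.
        - rewrite lie_pull, shear_sigma. f_equal. unfold Submission.lie. rewrite V_eq; [reflexivity|].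
          rewrite <- shear_sigma.
          pose proof (dsup_tri (1, 1) (sigma x) (shear alpha beta e (sigma x))).
          pose proof (shear_close alpha beta e (sigma x) ltac:(lra)). lra. }
      assert (HXV : forall x, dsup (1, 1) (sigma x) <= d1 / 2 -> lie (X zb) (sigma x) = lie (V zb) (sigma x)).
      { intros x Hx. unfold Submission.lie. rewrite V_eq; [reflexivity|lra]. }
      intros i j. destruct (zone_cases za i) as [-> | ->]; fold zb.
      + rewrite xsa. destruct (zone_cases za j) as [-> | ->]; fold zb.
        * rewrite X'a. destruct (Hpull (b us) Ba) as [k [Hk ->]].
          match goal with |- 0 < ?s * (k * ?x) => replace (s * (k * x)) with (k * (s * x)) by ring end.
          apply Rmult_lt_0_compat; [exact Hk|apply (transA _ za W2)].
        * rewrite X'b, HXV by exact Ba. apply transA. lra.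
      + rewrite xsb. destruct (zone_cases za j) as [-> | ->]; fold zb.
        * rewrite X'a. destruct (Hpull (- us) Bb) as [k [Hk ->]]. rewrite Aa2.
          pose proof (hm_out HA (slide e (b us)) W2). unfold zb. rewrite sgn_other.
          match goal with |- 0 < - ?s * (k * ?x) => replace (- s * (k * x)) with (k * (- (s * x))) by ring end.
          apply Rmult_lt_0_compat; lra.
        * rewrite X'b, HXV by exact Bb. apply transB. lra.
    - exact Heta.
    - split; [apply Rmax_l|]. apply Rmax_lub_lt; lra.
    - (* contraction, from the slope of the closing parameter *)
      intros x x' Hx [y [T1 [T2 [A1 A2]]]]. rewrite xsb in *. rewrite ozb in A2.
      set (u := - x). assert (Ex : x = - u) by (unfold u; ring). rewrite Ex in *. clearbody u. clear Ex x.
      replace (- u - - us) with (- (u - us)) in * by ring. rewrite Rabs_Ropp in *.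
      pose proof Hx as Hx2. apply Rabs_lt_between in Hx2.
      assert (Hu : 0 < u < u1) by lra.
      destruct (arc_unique alpha beta Phi' beta_neq0 _ _ _ _ _ _ A1 (proj1 (arcb u Hu))) as [_ ->].
      destruct (beta_end u T2 x' Hu A2) as [Hsx Hbx].
      assert (EE : E u - e = (u - us) * phi u) by (rewrite (Hphi u); fold e; ring).
      assert (Hphil : l / 2 < phi u).
      { assert (Hux : Rabs (u - us) < dphi) by lra. specialize (Cphi u Hux). apply Rabs_lt_between in Cphi. lra. }
      destruct (HE u Hu) as [Hre Hze].
      destruct (sl (- u) x' (beta_neg u Hu) Hbx) as [k [Hk1 Hk2]].
      destruct (sl (- us) x' (beta_neg us Hus) Hbx) as [k' [Hk3 Hk4]].
      assert (HF : slide e x' - slide e (- u) = - Fd u e) by (unfold Fd; rewrite Hsx; ring).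
      assert (HF2 : slide e x' - slide e (- us) = Ra (slide e (b u)) - Ra (slide e (b us))).
      { unfold Fd in Hz. rewrite Hsx. lra. }
      destruct (slide_b u1 ltac:(lra) Hbu us e Hus ltac:(lra)) as [_ W2].
      destruct (slide_b u1 ltac:(lra) Hbu u e Hu ltac:(lra)) as [_ W3].
      assert (Hslb : forall v v', 0 < v < u1 -> 0 < v' < u1 -> v < v' -> slide e (b v) <= slide e (b v')).
      { intros v v' Hv Hv' Hvv. pose proof (b_incr v v' ltac:(lra) Hvv ltac:(lra)).
        pose proof (Hb v Hv). pose proof (Hb v' Hv').
        assert (Hbb : forall z, 0 < z < bm -> Rabs (beta * z) <= 1).
        { intros z Hz'. rewrite Rabs_mult, (Rabs_pos_eq z) by lra.
          assert (Rabs beta <= K) by (unfold Kab; pose proof (Rabs_pos alpha); lra).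
          assert (Rabs beta * z <= K * bm) by (apply Rmult_le_compat; try lra; apply Rabs_pos). lra. }
        destruct (sl (b v) (b v') (Hbb _ (Hb v Hv)) (Hbb _ (Hb v' Hv'))) as [k0 [K0 K0']].
        assert (0 <= (b v' - b v) * k0) by (apply Rmult_le_pos; lra). lra. }
      pose proof (Rmax_r 0 (1 - l / 6)) as Hlam.
      destruct (Rtotal_order u us) as [Hlt|[Heq|Hgt]].
      + (* inside the cycle: the return map moves the point outwards *)
        assert (HEd : l / 2 * (us - u) <= e - E u).
        { replace (e - E u) with (phi u * (us - u)) by lra. apply Rmult_le_compat_r; lra. }
        assert (0 <= l / 2 * (us - u)) by (apply Rmult_le_pos; lra).
        assert (HEu : E u <= e) by lra.
        pose proof (Fd_incr u1 ltac:(lra) ltac:(lra) Hbu u (E u) e Hu ltac:(lra) HEu ltac:(lra)) as Hinc.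
        pose proof (Hslb u us Hu Hus Hlt) as Hw.
        pose proof (Ra_decr _ _ (proj1 W3) Hw (proj2 W2)) as HR.
        assert (G1 : 0 <= x' - - us).
        { apply Rmult_le_reg_r with k'; lra. }
        assert (G3 : l / 6 * (us - u) <= - (x' - - u)).
        { apply Rmult_le_reg_r with k; [lra|].
          assert (l / 6 * (us - u) * k <= l / 6 * (us - u) * (3 / 2)) by (apply Rmult_le_compat_l; lra).
          lra. }
        rewrite (Rabs_left (u - us)) by lra. rewrite Rabs_pos_eq by lra.
        assert ((1 - l / 6) * - (u - us) <= Rmax 0 (1 - l / 6) * - (u - us)) by (apply Rmult_le_compat_r; lra).
        lra.
      + rewrite Heq in *. assert (x' - - us = 0) by (apply Rmult_eq_reg_r with k'; lra).
        replace (x' - - us) with 0 by lra. rewrite Rminus_diag, Rabs_R0. lra.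
      + assert (HEd : l / 2 * (u - us) <= E u - e).
        { replace (E u - e) with (phi u * (u - us)) by lra. apply Rmult_le_compat_r; lra. }
        assert (0 <= l / 2 * (u - us)) by (apply Rmult_le_pos; lra).
        assert (HEu : e <= E u) by lra.
        pose proof (Fd_incr u1 ltac:(lra) ltac:(lra) Hbu u e (E u) Hu ltac:(lra) HEu ltac:(lra)) as Hinc.
        pose proof (Hslb us u Hus Hu Hgt) as Hw.
        pose proof (Ra_decr _ _ (proj1 W2) Hw (proj2 W3)) as HR.
        assert (G1 : x' - - us <= 0).
        { apply Rmult_le_reg_r with k'; lra. }
        assert (G3 : l / 6 * (u - us) <= x' - - u).
        { apply Rmult_le_reg_r with k; [lra|].
          assert (l / 6 * (u - us) * k <= l / 6 * (u - us) * (3 / 2)) by (apply Rmult_le_compat_l; lra).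
          lra. }
        rewrite (Rabs_pos_eq (u - us)) by lra. rewrite Rabs_left1 by lra.
        assert ((1 - l / 6) * (u - us) <= Rmax 0 (1 - l / 6) * (u - us)) by (apply Rmult_le_compat_r; lra).
        lra. }
  exists e, (cycle alpha beta Phi' xs Ts).
  split; [lra|]. split; [apply Hcyc|]. split; [apply Hcyc|].
  intros p [i [t [Ht ->]]]. destruct (zone_cases za i) as [-> | ->]; fold zb in Ht |- *.
  - rewrite xsa. rewrite Tsa in Ht. apply Aa3, Ht.
  - rewrite xsb. rewrite Tsb in Ht. rewrite Phi'b, <- sigma_opp. apply HsmB; lra.
Qed.

End Core.

(** * Rotation around the pseudo-equilibrium *)

(** The two half-return maps of a system that turns around (1, 1), entering zone
    [za] through [s > 0]. Both fields are transversal to the line along the arcs'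
    starting points, as required of crossing trajectories. *)
Record rotation (alpha beta : R) (V : zone -> R * R -> R * R) (Phi : zone -> R -> R * R -> R * R)
    (za : zone) (d s0 : R) (Ta Ra Tb Rb : R -> R) : Prop := {
  rot_pos : 0 < s0;
  rot_A : half_map alpha beta (V za) (Phi za) (sgn za) s0 Ta Ra;
  rot_B : half_map (- alpha) (- beta) (V (other za)) (Phi (other za)) (sgn za) s0 Tb Rb;
  rot_boxA : forall s t, 0 < s < s0 -> 0 <= t <= Ta s ->
    dsup (1, 1) (Phi za t (Defs.sigma alpha beta s)) <= d;
  rot_boxB : forall s t, 0 < s < s0 -> 0 <= t <= Tb s ->
    dsup (1, 1) (Phi (other za) t (Defs.sigma (- alpha) (- beta) s)) <= d;
  rot_transA : forall s j, 0 < s < s0 -> 0 < sgn za * lie alpha beta (V j) (Defs.sigma alpha beta s);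
  rot_transB : forall s j, 0 < s < s0 ->
    0 < sgn (other za) * lie alpha beta (V j) (Defs.sigma alpha beta (- s))
}.

Arguments rot_pos {alpha beta V Phi za d s0 Ta Ra Tb Rb} _.
Arguments rot_A {alpha beta V Phi za d s0 Ta Ra Tb Rb} _.
Arguments rot_B {alpha beta V Phi za d s0 Ta Ra Tb Rb} _.
Arguments rot_boxA {alpha beta V Phi za d s0 Ta Ra Tb Rb} _.
Arguments rot_boxB {alpha beta V Phi za d s0 Ta Ra Tb Rb} _.
Arguments rot_transA {alpha beta V Phi za d s0 Ta Ra Tb Rb} _.
Arguments rot_transB {alpha beta V Phi za d s0 Ta Ra Tb Rb} _.

Lemma half_map_shrink alpha beta V Phi c s0 s0' Tf Rf : s0' <= s0 ->
  half_map alpha beta V Phi c s0 Tf Rf -> half_map alpha beta V Phi c s0' Tf Rf.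
Proof.
  intros Hle H. constructor.
  - intros s Hs. apply (hm_arc H). lra.
  - intros s Hs. apply (hm_in H). lra.
  - intros s Hs. apply (hm_out H). lra.
  - intros rho Hr. destruct (hm_small H rho Hr) as [s1 [H1 H2]].
    exists s1. split; [exact H1|]. intros s Hs1 Hs2. apply H2; lra.
Qed.

(** Arcs run backwards: the half map of the opposite field is the inverse. *)
Lemma half_map_rev alpha beta V Phi L c s0 Tf Rf : beta <> 0 -> flow V Phi L -> 0 < s0 ->
  half_map alpha beta V Phi c s0 Tf Rf ->
  exists s0' Tf' Rf', 0 < s0' /\
    half_map (- alpha) (- beta) (fun p => vopp (V p)) (fun t p => Phi (- t) p) (- c) s0' Tf' Rf' /\
    forall u, 0 < u < s0' -> 0 < - Rf' u < s0 /\ Rf (- Rf' u) = - u.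
Proof.
  intros Hb F Hs0 H.
  assert (Hm : 0 < s0 / 2 < s0) by lra.
  destruct (choice (fun u s => 0 < u < - Rf (s0 / 2) -> 0 < s < s0 / 2 /\ Rf s = - u)) as [g Hg].
  { intros u. destruct (classic (0 < u < - Rf (s0 / 2))) as [Hu|Hn]; [|exists 0; tauto].
    destruct (half_surj Hb F H (s0 / 2) (- u) Hm) as [s [A1 A2]]; [lra|].
    exists s. intros _. split; assumption. }
  exists (- Rf (s0 / 2)), (fun u => Tf (g u)), (fun u => - g u).
  destruct (hm_arc H _ Hm) as [_ [Hneg _]].
  split; [lra|]. split; [|intros u Hu; destruct (Hg u Hu); rewrite Ropp_involutive; split; lra].
  assert (Hback : forall u t, 0 < u < - Rf (s0 / 2) ->
    Phi (- t) (Defs.sigma (- alpha) (- beta) u) = Phi (Tf (g u) - t) (Defs.sigma alpha beta (g u))).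
  { intros u t Hu. destruct (Hg u Hu) as [G1 G2].
    destruct (hm_arc H (g u) ltac:(lra)) as [_ [_ [A3 _]]].
    rewrite sigma_opp, <- G2, <- A3, <- (flow_add F). f_equal. ring. }
  constructor.
  - intros u Hu. destruct (Hg u Hu) as [G1 G2].
    destruct (hm_arc H (g u) ltac:(lra)) as [A1 [A2 [A3 A4]]].
    split; [exact A1|]. split; [lra|]. split.
    + rewrite Hback by exact Hu. rewrite Rminus_diag, (fl_0 F), sigma_opp. f_equal. ring.
    + intros t Ht. rewrite Hback by exact Hu. rewrite h_opp. specialize (A4 (Tf (g u) - t) ltac:(lra)). lra.
  - intros u Hu. destruct (Hg u Hu) as [G1 G2].
    pose proof (hm_out H (g u) ltac:(lra)) as A.
    rewrite lie_opp, lie_vopp, sigma_opp, <- G2. lra.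
  - intros u Hu. destruct (Hg u Hu) as [G1 G2].
    pose proof (hm_in H (g u) ltac:(lra)) as A.
    rewrite lie_opp, lie_vopp, sigma_opp, !Ropp_involutive. lra.
  - intros rho Hr. destruct (hm_small H rho Hr) as [s1 [H1 H2]].
    set (s2 := Rmin s1 s0 / 2).
    assert (Hs2 : 0 < s2 /\ s2 < s1 /\ s2 < s0).
    { pose proof (Rmin_pos s1 s0 H1 Hs0). pose proof (Rmin_l s1 s0). pose proof (Rmin_r s1 s0). unfold s2. lra. }
    destruct (hm_arc H s2 ltac:(lra)) as [_ [Hneg2 _]].
    exists (- Rf s2). split; [lra|]. intros u Hu Hu2 t Ht.
    destruct (Hg u ltac:(lra)) as [G1 G2].
    rewrite Hback by lra. apply H2; [|lra|lra]. split; [lra|].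
    apply Rlt_trans with s2; [|lra]. apply Rnot_le_lt. intros Hle.
    assert (Rf (g u) <= Rf s2); [|lra].
    destruct Hle as [Hlt| <-]; [|lra]. left. apply (half_decr Hb F H); lra.
Qed.

Section Rotation.

Variables (alpha beta : R) (X V : zone -> R * R -> R * R) (Phi : zone -> R -> R * R -> R * R).
Variables (L d0 d s0 : R) (za : zone) (Ta Ra Tb Rb : R -> R).
Hypothesis beta_neq0 : beta <> 0.
Hypothesis F : forall i, flow (V i) (Phi i) L.
Hypothesis V_eq : forall i p, dsup (1, 1) p < d0 -> V i p = X i p.
Hypothesis d_d0 : d < d0.
Hypothesis d0_pos : 0 < d0.
Hypothesis ROT : rotation alpha beta V Phi za d s0 Ta Ra Tb Rb.

Local Notation h := (Defs.h alpha beta).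
Local Notation sigma := (Defs.sigma alpha beta).
Local Notation lie := (lie alpha beta).
Local Notation region := (region alpha beta).

Let HA := rot_A ROT.
Let HB := rot_B ROT.

(** A trajectory never meets [(1, 1)], where both fields are tangent to the line. *)
Lemma gtraj_avoids gamma (a b : Rbar) (t : R) : gtraj alpha beta X a b gamma ->
  Rbar_lt a t -> Rbar_lt t b -> gamma t <> (1, 1).
Proof.
  intros G Ha Hb E. destruct (G t Ha Hb) as [_ [_ Hc]]. rewrite E in Hc.
  destruct Hc as [i [Hi _]]; [unfold Defs.h; simpl; ring|].
  specialize (Hi za).
  assert (EV : lie (X za) (1, 1) = lie (V za) (1, 1)).
  { unfold Submission.lie. rewrite V_eq; [reflexivity|]. rewrite dsup_refl. exact d0_pos. }
  rewrite EV in Hi.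
  destruct (lie_near alpha beta (V za) (Phi za) L (1, 1) _ (F za) Hi) as [e [He Hn]].
  pose proof (rot_pos ROT) as Hs0.
  set (K := Rabs alpha + Rabs beta).
  assert (HK : 0 <= K) by (unfold K; pose proof (Rabs_pos alpha); pose proof (Rabs_pos beta); lra).
  set (s := Rmin s0 (e / (K + 1)) / 2).
  assert (Hs : 0 < s < s0 /\ K * s < e).
  { assert (0 < e / (K + 1)) by (apply Rdiv_lt_0_compat; lra).
    pose proof (Rmin_pos s0 (e / (K + 1)) Hs0 ltac:(lra)). pose proof (Rmin_l s0 (e / (K + 1))).
    pose proof (Rmin_r s0 (e / (K + 1))). split; [unfold s; lra|].
    assert (Hle : s < e / (K + 1)) by (unfold s; lra). apply Rlt_div_r in Hle; [|lra]. unfold s in *. lra. }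
  assert (Hd : forall x, Rabs x = s -> dsup (1, 1) (sigma x) < e).
  { intros x Hx. rewrite <- (sigma_0 alpha beta). eapply Rle_lt_trans; [apply sigma_dsup|].
    rewrite Rminus_0_r, Hx. fold K. lra. }
  pose proof (Hn (sigma s) (Hd s ltac:(apply Rabs_pos_eq; lra))) as N1.
  pose proof (Hn (sigma (- s)) (Hd (- s) ltac:(rewrite Rabs_Ropp; apply Rabs_pos_eq; lra))) as N2.
  pose proof (rot_transA ROT s za (proj1 Hs)) as T1.
  pose proof (rot_transB ROT s za (proj1 Hs)) as T2.
  rewrite sgn_other in T2. apply Rabs_lt_between in N1, N2.
  destruct (sgn_pm i) as [Ei|Ei], (sgn_pm za) as [Ez|Ez]; rewrite Ei in *; rewrite Ez in *; lra.
Qed.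

Lemma arc_follow gamma (a b : Rbar) (t0 : R) i p T : gtraj alpha beta X a b gamma ->
  Rbar_lt a t0 -> gamma t0 = p ->
  region i p \/ (h p = 0 /\ 0 < sgn i * lie (V i) p) ->
  (forall t, 0 < t < T -> region i (Phi i t p)) ->
  (forall t, 0 <= t <= T -> dsup (1, 1) (Phi i t p) <= d) ->
  forall t, 0 <= t <= T -> Rbar_lt (t0 + t) b -> gamma (t0 + t) = Phi i t p.
Proof.
  intros G Ha Hp Hent Hreg Hbox t Ht Hb.
  apply (follow alpha beta X V Phi L d0 F V_eq gamma a b t0 i p t); auto; try lra.
  - destruct Hent as [Hr|[Hh Hl]]; [left; exact Hr|right; split; [exact Hh|]].
    unfold Submission.lie in *. rewrite <- V_eq; [exact Hl|].
    specialize (Hbox 0 ltac:(lra)). rewrite (fl_0 (F i)) in Hbox. lra.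
  - intros u Hu. apply Hreg. lra.
  - intros u Hu. specialize (Hbox u ltac:(lra)). lra.
Qed.

Lemma arcA s : 0 < s < s0 -> 0 < Ta s /\ Ra s < 0 /\ Phi za (Ta s) (sigma s) = sigma (Ra s) /\
  (forall t, 0 < t < Ta s -> region za (Phi za t (sigma s))).
Proof.
  intros Hs. destruct (hm_arc HA s Hs) as [A1 [A2 [A3 A4]]]. auto.
Qed.

Lemma arcB u : 0 < u < s0 -> 0 < Tb u /\ Rb u < 0 /\
  Phi (other za) (Tb u) (sigma (- u)) = sigma (- Rb u) /\
  (forall t, 0 < t < Tb u -> region (other za) (Phi (other za) t (sigma (- u)))).
Proof.
  intros Hs. destruct (hm_arc HB u Hs) as [A1 [A2 [A3 A4]]].
  rewrite !sigma_opp in A3. split; [exact A1|]. split; [exact A2|]. split; [exact A3|].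
  intros t Ht. specialize (A4 t Ht). rewrite h_opp, sigma_opp in A4. unfold Defs.region.
  rewrite sgn_other. lra.
Qed.

Section Trap.

Variable u0 : R.
Hypothesis u0_range : 0 < u0 < s0.
Hypothesis b0_range : - Rb u0 < s0.
Hypothesis return_inside : - Ra (- Rb u0) <= u0.

Let inside x := - u0 < x < 0 \/ 0 < x < - Rb u0.

(** Without (1, 1), the open segment between [sigma (- u0)] and its first image
    is mapped into itself by both half maps, because they are decreasing. *)
Lemma inside_arc x : inside x -> exists i T x', inside x' /\ 0 < T /\
  0 < sgn i * lie (V i) (sigma x) /\
  Phi i T (sigma x) = sigma x' /\ (forall t, 0 < t < T -> region i (Phi i t (sigma x))) /\
  (forall t, 0 <= t <= T -> dsup (1, 1) (Phi i t (sigma x)) <= d).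
Proof.
  assert (Hmb : - beta <> 0) by lra.
  intros [Hx|Hx].
  - set (u := - x). assert (Ex : x = - u) by (unfold u; ring). rewrite Ex in *. clearbody u.
    destruct (arcB u ltac:(lra)) as [A1 [A2 [A3 A4]]].
    exists (other za), (Tb u), (- Rb u).
    split; [|split; [exact A1|split; [|split; [exact A3|split; [exact A4|]]]]].
    + right. split; [lra|].
      pose proof (half_decr Hmb (F (other za)) HB u u0 ltac:(lra) ltac:(lra) ltac:(lra)). lra.
    + apply (rot_transB ROT). lra.
    + intros t Ht. rewrite <- sigma_opp. apply (rot_boxB ROT); [lra|exact Ht].
  - destruct (arcA x ltac:(lra)) as [A1 [A2 [A3 A4]]].
    exists za, (Ta x), (Ra x).
    split; [|split; [exact A1|split; [|split; [exact A3|split; [exact A4|]]]]].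
    + left. split; [|lra].
      pose proof (half_decr beta_neq0 (F za) HA x (- Rb u0) ltac:(lra) ltac:(lra) ltac:(lra)). lra.
    + apply (rot_transA ROT). lra.
    + intros t Ht. apply (rot_boxA ROT); [lra|exact Ht].
Qed.

(** Each crossing is followed by one inside the segment, and crossings cannot
    accumulate, since a trajectory meets the line at isolated times. *)
Lemma trap gamma (a b : Rbar) (t0 t1 : R) x : gtraj alpha beta X a b gamma ->
  Rbar_lt a t0 -> t0 <= t1 -> Rbar_lt t1 b -> inside x -> gamma t0 = sigma x ->
  gamma t1 <> sigma (- u0).
Proof.
  intros G Ha Ht Hb Hx H0 H1.
  set (C := fun t => t0 <= t <= t1 /\ exists x, inside x /\ gamma t = sigma x).
  destruct (completeness C) as [m [Hub Hlub]].
  { exists t1. intros t [Hc _]. lra. }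
  { exists t0. split; [lra|]. exists x. split; assumption. }
  assert (Hm0 : t0 <= m) by (apply Hub; split; [lra|]; exists x; split; assumption).
  assert (Hm1 : m <= t1) by (apply Hlub; intros t [Hc _]; lra).
  assert (Ham : Rbar_lt a m) by (destruct a; simpl in *; auto; lra).
  assert (Hdom : forall t, t <= t1 -> Rbar_lt t b) by (intros t Hle; destruct b; simpl in *; auto; lra).
  destruct (classic (C m)) as [[_ [y [Hy Ey]]]|Hn].
  - destruct (inside_arc y Hy) as [i [T [y' [Hy' [HT [Hl [Hend [Hreg Hbox]]]]]]]].
    assert (Hf : forall t, 0 <= t <= T -> m + t <= t1 -> gamma (m + t) = Phi i t (sigma y)).
    { intros t Htt Hle. apply (arc_follow gamma a b m i (sigma y) T); auto.
      right. split; [apply h_sigma|exact Hl]. }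
    destruct (Rle_dec (m + T) t1) as [Hle|Hgt].
    + assert (m + T <= m); [|lra]. apply Hub. split; [lra|]. exists y'. split; [exact Hy'|].
      rewrite Hf by lra. exact Hend.
    + pose proof (Hf (t1 - m) ltac:(lra) ltac:(lra)) as Hf1.
      replace (m + (t1 - m)) with t1 in Hf1 by ring. rewrite H1 in Hf1.
      destruct (Req_dec t1 m) as [E|Hne].
      * rewrite E, Rminus_diag, (fl_0 (F i)) in Hf1. apply sigma_inj in Hf1; [|exact beta_neq0].
        destruct Hy; lra.
      * specialize (Hreg (t1 - m) ltac:(lra)). rewrite <- Hf1 in Hreg. unfold Defs.region in Hreg.
        rewrite h_sigma in Hreg. lra.
  - assert (Hacc : forall e, 0 < e -> exists t, m - e < t < m /\ h (gamma t) = 0).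
    { intros e He. apply NNPP. intros Hno.
      assert (m <= m - e); [|lra]. apply Hlub. intros t Hct.
      apply Rnot_lt_le. intros Hlt. apply Hno. exists t.
      pose proof (Hub t Hct). destruct (Req_dec t m) as [E|Hne]; [rewrite E in Hct; contradiction|].
      split; [lra|]. destruct Hct as [_ [y [_ ->]]]. apply h_sigma. }
    destruct (G m Ham (Hdom m Hm1)) as [Hcont [_ Hcr]].
    assert (Hhm : h (gamma m) = 0).
    { apply continuous_cts in Hcont. apply (h_continuity alpha beta gamma m) in Hcont.
      destruct (Req_dec (h (gamma m)) 0) as [E|Hne]; [exact E|]. exfalso.
      apply continuity_pt_locally with (eps := mkposreal _ (Rabs_pos_lt _ Hne)) in Hcont.
      destruct Hcont as [e He]. destruct (Hacc e (cond_pos e)) as [t [Htm Hht]].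
      assert (Hbt : Rabs (t - m) < e) by (apply Rabs_lt_between; lra).
      specialize (He t Hbt). simpl in He. rewrite Hht, Rminus_0_l, Rabs_Ropp in He. lra. }
    destruct (Hcr Hhm) as [i [_ [Hleft _]]]. apply at_left_iff in Hleft. destruct Hleft as [e [He Hl]].
    destruct (Hacc e He) as [t [Htm Hht]]. specialize (Hl t ltac:(lra)). unfold Defs.region in Hl.
    rewrite Hht in Hl. lra.
Qed.

(** Every point near (1, 1) other than (1, 1) lies on an arc that ends in the
    trap, or is itself in the trap; (1, 1) is not met by trajectories. *)
Lemma no_return : exists eps, 0 < eps /\ forall gamma (a b : Rbar) (t0 t1 : R),
  gtraj alpha beta X a b gamma -> Rbar_lt a t0 -> t0 <= t1 -> Rbar_lt t1 b ->
  dsup (1, 1) (gamma t0) < eps -> gamma t1 <> sigma (- u0).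
Proof.
  assert (Hmb : - beta <> 0) by lra.
  destruct (arcB u0 u0_range) as [_ [Hb0 _]].
  destruct (half_fill beta_neq0 (F za) HA (- Rb u0)) as [e1 [E1 H1]]; [lra|].
  destruct (half_fill Hmb (F (other za)) HB u0 u0_range) as [e2 [E2 H2]].
  assert (Hbp : 0 < Rabs beta) by (apply Rabs_pos_lt; assumption).
  set (m := Rmin u0 (- Rb u0)).
  assert (Hm : 0 < m /\ m <= u0 /\ m <= - Rb u0).
  { unfold m. split; [apply Rmin_pos; lra|]. split; [apply Rmin_l|apply Rmin_r]. }
  exists (Rmin (Rmin e1 e2) (Rabs beta * m)).
  split; [repeat apply Rmin_pos; try assumption; apply Rmult_lt_0_compat; lra|].
  intros gamma a b t0 t1 G Ha Ht Hb Hd.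
  pose proof (Rmin_l (Rmin e1 e2) (Rabs beta * m)). pose proof (Rmin_r (Rmin e1 e2) (Rabs beta * m)).
  pose proof (Rmin_l e1 e2). pose proof (Rmin_r e1 e2).
  assert (Hdom : forall t, t <= t1 -> Rbar_lt t b) by (intros t Hle; destruct b; simpl in *; auto; lra).
  (* the rest of an arc, then the trap *)
  assert (finish : forall i p q T t x, p = Phi i t q -> 0 < t < T -> gamma t0 = p -> region i p ->
    Phi i T q = sigma x -> (forall v, 0 < v < T -> region i (Phi i v q)) ->
    (forall v, 0 <= v <= T -> dsup (1, 1) (Phi i v q) <= d) -> inside x -> gamma t1 <> sigma (- u0)).
  { intros i p q T t x Ep Htt Hp Hr Hend Hreg Hbox Hin.
    assert (Hsh : forall v, Phi i v p = Phi i (v + t) q).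
    { intros v. rewrite Ep, <- (flow_add (F i)). reflexivity. }
    assert (Hf : forall v, 0 <= v <= T - t -> t0 + v <= t1 -> gamma (t0 + v) = Phi i (v + t) q).
    { intros v Hv Hle. rewrite <- Hsh. apply (arc_follow gamma a b t0 i p (T - t)); auto.
      - intros w Hw. rewrite Hsh. apply Hreg. lra.
      - intros w Hw. rewrite Hsh. apply Hbox. lra. }
    destruct (Rle_dec (t0 + (T - t)) t1) as [Hle|Hgt].
    - apply (trap gamma a b (t0 + (T - t)) t1 x); auto.
      + destruct a; simpl in *; auto. lra.
      + rewrite Hf by lra. replace (T - t + t) with T by ring. exact Hend.
    - intros Eq. pose proof (Hf (t1 - t0) ltac:(lra) ltac:(lra)) as Hf1.
      replace (t0 + (t1 - t0)) with t1 in Hf1 by ring. rewrite Eq in Hf1.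
      specialize (Hreg (t1 - t0 + t) ltac:(lra)). rewrite <- Hf1 in Hreg.
      unfold Defs.region in Hreg. rewrite h_sigma in Hreg. lra. }
  destruct (Req_dec (h (gamma t0)) 0) as [Hh|Hh].
  - pose proof (h_zero_sigma alpha beta _ beta_neq0 Hh) as Es.
    set (x := (fst (gamma t0) - 1) / beta) in Es.
    assert (Hx0 : x <> 0).
    { intros E. rewrite E, sigma_0 in Es. revert Es. apply (gtraj_avoids gamma a b t0 G Ha). apply Hdom, Ht. }
    assert (Hxm : Rabs x < m).
    { rewrite Es, <- (sigma_0 alpha beta) in Hd. pose proof (proj1 (sigma_dsup alpha beta 0 x)) as B.
      rewrite Rminus_0_r in B. apply Rmult_lt_reg_l with (Rabs beta); [exact Hbp|]. lra. }
    apply Rabs_lt_between in Hxm.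
    apply (trap gamma a b t0 t1 x); auto. unfold inside. lra.
  - assert (Hreg : region za (gamma t0) \/ region (other za) (gamma t0)).
    { unfold Defs.region. rewrite sgn_other. destruct (sgn_pm za) as [E|E]; rewrite E; lra. }
    destruct Hreg as [Hreg|Hreg].
    + destruct (H1 (gamma t0)) as [s [t [Hs [Htt Ep]]]]; [lra|exact Hreg|].
      destruct (arcA s ltac:(lra)) as [A1 [A2 [A3 A4]]].
      apply (finish za (gamma t0) (sigma s) (Ta s) t (Ra s)); auto.
      * intros v Hv. apply (rot_boxA ROT); [lra|exact Hv].
      * left. split; [|lra].
        pose proof (half_decr beta_neq0 (F za) HA s (- Rb u0) ltac:(lra) ltac:(lra) ltac:(lra)). lra.
    + destruct (H2 (gamma t0)) as [u [t [Hu [Htt Ep]]]]; [lra| |].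
      { rewrite h_opp. unfold Defs.region in Hreg. rewrite sgn_other in Hreg. lra. }
      rewrite sigma_opp in Ep. destruct (arcB u ltac:(lra)) as [A1 [A2 [A3 A4]]].
      apply (finish (other za) (gamma t0) (sigma (- u)) (Tb u) t (- Rb u)); auto.
      * intros v Hv. rewrite <- sigma_opp. apply (rot_boxB ROT); [lra|exact Hv].
      * right. split; [lra|].
        pose proof (half_decr Hmb (F (other za)) HB u u0 ltac:(lra) ltac:(lra) ltac:(lra)). lra.
Qed.

End Trap.

(** The return map of the reversed system is the inverse return map. *)
Lemma rotation_rev : exists s0' Ta' Ra' Tb' Rb', s0' <= s0 /\
  rotation alpha beta (fun i p => vopp (V i p)) (fun i t p => Phi i (- t) p) (other za) d s0' Ta' Ra' Tb' Rb' /\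
  (forall u, 0 < u < s0' -> 0 < - Rb' u < s0 /\ Ra (- Rb' u) = - u) /\
  (forall s, 0 < s < s0' -> 0 < - Ra' s < s0 /\ Rb (- Ra' s) = - s).
Proof.
  assert (Hmb : - beta <> 0) by lra.
  pose proof (rot_pos ROT) as Hs0.
  destruct (half_map_rev _ _ _ _ _ _ _ _ _ beta_neq0 (F za) Hs0 HA) as [sB [Tb' [Rb' [HsB [MB IB]]]]].
  destruct (half_map_rev _ _ _ _ _ _ _ _ _ Hmb (F (other za)) Hs0 HB) as [sA [Ta' [Ra' [HsA [MA IA]]]]].
  rewrite !Ropp_involutive in MA.
  assert (Hd : 0 < d).
  { pose proof (rot_boxA ROT (s0 / 2) 0 ltac:(lra)) as Hbox.
    destruct (arcA (s0 / 2) ltac:(lra)) as [A1 _]. specialize (Hbox ltac:(lra)).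
    rewrite (fl_0 (F za)), <- (sigma_0 alpha beta) in Hbox.
    pose proof (proj1 (sigma_dsup alpha beta 0 (s0 / 2))) as B. rewrite Rminus_0_r in B.
    assert (0 < Rabs beta * Rabs (s0 / 2)) by (apply Rmult_lt_0_compat; apply Rabs_pos_lt; lra). lra. }
  destruct (hm_small MB d Hd) as [s1 [Hs1 BoxB]]. destruct (hm_small MA d Hd) as [s2 [Hs2 BoxA]].
  destruct (exists_below (s0 :: sA :: sB :: s1 :: s2 :: nil)) as [m [Hm Hl]].
  { simpl. intros x [<-|[<-|[<-|[<-|[<-|[]]]]]]; assumption. }
  assert (M1 : m <= s0) by (apply Hl; simpl; tauto).
  assert (M2 : m <= sA) by (apply Hl; simpl; tauto).
  assert (M3 : m <= sB) by (apply Hl; simpl; tauto).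
  assert (M4 : m <= s1) by (apply Hl; simpl; tauto).
  assert (M5 : m <= s2) by (apply Hl; simpl; tauto).
  exists m, Ta', Ra', Tb', Rb'. split; [exact M1|]. split; [|split].
  - constructor; rewrite ?other_other, ?sgn_other.
    + exact Hm.
    + apply (half_map_shrink _ _ _ _ _ sA); [exact M2|exact MA].
    + apply (half_map_shrink _ _ _ _ _ sB); [exact M3|exact MB].
    + intros s t Hs Ht. left. apply BoxA; lra.
    + intros s t Hs Ht. left. apply BoxB; lra.
    + intros s j Hs. rewrite lie_vopp.
      pose proof (rot_transA ROT s j ltac:(lra)). lra.
    + intros s j Hs. rewrite lie_vopp.
      pose proof (rot_transB ROT s j ltac:(lra)) as HT. rewrite sgn_other in HT. lra.
  - intros u Hu. apply IB. lra.
  - intros s Hs. destruct (IA s ltac:(lra)) as [I1 I2]. split; [exact I1|exact I2].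
Qed.

End Rotation.

(** Attraction of all nearby points forces the return map to move inwards: if
    some point were not moved inwards, the inverse return map would preserve the
    segment it bounds, and following a trajectory from a small neighbourhood of
    [(1, 1)] back in time could not lead to that point. *)
Theorem stable_contracting alpha beta X V Phi L d0 d s0 za Ta Ra Tb Rb :
  beta <> 0 -> (forall i, flow (V i) (Phi i) L) ->
  (forall i p, dsup (1, 1) p < d0 -> V i p = X i p) -> d < d0 -> 0 < d0 ->
  rotation alpha beta V Phi za d s0 Ta Ra Tb Rb ->
  gstable alpha beta X (eq (1, 1)) ->
  exists u1, 0 < u1 /\ forall u, 0 < u < u1 -> u < s0 -> - Rb u < s0 -> - Ra (- Rb u) < u.
Proof.
  intros Hb F Veq Hd Hd0 ROT [delta [Hdelta Hst]].
  assert (Hmb : - beta <> 0) by lra.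
  destruct (rotation_rev alpha beta V Phi L d s0 za Ta Ra Tb Rb Hb F ROT)
    as [s0' [Ta' [Ra' [Tb' [Rb' [Hs0' [ROT' [IB IA]]]]]]]].
  set (F' := fun i => flow_rev _ _ _ (F i)).
  assert (Veq' : forall i p, dsup (1, 1) p < d0 -> vopp (V i p) = xopp X i p).
  { intros i p Hp. unfold xopp. rewrite Veq by exact Hp. reflexivity. }
  pose proof (rot_pos ROT') as Hp'.
  destruct (half_lim Hmb (rot_B ROT') s0' Hp') as [sl [Hsl Hlim]].
  set (K := Rabs alpha + Rabs beta).
  assert (HK : 0 < K).
  { unfold K. pose proof (Rabs_pos alpha). pose proof (Rabs_pos_lt beta Hb). lra. }
  destruct (exists_below (s0' :: sl :: delta / K :: nil)) as [u1 [Hu1 Hl]].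
  { simpl. intros x [<-|[<-|[<-|[]]]]; try assumption. apply Rdiv_lt_0_compat; assumption. }
  assert (M1 : u1 <= s0') by (apply Hl; simpl; tauto).
  assert (M2 : u1 <= sl) by (apply Hl; simpl; tauto).
  assert (M3 : u1 <= delta / K) by (apply Hl; simpl; tauto).
  exists u1. split; [exact Hu1|]. intros u Hu Hus0 Hbs0.
  apply Rnot_le_lt. intros Hge.
  (* the inverse return map moves [u] inwards *)
  destruct (IB u ltac:(lra)) as [I1 I2]. set (s := - Rb' u) in *.
  assert (Hs : 0 < s < s0') by (specialize (Hlim u ltac:(lra) ltac:(lra)); unfold s in *; lra).
  destruct (IA s Hs) as [I3 I4]. set (u' := - Ra' s) in *.
  rewrite ?other_other in *.
  pose proof (rot_A ROT) as HA. pose proof (rot_B ROT) as HB.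
  destruct (hm_arc HB u ltac:(lra)) as [_ [Hbneg _]].
  assert (Hle : u' <= u).
  { apply Rnot_lt_le. intros Hlt.
    pose proof (half_decr Hmb (F (other za)) HB u u' ltac:(lra) Hlt ltac:(lra)) as D1.
    pose proof (half_decr Hb (F za) HA (- Rb u) s ltac:(lra) ltac:(lra) ltac:(lra)) as D2.
    lra. }
  destruct (no_return alpha beta (xopp X) (fun i p => vopp (V i p)) (fun i t p => Phi i (- t) p)
    L d0 d s0' (other za) Ta' Ra' Tb' Rb' Hb F' Veq' Hd Hd0 ROT' u ltac:(lra)) as [eps [Heps Hno]].
  { fold s. lra. }
  { fold s. fold u'. exact Hle. }
  destruct (Hst (Defs.sigma alpha beta (- u))) as [gamma [a [b [Ha [Hbb [G [G0 Hlimit]]]]]]].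
  { rewrite <- (sigma_0 alpha beta). intros E. apply sigma_inj in E; [lra|exact Hb]. }
  { apply near_dsup. exists (1, 1). split; [reflexivity|]. rewrite <- (sigma_0 alpha beta).
    eapply Rle_lt_trans; [apply sigma_dsup|]. fold K.
    rewrite Rminus_0_r, Rabs_Ropp, Rabs_pos_eq by lra.
    assert (Hlt : u < delta / K) by lra. apply Rlt_div_r in Hlt; [|exact HK]. lra. }
  destruct (Hlimit eps Heps) as [t0 [Ht0 [Ht0b Hnear]]].
  assert (Hex : exists t, t0 < t /\ Rbar_lt t b).
  { destruct b as [b| |]; simpl in *; [exists ((t0 + b) / 2); lra|exists (t0 + 1); split; [lra|exact I]|contradiction]. }
  destruct Hex as [t [Ht Htb]]. specialize (Hnear t Ht Htb). apply near_dsup in Hnear.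
  destruct Hnear as [q [<- Hq]].
  assert (Ht1 : - t <= 0) by lra.
  apply (Hno (fun t => gamma (- t)) (Rbar_opp b) (Rbar_opp a) (- t) 0).
  - apply gtraj_rev. exact G.
  - destruct b; simpl in *; auto; lra.
  - exact Ht1.
  - destruct a; simpl in *; auto; lra.
  - rewrite Ropp_involutive. exact Hq.
  - rewrite Ropp_0. exact G0.
Qed.

(** * Smooth families *)

(** Families [G e x y] whose partial derivatives in [x] and [y] up to order [n]
    are jointly continuous in all three variables. Witnesses for the derivatives
    make the closure properties inductive. *)
Fixpoint famC (n : nat) (G : R -> R -> R -> R) : Prop :=
  (forall e x y, continuous (fun q : R * (R * R) => G (fst q) (fst (snd q)) (snd (snd q))) (e, (x, y))) /\
  match n with
  | O => True
  | S n => exists Gx Gy : R -> R -> R -> R,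
      (forall e x y, is_derive (fun t => G e t y) x (Gx e x y)) /\
      (forall e x y, is_derive (fun t => G e x t) y (Gy e x y)) /\
      famC n Gx /\ famC n Gy
  end.

Definition smooth_family (G : R -> R -> R -> R) : Prop := forall n, famC n G.

Lemma famC_continuous n G e x y : famC n G ->
  continuous (fun q : R * (R * R) => G (fst q) (fst (snd q)) (snd (snd q))) (e, (x, y)).
Proof. destruct n; intros [H _]; apply H. Qed.

Lemma famC_pred n G : famC (S n) G -> famC n G.
Proof.
  revert G. induction n as [|n IH]; intros G [H1 [Gx [Gy [H2 [H3 [H4 H5]]]]]]; split; auto.
  exists Gx, Gy. auto.
Qed.

Lemma famC_const c n : famC n (fun _ _ _ => c).
Proof.
  revert c. induction n as [|n IH]; intros c; (split; [intros; apply continuous_const|]); [exact I|].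
  exists (fun _ _ _ => 0), (fun _ _ _ => 0).
  split; [intros; apply (is_derive_const c)|]. split; [intros; apply (is_derive_const c)|]. auto.
Qed.

Lemma famC_e n : famC n (fun e _ _ => e).
Proof.
  destruct n as [|n]; (split; [intros; apply (continuous_fst (U := R_UniformSpace))|]); [exact I|].
  exists (fun _ _ _ => 0), (fun _ _ _ => 0).
  split; [intros e x y; apply (is_derive_const e)|]. split; [intros e x y; apply (is_derive_const e)|].
  auto using famC_const.
Qed.

Lemma famC_x n : famC n (fun _ x _ => x).
Proof.
  assert (C : forall e x y, continuous (fun q : R * (R * R) => fst (snd q)) (e, (x, y))).
  { intros e x y. apply (continuous_comp (fun q : R * (R * R) => snd q) (fun r : R * R => fst r));
      [apply continuous_snd|apply continuous_fst]. }
  destruct n as [|n]; (split; [exact C|]); [exact I|].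
  exists (fun _ _ _ => 1), (fun _ _ _ => 0).
  split; [intros e x y; apply (is_derive_id x)|]. split; [intros e x y; apply (is_derive_const x)|].
  auto using famC_const.
Qed.

Lemma famC_y n : famC n (fun _ _ y => y).
Proof.
  assert (C : forall e x y, continuous (fun q : R * (R * R) => snd (snd q)) (e, (x, y))).
  { intros e x y. apply (continuous_comp (fun q : R * (R * R) => snd q) (fun r : R * R => snd r));
      apply continuous_snd. }
  destruct n as [|n]; (split; [exact C|]); [exact I|].
  exists (fun _ _ _ => 0), (fun _ _ _ => 1).
  split; [intros e x y; apply (is_derive_const y)|]. split; [intros e x y; apply (is_derive_id y)|].
  auto using famC_const.
Qed.

Lemma famC_plus n G H : famC n G -> famC n H -> famC n (fun e x y => G e x y + H e x y).
Proof.
  revert G H. induction n as [|n IH]; intros G H HG HH.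
  - split; [|exact I]. intros e x y.
    apply (continuous_plus (fun q : R * (R * R) => G (fst q) (fst (snd q)) (snd (snd q)))
      (fun q => H (fst q) (fst (snd q)) (snd (snd q)))); [apply HG|apply HH].
  - destruct HG as [G0 [Gx [Gy [G1 [G2 [G3 G4]]]]]], HH as [H0 [Hx [Hy [H1 [H2 [H3 H4]]]]]].
    split.
    + intros e x y.
      apply (continuous_plus (fun q : R * (R * R) => G (fst q) (fst (snd q)) (snd (snd q)))
        (fun q => H (fst q) (fst (snd q)) (snd (snd q)))); [apply G0|apply H0].
    + exists (fun e x y => Gx e x y + Hx e x y), (fun e x y => Gy e x y + Hy e x y).
      split; [|split; [|split; apply IH; assumption]].
      * intros e x y. apply (is_derive_plus (fun t => G e t y) (fun t => H e t y)); auto.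
      * intros e x y. apply (is_derive_plus (fun t => G e x t) (fun t => H e x t)); auto.
Qed.

Lemma famC_mult n G H : famC n G -> famC n H -> famC n (fun e x y => G e x y * H e x y).
Proof.
  revert G H. induction n as [|n IH]; intros G H HG HH.
  - split; [|exact I]. intros e x y.
    apply (continuous_mult (fun q : R * (R * R) => G (fst q) (fst (snd q)) (snd (snd q)))
      (fun q => H (fst q) (fst (snd q)) (snd (snd q)))); [apply HG|apply HH].
  - pose proof (famC_pred _ _ HG) as HG'. pose proof (famC_pred _ _ HH) as HH'.
    destruct HG as [G0 [Gx [Gy [G1 [G2 [G3 G4]]]]]], HH as [H0 [Hx [Hy [H1 [H2 [H3 H4]]]]]].
    split.
    + intros e x y.
      apply (continuous_mult (fun q : R * (R * R) => G (fst q) (fst (snd q)) (snd (snd q)))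
        (fun q => H (fst q) (fst (snd q)) (snd (snd q)))); [apply G0|apply H0].
    + exists (fun e x y => Gx e x y * H e x y + G e x y * Hx e x y),
        (fun e x y => Gy e x y * H e x y + G e x y * Hy e x y).
      split; [|split; [|split; apply famC_plus; apply IH; assumption]].
      * intros e x y. apply (is_derive_mult (fun t => G e t y) (fun t => H e t y)); auto.
        intros u v. apply Rmult_comm.
      * intros e x y. apply (is_derive_mult (fun t => G e x t) (fun t => H e x t)); auto.
        intros u v. apply Rmult_comm.
Qed.

Lemma smooth_dx f : smooth f -> smooth (fun u v => Derive (fun z => f z v) u).
Proof. intros H n x y. apply (H (S n) x y). Qed.

Lemma smooth_dy f : smooth f -> smooth (fun u v => Derive (fun z => f u z) v).
Proof. intros H n x y. apply (H (S n) x y). Qed.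

Lemma smooth_continuous f x y : smooth f -> continuity_2d_pt f x y.
Proof. intros H. apply (H 0%nat x y). Qed.

Lemma smooth_is_dx f x y : smooth f -> is_derive (fun z => f z y) x (Derive (fun z => f z y) x).
Proof. intros H. apply Derive_correct. apply (H 1%nat x y). Qed.

Lemma smooth_is_dy f x y : smooth f -> is_derive (fun z => f x z) y (Derive (fun z => f x z) y).
Proof. intros H. apply Derive_correct. apply (H 1%nat x y). Qed.

Lemma continuity_2d_continuous (f : R -> R -> R) x y : continuity_2d_pt f x y <->
  continuous (fun q : R * R => f (fst q) (snd q)) (x, y).
Proof. apply continuity_2d_pt_filterlim. Qed.

Lemma smooth_differentiable f x y : smooth f ->
  differentiable_pt_lim f x y (Derive (fun z => f z y) x) (Derive (fun z => f x z) y).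
Proof.
  intros H. apply filterdiff_differentiable_pt_lim.
  apply (is_derive_filterdiff f x y (fun u v => Derive (fun z => f z v) u)).
  - exists (mkposreal 1 Rlt_0_1). intros q _. apply (smooth_is_dx f (fst q) (snd q) H).
  - apply smooth_is_dy, H.
  - apply (continuity_2d_continuous (fun u v => Derive (fun z => f z v) u)).
    apply (smooth_continuous _ x y (smooth_dx f H)).
Qed.

(** The chain rule keeps the order: the outer function is smooth, so that its
    partial derivatives can be composed again. *)
Lemma famC_comp n f A B : smooth f -> famC n A -> famC n B ->
  famC n (fun e x y => f (A e x y) (B e x y)).
Proof.
  revert f A B. induction n as [|n IH]; intros f A B Hf HA HB.
  - split; [|exact I]. intros e x y.
    apply (continuous_comp_2 (fun q : R * (R * R) => A (fst q) (fst (snd q)) (snd (snd q)))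
      (fun q => B (fst q) (fst (snd q)) (snd (snd q))) f); [apply HA|apply HB|].
    apply (continuity_2d_continuous f). apply smooth_continuous, Hf.
  - pose proof (famC_pred _ _ HA) as HA'. pose proof (famC_pred _ _ HB) as HB'.
    destruct HA as [A0 [Ax [Ay [A1 [A2 [A3 A4]]]]]], HB as [B0 [Bx [By [B1 [B2 [B3 B4]]]]]].
    split.
    + intros e x y.
      apply (continuous_comp_2 (fun q : R * (R * R) => A (fst q) (fst (snd q)) (snd (snd q)))
        (fun q => B (fst q) (fst (snd q)) (snd (snd q))) f); [apply A0|apply B0|].
      apply (continuity_2d_continuous f). apply smooth_continuous, Hf.
    + exists (fun e x y => Derive (fun z => f z (B e x y)) (A e x y) * Ax e x y
                           + Derive (fun z => f (A e x y) z) (B e x y) * Bx e x y),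
        (fun e x y => Derive (fun z => f z (B e x y)) (A e x y) * Ay e x y
                      + Derive (fun z => f (A e x y) z) (B e x y) * By e x y).
      pose proof (IH _ A B (smooth_dx f Hf) HA' HB') as D1. cbv beta in D1.
      pose proof (IH _ A B (smooth_dy f Hf) HA' HB') as D2. cbv beta in D2.
      split; [|split; [|split; apply famC_plus; apply famC_mult; assumption]].
      * intros e x y. apply is_derive_Reals.
        apply (derivable_pt_lim_comp_2d f (fun t => A e t y) (fun t => B e t y)).
        -- apply smooth_differentiable, Hf.
        -- apply is_derive_Reals, A1.
        -- apply is_derive_Reals, B1.
      * intros e x y. apply is_derive_Reals.
        apply (derivable_pt_lim_comp_2d f (fun t => A e x t) (fun t => B e x t)).
        -- apply smooth_differentiable, Hf.
        -- apply is_derive_Reals, A2.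
        -- apply is_derive_Reals, B2.
Qed.

Lemma famC_smooth n G e x y : famC n G -> ex_diff_n (G e) n x y.
Proof.
  assert (C : forall n G e x y, famC n G -> continuity_2d_pt (G e) x y).
  { clear. intros n G e x y H. apply (continuity_2d_continuous (G e)).
    apply (continuous_comp (fun z : R * R => (e, z)) (fun q : R * (R * R) => G (fst q) (fst (snd q)) (snd (snd q)))).
    - apply (continuous_comp_2 (fun _ : R * R => e) (fun z : R * R => z) (fun a b => (a, b))).
      + apply continuous_const.
      + apply continuous_id.
      + apply (continuous_ext (fun z : R * (R * R) => z)); [intros [a b]; reflexivity|apply continuous_id].
    - apply (famC_continuous n G e x y H). }
  revert G x y. induction n as [|n IH]; intros G x y H.
  - split; [|exact I]. apply (C 0%nat), H.
  - pose proof (C _ _ e x y H) as C0.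
    destruct H as [_ [Gx [Gy [H1 [H2 [H3 H4]]]]]]. split; [exact C0|].
    split; [eexists; apply H1|]. split; [eexists; apply H2|]. split.
    + replace (fun u v => Derive (fun z => G e z v) u) with (Gx e); [apply IH, H3|].
      apply functional_extensionality; intros u. apply functional_extensionality; intros v.
      symmetry. apply is_derive_unique, H1.
    + replace (fun u v => Derive (fun z => G e u z) v) with (Gy e); [apply IH, H4|].
      apply functional_extensionality; intros u. apply functional_extensionality; intros v.
      symmetry. apply is_derive_unique, H2.
Qed.

Lemma smooth_family_smooth G e : smooth_family G -> smooth (G e).
Proof. intros H n x y. apply famC_smooth, H. Qed.

Lemma smooth_family_continuous G e0 : smooth_family G -> continuous_family G e0.
Proof.
  intros HG m k e x y _.
  assert (Hy : forall k n G, famC (k + n) G -> exists H, famC n H /\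
    forall e x y, Derive_n (fun z => G e x z) k y = H e x y).
  { clear. induction k as [|k IH]; intros n G HG; [exists G; split; [exact HG|reflexivity]|].
    destruct (IH (S n) G) as [H [H1 H2]]; [rewrite Nat.add_succ_r; exact HG|].
    destruct H1 as [_ [Hx [Hy [_ [H3 [_ H4]]]]]]. exists Hy. split; [exact H4|].
    intros e x y. simpl. rewrite (Derive_ext _ (H e x)) by (intros; apply H2).
    apply is_derive_unique, H3. }
  assert (Hx : forall m n G, famC (m + n) G -> exists H, famC n H /\
    forall e x y, Derive_n (fun z => G e z y) m x = H e x y).
  { clear. induction m as [|m IH]; intros n G HG; [exists G; split; [exact HG|reflexivity]|].
    destruct (IH (S n) G) as [H [H1 H2]]; [rewrite Nat.add_succ_r; exact HG|].
    destruct H1 as [_ [Hx [Hy [H3 [_ [H4 _]]]]]]. exists Hx. split; [exact H4|].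
    intros e x y. simpl. rewrite (Derive_ext _ (fun z => H e z y)) by (intros; apply H2).
    apply is_derive_unique, H3. }
  destruct (Hy k (m + 0)%nat G (HG _)) as [H1 [A1 A2]].
  destruct (Hx m 0%nat H1 A1) as [H2 [B1 B2]].
  apply (continuous_ext (fun q : R * (R * R) => H2 (fst q) (fst (snd q)) (snd (snd q)))).
  - intros q. unfold partial_derive. rewrite <- B2. apply Derive_n_ext. intros t. symmetry. apply A2.
  - apply (famC_continuous 0 H2 e x y B1).
Qed.

(** * Local bounds of smooth fields *)

Lemma lip_on_le f d d' : d' <= d -> lip_on f d -> lip_on f d'.
Proof.
  intros Hd [L [HL Hf]]. exists L. split; [exact HL|]. intros p q Hp Hq. apply Hf; lra.
Qed.

Lemma smooth_increment f x y x' y' : smooth f -> exists u v,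
  (Rmin x x' <= u <= Rmax x x') /\ (Rmin y y' <= v <= Rmax y y') /\
  f x' y' - f x y = Derive (fun z => f z y') u * (x' - x) + Derive (fun z => f x z) v * (y' - y).
Proof.
  intros Hf.
  destruct (MVT_gen (fun z => f z y') x x' (fun u => Derive (fun z => f z y') u)) as [u [Hu E1]].
  - intros z _. apply smooth_is_dx, Hf.
  - intros z _. exact (is_derive_continuity_pt _ _ _ (smooth_is_dx f z y' Hf)).
  - destruct (MVT_gen (fun z => f x z) y y' (fun v => Derive (fun z => f x z) v)) as [v [Hv E2]].
    + intros z _. apply smooth_is_dy, Hf.
    + intros z _. exact (is_derive_continuity_pt _ _ _ (smooth_is_dy f x z Hf)).
    + exists u, v. split; [exact Hu|]. split; [exact Hv|]. rewrite <- E1, <- E2. ring.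
Qed.

Lemma between_close (a b c d : R) : Rabs (a - 1) <= d -> Rabs (b - 1) <= d ->
  Rmin a b <= c <= Rmax a b -> Rabs (c - 1) <= d.
Proof.
  intros Ha Hb Hc. apply Rabs_le_between in Ha, Hb. apply Rabs_le_between.
  revert Hc. unfold Rmin, Rmax. destruct (Rle_dec a b); lra.
Qed.

Lemma between_dist (a b c : R) : Rmin a b <= c <= Rmax a b -> Rabs (c - a) <= Rabs (b - a).
Proof.
  unfold Rmin, Rmax. destruct (Rle_dec a b); intros Hc.
  - rewrite !Rabs_pos_eq; lra.
  - rewrite (Rabs_left1 (c - a)), (Rabs_left1 (b - a)); lra.
Qed.

Lemma smooth_bounded f : smooth f -> exists d M, 0 < d /\ 0 <= M /\
  forall x y, Rabs (x - 1) <= d -> Rabs (y - 1) <= d -> Rabs (f x y) <= M.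
Proof.
  intros Hf. destruct (smooth_continuous f 1 1 Hf (mkposreal 1 Rlt_0_1)) as [d Hd].
  exists (d / 2), (Rabs (f 1 1) + 1). pose proof (cond_pos d). pose proof (Rabs_pos (f 1 1)).
  split; [lra|]. split; [lra|]. intros x y Hx Hy.
  specialize (Hd x y ltac:(lra) ltac:(lra)). simpl in Hd.
  replace (f x y) with (f 1 1 + (f x y - f 1 1)) by ring.
  eapply Rle_trans; [apply Rabs_triang|]. lra.
Qed.

Lemma smooth_lip f : smooth f -> exists d, 0 < d /\ lip_on (fun p => f (fst p) (snd p)) d.
Proof.
  intros Hf.
  destruct (smooth_bounded _ (smooth_dx f Hf)) as [d1 [M1 [D1 [P1 B1]]]].
  destruct (smooth_bounded _ (smooth_dy f Hf)) as [d2 [M2 [D2 [P2 B2]]]].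
  exists (Rmin d1 d2). split; [apply Rmin_pos; assumption|]. exists (M1 + M2). split; [lra|].
  intros [x y] [x' y'] Hp Hq. pose proof (Rmin_l d1 d2). pose proof (Rmin_r d1 d2).
  apply dsup_le in Hp, Hq. simpl in *. destruct Hp as [Hx Hy], Hq as [Hx' Hy'].
  destruct (smooth_increment f x y x' y' Hf) as [u [v [Hu [Hv ->]]]].
  eapply Rle_trans; [apply Rabs_triang|]. rewrite !Rabs_mult.
  pose proof (dsup_fst (x, y) (x', y')) as F1. pose proof (dsup_snd (x, y) (x', y')) as F2. simpl in F1, F2.
  pose proof (between_close _ _ _ _ Hx Hx' Hu). pose proof (between_close _ _ _ _ Hy Hy' Hv).
  specialize (B1 u y' ltac:(lra) ltac:(lra)). specialize (B2 x v ltac:(lra) ltac:(lra)).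
  rewrite Rmult_plus_distr_r. apply Rplus_le_compat; apply Rmult_le_compat; auto using Rabs_pos.
Qed.

(** Second order Taylor bound, from the mean value theorem for [f] and the
    Lipschitz bounds of its partial derivatives. *)
Lemma smooth_quadratic f : smooth f -> exists d K, 0 < d /\ 0 <= K /\
  forall p q, dsup (1, 1) p <= d -> dsup (1, 1) q <= d ->
    Rabs (f (fst q) (snd q) - f (fst p) (snd p)
      - (Derive (fun z => f z (snd p)) (fst p) * (fst q - fst p)
         + Derive (fun z => f (fst p) z) (snd p) * (snd q - snd p))) <= K * dsup p q ^ 2.
Proof.
  intros Hf.
  destruct (smooth_lip _ (smooth_dx f Hf)) as [d1 [D1 [K1 [P1 B1]]]].
  destruct (smooth_lip _ (smooth_dy f Hf)) as [d2 [D2 [K2 [P2 B2]]]].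
  exists (Rmin d1 d2), (K1 + K2). split; [apply Rmin_pos; assumption|]. split; [lra|].
  intros [x y] [x' y'] Hp Hq. pose proof (Rmin_l d1 d2). pose proof (Rmin_r d1 d2).
  pose proof Hp as Hp'. pose proof Hq as Hq'.
  apply dsup_le in Hp', Hq'. simpl in *. destruct Hp' as [Hx Hy], Hq' as [Hx' Hy'].
  destruct (smooth_increment f x y x' y' Hf) as [u [v [Hu [Hv ->]]]].
  set (D := dsup (x, y) (x', y')).
  pose proof (dsup_fst (x, y) (x', y')) as F1. pose proof (dsup_snd (x, y) (x', y')) as F2. simpl in F1, F2.
  fold D in F1, F2.
  pose proof (between_close _ _ _ _ Hx Hx' Hu). pose proof (between_close _ _ _ _ Hy Hy' Hv).
  pose proof (between_dist _ _ _ Hu). pose proof (between_dist _ _ _ Hv).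
  assert (C1 : Rabs (Derive (fun z => f z y') u - Derive (fun z => f z y) x) <= K1 * D).
  { specialize (B1 (x, y) (u, y')). simpl in B1. eapply Rle_trans; [apply B1|].
    - apply dsup_le; simpl; lra.
    - apply dsup_le; simpl; lra.
    - apply Rmult_le_compat_l; [exact P1|]. apply dsup_le; simpl; lra. }
  assert (C2 : Rabs (Derive (fun z => f x z) v - Derive (fun z => f x z) y) <= K2 * D).
  { specialize (B2 (x, y) (x, v)). simpl in B2. eapply Rle_trans; [apply B2|].
    - apply dsup_le; simpl; lra.
    - apply dsup_le; simpl; lra.
    - apply Rmult_le_compat_l; [exact P2|]. apply dsup_le; simpl. rewrite Rminus_diag, Rabs_R0.
      pose proof (dsup_pos (x, y) (x', y')). fold D in H5. lra. }
  match goal with |- Rabs ?E <= _ => replace E with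
    ((Derive (fun z => f z y') u - Derive (fun z => f z y) x) * (x' - x)
     + (Derive (fun z => f x z) v - Derive (fun z => f x z) y) * (y' - y)) by ring end.
  eapply Rle_trans; [apply Rabs_triang|]. rewrite !Rabs_mult.
  replace ((K1 + K2) * (D * (D * 1))) with (K1 * D * D + K2 * D * D) by ring.
  apply Rplus_le_compat; apply Rmult_le_compat; auto using Rabs_pos.
Qed.

Definition smooth_field (X : R * R -> R * R) : Prop :=
  smooth (fun x y => fst (X (x, y))) /\ smooth (fun x y => snd (X (x, y))).

Lemma smooth_field_bounds X : smooth_field X -> exists d, 0 < d /\ forall d', 0 < d' <= d ->
  lip_on (fun p => fst (X p)) d' /\ lip_on (fun p => snd (X p)) d' /\ quadratic X d'.
Proof.
  intros [H1 H2].
  destruct (smooth_lip _ H1) as [d1 [D1 L1]]. destruct (smooth_lip _ H2) as [d2 [D2 L2]].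
  destruct (smooth_quadratic _ H1) as [d3 [K3 [D3 [P3 Q3]]]].
  destruct (smooth_quadratic _ H2) as [d4 [K4 [D4 [P4 Q4]]]].
  destruct (smooth_bounded _ (smooth_dx _ H1)) as [e1 [M1 [E1 [N1 B1]]]].
  destruct (smooth_bounded _ (smooth_dy _ H1)) as [e2 [M2 [E2 [N2 B2]]]].
  destruct (smooth_bounded _ (smooth_dx _ H2)) as [e3 [M3 [E3 [N3 B3]]]].
  destruct (smooth_bounded _ (smooth_dy _ H2)) as [e4 [M4 [E4 [N4 B4]]]].
  destruct (exists_below (d1 :: d2 :: d3 :: d4 :: e1 :: e2 :: e3 :: e4 :: nil)) as [d [Hd Hl]].
  { simpl. intros x [<-|[<-|[<-|[<-|[<-|[<-|[<-|[<-|[]]]]]]]]]; assumption. }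
  assert (T1 : d <= d1) by (apply Hl; simpl; tauto). assert (T2 : d <= d2) by (apply Hl; simpl; tauto).
  assert (T3 : d <= d3) by (apply Hl; simpl; tauto). assert (T4 : d <= d4) by (apply Hl; simpl; tauto).
  assert (T5 : d <= e1) by (apply Hl; simpl; tauto). assert (T6 : d <= e2) by (apply Hl; simpl; tauto).
  assert (T7 : d <= e3) by (apply Hl; simpl; tauto). assert (T8 : d <= e4) by (apply Hl; simpl; tauto).
  exists d. split; [exact Hd|]. intros d' Hd'. split; [|split].
  - apply (lip_on_le _ d1); [lra|]. destruct L1 as [L [HL Hf]]. exists L. split; [exact HL|].
    intros [x y] [x' y']. apply (Hf (x, y) (x', y')).
  - apply (lip_on_le _ d2); [lra|]. destruct L2 as [L [HL Hf]]. exists L. split; [exact HL|].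
    intros [x y] [x' y']. apply (Hf (x, y) (x', y')).
  - exists (fun p => Derive (fun z => fst (X (z, snd p))) (fst p)),
      (fun p => Derive (fun z => fst (X (fst p, z))) (snd p)),
      (fun p => Derive (fun z => snd (X (z, snd p))) (fst p)),
      (fun p => Derive (fun z => snd (X (fst p, z))) (snd p)),
      (M1 + M2 + M3 + M4), (K3 + K4).
    split; [lra|]. split; [lra|]. split.
    + intros [x y] Hp. apply dsup_lt in Hp. simpl in *. destruct Hp as [Hx Hy].
      specialize (B1 x y ltac:(lra) ltac:(lra)). specialize (B2 x y ltac:(lra) ltac:(lra)).
      specialize (B3 x y ltac:(lra) ltac:(lra)). specialize (B4 x y ltac:(lra) ltac:(lra)). lra.
    + intros [x y] [x' y'] Hp Hq. pose proof (pow2_ge_0 (dsup (x, y) (x', y'))).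
      specialize (Q3 (x, y) (x', y') ltac:(lra) ltac:(lra)).
      specialize (Q4 (x, y) (x', y') ltac:(lra) ltac:(lra)). cbn [fst snd] in *.
      rewrite Rmult_plus_distr_r.
      assert (0 <= K3 * dsup (x, y) (x', y') ^ 2) by (apply Rmult_le_pos; assumption).
      assert (0 <= K4 * dsup (x, y) (x', y') ^ 2) by (apply Rmult_le_pos; assumption).
      split; lra.
Qed.

Lemma quadratic_ext X V d : (forall p, dsup (1, 1) p < d -> V p = X p) -> quadratic X d -> quadratic V d.
Proof.
  intros E [a11 [a12 [a21 [a22 [M [K [HM [HK [Ha Hq]]]]]]]]].
  exists a11, a12, a21, a22, M, K. repeat split; try assumption; try (apply Ha; assumption);
  rewrite !E by assumption; apply Hq; assumption.
Qed.

Lemma quadratic_vopp V d : quadratic V d -> quadratic (fun p => vopp (V p)) d.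
Proof.
  intros [a11 [a12 [a21 [a22 [M [K [HM [HK [Ha Hq]]]]]]]]].
  exists (fun p => - a11 p), (fun p => - a12 p), (fun p => - a21 p), (fun p => - a22 p), M, K.
  split; [exact HM|]. split; [exact HK|]. split.
  - intros p Hp. rewrite !Rabs_Ropp. apply Ha, Hp.
  - intros p q Hp Hq'. destruct (Hq p q Hp Hq') as [Q1 Q2]. unfold vopp; cbn [fst snd]. split.
    + rewrite <- Rabs_Ropp. match goal with |- Rabs ?E <= _ => replace E with
        (fst (V q) - fst (V p) - (a11 p * (fst q - fst p) + a12 p * (snd q - snd p))) by ring end. exact Q1.
    + rewrite <- Rabs_Ropp. match goal with |- Rabs ?E <= _ => replace E with
        (snd (V q) - snd (V p) - (a21 p * (fst q - fst p) + a22 p * (snd q - snd p))) by ring end. exact Q2.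
Qed.

Lemma lip_on_opp f d : lip_on f d -> lip_on (fun p => - f p) d.
Proof.
  intros [L [HL Hf]]. exists L. split; [exact HL|]. intros p q Hp Hq.
  replace (- f q - - f p) with (- (f q - f p)) by ring. rewrite Rabs_Ropp. apply Hf; assumption.
Qed.

(** * From monodromy to half maps *)

Section Monodromy.

Variables (alpha beta : R) (K : kolmogorov) (V : zone -> R * R -> R * R) (Phi : zone -> R -> R * R -> R * R).
Variables (L d0 d : R).
Hypothesis beta_neq0 : beta <> 0.
Hypothesis F : forall i, flow (V i) (Phi i) L.
Hypothesis V_eq : forall i p, dsup (1, 1) p < d0 -> V i p = field K i p.
Hypothesis d_range : 0 < d < d0.
Hypothesis mono : monodromic_ccw alpha beta K.

Local Notation h := (Defs.h alpha beta).
Local Notation sigma := (Defs.sigma alpha beta).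
Local Notation lie := (lie alpha beta).
Local Notation region := (region alpha beta).

(** Uniqueness of solutions identifies the two parts of a turn with arcs of the
    flows; the crossing directions at its three points on the line are read off
    from the zones visited before and after. *)
Lemma return_arcs rho s s' : rho <= d0 -> ccw_return alpha beta K rho s s' ->
  exists T1 r T2,
    halfarc alpha beta (Phi zone1) (sgn zone1) s T1 r /\
    halfarc (- alpha) (- beta) (Phi zone2) (sgn zone1) (- r) T2 (- s') /\
    (forall t, 0 <= t <= T1 -> dsup (1, 1) (Phi zone1 t (sigma s)) < rho) /\
    (forall t, 0 <= t <= T2 -> dsup (1, 1) (Phi zone2 t (sigma r)) < rho) /\
    (forall j, 0 < sgn zone1 * lie (V j) (sigma s)) /\
    (forall j, 0 < sgn zone2 * lie (V j) (sigma r)) /\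
    (forall j, 0 < sgn zone1 * lie (V j) (sigma s')).
Proof.
  intros Hrho [gamma [a [t1 [t2 [b [r [Ha [Ht1 [Ht2 [Htb [Hr [Hs' [G [G0 [R1 [G1 [R2 [G2 B]]]]]]]]]]]]]]]]]].
  assert (Hbox : forall t, 0 <= t <= t2 -> dsup (1, 1) (gamma t) < rho).
  { intros t Ht. apply ball_dsup, B, Ht. }
  assert (Hdom : forall t, 0 <= t <= t2 -> Rbar_lt a t /\ Rbar_lt t b) by (intros t Ht; simpl; lra).
  assert (Hcts : forall t, 0 <= t <= t2 -> cts gamma t).
  { intros t Ht. apply continuous_cts. apply (G t); apply Hdom, Ht. }
  assert (Hder : forall i t, 0 <= t <= t2 -> region i (gamma t) -> der gamma t (V i (gamma t))).
  { intros i t Ht Hi. rewrite V_eq by (specialize (Hbox t Ht); lra).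
    apply is_derive_der. apply (G t); [apply Hdom, Ht|apply Hdom, Ht|exact Hi]. }
  assert (E1 : forall t, 0 <= t <= t1 -> gamma t = Phi zone1 t (sigma s)).
  { intros t Ht. rewrite <- G0. apply (flow_unique (V zone1) (Phi zone1) L gamma t (F zone1)); [lra| |].
    - intros u Hu. apply Hcts. lra.
    - intros u Hu. apply Hder; [lra|apply R1; lra]. }
  assert (E2 : forall t, 0 <= t <= t2 - t1 -> gamma (t + t1) = Phi zone2 t (sigma r)).
  { intros t Ht. rewrite <- G1.
    pose proof (flow_unique (V zone2) (Phi zone2) L (fun u => gamma (u + t1)) t (F zone2)) as U.
    cbv beta in U. rewrite Rplus_0_l in U. apply U; [lra| |].
    - intros u Hu. apply cts_dsup. intros e He.
      destruct (proj1 (cts_dsup gamma (u + t1)) (Hcts (u + t1) ltac:(lra)) e He) as [q [Hq Hn]].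
      exists q. split; [exact Hq|]. intros w Hw. apply Hn. replace (w + t1 - (u + t1)) with (w - u) by ring. exact Hw.
    - intros u Hu. apply (der_shift gamma). apply Hder; [lra|apply R2; lra]. }
  assert (Hcross : forall t i, 0 <= t <= t2 -> h (gamma t) = 0 ->
    (exists e, 0 < e /\ forall u, t < u < t + e -> region i (gamma u)) ->
    forall j, 0 < sgn i * lie (V j) (gamma t)).
  { intros t i Ht Hh [e [He Hu]] j. destruct (G t) as [_ [_ Hc]]; [apply Hdom, Ht|apply Hdom, Ht|].
    destruct (Hc Hh) as [i' [I1 [_ I3]]]. apply at_right_iff in I3. destruct I3 as [e' [He' I3]].
    assert (Hm : 0 < Rmin e e') by (apply Rmin_pos; assumption).
    pose proof (Rmin_l e e'). pose proof (Rmin_r e e').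
    assert (i = i').
    { eapply sgn_pos_inj; [apply (Hu (t + Rmin e e' / 2)); lra|apply (I3 (t + Rmin e e' / 2)); lra]. }
    subst i'. specialize (I1 j). unfold lie_h in I1. unfold Submission.lie. rewrite V_eq; [exact I1|].
    specialize (Hbox t Ht). lra. }
  exists t1, r, (t2 - t1). split; [|split; [|split; [|split; [|split; [|split]]]]].
  - split; [exact Ht1|]. split; [exact Hr|]. split.
    + rewrite <- E1 by lra. exact G1.
    + intros t Ht. rewrite <- E1 by lra. apply R1, Ht.
  - split; [lra|]. split; [lra|]. rewrite !sigma_opp, !Ropp_involutive. split.
    + rewrite <- E2 by lra. replace (t2 - t1 + t1) with t2 by ring. exact G2.
    + intros t Ht. rewrite h_opp, <- E2 by lra. specialize (R2 (t + t1) ltac:(lra)).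
      unfold Defs.region in R2. simpl in *. lra.
  - intros t Ht. rewrite <- E1 by exact Ht. apply Hbox. lra.
  - intros t Ht. rewrite <- E2 by exact Ht. apply Hbox. lra.
  - intros j. rewrite <- G0. apply Hcross.
    + lra.
    + rewrite G0. apply h_sigma.
    + exists t1. split; [exact Ht1|]. intros u Hu. apply R1. lra.
  - intros j. rewrite <- G1. apply Hcross.
    + lra.
    + rewrite G1. apply h_sigma.
    + exists (t2 - t1). split; [lra|]. intros u Hu. apply R2. lra.
  - (* the side from which the trajectory arrives tells the crossing direction *)
    intros j. destruct (G t2) as [_ [_ Hc]]; [apply Hdom; lra|apply Hdom; lra|].
    destruct Hc as [i' [I1 [I2 _]]]; [rewrite G2; apply h_sigma|]. apply at_left_iff in I2. destruct I2 as [e' [He' I2]].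
    set (w := Rmax (t2 - e') t1). assert (Hw : w < t2) by (apply Rmax_lub_lt; lra).
    pose proof (Rmax_l (t2 - e') t1). pose proof (Rmax_r (t2 - e') t1). fold w in H, H0.
    assert (E : zone2 = other i').
    { eapply sgn_pos_inj; [apply (R2 ((w + t2) / 2)); lra|apply (I2 ((w + t2) / 2)); lra]. }
    destruct i'; [|discriminate E]. specialize (I1 j). rewrite G2 in I1. unfold lie_h in I1. unfold Submission.lie.
    rewrite V_eq; [exact I1|]. rewrite <- G2. specialize (Hbox t2 ltac:(lra)). lra.
Qed.

(** The turns starting on [s > 0] provide both half-return maps: the first one is
    onto an interval of [s < 0], so that every arc of the second zone near (1, 1)
    is the second half of a turn. *)
Theorem monodromic_rotation : exists s0 Ta Ra Tb Rb,
  rotation alpha beta V Phi zone1 d s0 Ta Ra Tb Rb.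
Proof.
  destruct (mono d ltac:(lra)) as [s0 [Hs0 Hret]].
  assert (Hmb : - beta <> 0) by lra.
  destruct (choice (fun s (q : R * R * (R * R)) => 0 < s < s0 ->
    halfarc alpha beta (Phi zone1) (sgn zone1) s (fst (fst q)) (snd (fst q)) /\
    halfarc (- alpha) (- beta) (Phi zone2) (sgn zone1) (- snd (fst q)) (fst (snd q)) (snd (snd q)) /\
    (forall t, 0 <= t <= fst (fst q) -> dsup (1, 1) (Phi zone1 t (sigma s)) < d) /\
    (forall t, 0 <= t <= fst (snd q) -> dsup (1, 1) (Phi zone2 t (sigma (snd (fst q)))) < d) /\
    (forall j, 0 < sgn zone1 * lie (V j) (sigma s)) /\
    (forall j, 0 < sgn zone2 * lie (V j) (sigma (snd (fst q)))) /\
    (forall j, 0 < sgn zone1 * lie (V j) (sigma (- snd (snd q)))))) as [f Hf].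
  { intros s. destruct (classic (0 < s < s0)) as [Hs|Hn]; [|exists (0, 0, (0, 0)); tauto].
    destruct (Hret s Hs) as [s' Hs'].
    destruct (return_arcs d s s' ltac:(lra) Hs') as [T1 [r [T2 H]]].
    exists (T1, r, (T2, - s')). intros _. simpl. rewrite Ropp_involutive. exact H. }
  set (Ta := fun s => fst (fst (f s))). set (Ra := fun s => snd (fst (f s))).
  set (T2 := fun s => fst (snd (f s))). set (S2 := fun s => snd (snd (f s))).
  assert (HA : half_map alpha beta (V zone1) (Phi zone1) (sgn zone1) s0 Ta Ra).
  { constructor.
    - intros s Hs. apply (Hf s Hs).
    - intros s Hs. apply (Hf s Hs).
    - intros s Hs. destruct (Hf s Hs) as [_ [_ [_ [_ [_ [H _]]]]]]. specialize (H zone1). fold (Ra s) in H.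
      simpl in *. lra.
    - intros rho Hrho. set (rho' := Rmin rho d). pose proof (Rmin_l rho d). pose proof (Rmin_r rho d).
      destruct (mono rho') as [s1 [Hs1 Hret1]]; [apply Rmin_pos; lra|].
      exists s1. split; [exact Hs1|]. intros s Hs Hss t Ht.
      destruct (Hret1 s Hs) as [s' Hs'].
      destruct (return_arcs rho' s s' ltac:(unfold rho'; lra) Hs') as [T1 [r [T2' [A1 [_ [A2 _]]]]]].
      destruct (Hf s ltac:(lra)) as [B1 _].
      destruct (halfarc_unique beta_neq0 A1 B1) as [E _].
      eapply Rlt_le_trans; [apply A2|unfold rho'; lra]. rewrite E. exact Ht. }
  assert (Hm : 0 < s0 / 2 < s0) by lra.
  destruct (choice (fun u s => 0 < u < - Ra (s0 / 2) -> 0 < s < s0 / 2 /\ Ra s = - u)) as [g Hg].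
  { intros u. destruct (classic (0 < u < - Ra (s0 / 2))) as [Hu|Hn]; [|exists 0; tauto].
    destruct (half_surj beta_neq0 (F zone1) HA (s0 / 2) (- u) Hm) as [s [A1 A2]]; [lra|].
    exists s. intros _. split; assumption. }
  set (r0 := - Ra (s0 / 2)) in *.
  assert (Hr0 : 0 < r0).
  { destruct (hm_arc HA _ Hm) as [_ [Hneg _]]. unfold r0. lra. }
  set (Tb := fun u => T2 (g u)). set (Rb := fun u => S2 (g u)).
  assert (HgR : forall u, 0 < u < r0 -> 0 < g u < s0 /\ snd (fst (f (g u))) = - u).
  { intros u Hu. destruct (Hg u Hu) as [G1 G2]. split; [lra|exact G2]. }
  assert (HB : half_map (- alpha) (- beta) (V zone2) (Phi zone2) (sgn zone1) r0 Tb Rb).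
  { constructor.
    - intros u Hu. destruct (HgR u Hu) as [G1 G2]. destruct (Hf (g u) G1) as [_ [A _]].
      rewrite G2, Ropp_involutive in A. exact A.
    - intros u Hu. destruct (HgR u Hu) as [G1 G2]. destruct (Hf (g u) G1) as [_ [_ [_ [_ [_ [A _]]]]]].
      specialize (A zone2). rewrite G2 in A. rewrite lie_opp, sigma_opp. simpl in *. lra.
    - intros u Hu. destruct (HgR u Hu) as [G1 G2]. destruct (Hf (g u) G1) as [_ [_ [_ [_ [_ [_ A]]]]]].
      specialize (A zone2). rewrite lie_opp, sigma_opp. fold (S2 (g u)) in A. fold (Rb u) in A. simpl in *. lra.
    - intros rho Hrho. destruct (mono (Rmin rho d)) as [s1 [Hs1 Hret1]]; [apply Rmin_pos; lra|].
      pose proof (Rmin_l rho d). pose proof (Rmin_r rho d).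
      set (s2 := Rmin s1 s0 / 2).
      assert (Hs2 : 0 < s2 /\ s2 < s1 /\ s2 < s0).
      { pose proof (Rmin_pos s1 s0 Hs1 Hs0). pose proof (Rmin_l s1 s0). pose proof (Rmin_r s1 s0). unfold s2. lra. }
      destruct (hm_arc HA s2 ltac:(lra)) as [_ [Hneg2 _]].
      exists (- Ra s2). split; [lra|]. intros u Hu Hu2 t Ht.
      destruct (HgR u ltac:(lra)) as [G1 G2].
      assert (Hgs : g u < s2).
      { apply Rnot_le_lt. intros Hle. assert (Ra (g u) <= Ra s2); [|unfold Ra at 1 in H1; lra].
        destruct Hle as [Hlt| <-]; [|lra]. left. apply (half_decr beta_neq0 (F zone1) HA); lra. }
      destruct (Hret1 (g u) ltac:(lra)) as [s' Hs'].
      destruct (return_arcs (Rmin rho d) (g u) s' ltac:(lra) Hs') as [T1 [r [T2' [A1 [A1' [_ [A2 _]]]]]]].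
      destruct (Hf (g u) G1) as [B1 [B2 _]].
      destruct (halfarc_unique beta_neq0 A1 B1) as [_ E]. rewrite G2 in E.
      subst r. rewrite G2 in B2.
      destruct (halfarc_unique Hmb A1' B2) as [E _].
      rewrite sigma_opp. eapply Rlt_le_trans; [apply A2|lra]. rewrite E. exact Ht. }
  set (s3 := Rmin s0 r0).
  pose proof (Rmin_l s0 r0). pose proof (Rmin_r s0 r0).
  exists s3, Ta, Ra, Tb, Rb. constructor.
  - apply Rmin_pos; assumption.
  - apply (half_map_shrink _ _ _ _ _ s0); assumption.
  - apply (half_map_shrink _ _ _ _ _ r0); assumption.
  - intros s t Hs Ht. destruct (Hf s ltac:(unfold s3 in *; lra)) as [_ [_ [A _]]]. left. apply A, Ht.
  - intros u t Hu Ht. destruct (HgR u ltac:(unfold s3 in *; lra)) as [G1 G2].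
    destruct (Hf (g u) G1) as [_ [_ [_ [A _]]]]. rewrite G2 in A. rewrite sigma_opp. left. apply A, Ht.
  - intros s j Hs. apply (Hf s). unfold s3 in *. lra.
  - intros u j Hu. destruct (HgR u ltac:(unfold s3 in *; lra)) as [G1 G2].
    destruct (Hf (g u) G1) as [_ [_ [_ [_ [_ [A _]]]]]]. rewrite G2 in A. apply A.
Qed.

End Monodromy.

(** * The Kolmogorov family *)

Lemma famC_minus n G H : famC n G -> famC n H -> famC n (fun e x y => G e x y - H e x y).
Proof.
  intros HG HH.
  replace (fun e x y => G e x y - H e x y) with (fun e x y => G e x y + -1 * H e x y).
  - apply famC_plus; [exact HG|]. apply famC_mult; [apply famC_const|exact HH].
  - apply functional_extensionality; intros e. apply functional_extensionality; intros x.
    apply functional_extensionality; intros y. ring.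
Qed.

Lemma smooth_field_kolmogorov K i : smooth_field (field K i).
Proof.
  split.
  - apply (smooth_family_smooth (fun _ x y => x * kf K i x y) 0). intros n.
    apply famC_mult; [apply famC_x|]. apply famC_comp; [apply kf_smooth|apply famC_x|apply famC_y].
  - apply (smooth_family_smooth (fun _ x y => y * kg K i x y) 0). intros n.
    apply famC_mult; [apply famC_y|]. apply famC_comp; [apply kg_smooth|apply famC_x|apply famC_y].
Qed.

Section Family.

Variables (alpha beta : R) (za : zone) (K : kolmogorov).

(** The components of [pull alpha beta e (field K i)] are divisible by [x] and
    [y], since [shear e] fixes the axes, which are invariant under the field;
    these are the quotients. *)
Definition pull_f (i : zone) (e x y : R) : R :=
  (1 + alpha * e * x) *
    ((1 + beta * e * y) * kf K i (x + beta * (e * x * y)) (y + alpha * (e * x * y))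
     - beta * e * y * kg K i (x + beta * (e * x * y)) (y + alpha * (e * x * y))).

Definition pull_g (i : zone) (e x y : R) : R :=
  (1 + beta * e * y) *
    ((1 + alpha * e * x) * kg K i (x + beta * (e * x * y)) (y + alpha * (e * x * y))
     - alpha * e * x * kf K i (x + beta * (e * x * y)) (y + alpha * (e * x * y))).

Ltac fam := repeat first [apply famC_const | apply famC_e | apply famC_x | apply famC_y |
  apply kf_smooth | apply kg_smooth | apply famC_minus | apply famC_plus | apply famC_mult | apply famC_comp].

Lemma pull_f_smooth i : smooth_family (pull_f i).
Proof. intros n. unfold pull_f. fam. Qed.

Lemma pull_g_smooth i : smooth_family (pull_g i).
Proof. intros n. unfold pull_g. fam. Qed.

Definition fam_f (i : zone) (e : R) : R -> R -> R :=
  if zone_eq_dec i za then pull_f i e else kf K i.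

Definition fam_g (i : zone) (e : R) : R -> R -> R :=
  if zone_eq_dec i za then pull_g i e else kg K i.

Lemma fam_f_smooth i : smooth_family (fam_f i).
Proof.
  unfold fam_f. destruct (zone_eq_dec i za) as [_|_]; [apply pull_f_smooth|]. intros n. fam.
Qed.

Lemma fam_g_smooth i : smooth_family (fam_g i).
Proof.
  unfold fam_g. destruct (zone_eq_dec i za) as [_|_]; [apply pull_g_smooth|]. intros n. fam.
Qed.

Definition family (e : R) : kolmogorov :=
  Kolmogorov (fun i => fam_f i e) (fun i => fam_g i e)
    (fun i => smooth_family_smooth _ e (fam_f_smooth i))
    (fun i => smooth_family_smooth _ e (fam_g_smooth i)).

Lemma field_family e : field (family e) = perturb alpha beta za e (field K).
Proof.
  apply functional_extensionality; intros i. apply functional_extensionality; intros [x y].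
  unfold perturb, field, family, fam_f, fam_g; simpl. destruct (zone_eq_dec i za); [|reflexivity].
  unfold pull, shear, pull_f, pull_g; simpl. f_equal; ring.
Qed.

Lemma family_perturbation : perturbation K family.
Proof.
  split.
  - intros i x y. unfold family, fam_f, fam_g; simpl. destruct (zone_eq_dec i za); [|auto].
    unfold pull_f, pull_g.
    replace (x + beta * (0 * x * y)) with x by ring. replace (y + alpha * (0 * x * y)) with y by ring.
    split; ring.
  - exists 1. split; [lra|]. intros i.
    split; [apply (smooth_family_continuous (fam_f i) 1), fam_f_smooth|
            apply (smooth_family_continuous (fam_g i) 1), fam_g_smooth].
Qed.

End Family.

(** * Reversal of time *)

Lemma xopp_xopp X : xopp (xopp X) = X.
Proof.
  apply functional_extensionality; intros i. apply functional_extensionality; intros p.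
  unfold xopp, vopp; simpl. rewrite !Ropp_involutive. destruct (X i p); reflexivity.
Qed.

Lemma perturb_xopp alpha beta za e X :
  perturb alpha beta za e (xopp X) = xopp (perturb alpha beta za e X).
Proof.
  apply functional_extensionality; intros i. apply functional_extensionality; intros p.
  unfold perturb, xopp. destruct (zone_eq_dec i za); [|reflexivity].
  apply (pull_vopp alpha beta e (X i)).
Qed.

Lemma gperiodic_rev alpha beta X G : gperiodic alpha beta X G -> gperiodic alpha beta (xopp X) G.
Proof.
  intros [gamma [T [HT [H1 [H2 [[t H3] H4]]]]]]. exists (fun t => gamma (- t)), T.
  split; [exact HT|]. split; [apply (gtraj_rev _ _ _ m_infty p_infty), H1|]. split; [|split].
  - intros u. rewrite <- (H2 (- (u + T))). f_equal. ring.
  - exists (- t). rewrite Ropp_involutive, Ropp_0. exact H3.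
  - intros p. rewrite H4. split; intros [u Hu]; exists (- u); [rewrite Ropp_involutive|]; exact Hu.
Qed.

Lemma glimit_cycle_rev alpha beta X G : glimit_cycle alpha beta (xopp X) G -> glimit_cycle alpha beta X G.
Proof.
  intros [H1 [H2 [delta [Hd H3]]]]. split; [|split; [exact H2|exists delta; split; [exact Hd|]]].
  - apply gperiodic_rev in H1. rewrite xopp_xopp in H1. exact H1.
  - intros G' HG'. apply H3, gperiodic_rev, HG'.
Qed.

Lemma unstable_iff alpha beta K A : unstable alpha beta K A <-> gstable alpha beta (xopp (field K)) A.
Proof.
  split; intros [delta [Hd H]]; exists delta; (split; [exact Hd|]); intros p Hp Hn;
  destruct (H p Hp Hn) as [gamma [a [b [Ha [Hb [G [G0 Ht]]]]]]];
  exists (fun t => gamma (- t)), (Rbar_opp b), (Rbar_opp a).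
  - split; [destruct b; simpl in *; auto; lra|]. split; [destruct a; simpl in *; auto; lra|].
    split; [apply gtraj_rev; exact G|]. rewrite Ropp_0. split; [exact G0|].
    intros eta He. destruct (Ht eta He) as [t0 [T1 [T2 T3]]]. exists (- t0).
    split; [lra|]. split; [destruct a; simpl in *; auto; lra|].
    intros t H1 H2. apply T3; [lra|]. destruct a; simpl in *; auto; lra.
  - split; [destruct b; simpl in *; auto; lra|]. split; [destruct a; simpl in *; auto; lra|].
    split; [change (gtraj alpha beta (field K) (Rbar_opp b) (Rbar_opp a) (fun t => gamma (- t)));
      rewrite <- (xopp_xopp (field K)); apply gtraj_rev; exact G|]. rewrite Ropp_0. split; [exact G0|].
    intros eta He. destruct (Ht eta He) as [t0 [T1 [T2 T3]]]. exists (- t0).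
    split; [lra|]. split; [destruct b; simpl in *; auto; lra|].
    intros t H1 H2. apply T3; [lra|]. destruct b; simpl in *; auto; lra.
Qed.

(** * Bifurcation *)

(** The factor [2 / 5] leaves room for the perturbed arcs: the rotation stays in half
    of a box whose enlargement by [5 / 4] is the box of the flows. *)
Lemma small_cycles alpha beta X V Phi L d0 s0 za Ta Ra Tb Rb : beta <> 0 ->
  (forall i, flow (V i) (Phi i) L) ->
  (forall i p, dsup (1, 1) p <= d0 -> V i p = X i p) ->
  lip_on (fun p => fst (X za p)) d0 -> lip_on (fun p => snd (X za p)) d0 ->
  (forall i, quadratic (V i) d0) -> 0 < d0 <= 1 ->
  rotation alpha beta V Phi za (2 / 5 * d0) s0 Ta Ra Tb Rb ->
  gstable alpha beta X (eq (1, 1)) ->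
  forall rho, 0 < rho -> exists e G, 0 < e < rho /\
    glimit_cycle alpha beta (perturb alpha beta za e X) G /\
    gstable alpha beta (perturb alpha beta za e X) G /\
    forall p, G p -> dsup (1, 1) p < rho.
Proof.
  intros Hb F Veq L1 L2 Q Hd ROT Hst.
  assert (C : exists u1, 0 < u1 /\ forall u, 0 < u < u1 -> u < s0 -> - Rb u < s0 -> - Ra (- Rb u) < u).
  { apply (stable_contracting alpha beta X V Phi L d0 (2 / 5 * d0) s0 za Ta Ra Tb Rb); auto; try lra.
    intros i p Hp. apply Veq. lra. }
  destruct ROT as [R0 R1 R2 R3 R4 R5 R6].
  apply (cycle_exists alpha beta X V Phi L d0 (4 / 5 * d0) s0 za Ta Ra Tb Rb); auto; try lra.
  - intros s t Hs Ht. specialize (R3 s t Hs Ht). lra.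
  - intros s t Hs Ht. specialize (R4 s t Hs Ht). lra.
Qed.

Lemma local_setting K : exists d0 V Phi L, 0 < d0 <= 1 /\
  (forall i, flow (V i) (Phi i) L) /\
  (forall i p, dsup (1, 1) p <= d0 -> V i p = field K i p) /\
  (forall i, lip_on (fun p => fst (field K i p)) d0 /\ lip_on (fun p => snd (field K i p)) d0) /\
  (forall i, quadratic (V i) d0).
Proof.
  destruct (smooth_field_bounds _ (smooth_field_kolmogorov K zone1)) as [d1 [D1 B1]].
  destruct (smooth_field_bounds _ (smooth_field_kolmogorov K zone2)) as [d2 [D2 B2]].
  destruct (exists_below (1 :: d1 :: d2 :: nil)) as [d0 [Hd0 Hm]].
  { intros x [<-|[<-|[<-|[]]]]; lra. }
  assert (H1 : d0 <= 1) by (apply Hm; simpl; tauto).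
  assert (H2 : d0 <= d1) by (apply Hm; simpl; tauto).
  assert (H3 : d0 <= d2) by (apply Hm; simpl; tauto).
  destruct (B1 d0 ltac:(lra)) as [L1 [L1' Q1]]. destruct (B2 d0 ltac:(lra)) as [L2 [L2' Q2]].
  destruct (local_flow (field K zone1) d0 Hd0 L1 L1') as [V1 [P1 [M1 [F1 E1]]]].
  destruct (local_flow (field K zone2) d0 Hd0 L2 L2') as [V2 [P2 [M2 [F2 E2]]]].
  exists d0, (fun i => match i with zone1 => V1 | zone2 => V2 end),
    (fun i => match i with zone1 => P1 | zone2 => P2 end), (Rmax M1 M2).
  split; [lra|]. split; [|split; [|split]].
  - intros [|]; [apply (flow_weaken _ _ M1); [exact F1|apply Rmax_l]|apply (flow_weaken _ _ M2); [exact F2|apply Rmax_r]].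
  - intros [|]; assumption.
  - intros [|]; split; assumption.
  - intros [|]; [apply (quadratic_ext (field K zone1)); [|exact Q1]|apply (quadratic_ext (field K zone2)); [|exact Q2]];
    intros p Hp; [apply E1|apply E2]; lra.
Qed.

(** Cycles for arbitrarily small parameters give a bifurcation: the parameter
    of the cycle chosen in the ball of radius [1 / (n + 1)] is bounded below
    for [n <= N], so that small parameters come with small cycles. *)
Lemma bifurcates alpha beta W kind :
  (forall rho, 0 < rho -> exists e G, 0 < e < rho /\
     (crossing_limit_cycle alpha beta (W e) G /\ kind (W e) G) /\
     forall p, G p -> dsup (1, 1) p < rho) ->
  cycle_bifurcates alpha beta W kind.
Proof.
  intros H.
  assert (Hn : forall n, 0 < / (INR n + 1)) by (intros n; apply Rinv_0_lt_compat; pose proof (pos_INR n); lra).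
  destruct (choice (fun n (q : R * (R * R -> Prop)) => 0 < fst q < / (INR n + 1) /\
     (crossing_limit_cycle alpha beta (W (fst q)) (snd q) /\ kind (W (fst q)) (snd q)) /\
     forall p, snd q p -> dsup (1, 1) p < / (INR n + 1))) as [f Hf].
  { intros n. destruct (H _ (Hn n)) as [e [G HG]]. exists (e, G). exact HG. }
  destruct (choice (fun e n => (exists m, fst (f m) = e) -> fst (f n) = e)) as [m Hm].
  { intros e. destruct (classic (exists m, fst (f m) = e)) as [[n Hn']|Hno]; [exists n; auto|exists 0%nat; tauto]. }
  assert (Harch : forall rho, 0 < rho -> exists N, forall n, (N <= n)%nat -> / (INR n + 1) < rho).
  { intros rho Hrho. destruct (archimed_cor1 rho Hrho) as [N [H1 H2]]. exists N. intros n Hle.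
    apply Rle_lt_trans with (/ INR N); [|exact H1]. apply Rinv_le_contravar.
    - apply lt_0_INR, H2.
    - apply le_INR in Hle. lra. }
  exists (fun e => exists n, fst (f n) = e), (fun e => snd (f (m e))). split; [|split].
  - intros delta Hdelta. destruct (Harch delta Hdelta) as [N HN]. exists (fst (f N)).
    destruct (Hf N) as [[H1 H2] _]. specialize (HN N (le_n N)). split; [|exists N; reflexivity].
    rewrite Rabs_pos_eq by lra. lra.
  - intros e He. apply Hm in He. destruct (Hf (m e)) as [_ [H1 _]]. rewrite He in H1. exact H1.
  - intros rho Hrho. destruct (Harch rho Hrho) as [N HN].
    destruct (exists_below (map (fun n => fst (f n)) (seq 0 N))) as [delta [Hdelta Hlow]].
    { intros x Hx. apply in_map_iff in Hx. destruct Hx as [n [<- _]]. apply (Hf n). }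
    exists delta. split; [exact Hdelta|]. intros e He Hed p Hp. apply Hm in He. apply ball_dsup.
    assert (Hge : (N <= m e)%nat).
    { apply Nat.nlt_ge. intros Hlt. assert (delta <= e).
      { rewrite <- He. apply Hlow. apply (in_map (fun n => fst (f n))), in_seq. lia. }
      pose proof (Rle_abs e). lra. }
    destruct (Hf (m e)) as [_ [_ H2]]. specialize (H2 p Hp). specialize (HN _ Hge). lra.
Qed.

Theorem proposition2p6 (alpha beta : R) (K : kolmogorov)
  (hab : (alpha, beta) <> (0, 0))
  (hbeta : 0 < beta)
  (hsum : alpha + beta <> 0)
  (hmono : monodromic_ccw alpha beta K) :
  (beta <= Rabs alpha ->
   unstable alpha beta K (eq (1, 1)) ->
   exists W : R -> kolmogorov,
     perturbation K W /\ cycle_bifurcates alpha beta W (unstable alpha beta)) /\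
  (Rabs alpha <= beta ->
   stable alpha beta K (eq (1, 1)) ->
   exists W : R -> kolmogorov,
     perturbation K W /\ cycle_bifurcates alpha beta W (stable alpha beta)).
Proof.
  assert (Hb : beta <> 0) by lra.
  destruct (local_setting K) as [d0 [V [Phi [L [Hd0 [F [Veq [Hlip Q]]]]]]]].
  destruct (monodromic_rotation alpha beta K V Phi L d0 (2 / 5 * d0) Hb F) as [s0 [Ta [Ra [Tb [Rb ROT]]]]];
    [intros i p Hp; apply Veq; lra|lra|exact hmono|].
  split; intros _ Hst.
  - exists (family alpha beta zone2 K). split; [apply family_perturbation|].
    apply bifurcates. intros rho Hrho.
    destruct (rotation_rev alpha beta V Phi L _ _ _ _ _ _ _ Hb F ROT)
      as [s0' [Ta' [Ra' [Tb' [Rb' [_ [ROT' _]]]]]]].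
    destruct (small_cycles alpha beta (xopp (field K)) (fun i p => vopp (V i p))
      (fun i t p => Phi i (- t) p) L d0 s0' zone2 Ta' Ra' Tb' Rb') with (rho := rho)
      as [e [G [He [HG [HS Hsm]]]]]; auto.
    + intros i. apply flow_rev, F.
    + intros i p Hp. unfold xopp. rewrite Veq by exact Hp. reflexivity.
    + apply (lip_on_opp (fun p => fst (field K zone2 p))), Hlip.
    + apply (lip_on_opp (fun p => snd (field K zone2 p))), Hlip.
    + intros i. apply quadratic_vopp, Q.
    + apply unstable_iff, Hst.
    + exists e, G. split; [exact He|]. split; [split|exact Hsm].
      * rewrite perturb_xopp, <- field_family in HG. exact (glimit_cycle_rev _ _ _ _ HG).
      * rewrite perturb_xopp, <- field_family in HS. apply unstable_iff, HS.
  - exists (family alpha beta zone1 K). split; [apply family_perturbation|].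
    apply bifurcates. intros rho Hrho.
    destruct (small_cycles alpha beta (field K) V Phi L d0 s0 zone1 Ta Ra Tb Rb) with (rho := rho)
      as [e [G [He [HG [HS Hsm]]]]]; auto; try apply Hlip.
    exists e, G. rewrite <- field_family in HG, HS.
    split; [exact He|]. split; [split; [exact HG|exact HS]|exact Hsm].
Qed.
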